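(* Let $(X_t)_{t\ge 0}$ be a regular jump Lévy process in $\mathbf{R}^d$ and let $V$ be a confining $X$-Kato class potential, with Feynman--Kac semigroup $\{T_t\}$ and eigenfunctions $\varphi_n$ (all as defined in the context). Then for every $n\in\{0,1,2,\dots\}$ there exist a radius $R=R(X,V,n)>0$ and constants $C_7=C_7(X,V,n)$, $C_9=C_9(X,V)$, $C_{11}=C_{11}(X,V)$ such that $$|\varphi_n(x)|\le C_7\,\frac{\nu(x)}{\inf_{y\in B(x,1)}V(y)},\qquad |x|\ge R,$$ and $$C_{11}\,\frac{\nu(x)}{\sup_{y\in B(x,1)}V(y)}\le\varphi_0(x)\le C_9\,\frac{\nu(x)}{\inf_{y\in B(x,1)}V(y)},\qquad |x|\ge R.$$ In particular, if for some $n\in\{0,1,2,\dots\}$ there is a constant $C>1$ such that $\sup_{y\in B}V(y)\le C\inf_{y\in B}V(y)$ for all unit balls $B\subset B(0,R)^c$ (where $R=R(X,V,n)$ is the radius for which these bounds on $\varphi_n$ and $\varphi_0$ hold for $|x|\ge R$), then $$|\varphi_n(x)|\le C_7C\,\frac{\nu(x)}{V(x)},\qquad |x|\ge R+1,$$ and $$C_{11}C^{-1}\,\frac{\nu(x)}{V(x)}\le\varphi_0(x)\le C_9C\,\frac{\nu(x)}{V(x)},\qquad |x|\ge R+1.$$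
   Context: Conventions. $(X_t)_{t\ge0}$ is a Lévy process in $\mathbf{R}^d$, $d\ge1$; $\mathbf{P}^x,\mathbf{E}^x$ refer to the process started at $x$. $B(x,r)$ is the open ball; a unit ball is a ball of radius $1$; $1/\infty=0$. $C, C_i$ denote positive constants; $C(X,a,\dots)$ depends only on the process (and the dimension $d$) and on the listed parameters, and similarly for radii. $f\asymp Cg$ means $C^{-1}g\le f\le Cg$. Regular jump Lévy process: a Lévy process satisfying (A1)--(A3). (A1) $(X_t)$ is symmetric, its Lévy measure is absolutely continuous with a strictly positive density $\nu$, and: (1) for every $0<r\le 1/2$ there is $C_1=C_1(X,r)\ge1$ with $\nu(x)\asymp C_1\nu(y)$ for $r\le|y|\le|x|\le|y|+1$; (2) there is $C_2=C_2(X)\ge1$ with $\nu(x)\le C_2\nu(y)$ for $1/2\le|y|\le|x|$; (3) there is $C_3=C_3(X)\ge1$ with $\int_{|z-x|>1/2,\,|z-y|>1/2}\nu(x-z)\nu(z-y)\,dz\le C_3\nu(x-y)$ for $|y-x|\ge1$. (A2) $(X_t)$ is strong Feller, equivalently it has transition densities $p(t,x,y)=p(t,y-x)$ for $t>0$; moreover there are $t_b>0$ and a constant $C(X,t_b)$ with $0<p(t_b,x)\le C(X,t_b)$ for all $x\in\mathbf{R}^d$. (A3) For all $0<p<q<R\le1$, $\sup_{x\in B(0,p)}\sup_{y\in B(0,q)^c}G_{B(0,R)}(x,y)<\infty$, where for a bounded open set $D$, $G_D(x,y)=\int_0^\infty p_D(t,x,y)\,dt$ for $x,y\in D$ (and $0$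 otherwise), and $p_D$ is the transition density of the process killed upon exiting $D$. Potentials. A Borel function $V:\mathbf{R}^d\to\mathbf{R}$ belongs to $\mathcal{K}^X$ if $\lim_{t\to0}\sup_x\mathbf{E}^x[\int_0^t|V(X_s)|ds]=0$, and to $\mathcal{K}^X_{\mathrm{loc}}$ if $V\mathbf{1}_B\in\mathcal{K}^X$ for every ball $B$. $V$ is an $X$-Kato class potential if $V_-\in\mathcal{K}^X$ and $V_+\in\mathcal{K}^X_{\mathrm{loc}}$. It is confining if also $V(x)\to\infty$ as $|x|\to\infty$. Feynman--Kac semigroup: $T_tf(x)=\mathbf{E}^x[e^{-\int_0^tV(X_s)ds}f(X_t)]$, $t>0$. Whenever $(X_t)$ is a regular jump Lévy process and $V$ is a confining $X$-Kato class potential, $\{T_t\}$ is a strongly continuous semigroup of symmetric compact operators on $L^2(\mathbf{R}^d)$; there is an orthonormal basis $\{\varphi_n\}_{n\ge0}$ of $L^2(\mathbf{R}^d)$ with $T_t\varphi_n=e^{-\lambda_nt}\varphi_n$, $t>0$, where $\lambda_0<\lambda_1\le\lambda_2\le\cdots\to\infty$; each $\varphi_n$ is (taken to be) bounded and continuous, and $\varphi_0$ (the ground state) is chosen strictly positive. *)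

(* Defs.v *)
From HB Require Import structures.
From mathcomp Require Import all_boot all_order all_algebra.
From mathcomp Require Import all_classical all_reals all_analysis.
From mathcomp Require Import measurable_realfun.

Set Implicit Arguments.
Unset Strict Implicit.
Unset Printing Implicit Defensive.

Import Order.TTheory GRing.Theory Num.Theory.
Import numFieldNormedType.Exports.

Local Open Scope classical_set_scope.
Local Open Scope ring_scope.

(* R^d is 'rV[R]_d, with its Borel sigma-algebra. The library topology on 'rV
   comes from the max norm and coincides with the Euclidean one. *)
HB.instance Definition _ (R : realType) (d : nat) :=
  @isMeasurable.Build (sigma_display (@open 'rV[R]_d)) 'rV[R]_d
    <<s @open 'rV[R]_d >> (@sigma_algebra0 _ setT _) (@sigma_algebraC _ _)
    (@sigma_algebra_bigcup _ setT _).

Section lebesgue_rV.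
Variable R : realType.

Definition rv_cons (d : nat) (z : measurableTypeR R * 'rV[R]_d) :
  'rV[R]_d.+1 := row_mx (z.1%:M : 'rV[R]_1) z.2.

Lemma open_measurable_rV (d : nat) (U : set 'rV[R]_d) :
  open U -> measurable U.
Proof. by move=> oU; exact: sub_sigma_algebra. Qed.

Lemma measurable_rV_coord (d : nat) (i : 'I_d) :
  measurable_fun setT (fun v : 'rV[R]_d => v 0 i : measurableTypeR R).
Proof.
apply: (measurability _ (RGenOpens.measurableE R)) => // _ [_ [a [b ->]] <-].
rewrite setTI; apply: open_measurable_rV.
apply: (@open_comp _ _ _ _ _ (@interval_open R (BRight a) (BLeft b) _ _)) => //.
by move=> v _; exact: coord_continuous.
Qed.

Lemma rv_consE0 (d : nat) (z : measurableTypeR R * 'rV[R]_d) :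
  rv_cons z 0 0 = z.1.
Proof.
by rewrite mxE; case: splitP => // j _; rewrite ord1 mxE eqxx.
Qed.

Lemma rv_consES (d : nat) (z : measurableTypeR R * 'rV[R]_d) (i : 'I_d) :
  rv_cons z 0 (lift 0 i) = z.2 0 i.
Proof.
rewrite mxE; case: splitP => [[[]]//|j /= [ij]].
by congr (z.2 _ _); exact/val_inj.
Qed.

Lemma measurable_rv_cons (d : nat) : measurable_fun setT (@rv_cons d).
Proof.
apply: (measurability (@open 'rV[R]_d.+1)) => // _ [U oU <-].
rewrite setTI.
pose C (u : 'rV[rat]_d.+1 * nat) : set (measurableTypeR R * 'rV[R]_d) :=
  ball (ratr (u.1 0 0) : R) u.2.+1%:R^-1 `*`
  ball (map_mx ratr (\row_i u.1 0 (lift 0 i)) : 'rV[R]_d) u.2.+1%:R^-1.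
pose B u := if `[< C u `<=` @rv_cons d @^-1` U >] then C u else set0.
suff -> : @rv_cons d @^-1` U = \bigcup_u B u.
  apply: countable_bigcupT_measurable => [|u]; first exact: countableP.
  rewrite /B; case: ifPn => // _; apply: measurableX.
    by apply: open_measurable; exact: ball_open.
  apply: open_measurable_rV; exact: ball_open.
apply/seteqP; split => [z Uz|z [u _]]; last first.
  by rewrite /B; case: asboolP => // CU /CU.
have /nbhs_ballP[e /= e0 eU] := open_nbhs_nbhs (conj oU Uz).
have [k ke] : exists k : nat, k.+1%:R^-1 *+ 2 < e.
  near \oo => k; exists k; rewrite -(mulr_natr _ 2) -ltr_pdivlMr//.
  by near: k; apply: near_infty_natSinv_lt (PosNum _); rewrite divr_gt0.
have k0 : (0 : R) < k.+1%:R^-1 by rewrite invr_gt0.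
have rd (x : R) : exists q : rat, ball x k.+1%:R^-1 (ratr q : R).
  have /rat_in_itvoo[q] : x - k.+1%:R^-1 < x + k.+1%:R^-1.
    by rewrite ltrD2l gtrN.
  rewrite in_itv /= => /andP[xq qx]; exists q.
  by rewrite -ball_normE /= ltr_distlC xq qx.
have [q Hq] := choice (fun i => rd (rv_cons z 0 i)).
exists (\row_i q i, k) => //.
rewrite /B; case: asboolP => [_|]; last first.
  case=> w [/= w1 w2]; apply: eU; split => // i j.
  rewrite ord1; apply: (@le_ball _ _ _ (k.+1%:R^-1 + k.+1%:R^-1)).
    by rewrite -mulr2n ltW.
  apply: (ball_triangle (Hq j)); case: (unliftP 0 j) => [j'|] ->.
    by rewrite rv_consES; have [_ /(_ 0 j')] := w2; rewrite !mxE.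
  by rewrite rv_consE0; move: w1; rewrite mxE.
split => /=.
  by rewrite mxE; apply: ball_sym; have := Hq 0; rewrite rv_consE0.
split=> // i j; rewrite ord1 !mxE; apply: ball_sym.
by have := Hq (lift 0 j); rewrite rv_consES.
Unshelve. all: by end_near. Qed.


Section lebesgue_rVS.
Variables (d : nat) (m : {sigma_finite_measure set 'rV[R]_d -> \bar R}).

(* Image of lebesgue_measure \x m under R * R^d ~ R^(d+1). *)
Definition lebesgue_rVS : set 'rV[R]_d.+1 -> \bar R :=
  pushforward (@lebesgue_measure R \x m)%E (@rv_cons d).

Let lebesgue_rVS0 : lebesgue_rVS set0 = 0%E.
Proof. by rewrite /lebesgue_rVS /pushforward preimage_set0 measure0. Qed.

Let lebesgue_rVS_ge0 A : (0 <= lebesgue_rVS A)%E.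
Proof. by rewrite /lebesgue_rVS /pushforward measure_ge0. Qed.

Let lebesgue_rVS_sigma_additive : semi_sigma_additive lebesgue_rVS.
Proof.
have mf A : measurable A -> measurable (@rv_cons d @^-1` A).
  by move=> mA; rewrite -[X in measurable X]setTI; exact: measurable_rv_cons.
move=> F mF tF mUF; rewrite /lebesgue_rVS /pushforward preimage_bigcup.
apply: measure_semi_sigma_additive.
- by move=> n; exact: mf.
- apply/trivIsetP => i j _ _ ij; rewrite -preimage_setI.
  by move/trivIsetP : tF => /(_ _ _ _ _ ij) ->//; rewrite preimage_set0.
- by rewrite -preimage_bigcup; exact: mf.
Qed.

HB.instance Definition _ := isMeasure.Build _ _ _ lebesgue_rVS
  lebesgue_rVS0 lebesgue_rVS_ge0 lebesgue_rVS_sigma_additive.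

Let lebesgue_rVS_sigma_finite : sigma_finite setT lebesgue_rVS.
Proof.
have /sigma_finiteP[F [FT ndF mF]] := sigma_finiteT (@lebesgue_measure R).
have /sigma_finiteP[G [GT ndG mG]] := sigma_finiteT m.
pose p (v : 'rV[R]_d.+1) : measurableTypeR R * 'rV[R]_d :=
  (v 0 0, \row_i v 0 (lift 0 i)).
have pK : cancel (@rv_cons d) p.
  case=> x v; rewrite /p rv_consE0; congr pair.
  by apply/rowP => i; rewrite mxE rv_consES.
have mp : measurable_fun setT p.
  apply/measurable_fun_pairP; split.
    exact: measurable_rV_coord.
  apply: (measurability (@open 'rV[R]_d)) => // _ [A oA <-].
  rewrite setTI; apply: open_measurable_rV.
  apply: (open_comp _ oA) => v _ W /nbhs_ballP[e e0 eW].
  apply/nbhs_ballP; exists e => // w [_ vw]; apply: eW; split => // i j.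
  by rewrite !mxE; exact: vw.
exists (fun k => p @^-1` (F k `*` G k)).
  apply/esym/seteqP; split => // v _.
  have [n _ Fn] : (\bigcup_k F k) (p v).1 by rewrite -FT.
  have [k _ Gk] : (\bigcup_k G k) (p v).2 by rewrite -GT.
  exists (maxn n k) => //; split.
    by move: Fn; exact/subsetPset/ndF/leq_maxl.
  by move: Gk; exact/subsetPset/ndG/leq_maxr.
move=> k; have [mFk Fk] := mF k; have [mGk Gk] := mG k; split.
  by rewrite -[X in measurable X]setTI; apply: mp => //; exact: measurableX.
rewrite /lebesgue_rVS /pushforward -comp_preimage.
rewrite (_ : p \o _ = id); last by apply/funext => z /=; rewrite pK.
by rewrite preimage_id product_measure1E// lte_mul_pinfty// ge0_fin_numE.
Qed.

HB.instance Definition _ := Measure_isSigmaFinite.Build _ _ _ lebesgue_rVS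
  lebesgue_rVS_sigma_finite.

End lebesgue_rVS.

Fixpoint lebesgue_rV (d : nat) : {sigma_finite_measure set 'rV[R]_d -> \bar R} :=
  if d is n.+1 then lebesgue_rVS (lebesgue_rV n) else \d_(0 : 'rV[R]_0).

(* This determines lebesgue_rV. *)
Lemma lebesgue_rV_box (d : nat) (A : 'I_d -> set (measurableTypeR R)) :
  (forall i, measurable (A i)) ->
  lebesgue_rV d [set v | forall i, A i (v 0 i)] =
  (\prod_(i < d) lebesgue_measure (A i))%E.
Proof.
elim: d A => [|d IH] A mA.
  rewrite big_ord0 /= /dirac indicE mem_set//.
  by case.
rewrite big_ord_recl -IH//= /lebesgue_rVS /pushforward -product_measure1E//.
  congr (_ _); apply/seteqP; split => [[x v] /= H|[x v] [/= H0 H] i].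
    split=> /= [|i]; first by have := H 0; rewrite rv_consE0.
    by have := H (lift 0 i); rewrite rv_consES.
  case: (unliftP 0 i) => [j|] ->; first by rewrite rv_consES; exact: H.
  by rewrite rv_consE0.
rewrite [X in measurable X](_ : _ =
    \bigcap_i [set v : 'rV[R]_d | A (lift 0 i) (v 0 i)]).
  apply: fin_bigcap_measurable => // i _.
  rewrite -[X in measurable X]setTI.
  exact: (measurable_rV_coord i _ (mA (lift 0 i))).
by apply/seteqP; split => [v H i _|v H i]; exact: H.
Qed.

End lebesgue_rV.

Section euclidean.
Context {R : realType} {d : nat}.
Implicit Types x y : 'rV[R]_d.

Definition dotp x y : R := \sum_i x 0 i * y 0 i.

Definition enorm x : R := Num.sqrt (dotp x x).

Definition eball x (r : R) : set 'rV[R]_d := [set y | enorm (y - x) < r].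

End euclidean.

Section levy.
Context {R : realType} {d : nat} {dO : measure_display}.
Context {Omega : measurableType dO}.
Variables (P : probability Omega R) (X : R -> Omega -> 'rV[R]_d).
Local Notation mu := (lebesgue_rV R d).
Local Notation leb := (@lebesgue_measure R).

(* X t is only meaningful for t >= 0. The law P^x of the process started at x
   is the law of (x + X t)_t under P. *)
Record levy_process : Prop := {
  levy_measurable : forall t, 0 <= t -> measurable_fun setT (X t) ;
  levy_start : P [set w | X 0 w = 0] = 1%E ;
  levy_stationary : forall (s t : R) (A : set 'rV[R]_d),
    0 <= s -> 0 <= t -> measurable A ->
    P [set w | A (X (s + t) w - X s w)] = P [set w | A (X t w)] ;
  levy_independent : forall (n : nat) (t : nat -> R) (A : nat -> set 'rV[R]_d),
    0 <= t 0%N -> (forall k, t k <= t k.+1) -> (forall k, measurable (A k)) ->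
    P (\bigcap_(k in `I_n) [set w | A k (X (t k.+1) w - X (t k) w)]) =
    (\prod_(k < n) P [set w | A k (X (t k.+1) w - X (t k) w)%R])%E ;
  levy_right_continuous : forall w (t : R), 0 <= t ->
    X s w @[s --> t^'+] --> X t w ;
  levy_left_limits : forall w (t : R), 0 < t -> cvg (X s w @[s --> t^'-])
}.

Definition symmetric_process : Prop :=
  forall (t : R) (A : set 'rV[R]_d), 0 <= t -> measurable A ->
    P [set w | A (X t w)] = P [set w | A (- X t w)].

Section levy_khintchine.
Variables (b : 'rV[R]_d) (Q : 'M[R]_d) (N : {measure set 'rV[R]_d -> \bar R}).

(* The characteristic exponent psi of E exp(i xi.X_t) = exp(- t psi(xi)) is
   - i xi.b + 1/2 xi.Q xi
     + \int (1 - exp(i xi.z) + i xi.z 1_{|z| <= 1}) N(dz);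
   lk_re is its real part, and lk_im is minus its imaginary part. *)
Definition lk_re (xi : 'rV[R]_d) : R :=
  2^-1 * dotp xi (xi *m Q) + \int[N]_z (1 - cos (dotp xi z)).

Definition lk_im (xi : 'rV[R]_d) : R :=
  dotp xi b +
  \int[N]_z (sin (dotp xi z) - dotp xi z * \1_[set u | enorm u <= 1] z).

Record levy_triplet : Prop := {
  triplet_sym : Q^T = Q ;
  triplet_psd : forall xi, 0 <= dotp xi (xi *m Q) ;
  triplet_zero : N [set 0] = 0%E ;
  triplet_finite : (\int[N]_z (Num.min 1 (enorm z ^+ 2))%:E < +oo)%E ;
  triplet_cos : forall (t : R) xi, 0 <= t ->
    \int[P]_w cos (dotp xi (X t w)) = expR (- t * lk_re xi) * cos (t * lk_im xi) ;
  triplet_sin : forall (t : R) xi, 0 <= t ->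
    \int[P]_w sin (dotp xi (X t w)) = expR (- t * lk_re xi) * sin (t * lk_im xi)
}.

End levy_khintchine.

(* nu 0 is irrelevant: the Levy measure lives on R^d minus the origin. *)
Definition levy_density (nu : 'rV[R]_d -> R) : Prop :=
  measurable_fun setT nu /\
  exists (b : 'rV[R]_d) (Q : 'M[R]_d) (N : {measure set 'rV[R]_d -> \bar R}),
    levy_triplet b Q N /\
    forall A, measurable A -> N A = (\int[mu]_(z in A) (nu z)%:E)%E.

Record assumptionA1 (nu : 'rV[R]_d -> R) : Prop := {
  A1_symmetric : symmetric_process ;
  A1_density : levy_density nu ;
  A1_positive : forall x, x != 0 -> 0 < nu x ;
  A1_1 : forall r : R, 0 < r -> r <= 2^-1 ->
    exists C1 : R, 1 <= C1 /\ forall x y,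
      r <= enorm y -> enorm y <= enorm x -> enorm x <= enorm y + 1 ->
      C1^-1 * nu y <= nu x /\ nu x <= C1 * nu y ;
  A1_2 : exists C2 : R, 1 <= C2 /\ forall x y,
      2^-1 <= enorm y -> enorm y <= enorm x -> nu x <= C2 * nu y ;
  A1_3 : exists C3 : R, 1 <= C3 /\ forall x y, 1 <= enorm (y - x) ->
      (\int[mu]_(z in [set z | 2^-1 < enorm (z - x) /\ 2^-1 < enorm (z - y)]%R)
         (nu (x - z) * nu (z - y))%R%:E <= (C3 * nu (x - y))%R%:E)%E
}.

Definition strong_feller : Prop :=
  forall (t : R) (f : 'rV[R]_d -> R), 0 < t ->
    measurable_fun setT f -> (exists M, forall x, `|f x| <= M) ->
    continuous (fun x : 'rV[R]_d => \int[P]_w f (x + X t w)).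

(* p t (y - x) is the transition density p(t,x,y). The Chapman-Kolmogorov
   identity at every point selects a unique version; it may take the value +oo,
   typically at 0 for small t. *)
Record transition_density (p : R -> 'rV[R]_d -> \bar R) : Prop := {
  density_ge0 : forall t x, 0 < t -> (0 <= p t x)%E ;
  density_measurable :
    measurable_fun [set z : measurableTypeR R * 'rV[R]_d | 0 < (z.1 : R)]
      (fun z => p z.1 z.2) ;
  density_law : forall t (A : set 'rV[R]_d), 0 < t -> measurable A ->
    P [set w | A (X t w)] = (\int[mu]_(x in A) p t x)%E ;
  density_CK : forall s t x, 0 < s -> 0 < t ->
    p (s + t) x = (\int[mu]_y (p s y * p t (x - y)%R))%E
}.

Definition assumptionA2 : Prop :=
  strong_feller /\
  exists p, transition_density p /\
    exists tb C : R, [/\ 0 < tb, 0 < C &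
      forall x, (0 < p tb x)%E /\ (p tb x <= C%:E)%E].

Definition exit_time (D : set 'rV[R]_d) (path : R -> 'rV[R]_d) : \bar R :=
  ereal_inf [set t%:E | t in [set t : R | 0 <= t /\ ~ D (path t)]].

(* The event {t < tau_D} is in general only measurable for the completion of P,
   and mu_ext P, the outer measure of P, extends that completion. Symmetry and
   the Chapman-Kolmogorov identity at every point select a unique version. *)
Record killed_density (D : set 'rV[R]_d)
    (pD : R -> 'rV[R]_d -> 'rV[R]_d -> \bar R) : Prop := {
  killed_ge0 : forall t x y, 0 < t -> D x -> D y -> (0 <= pD t x y)%E ;
  killed_measurable :
    measurable_fun
      [set z : measurableTypeR R * ('rV[R]_d * 'rV[R]_d) |
        [/\ 0 < (z.1 : R), D z.2.1 & D z.2.2]]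
      (fun z => pD z.1 z.2.1 z.2.2) ;
  killed_law : forall t x (A : set 'rV[R]_d), 0 < t -> D x -> measurable A ->
    mu_ext P [set w | A (x + X t w) /\
                      (t%:E < exit_time D (fun s => (x + X s w)%R))%E] =
    (\int[mu]_(y in A `&` D) pD t x y)%E ;
  killed_sym : forall t x y, 0 < t -> D x -> D y -> pD t x y = pD t y x ;
  killed_CK : forall s t x y, 0 < s -> 0 < t -> D x -> D y ->
    pD (s + t) x y = (\int[mu]_(z in D) (pD s x z * pD t z y))%E
}.

Definition green (D : set 'rV[R]_d) (pD : R -> 'rV[R]_d -> 'rV[R]_d -> \bar R)
    (x y : 'rV[R]_d) : \bar R :=
  if `[< D x /\ D y >] then (\int[leb]_(t in `]0%R, +oo[) pD t x y)%E else 0%E.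

Definition assumptionA3 : Prop :=
  forall p q r : R, 0 < p -> p < q -> q < r -> r <= 1 ->
    exists pD, killed_density (eball 0 r) pD /\
      (ereal_sup [set green (eball 0 r) pD x y |
         x in eball 0 p & y in ~` eball 0 q] < +oo)%E.

Definition regular_jump_levy_process (nu : 'rV[R]_d -> R) : Prop :=
  [/\ levy_process, assumptionA1 nu, assumptionA2 & assumptionA3].

Section potential.
Implicit Type V : 'rV[R]_d -> R.

Definition kato V : Prop :=
  measurable_fun setT V /\
  ereal_sup [set (\int[P]_w \int[leb]_(s in `[0%R, t])
                   `|V (x + X s w)%R|%:E)%E | x in setT]
    @[t --> (0 : R)^'+] --> 0%E.

Definition kato_loc V : Prop :=
  measurable_fun setT V /\ forall z r, kato (fun x => V x * \1_(eball z r) x).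

Definition kato_potential V : Prop :=
  [/\ measurable_fun setT V, kato V^\- & kato_loc V^\+].

Definition confining V : Prop :=
  forall M : R, exists r : R, forall x, r <= enorm x -> M <= V x.

Definition feynman_kac V (t : R) (f : 'rV[R]_d -> R) (x : 'rV[R]_d) : \bar R :=
  (\int[P]_w (expeR (- \int[leb]_(s in `[0%R, t]) (V (x + X s w)%R)%:E) *
              (f (x + X t w)%R)%:E))%E.

Record orthonormal_basis (phi : nat -> 'rV[R]_d -> R) : Prop := {
  basis_L2 : forall n, measurable_fun setT (phi n) /\ finite_norm mu 2%:E (phi n) ;
  basis_orthonormal : forall m n, \int[mu]_x (phi m x * phi n x) = (m == n)%:R ;
  basis_complete : forall f : 'rV[R]_d -> R,
    measurable_fun setT f -> finite_norm mu 2%:E f ->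
    'N[mu]_2%:E[EFin \o (fun x => f x -
                  \sum_(k < n) (\int[mu]_y (f y * phi k y)) * phi k x)%R]%E
      @[n --> \oo] --> 0%E
}.

Record eigenbasis V (lambda : nat -> R) (phi : nat -> 'rV[R]_d -> R) : Prop := {
  eigen_basis : orthonormal_basis phi ;
  eigen_eq : forall n t, 0 < t -> {ae mu, forall x,
    feynman_kac V t (phi n) x = (expR (- lambda n * t) * phi n x)%:E} ;
  eigen_gap : lambda 0%N < lambda 1%N ;
  eigen_nondecreasing : forall n, (1 <= n)%N -> lambda n <= lambda n.+1 ;
  eigen_diverge : lambda n @[n --> \oo] --> +oo ;
  eigen_bounded : forall n, exists M, forall x, `|phi n x| <= M ;
  eigen_continuous : forall n, continuous (phi n) ;
  eigen_ground_state : forall x, 0 < phi 0%N x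
}.

End potential.
End levy.

Section unit_ball.
Context {R : realType} {d : nat}.
Implicit Types (V : 'rV[R]_d -> R) (x : 'rV[R]_d).

(* A confining V is bounded below on unit balls far from the origin, but a
   locally Kato V may be unbounded above on a ball; hence the extended real
   supremum, with inverse 0 when it is +oo. *)
Definition inf_ball V x : R := inf [set V y | y in eball x 1].

Definition sup_ball V x : \bar R := ereal_sup [set (V y)%:E | y in eball x 1].

End unit_ball.

(* Main.v *)
(* Since T_h phi = exp(-lambda h) phi for all h > 0, the bounds are read off the
   first order expansion of T_h phi as h -> 0, at a point x with 4 <= |x|. During
   a short time a path started at y near x either stays in B(x,1), where V >= L
   kills it at rate L, or makes one jump, while two moves have probability
   O(h^2). If |phi| <= a + b nu away from the origin, then the convolution bound
   (A1)(3) shows that one jump contributes at most h (K (a + b nu(x)) + o(1)).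
   Adding a barrier, a trigonometric polynomial on which the generator is
   bounded, localizes the supremum of |phi| to a neighbourhood of x, and gives
     |phi(x)| <= K (a + b nu(x)) / (L - lambda).
   Far out K / (L - lambda) <= 1/2, so iteration from a = sup |phi| reaches a = 0,
   and one more application with L = inf V over B(x,1) is the upper bound. For the
   ground state, a single jump from x into B(0,1) has probability at least
   h (c nu(x) - o(1)), and dually phi_0(x) >= C nu(x) / S when V <= S on B(x,1).

   Jump probabilities at rate h are compared with the Levy measure by
   approximating indicators by trigonometric polynomials, on which the
   Levy-Khintchine formula is exact. Khasminskii's lemma controls the exponential
   of the Kato part of V.

   The constants must not depend on the choice of eigenbasis. Two eigenbases have
   the same eigenvalues, and each function of one is a combination, with
   coefficients at most 1, of the functions of the other for the same eigenvalue;
   the ground states coincide. *)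
Require Import Defs.
From HB Require Import structures.
From mathcomp Require Import all_boot all_order all_algebra.
From mathcomp Require Import all_classical all_reals all_analysis.
From mathcomp Require Import measurable_realfun zify ring lra.

Set Implicit Arguments.
Unset Strict Implicit.
Unset Printing Implicit Defensive.

Import Order.TTheory GRing.Theory Num.Theory.
Import numFieldNormedType.Exports.

Local Open Scope classical_set_scope.
Local Open Scope ring_scope.

(** * The Euclidean norm *)

(** The supremum of [|phi|] near [x] is formed before [h] tends to 0, so errors must be [o(h)]
    uniformly over starting points [y] within 1/2 of [x]. This dictates the [eta * h] terms of the
    one-step bounds, whose threshold [h0] is fixed before [x], [y] and the function. Leaving the
    unit ball has probability of order [h], not [o(h)]; the correction by [V^-] is nevertheless
    [o(h)] because [V^-] vanishes near [y], so that the Kato smallness [e] gets multiplied by an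
    exit probability. Exits are handled without stopping times: paths are split by the index of the
    first exit on a finite grid, the Markov property is applied at deterministic times only, and
    right-continuity passes from dyadic grids to whole paths. The barrier averages [1 - cos] over a
    range of frequencies: a single cosine returns to 1 far away, the average does not, and for each
    frequency the Levy-Khintchine formula bounds the growth of the mean linearly in [h].
    Orthogonality of eigenfunctions from two bases is drawn from completeness together with an L2
    estimate for one Feynman-Kac operator. *)

Lemma cvg_sumr (R : realType) (T : Type) (F : set_system T) {FF : Filter F}
    (I : Type) (r : seq I) (f : I -> T -> R) (l : I -> R) :
  (forall i, f i x @[x --> F] --> l i) ->
  \sum_(i <- r) f i x @[x --> F] --> \sum_(i <- r) l i.
Proof.
move=> fl; elim: r => [|i r IH].
  by rewrite big_nil; under eq_fun do rewrite big_nil; exact: cvg_cst.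
by rewrite big_cons; under eq_fun do rewrite big_cons; exact: cvgD.
Qed.

Section euclidean_norm.
Context {R : realType} {d : nat}.
Implicit Types x y z : 'rV[R]_d.

Lemma dotpC x y : dotp x y = dotp y x.
Proof. by apply: eq_bigr => i _; rewrite mulrC. Qed.

Lemma dotpDr x y z : dotp x (y + z) = dotp x y + dotp x z.
Proof. by rewrite /dotp -big_split; apply: eq_bigr => i _; rewrite mxE mulrDr. Qed.

Lemma dotpDl x y z : dotp (y + z) x = dotp y x + dotp z x.
Proof. by rewrite dotpC dotpDr !(dotpC x). Qed.

Lemma dotpZr a x y : dotp x (a *: y) = a * dotp x y.
Proof. by rewrite /dotp big_distrr; apply: eq_bigr => i _; rewrite mxE mulrCA. Qed.

Lemma dotpZl a x y : dotp (a *: x) y = a * dotp x y.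
Proof. by rewrite dotpC dotpZr dotpC. Qed.

Lemma dotpNr x y : dotp x (- y) = - dotp x y.
Proof. by rewrite -scaleN1r dotpZr mulN1r. Qed.

Lemma dotpNl x y : dotp (- x) y = - dotp x y.
Proof. by rewrite dotpC dotpNr dotpC. Qed.

Lemma dotp0l x : dotp 0 x = 0.
Proof. by apply: big1 => i _; rewrite mxE mul0r. Qed.

Lemma dotpxx_ge0 x : 0 <= dotp x x.
Proof. by apply: sumr_ge0 => i _; rewrite -expr2 sqr_ge0. Qed.

Lemma sqr_enorm x : enorm x ^+ 2 = dotp x x.
Proof. by rewrite sqr_sqrtr// dotpxx_ge0. Qed.

Lemma enorm_ge0 x : 0 <= enorm x.
Proof. exact: sqrtr_ge0. Qed.

Lemma coord_le_enorm x i : `|x 0 i| <= enorm x.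
Proof.
rewrite -ler_sqr ?nnegrE ?enorm_ge0// sqr_enorm real_normK ?num_real//.
rewrite /dotp (bigD1 i)//= -expr2 lerDl; apply: sumr_ge0 => j _.
by rewrite -expr2 sqr_ge0.
Qed.

Lemma cauchy_schwarz_dotp x y : dotp x y <= enorm x * enorm y.
Proof.
have sq : dotp x y ^+ 2 <= dotp x x * dotp y y.
  have [y0|y0] := leP (dotp y y) 0.
    have -> : y = 0.
      apply/rowP => i; rewrite mxE; apply/eqP; rewrite -normr_le0.
      rewrite (le_trans (coord_le_enorm _ _))// -sqrtr0 ler_sqrt//.
    by rewrite dotpC !dotp0l expr0n mulr0.
  have := dotpxx_ge0 (dotp y y *: x - dotp x y *: y).
  rewrite !(dotpDl, dotpDr, dotpNl, dotpNr, dotpZl, dotpZr) (dotpC y x).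
  set a := dotp x x; set b := dotp y y; set c := dotp x y => H.
  have {H} : 0 <= b * (a * b - c ^+ 2).
    by apply: le_trans H _; rewrite le_eqVlt; apply/orP; left; apply/eqP; ring.
  by rewrite pmulr_rge0// subr_ge0.
apply: le_trans (ler_norm _) _.
rewrite -ler_sqr ?nnegrE ?mulr_ge0 ?enorm_ge0//.
by rewrite exprMn !sqr_enorm real_normK ?num_real.
Qed.

Lemma enormD x y : enorm (x + y) <= enorm x + enorm y.
Proof.
rewrite -ler_sqr ?nnegrE ?addr_ge0 ?enorm_ge0//.
rewrite sqrrD !sqr_enorm !(dotpDl, dotpDr) (dotpC y x).
have := cauchy_schwarz_dotp x y; lra.
Qed.

Lemma enormN x : enorm (- x) = enorm x.
Proof. by rewrite /enorm dotpNl dotpNr opprK. Qed.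

Lemma enormB x y : enorm (x - y) <= enorm x + enorm y.
Proof. by rewrite -(enormN y) enormD. Qed.

Lemma enorm_distC x y : enorm (x - y) = enorm (y - x).
Proof. by rewrite -enormN opprB. Qed.

Lemma enorm_sub_ge x y : enorm x - enorm y <= enorm (x - y).
Proof. by rewrite lerBlDr -{1}(subrK y x) enormD. Qed.

Lemma enorm0 : enorm (0 : 'rV[R]_d) = 0.
Proof. by rewrite /enorm dotp0l sqrtr0. Qed.

Lemma enorm_le_sum x : enorm x <= \sum_i `|x 0 i|.
Proof.
have s0 : 0 <= \sum_i `|x 0 i| by apply: sumr_ge0.
rewrite -ler_sqr ?nnegrE ?enorm_ge0// sqr_enorm /dotp expr2 big_distrl /=.
apply: ler_sum => i _; rewrite (le_trans (ler_norm _))// normrM ler_wpM2l//.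
by rewrite (bigD1 i)//= lerDl sumr_ge0.
Qed.

Lemma norm_le_enorm x : `|x| <= enorm x.
Proof.
rewrite [leLHS]mx_normrE; apply/bigmax_leP; split; first exact: enorm_ge0.
by move=> [i j] _ /=; rewrite ord1 coord_le_enorm.
Qed.

(** Barriers and cubes are built coordinate by coordinate; this is the passage from the Euclidean
    norm to one large coordinate, at the price of a factor [d]. *)
Lemma exists_coord_ge x (r : R) : (0 < d)%N -> r <= enorm x ->
  exists i, r / d%:R <= `|x 0 i|.
Proof.
move=> d0 rx; apply/existsP; rewrite -[X in is_true X]negbK negb_exists.
apply/negP => /forallP H.
have d0' : (0 : R) < d%:R by rewrite ltr0n.
have := le_trans rx (enorm_le_sum x); rewrite leNgt => /negP; apply.
have : (\sum_(i < d) `|x 0 i| < \sum_(i < d) r / d%:R).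
  apply: ltr_sum; first by apply/hasP; exists (Ordinal d0) => //; rewrite mem_index_enum.
  by move=> i _; have := H i; rewrite -ltNge.
by rewrite big_const_ord iter_addr_0 -(mulr_natr (r / d%:R)) divfK// gt_eqF.
Qed.

Lemma continuous_dotp y : continuous (dotp y : 'rV[R]_d -> R).
Proof.
by move=> x; apply: (@cvg_sumr _ _ (nbhs x)) => i; apply: cvgMr; exact: coord_continuous.
Qed.

Lemma continuous_enorm : continuous (enorm : 'rV[R]_d -> R).
Proof.
move=> x; apply: (@continuous_comp _ _ _ (fun x => dotp x x) Num.sqrt).
  by apply: (@cvg_sumr _ _ (nbhs x)) => i; apply: cvgM; exact: coord_continuous.
exact: sqrt_continuous.
Qed.

Lemma open_eball x r : open (eball x r).
Proof.
rewrite (_ : eball x r = (fun y => enorm (y - x)) @^-1` [set z | z < r])//.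
apply: (@open_comp _ _ (fun y : 'rV[R]_d => enorm (y - x)) [set z : R | z < r]); last exact: open_lt.
move=> y _; apply: (@continuous_comp _ _ _ (fun y : 'rV[R]_d => y - x) enorm).
  by apply: (@cvgB _ _ _ (nbhs y) _ id (cst x)); [exact: cvg_id|exact: cvg_cst].
exact: continuous_enorm.
Qed.

End euclidean_norm.

(** * Measurability of maps into R^d *)

Section measurable_rV.
Context {R : realType}.

Lemma measurable_fun_rV (d : nat) d' (T : measurableType d') (f : T -> 'rV[R]_d) :
  (forall i, measurable_fun setT (fun w => f w 0 i : measurableTypeR R)) ->
  measurable_fun setT f.
Proof.
elim: d f => [|d IH] f mf _ A mA.
  have [fA|fA] := pselect (A 0).
    rewrite setTI (_ : _ @^-1` _ = setT)//; apply/seteqP; split => // x _ /=.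
    by rewrite (_ : f x = 0)//; apply/rowP => -[].
  rewrite setTI (_ : _ @^-1` _ = set0)//; apply/seteqP; split => x //=.
  by rewrite (_ : f x = 0)//; apply/rowP => -[].
have fE : f = @rv_cons R d \o (fun w => (f w 0 0, \row_i f w 0 (lift 0 i))).
  apply/funext => w /=; apply/rowP => j; case: (unliftP 0 j) => [j'|] ->.
    by rewrite rv_consES mxE.
  by rewrite rv_consE0.
rewrite fE; apply: (@measurable_comp _ _ _ _ _ _ setT) => //.
  exact: measurable_rv_cons.
apply/measurable_fun_pairP; split => /=; first exact: mf.
apply: IH => i; under eq_fun do rewrite mxE; exact: mf.
Qed.

Lemma continuous_measurable_rV (d : nat) (f : 'rV[R]_d -> R) :
  continuous f -> measurable_fun setT f.
Proof.
move=> cf; apply: (measurability _ (RGenOpens.measurableE R)) => // _ [_ [a [b ->]] <-].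
rewrite setTI; apply: open_measurable_rV.
apply: (@open_comp _ _ _ _ _ (@interval_open R (BRight a) (BLeft b) _ _)) => //.
Qed.

Lemma measurable_coord (d : nat) (D : set 'rV[R]_d) (i : 'I_d) :
  measurable_fun D (fun v : 'rV[R]_d => v 0 i).
Proof. by apply: measurable_funTS; exact: measurable_rV_coord. Qed.

Lemma measurable_coord_comp (d : nat) d' (T : measurableType d')
    (f : T -> 'rV[R]_d) i :
  measurable_fun setT f -> measurable_fun setT (fun w => f w 0 i).
Proof. by move=> mf; apply: (measurableT_comp (@measurable_coord d setT i) mf). Qed.

Lemma measurable_rVD (d : nat) d' (T : measurableType d')
    (f g : T -> 'rV[R]_d) :
  measurable_fun setT f -> measurable_fun setT g ->
  measurable_fun setT (fun w => f w + g w).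
Proof.
move=> mf mg; apply: measurable_fun_rV => i; under eq_fun do rewrite mxE.
by apply: measurable_funD; exact: measurable_coord_comp.
Qed.

Lemma measurable_rVN (d : nat) d' (T : measurableType d') (f : T -> 'rV[R]_d) :
  measurable_fun setT f -> measurable_fun setT (fun w => - f w).
Proof.
move=> mf; apply: measurable_fun_rV => i; under eq_fun do rewrite mxE.
apply: measurable_funN; exact: measurable_coord_comp.
Qed.

Lemma measurable_rVB (d : nat) d' (T : measurableType d')
    (f g : T -> 'rV[R]_d) :
  measurable_fun setT f -> measurable_fun setT g ->
  measurable_fun setT (fun w => f w - g w).
Proof. by move=> mf mg; apply: measurable_rVD => //; exact: measurable_rVN. Qed.

Lemma measurable_enorm (d : nat) (D : set 'rV[R]_d) :
  measurable_fun D (enorm : 'rV[R]_d -> R).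
Proof.
by apply: measurable_funTS; apply: continuous_measurable_rV; exact: continuous_enorm.
Qed.

Lemma measurable_rV_cvg (d : nat) d' (T : measurableType d')
    (f : nat -> T -> 'rV[R]_d) (g : T -> 'rV[R]_d) :
  (forall n, measurable_fun setT (f n)) ->
  (forall w, f n w @[n --> \oo] --> g w) -> measurable_fun setT g.
Proof.
move=> mf fg; apply: measurable_fun_rV => i.
apply: (@measurable_fun_cvg _ _ _ setT (fun n w => f n w 0 i)).
  by move=> n; exact: measurable_coord_comp.
move=> w _; apply: (@cvg_comp _ _ _ (f^~ w) (fun v : 'rV[R]_d => v 0 i) _ _ _ (fg w)).
exact: coord_continuous.
Qed.

Lemma measurable_eball (d : nat) (x : 'rV[R]_d) r : measurable (eball x r).
Proof. by apply: open_measurable_rV; exact: open_eball. Qed.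

End measurable_rV.

(** * Laws and the Markov property *)

Section laws.
Local Open Scope ereal_scope.

Definition push_measure (R : realType) d1 d2 (T1 : measurableType d1)
    (T2 : measurableType d2) (m : {measure set T1 -> \bar R}) (f : T1 -> T2)
    (mf : measurable_fun setT f) : {measure set T2 -> \bar R} :=
  measure_function_pushforward__canonical__measure_function_Measure m mf.

Lemma measurable_preimage d1 d2 (T1 : measurableType d1)
    (T2 : measurableType d2) (f : T1 -> T2) (A : set T2) :
  measurable_fun setT f -> measurable A -> measurable (f @^-1` A).
Proof. by move=> mf mA; rewrite -[X in measurable X]setTI; exact: mf. Qed.

Lemma ge0_integral_law (R : realType) d1 d2 d3 (T1 : measurableType d1)
    (T2 : measurableType d2) (T3 : measurableType d3)
    (m1 : {measure set T1 -> \bar R}) (m2 : {measure set T2 -> \bar R})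
    (f1 : T1 -> T3) (f2 : T2 -> T3) :
  measurable_fun setT f1 -> measurable_fun setT f2 ->
  (forall A, measurable A -> m1 (f1 @^-1` A) = m2 (f2 @^-1` A)) ->
  forall g : T3 -> \bar R, measurable_fun setT g -> (forall x, 0 <= g x) ->
  \int[m1]_x g (f1 x) = \int[m2]_x g (f2 x).
Proof.
move=> mf1 mf2 m12 g mg g0.
have := @ge0_integral_pushforward _ _ _ _ R f1 mf1 m1 setT g measurableT mg
  (fun x _ => g0 x).
have := @ge0_integral_pushforward _ _ _ _ R f2 mf2 m2 setT g measurableT mg
  (fun x _ => g0 x).
rewrite !preimage_setT /= => <- <-.
apply: (@eq_measure_integral _ _ _ _ (push_measure m2 mf2)) => A mA _.
exact: m12.
Qed.

Lemma measure_prod_unique (R : realType) d1 d2 (T1 : measurableType d1)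
    (T2 : measurableType d2) (m1 m2 : {measure set (T1 * T2) -> \bar R}) :
  (forall A B, measurable A -> measurable B -> m1 (A `*` B) = m2 (A `*` B)) ->
  m1 setT < +oo -> forall A, measurable A -> m1 A = m2 A.
Proof.
move=> m12 m1oo.
apply: (measure_unique [set A `*` B | A in measurable & B in measurable]
  (fun=> setT)) => //.
- by rewrite measurable_prod_measurableType.
- move=> _ _ [A1 mA1 [B1 mB1 <-]] [A2 mA2 [B2 mB2 <-]].
  exists (A1 `&` A2); first exact: measurableI.
  by exists (B1 `&` B2); [exact: measurableI|rewrite setXI].
- by move=> _; exists setT => //; exists setT => //; rewrite setXTT.
- by rewrite bigcup_const//; exists 0%N.
- by move=> _ [A mA [B mB <-]]; exact: m12.
Qed.

End laws.

(** The path is the pointwise limit of its values at grid times approaching [s] from the right; each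
    approximation is constant in time on countably many intervals, hence jointly measurable. *)
Lemma measurable_right_continuous (R : realType) (d : nat) d'
    (T : measurableType d') (Y : R -> T -> 'rV[R]_d) :
  (forall s, measurable_fun setT (Y s)) ->
  (forall w s, Y u w @[u --> s^'+] --> Y s w) ->
  measurable_fun setT (fun z : measurableTypeR R * T => Y z.1 z.2).
Proof.
move=> mY rY.
pose k n (s : R) := Num.floor (n.+1%:R * s).
(* Floor plus one rather than ceiling: the grid point lies strictly to the right of [s] even when
   [s] is on the grid, as the filter [s^'+] excludes [s]. *)
pose u n (s : R) : R := ((k n s)%:~R + 1) / n.+1%:R.
have us n s : s < u n s.
  by rewrite /u ltr_pdivlMr ?ltr0n// mulrC; have := floorD1_gt (n.+1%:R * s); rewrite intrD.
have us2 n s : u n s <= s + n.+1%:R^-1.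
  rewrite /u mulrDl mul1r lerD2r ler_pdivrMr ?ltr0n// mulrC.
  exact: floor_le.
apply: (@measurable_rV_cvg _ _ _ _ (fun n z => Y (u n z.1) z.2)) => [n|[s w]].
  move=> _ A mA; rewrite setTI.
  rewrite (_ : _ @^-1` _ = \bigcup_(j : int)
    ([set s : measurableTypeR R | k n s = j] `*`
     (Y ((j%:~R + 1) / n.+1%:R) @^-1` A))); last first.
    apply/seteqP; split => [[s w] /= As|[s w] [j _ [/= <-]]//].
    by exists (k n s).
  apply: countable_bigcupT_measurable => [|j]; first exact: countableP.
  apply: measurableX; last exact: measurable_preimage.
  rewrite (_ : [set _ | _] =
    [set` `[j%:~R / n.+1%:R, (j%:~R + 1) / n.+1%:R[%R]); first exact: measurable_itv.
  apply/seteqP; split => s; rewrite /= in_itv/= ler_pdivrMr ?ltr0n//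
    ltr_pdivlMr ?ltr0n// (mulrC s); [move=> <-|case/andP => h1 h2].
    by rewrite floor_le; have := floorD1_gt (n.+1%:R * s); rewrite intrD.
  by apply/eqP; rewrite floor_eq h1 intrD.
apply: (@cvg_comp _ _ _ (u^~ s) (Y^~ w) \oo (s^'+) (nbhs (Y s w))); last exact: rY.
move=> B [e /= e0 eB]; near=> n.
apply: eB; last exact: us.
rewrite /= ltr0_norm ?subr_lt0 ?us// opprB ltrBlDr addrC.
rewrite (le_lt_trans (us2 _ _))// ltrD2l; near: n.
exact: (near_infty_natSinv_lt (PosNum e0)).
Unshelve. all: by end_near. Qed.

Section filtration.
Context {R : realType} {d : nat} {dO : measure_display}.
Context {Omega : measurableType dO}.
Variables (P : probability Omega R) (X : R -> Omega -> 'rV[R]_d).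
Hypothesis LX : levy_process P X.

Let mX t : 0 <= t -> measurable_fun setT (X t).
Proof. exact: (levy_measurable LX). Qed.

(** Generators of the natural filtration at time [t]. Taking [g_sigma_algebraType (past_sets t)] as
    domain turns adaptedness into plain [measurable_fun], so the library's product and Fubini lemmas
    apply to it. *)
Definition past_sets (t : R) : set (set Omega) :=
  [set E | exists s A, [/\ 0 <= s, s <= t, measurable A & E = X s @^-1` A]].

Lemma past_sets_measurable t : <<s past_sets t >> `<=` measurable.
Proof.
apply: smallest_sub; first exact: sigma_algebra_measurable.
by move=> _ [s [A [s0 _ mA ->]]]; apply: measurable_preimage => //; exact: mX.
Qed.

Lemma past_sets_le s t : s <= t -> <<s past_sets s >> `<=` <<s past_sets t >>.
Proof.
move=> st; apply: sub_sigma_algebra2 => _ [u [A [u0 us mA ->]]].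
by exists u, A; split => //; exact: le_trans us st.
Qed.

Let cyl (tau : nat -> R) (A : nat -> set 'rV[R]_d) (n : nat) : set Omega :=
  \bigcap_(k in `I_n) [set w | A k (X (tau k.+1) w - X (tau k) w)].

Let pcyl (tau : nat -> R) (A : nat -> set 'rV[R]_d) (n : nat) : \bar R :=
  (\prod_(k < n) P [set w | A k (X (tau k.+1) w - X (tau k) w)%R])%E.

(* [E] is independent, jointly with [X t], of the increments after [t]. *)
Let good (t : R) (E : set Omega) := measurable E /\
  forall (B : set 'rV[R]_d) (n : nat) tau A, measurable B -> tau 0%N = t ->
    (forall k, tau k <= tau k.+1) -> (forall k, measurable (A k)) ->
    P (E `&` X t @^-1` B `&` cyl tau A n) =
    (P (E `&` X t @^-1` B) * pcyl tau A n)%E.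

Let minc (s t : R) : 0 <= s -> 0 <= t ->
  measurable_fun setT (fun w => X t w - X s w).
Proof. by move=> s0 t0; apply: measurable_rVB; exact: mX. Qed.

Let mcyl tau A n : 0 <= tau 0%N -> (forall k, tau k <= tau k.+1) ->
  (forall k, measurable (A k)) -> measurable (cyl tau A n).
Proof.
move=> t0 ndt mA; apply: fin_bigcap_measurable => // k _.
have tk m : 0 <= tau m by elim: m => // m IH; exact: le_trans IH (ndt m).
exact: (measurable_preimage (@minc (tau k) (tau k.+1) _ _)).
Qed.

Let pcyl_P tau A n : 0 <= tau 0%N -> (forall k, tau k <= tau k.+1) ->
  (forall k, measurable (A k)) -> P (cyl tau A n) = pcyl tau A n.
Proof. by move=> t0 ndt mA; exact: (levy_independent LX). Qed.

(** [X 0 = 0] holds only almost surely: according to whether [0] is in [B], the event [X 0] in [B]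
    is almost sure or null, and independence of increments does the rest. *)
Let good0 : good 0 setT.
Proof.
split=> // B n tau A mB tau0 ndt mA; rewrite setTI.
have t0 : 0 <= tau 0%N by rewrite tau0.
have mC := @mcyl tau A n t0 ndt mA.
have mX0 : measurable (X 0 @^-1` B) by apply: measurable_preimage => //; exact: mX.
have mX00 : measurable (X 0 @^-1` [set 0]).
  apply: measurable_preimage; first exact: mX.
  rewrite (_ : [set 0] = ~` [set v : 'rV[R]_d | 0 < enorm v]).
    apply: measurableC; apply: open_measurable_rV.
    rewrite (_ : [set _ | _] = enorm @^-1` [set r | 0 < r])//.
    apply: open_comp; last exact: open_gt.
    by move=> v _; exact: continuous_enorm.
  apply/seteqP; split => v /=; first by move=> ->; rewrite enorm0 ltxx.
  move=> /negP; rewrite -leNgt => v0; apply/eqP; rewrite -normr_le0.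
  exact: le_trans (norm_le_enorm v) v0.
have null (F : set Omega) : measurable F ->
    (forall w, F w -> X 0 w <> 0) -> P F = 0%E.
  move=> mF F0; apply/eqP; rewrite -measure_le0.
  have <- : P (~` (X 0 @^-1` [set 0])) = 0%E.
    rewrite probability_setC//; have := levy_start LX.
    by rewrite /preimage /= => ->; rewrite subee.
  by apply: le_measure; rewrite ?inE//; exact: measurableC.
have [B0|B0] := pselect (B 0).
  have PE (F : set Omega) : measurable F -> P (X 0 @^-1` B `&` F) = P F.
    move=> mF; have -> : P F = (P (X 0 @^-1` B `&` F) + P (F `\` X 0 @^-1` B))%E.
      rewrite -measureU//; first by rewrite setIC setUIDK.
      - exact: measurableI.
      - exact: measurableD.
      by apply/seteqP; split => // w [[? _] [_]].
    rewrite (null (_ `\` _)) ?adde0//; first exact: measurableD.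
    by move=> w [_ /= XB] X0; apply: XB; rewrite X0.
  rewrite PE// -(setIT (X 0 @^-1` B)) PE// probability_setT mul1e.
  exact: pcyl_P.
rewrite (null (X 0 @^-1` B)) ?mul0e//; last by move=> w /= + X0; rewrite X0.
by rewrite null//; [exact: measurableI|move=> w [/= + _] X0; rewrite X0].
Qed.

(** The pair of [X t] and [X t' - X t] has, on [E] cut with the later increments [C], the same law
    as on [E] alone scaled by [P C]: both agree on rectangles by the hypothesis with one increment
    prepended. The event [X t'] in [B] is the image event of a set of pairs whose sum lies in
    [B]. *)
Let good_le t t' E : 0 <= t -> t <= t' -> good t E -> good t' E.
Proof.
move=> t0 tt' [mE gE]; split=> // B n tau A mB tau0 ndt mA.
have t'0 : 0 <= t' by exact: le_trans tt'.
have tau00 : 0 <= tau 0%N by rewrite tau0.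
have mC := @mcyl tau A n tau00 ndt mA.
pose C := cyl tau A n.
pose Z (w : Omega) := (X t w, X t' w - X t w).
have mZ : measurable_fun setT Z.
  by apply: measurable_fun_pair; [exact: mX|exact: minc].
have c0 : 0 <= fine (P C) by rewrite fine_ge0.
pose m1 := push_measure (mrestr P (measurableI _ _ mE mC)) mZ.
pose m2 := mscale (NngNum c0) (push_measure (mrestr P mE) mZ).
have m12 D : measurable D -> m1 D = m2 D.
  apply: measure_prod_unique => [A1 A2 mA1 mA2|].
    change (P (Z @^-1` (A1 `*` A2) `&` (E `&` cyl tau A n)) =
      ((fine (P C))%:E * P (Z @^-1` (A1 `*` A2) `&` E))%E).
    have mI : measurable [set w | A2 (X t' w - X t w)].
      exact: (measurable_preimage (minc _ _)).
    pose tau' k := if k is k'.+1 then tau k' else t.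
    pose A' k := if k is k'.+1 then A k' else A2.
    have tau'E : forall k, tau' k <= tau' k.+1 by case=> //=; rewrite tau0.
    have mA' : forall k, measurable (A' k) by case.
    have cylE m : cyl tau' A' m.+1 = [set w | A2 (X t' w - X t w)] `&` cyl tau A m.
      apply/seteqP; split => w.
        move=> H; split; first by have := H 0%N isT; rewrite /= tau0.
        by move=> k km; exact: (H k.+1).
      by move=> [H1 H2] [_|k km]; [rewrite /= tau0|exact: H2].
    have pcylE m : pcyl tau' A' m.+1 =
        (P [set w | A2 (X t' w - X t w)%R] * pcyl tau A m)%E.
      by rewrite /pcyl big_ord_recl /= tau0.
    have g1 := gE A1 n.+1 tau' A' mA1 erefl tau'E mA'.
    have g2 := gE A1 1%N tau' A' mA1 erefl tau'E mA'.
    rewrite cylE pcylE in g1; rewrite cylE pcylE in g2.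
    rewrite /cyl /pcyl big_ord0 mule1 II0 bigcap_set0 setIT in g2.
    rewrite (_ : Z @^-1` (A1 `*` A2) `&` (E `&` cyl tau A n) =
      E `&` X t @^-1` A1 `&` ([set w | A2 (X t' w - X t w)] `&` cyl tau A n)).
      rewrite g1 (_ : Z @^-1` (A1 `*` A2) `&` E =
        E `&` X t @^-1` A1 `&` [set w | A2 (X t' w - X t w)]).
        rewrite g2 fineK ?fin_num_measure// -/C pcyl_P//.
        by rewrite muleA muleC.
      by apply/seteqP; split => w /=; rewrite /Z /=; tauto.
    by apply/seteqP; split => w /=; rewrite /Z /=; tauto.
  change (P (Z @^-1` setT `&` (E `&` cyl tau A n)) < +oo)%E.
  rewrite preimage_setT setTI.
  by rewrite (le_lt_trans (probability_le1 _ _)) ?ltry//; exact: measurableI.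
pose S := [set z : 'rV[R]_d * 'rV[R]_d | B (z.1 + z.2)].
have mD : measurable S.
  apply: (measurable_preimage _ mB).
  by apply: measurable_rVD; [exact: measurable_fst|exact: measurable_snd].
have : P (Z @^-1` S `&` (E `&` cyl tau A n)) =
    ((fine (P C))%:E * P (Z @^-1` S `&` E))%E by exact: m12 mD.
have ZE : Z @^-1` S = X t' @^-1` B.
  by apply/seteqP; split => w; rewrite /S /Z /preimage /= addrC subrK.
rewrite ZE fineK ?fin_num_measure// -pcyl_P// muleC.
by rewrite setIA (setIC (X t' @^-1` B)).
Qed.

Let goodI t E B : 0 <= t -> measurable B -> good t E -> good t (E `&` X t @^-1` B).
Proof.
move=> t0 mB [mE gE]; split.
  by apply: measurableI => //; apply: measurable_preimage => //; exact: mX.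
move=> B' n tau A mB' tau0 ndt mA.
by rewrite -(setIA E) -preimage_setI gE//; exact: measurableI.
Qed.

Let meets (l : seq (R * set 'rV[R]_d)) : set Omega :=
  [set w | forall p, p \in l -> p.2 (X p.1 w)].

Let good_path l t E : 0 <= t -> good t E -> (forall p, p \in l -> measurable p.2) ->
  path <=%R t (map fst l) -> good (last t (map fst l)) (E `&` meets l).
Proof.
elim: l t E => [|p l IH] t E t0 gE ml /=.
  move=> _; rewrite (_ : meets _ = setT) ?setIT//.
  by apply/seteqP; split.
move=> /andP[tp pl].
have p0 : 0 <= p.1 by exact: le_trans tp.
have -> : E `&` meets (p :: l) = (E `&` X p.1 @^-1` p.2) `&` meets l.
  apply/seteqP; split => w.
    move=> [Ew H]; split; first by split => //; apply: H; rewrite mem_head.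
    by move=> q ql; apply: H; rewrite inE ql orbT.
  move=> [[Ew H1] H]; split => // q; rewrite inE => /predU1P[->//|].
  exact: H.
apply: IH => //.
- apply: goodI => //; first by apply: ml; rewrite mem_head.
  exact: (good_le t0 tp).
- by move=> q ql; apply: ml; rewrite inE ql orbT.
Qed.

Let good_meets l t : 0 <= t ->
  (forall p, p \in l -> [/\ 0 <= p.1, p.1 <= t & measurable p.2]) ->
  good t (meets l).
Proof.
(* The constraints come in any order; sorting them by time lets [good_path] impose them one after
   the other. *)
move=> t0 ml; pose s := sort (fun p q => p.1 <= q.1) l.
have sl p : (p \in s) = (p \in l) by rewrite mem_sort.
have -> : meets l = setT `&` meets s.
  by rewrite setTI; apply/seteqP; split => w H p pl; apply: H; rewrite ?sl// -sl.
have ps : path <=%R 0 (map fst s).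
  have : sorted <=%R (map fst s).
    rewrite sorted_map; apply: sort_sorted => p q; exact: le_total.
  case E : (map fst s) => [//|a r] /= ->; rewrite andbT.
  have : a \in map fst s by rewrite E mem_head.
  by move=> /mapP[p ps ->]; rewrite sl in ps; case: (ml p ps).
apply: (good_le _ _ (good_path (lexx 0) good0 _ ps)).
- have : last 0 (map fst s) \in 0 :: map fst s by exact: mem_last.
  rewrite inE => /predU1P[->//|/mapP[p ps' ->]].
  by rewrite sl in ps'; case: (ml p ps').
- have : last 0 (map fst s) \in 0 :: map fst s by exact: mem_last.
  rewrite inE => /predU1P[->//|/mapP[p ps' ->]].
  by rewrite sl in ps'; case: (ml p ps').
- by move=> p; rewrite sl => /ml[].
Qed.

(** For fixed [B] both sides are finite measures in [E], and finite conjunctions [meets l] of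
    one-time constraints form a generating pi-system on which [good_meets] gives equality. *)
Theorem past_independent (s t : R) (E : set Omega) (B : set 'rV[R]_d) :
  0 <= t -> t <= s -> <<s past_sets t >> E -> measurable B ->
  P (E `&` [set w | B (X s w - X t w)]) = (P E * P [set w | B (X (s - t) w)])%E.
Proof.
move=> t0 ts pE mB; have s0 : 0 <= s by exact: le_trans ts.
have mI : measurable [set w | B (X s w - X t w)].
  exact: (measurable_preimage (minc _ _)).
have -> : P [set w | B (X (s - t) w)] = P [set w | B (X s w - X t w)].
  have := @levy_stationary _ _ _ _ _ _ LX t (s - t) B t0 _ mB.
  by rewrite subr_ge0 => /(_ ts); rewrite addrC subrK.
have c0 : 0 <= fine (P [set w | B (X s w - X t w)]) by rewrite fine_ge0.
pose m1 := mrestr P mI.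
pose m2 := mscale (NngNum c0) P.
suff : m1 E = m2 E.
  by rewrite /m1 /m2 /mrestr /mscale /= fineK ?fin_num_measure// muleC.
pose G : set (set Omega) := [set E | exists2 l, E = meets l &
  (forall p, p \in l -> [/\ 0 <= p.1, p.1 <= t & measurable p.2])].
have GE : <<s G >> E.
  apply: sub_sigma_algebra2 pE => _ [u [A [u0 ut mA ->]]].
  exists [:: (u, A)]; last by move=> p; rewrite inE => /eqP ->.
  apply/seteqP; split => w /=; first by move=> H p; rewrite inE => /eqP ->.
  by move=> /(_ (u, A)); apply; rewrite mem_head.
apply: (@g_sigma_algebra_measure_unique _ _ _ G _ (fun=> setT)) => //.
- by move=> _ [l -> ml]; case: (good_meets t0 ml).
- move=> _; exists [::] => //; by apply/seteqP; split.
- by rewrite bigcup_const//; exists 0%N.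
- move=> _ _ [l1 -> ml1] [l2 -> ml2]; exists (l1 ++ l2).
    apply/seteqP; split => w.
      by move=> [H1 H2] p; rewrite mem_cat => /orP[/H1|/H2].
    by move=> H; split => p pl; apply: H; rewrite mem_cat pl ?orbT.
  by move=> p; rewrite mem_cat => /orP[/ml1|/ml2].
- move=> _ [l -> ml]; have [_ g] := good_meets t0 ml.
  (* A single increment, from [t] to [s]; the sequence stays at [s] afterwards because [good] wants
     an infinite nondecreasing one. *)
  pose tau k := if k is 0%N then t else s.
  have := g setT 1%N tau (fun=> B) measurableT erefl _ (fun=> mB).
  rewrite preimage_setT setIT /pcyl big_ord1 /cyl /=.
  rewrite (_ : \bigcap_(k in _) _ = [set w | B (X s w - X t w)]).
    rewrite /m1 /m2 /mrestr /mscale /= fineK ?fin_num_measure// muleC; apply.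
    by case.
  apply/seteqP; split => w; first by move=> /(_ 0%N isT).
  by move=> H [|k].
- move=> _; rewrite /= /mrestr setTI.
  by rewrite (le_lt_trans (probability_le1 _ _))// ltry.
Qed.

Let idP (t : R) : Omega -> g_sigma_algebraType (past_sets t) := id.

Lemma measurable_past (t : R) d' (T : measurableType d')
    (f : g_sigma_algebraType (past_sets t) -> T) :
  measurable_fun setT f -> measurable_fun setT (f : Omega -> T).
Proof.
move=> mf _ A mA; rewrite setTI; apply: (@past_sets_measurable t).
exact: (measurable_preimage mf mA).
Qed.

Let measurable_idP t : measurable_fun setT (@idP t).
Proof. exact: (@measurable_past t _ _ id (@measurable_id _ _ _)). Qed.

(** Independence makes the joint law of past and increment a product measure. The function [g] sees
    the past through the whole sample point, measurably for the past sigma-algebra, which covers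
    path functionals and needs no conditional expectation. *)
Theorem markov_property (s t : R)
    (g : g_sigma_algebraType (past_sets t) * 'rV[R]_d -> \bar R) :
  0 <= t -> t <= s -> measurable_fun setT g -> (forall z, 0 <= g z)%E ->
  (\int[P]_w g (w, (X s w - X t w)%R) =
   \int[P]_w \int[P]_w' g (w, X (s - t)%R w'))%E.
Proof.
move=> t0 ts mg g0; have s0 : 0 <= s by exact: le_trans ts.
have st0 : 0 <= s - t by rewrite subr_ge0.
pose f1 (w : Omega) := (@idP t w, X s w - X t w).
pose f2 (z : Omega * Omega) := (@idP t z.1, X (s - t) z.2).
have mf1 : measurable_fun setT f1.
  by apply: measurable_fun_pair; [exact: measurable_idP|exact: minc].
have mf2 : measurable_fun setT f2.
  apply: measurable_fun_pair.
    exact: (measurableT_comp (@measurable_idP t) measurable_fst).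
  exact: (measurableT_comp (mX st0) measurable_snd).
have law A : measurable A -> P (f1 @^-1` A) = (P \x P)%E (f2 @^-1` A).
  pose m1 := push_measure P mf1.
  pose m2 := push_measure (P \x P)%E mf2.
  move=> mA; suff : m1 A = m2 A by [].
  apply: measure_prod_unique mA => [A1 A2 mA1 mA2|].
    change (P (f1 @^-1` (A1 `*` A2)) = (P \x P)%E (f2 @^-1` (A1 `*` A2))).
    rewrite (_ : f1 @^-1` _ = A1 `&` [set w | A2 (X s w - X t w)])//.
    rewrite past_independent//.
    rewrite (_ : f2 @^-1` _ = A1 `*` [set w | A2 (X (s - t) w)])//.
    rewrite product_measure1E//; first exact: (@past_sets_measurable t).
    by apply: measurable_preimage => //; exact: mX.
  change (P (f1 @^-1` setT) < +oo)%E.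
  by rewrite preimage_setT probability_setT ltry.
rewrite (ge0_integral_law mf1 mf2 law mg g0).
rewrite (fubini_tonelli1 (fun z => g (f2 z)))//.
exact: measurableT_comp.
Qed.

End filtration.

(** * The characteristic exponent *)

Section integral_tools.
Context {R : realType}.

Lemma integral_law d1 d2 d3 (T1 : measurableType d1)
    (T2 : measurableType d2) (T3 : measurableType d3)
    (m1 : {measure set T1 -> \bar R}) (m2 : {measure set T2 -> \bar R})
    (f1 : T1 -> T3) (f2 : T2 -> T3) :
  measurable_fun setT f1 -> measurable_fun setT f2 ->
  (forall A, measurable A -> m1 (f1 @^-1` A) = m2 (f2 @^-1` A)) ->
  forall g : T3 -> \bar R, measurable_fun setT g ->
  (\int[m1]_x g (f1 x) = \int[m2]_x g (f2 x))%E.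
Proof.
move=> mf1 mf2 m12 g mg; rewrite integralE [RHS]integralE; congr (_ - _)%E.
  have := ge0_integral_law mf1 mf2 m12 (measurable_funepos mg).
  by rewrite funepos.unlock; apply=> x; rewrite le_max lexx orbT.
have := ge0_integral_law mf1 mf2 m12 (measurable_funeneg mg).
by rewrite funeneg.unlock; apply=> x; rewrite le_max lexx orbT.
Qed.

Lemma bounded_integrable d1 (T1 : measurableType d1)
    (m : {finite_measure set T1 -> \bar R}) (f : T1 -> R) (M : R) :
  measurable_fun setT f -> (forall w, `|f w| <= M) ->
  m.-integrable setT (EFin \o f).
Proof.
move=> mf fM; apply: measurable_bounded_integrable => //.
  exact: fin_num_fun_lty.
exists M; split; first exact: num_real.
by move=> N MN w _; rewrite /= (le_trans (fM w))// ltW.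
Qed.

Lemma tonelli_in d1 d2 (T1 : measurableType d1) (T2 : measurableType d2)
    (m1 : {sigma_finite_measure set T1 -> \bar R})
    (m2 : {sigma_finite_measure set T2 -> \bar R}) (D : set T2)
    (f : T1 -> T2 -> \bar R) :
  measurable D -> measurable_fun setT (fun z : T1 * T2 => f z.1 z.2) ->
  (forall x y, (0 <= f x y)%E) ->
  (\int[m1]_x \int[m2]_(y in D) f x y = \int[m2]_(y in D) \int[m1]_x f x y)%E.
Proof.
move=> mD mf f0.
pose g (z : T1 * T2) := (f z.1 z.2 * (\1_D z.2)%:E)%E.
have mg : measurable_fun setT g.
  apply: emeasurable_funM => //; apply/measurable_EFinP.
  by apply: measurableT_comp => //; exact: measurable_indic.
have g0 z : (0 <= g z)%E by rewrite mule_ge0// lee_fin.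
transitivity (\int[m1]_x \int[m2]_y g (x, y))%E.
  apply: eq_integral => x _; rewrite integral_mkcond; apply: eq_integral => y _.
  by rewrite patchE /g /= indicE; case: (y \in D); rewrite ?mule1 ?mule0.
rewrite (fubini_tonelli g)// [RHS]integral_mkcond; apply: eq_integral => y _.
rewrite patchE /g /= indicE; case: (y \in D).
  by apply: eq_integral => x _; rewrite mule1.
by under eq_integral do rewrite mule0; rewrite integral0.
Qed.

End integral_tools.

Section trigonometric_inequalities.
Context {R : realType}.
Implicit Types u t : R.

Lemma normr_sin_le t : `|sin t| <= `|t|.
Proof.
have H u : 0 <= u -> `|sin u| <= u.
  move=> u0; have [|c _] := @MVT_segment R sin cos 0 u u0.
    by apply: continuous_subspaceT => x; exact: continuous_sin.
  rewrite sin0 !subr0 => ->; rewrite normrM (ger0_norm u0).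
  by rewrite ler_piMl// cos_max.
have [t0|/ltW t0] := leP 0 t; first by rewrite (ger0_norm t0) H.
by rewrite -normrN -sinN (ler0_norm t0) H// oppr_ge0.
Qed.

Lemma one_sub_cos_le u : 1 - cos u <= u ^+ 2 / 2.
Proof.
have h : sin (u / 2) ^+ 2 <= (u / 2) ^+ 2.
  rewrite -(real_normK (num_real (sin _))) -(real_normK (num_real (u / 2))).
  by rewrite ler_sqr ?nnegrE// normr_sin_le.
have e : 1 - cos u = sin (u / 2) ^+ 2 * 2.
  rewrite {1}(_ : u = (u / 2) *+ 2); last by rewrite -mulr_natr divfK.
  by rewrite cos_mulr2n sin2cos2; ring.
by rewrite e (le_trans (ler_wpM2r _ h))// le_eqVlt; apply/orP; left; apply/eqP; field.
Qed.

(** The average of [1 - cos (s * u)] over [s] in [0, 1]. It vanishes to second order at 0 like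
    [1 - cos u], but remains at least 1/2 once [|u| >= 2]. *)
Definition mean_cos u : R := if u == 0 then 0 else 1 - sin u / u.

Lemma integral_mean_cos u :
  (\int[lebesgue_measure]_(s in `[0%R, 1%R]) (1 - cos (s * u))%:E =
   (mean_cos u)%:E)%E.
Proof.
have [->|u0] := eqVneq u 0.
  rewrite /mean_cos eqxx; under eq_integral do rewrite mulr0 cos0 subrr.
  by rewrite integral0.
under eq_integral do rewrite mulrC.
pose F (s : R) := s - u^-1 * sin (u * s).
have dF (s : R) : is_derive s 1 F (1 - cos (u * s)).
  have h1 := is_deriveZ u (is_derive_id s (1 : R)).
  have h2 := is_derive1_comp (is_derive_sin (u * s)) h1.
  have h3 := is_deriveB (is_derive_id s (1 : R)) (is_deriveZ u^-1 h2).
  apply: (is_derive_eq h3); congr (_ - _).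
  by rewrite /GRing.scale /= mulr1 mulrCA mulVf ?mulr1.
have cF : continuous F.
  by move=> s; apply: differentiable_continuous; apply/derivable1_diffP; exact: ex_derive.
rewrite (@continuous_FTC2 _ _ F)//.
- by rewrite /F mulr0 sin0 mulr0 subr0 mulr1 -EFinB subr0 /mean_cos (negbTE u0) mulrC.
- apply: continuous_subspaceT => s; apply: cvgB; first exact: cvg_cst.
  apply: continuous_comp; last exact: continuous_cos.
  by apply: cvgMr; exact: cvg_id.
- split; [by move=> s _; exact: ex_derive| |].
  + exact: cvg_at_right_filter (cF _).
  + exact: cvg_at_left_filter (cF _).
- by move=> s _; rewrite derive1E; apply: derive_val.
Qed.

Lemma measurable_cos (D : set R) : measurable_fun D (@cos R).
Proof.
apply: measurable_funTS; apply: continuous_measurable_fun.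
exact: continuous_cos.
Qed.

Lemma measurable_sin (D : set R) : measurable_fun D (@sin R).
Proof.
apply: measurable_funTS; apply: continuous_measurable_fun.
exact: continuous_sin.
Qed.

Lemma mean_cos0 : mean_cos 0 = 0.
Proof. by rewrite /mean_cos eqxx. Qed.

Lemma mean_cos_ge0 u : 0 <= mean_cos u.
Proof.
rewrite /mean_cos; case: eqVneq => // u0; rewrite subr_ge0.
rewrite (le_trans (ler_norm _))// normrM normfV ler_pdivrMr ?normr_gt0//.
by rewrite mul1r normr_sin_le.
Qed.

Lemma mean_cos_ge u : 2 <= `|u| -> 2^-1 <= mean_cos u.
Proof.
move=> u2; have u0 : u != 0 by rewrite -normr_gt0 (lt_le_trans _ u2).
rewrite /mean_cos (negbTE u0) lerBrDl -lerBrDr.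
rewrite (_ : 1 - 2^-1 = 2^-1); last by field.
rewrite (le_trans (ler_norm _))// normrM normfV ler_pdivrMr ?normr_gt0//.
by rewrite (le_trans (sin_max _))// ler_pdivlMl// mulr1.
Qed.

Lemma mean_cos_le_sqr u : mean_cos u <= u ^+ 2 / 2.
Proof.
rewrite -lee_fin -integral_mean_cos.
apply: (@le_trans _ _ (\int[lebesgue_measure]_(s in `[0%R, 1%R]) (u ^+ 2 / 2)%:E)%E).
  apply: ge0_le_integral => //.
  - apply/measurable_EFinP; apply: measurable_funB => //.
    apply: measurable_funTS; apply: measurableT_comp.
      exact: measurable_cos.
    exact: measurable_funM.
  - move=> s; rewrite /= in_itv /= => /andP[s0 s1]; rewrite lee_fin.
    rewrite (le_trans (one_sub_cos_le _))// ler_wpM2r// exprMn.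
    by rewrite ler_piMl ?sqr_ge0// exprn_ile1.
rewrite integral_cst//= lebesgue_measure_itv /= lte_fin ltr01 oppr0 adde0 mule1.
exact: lexx.
Qed.

Lemma continuous_mean_cos : continuous mean_cos.
Proof.
move=> u; have [->|u0] := eqVneq u 0.
  rewrite /continuous_at mean_cos0.
  have h1 : (fun=> 0 : R) v @[v --> (0 : R)] --> (0 : R) by exact: cvg_cst.
  have h2 : v ^+ 2 / 2 @[v --> (0 : R)] --> (0 : R).
    rewrite -[X in _ --> X](_ : 0 ^+ 2 / 2 = 0 :> R); last by rewrite expr0n mul0r.
    by apply: cvgMl; exact: exprn_continuous.
  apply: (squeeze_cvgr _ h1 h2).
  by near=> v; rewrite mean_cos_ge0 mean_cos_le_sqr.
have c : {for u, continuous (fun v => 1 - sin v / v)}.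
  apply: cvgB; first exact: cvg_cst.
  by apply: cvgM; [exact: continuous_sin|apply: cvgV => //; exact: cvg_id].
have hn : \forall v \near u, v != 0 by exact: (@cvgr_neq0 _ _ _ (nbhs u) _ id u cvg_id u0).
rewrite /continuous_at {2}/mean_cos (negbTE u0).
apply: cvg_trans c; apply: near_eq_cvg; near=> v.
rewrite /mean_cos ifF//; apply/negbTE; near: v.
exact: hn.
Unshelve. all: by end_near. Qed.

End trigonometric_inequalities.

(** The integral of a nonnegative function is a supremum over the simple functions below it, which
    is monotone for arbitrary functions. *)
Lemma ge0_le_integral_any (R : realType) d0 (T : measurableType d0)
    (mu : {measure set T -> \bar R}) (D : set T) (f1 f2 : T -> \bar R) :
  (forall x, D x -> (0 <= f1 x)%E) -> (forall x, D x -> (f1 x <= f2 x)%E) ->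
  (\int[mu]_(x in D) f1 x <= \int[mu]_(x in D) f2 x)%E.
Proof.
move=> f10 f12; rewrite integral_mkcond [leRHS]integral_mkcond.
have f20 x : D x -> (0 <= f2 x)%E by move=> Dx; exact: le_trans (f10 _ Dx) (f12 _ Dx).
rewrite !ge0_integralTE; last 2 first.
- by move=> x; exact: erestrict_ge0.
- by move=> x; exact: erestrict_ge0.
apply: le_ereal_sup => _ [g /= gf <-].
by exists g => // x; apply: le_trans (gf x) _; exact: lee_restrict.
Qed.

Lemma dominated_cvg_integral (R : realType) d0 (T : measurableType d0)
    (mu : {measure set T -> \bar R}) (f_ : (T -> \bar R)^nat) (f g : T -> \bar R) :
  (forall n, measurable_fun setT (f_ n)) -> measurable_fun setT f ->
  (forall x, f_ n x @[n --> \oo] --> f x) -> mu.-integrable setT g ->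
  (forall x n, (`|f_ n x| <= g x)%E) ->
  (\int[mu]_x f_ n x)%E @[n --> \oo] --> (\int[mu]_x f x)%E.
Proof.
move=> mf_ mf ff ig fg.
have [_ _] := @dominated_convergence _ _ _ mu setT measurableT f_ f g mf_ mf
  (aeW _ (fun x _ => ff x)) ig (aeW _ (fun x n _ => fg x n)).
exact.
Qed.

Lemma Rintegral_prob_cst (R : realType) d0 (T : measurableType d0)
  (P : probability T R) (c : R) : \int[P]_w c = c.
Proof.
rewrite Rintegral_cst//; transitivity (c * fine (P setT)) => //.
by rewrite probability_setT mulr1.
Qed.

Section levy_exponent.
Context {R : realType} {d : nat} {dO : measure_display}.
Context {Omega : measurableType dO}.
Variables (P : probability Omega R) (X : R -> Omega -> 'rV[R]_d).
Hypothesis LX : levy_process P X.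
Hypothesis SX : symmetric_process P X.
Variables (b : 'rV[R]_d) (Q : 'M[R]_d) (N : {measure set 'rV[R]_d -> \bar R}).
Hypothesis TX : levy_triplet P X b Q N.

Let mX t : 0 <= t -> measurable_fun setT (X t).
Proof. exact: (levy_measurable LX). Qed.

Let psi := lk_re Q N.

Lemma measurable_dotp (xi : 'rV[R]_d) : measurable_fun setT (dotp xi).
Proof. by apply: continuous_measurable_rV; exact: continuous_dotp. Qed.

Lemma measurable_trig_dotp (F : R -> R) (a : R) xi t : continuous F -> 0 <= t ->
  measurable_fun setT (fun w => F (a + dotp xi (X t w))).
Proof.
move=> cF t0.
apply: (measurableT_comp (continuous_measurable_fun cF)).
apply: measurable_funD => //.
by apply: (measurableT_comp (measurable_dotp xi)); exact: mX.
Qed.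

Let integrable_cos_dotp xi t : 0 <= t ->
  P.-integrable setT (EFin \o (fun w => cos (dotp xi (X t w)))).
Proof.
move=> t0; apply: (@bounded_integrable _ _ _ _ _ 1) => [|w]; last exact: cos_max.
apply: measurableT_comp; first exact: measurable_cos.
by apply: (measurableT_comp (measurable_dotp xi)); exact: mX.
Qed.

Let integrable_sin_dotp xi t : 0 <= t ->
  P.-integrable setT (EFin \o (fun w => sin (dotp xi (X t w)))).
Proof.
move=> t0; apply: (@bounded_integrable _ _ _ _ _ 1) => [|w]; last exact: sin_max.
apply: measurableT_comp; first exact: measurable_sin.
by apply: (measurableT_comp (measurable_dotp xi)); exact: mX.
Qed.

Lemma expectation_sin_dotp xi t : 0 <= t -> \int[P]_w sin (dotp xi (X t w)) = 0.
Proof.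
move=> t0; set I := LHS.
have : I = - I.
  rewrite {1}/I /Rintegral.
  have mXN : measurable_fun setT (fun w => - X t w) by apply: measurable_rVN; exact: mX.
  rewrite (@integral_law R _ _ _ _ _ _ P P (X t) (fun w => - X t w) (mX t0) mXN _
     (fun z => (sin (dotp xi z))%:E)).
  - under eq_integral do rewrite dotpNr sinN -mulN1r.
    rewrite -/(Rintegral _ _ _) RintegralZl// ?mulN1r//.
    exact: integrable_sin_dotp.
  - by move=> A mA; exact: (SX t0 mA).
  - apply/measurable_EFinP; apply: measurableT_comp; first exact: measurable_sin.
    exact: measurable_dotp.
lra.
Qed.

(** By symmetry the sine expectation vanishes at all times, so [sin (t * m) = 0] for every [t >= 0]
    with [m] the value of [lk_im]; at [t = pi / (2 |m|)] this fails unless [m = 0], and the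
    oscillating factor disappears. *)
Lemma expectation_cos_dotp xi t : 0 <= t ->
  \int[P]_w cos (dotp xi (X t w)) = expR (- t * psi xi).
Proof.
move=> t0; rewrite (triplet_cos TX)// -/psi.
suff -> : lk_im b N xi = 0 by rewrite mulr0 cos0 mulr1.
set m := lk_im _ _ _; apply/eqP/negPn/negP => m0.
have s0 s : 0 <= s -> sin (s * m) = 0.
  move=> s0; have := triplet_sin TX xi s0; rewrite expectation_sin_dotp// -/m.
  by move=> /esym/eqP; rewrite mulf_eq0 gt_eqF ?expR_gt0//= => /eqP.
have : sin (pi / 2 / `|m| * m) = 0.
  by apply: s0; rewrite !divr_ge0// pi_ge0.
have [mp|mn|m00] := ltgtP 0 m; last by rewrite -m00 eqxx in m0.
  rewrite gtr0_norm// divfK// sin_pihalf => /eqP; by rewrite oner_eq0.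
rewrite ltr0_norm// invrN mulrN mulNr divfK// sinN sin_pihalf => /eqP.
by rewrite oppr_eq0 oner_eq0.
Qed.

Lemma psi_ge0 xi : 0 <= psi xi.
Proof.
have : \int[P]_w cos (dotp xi (X 1 w)) <= 1.
  apply: (@le_trans _ _ (\int[P]_w (cst 1 w))).
    apply: le_Rintegral => //; [exact: integrable_cos_dotp| |].
      by apply: (@bounded_integrable _ _ _ _ _ 1) => // w; rewrite normr1.
    by move=> w _; exact: cos_le1.
  by rewrite Rintegral_prob_cst.
rewrite expectation_cos_dotp// mulN1r -expR0 ler_expR; lra.
Qed.

Lemma expectation_cos_shift a xi t : 0 <= t ->
  \int[P]_w cos (a + dotp xi (X t w)) = cos a * expR (- t * psi xi).
Proof.
move=> t0; under eq_Rintegral do rewrite cosD.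
rewrite RintegralB//.
- rewrite !RintegralZl//; [|exact: integrable_sin_dotp|exact: integrable_cos_dotp].
  by rewrite expectation_sin_dotp// mulr0 subr0 expectation_cos_dotp.
- exact: (integrableZl measurableT (cos a) (integrable_cos_dotp xi t0)).
- exact: (integrableZl measurableT (sin a) (integrable_sin_dotp xi t0)).
Qed.

Lemma min_integrable (c : R) :
  (\int[N]_z (Num.min 2 (c ^+ 2 * enorm z ^+ 2))%:E < +oo)%E.
Proof.
pose M := Num.max 2 (c ^+ 2).
have M0 : 0 <= M by rewrite le_max ler0n.
have mE : measurable_fun setT (fun z : 'rV[R]_d => enorm z ^+ 2).
  by apply: measurable_funX; exact: measurable_enorm.
apply: (@le_lt_trans _ _ (\int[N]_z (M%:E * (Num.min 1 (enorm z ^+ 2))%:E))%E).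
  apply: ge0_le_integral => //.
  - by move=> z _; rewrite lee_fin le_min ler0n mulr_ge0// sqr_ge0.
  - apply/measurable_EFinP; apply: measurable_minr => //.
    exact: measurable_funM.
  - apply: measurable_funeM; apply/measurable_EFinP.
    exact: measurable_minr.
  - move=> z _; rewrite -EFinM lee_fin; case: (leP 1 (enorm z ^+ 2)) => h.
      by rewrite mulr1 ge_min /M le_max lexx.
    rewrite ge_min; apply/orP; right; rewrite ler_wpM2r ?sqr_ge0//.
    by rewrite /M le_max lexx orbT.
rewrite ge0_integralZl//; last 2 first.
- by apply/measurable_EFinP; exact: measurable_minr.
- by move=> z _; rewrite lee_fin le_min ler01 sqr_ge0.
apply: lte_mul_pinfty => //; exact: triplet_finite TX.
Qed.

(** Dominates the jump part of the exponent uniformly over frequencies of norm at most [c]. *)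
Definition min_moment (c : R) : R :=
  fine (\int[N]_z (Num.min 2 (c ^+ 2 * enorm z ^+ 2))%:E)%E.

Lemma one_sub_cos_le_min (xi z : 'rV[R]_d) :
  1 - cos (dotp xi z) <= Num.min 2 (enorm xi ^+ 2 * enorm z ^+ 2).
Proof.
rewrite le_min; apply/andP; split.
  by have := cos_geN1 (dotp xi z); lra.
apply: le_trans (one_sub_cos_le _) _.
have h : dotp xi z ^+ 2 <= enorm xi ^+ 2 * enorm z ^+ 2.
  rewrite -exprMn -(real_normK (num_real (dotp _ _))) ler_sqr ?nnegrE//; last first.
    by rewrite mulr_ge0// enorm_ge0.
  rewrite ler_norml cauchy_schwarz_dotp andbT lerNl -dotpNl.
  by rewrite -(enormN xi) cauchy_schwarz_dotp.
apply: le_trans h; rewrite ler_pdivrMr// ler_peMr ?sqr_ge0//.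
by rewrite ler1n.
Qed.

Lemma integrable_one_sub_cos xi :
  N.-integrable setT (fun z => (1 - cos (dotp xi z))%:E).
Proof.
have mf : measurable_fun setT (fun z => (1 - cos (dotp xi z))).
  apply: measurable_funB => //; apply: measurableT_comp.
    exact: measurable_cos.
  exact: measurable_dotp.
apply/integrableP; split; first exact/measurable_EFinP.
apply: le_lt_trans (min_integrable (enorm xi)); apply: ge0_le_integral => //.
- by apply/measurable_EFinP; apply: measurableT_comp mf.
- apply/measurable_EFinP; apply: measurable_minr => //.
  apply: measurable_funM => //; apply: measurable_funX; exact: measurable_enorm.
- move=> z _; rewrite /= lee_fin ger0_norm ?one_sub_cos_le_min//.
Qed.

Definition psi_bound (c : R) : R :=
  2^-1 * (c ^+ 2 * (\sum_i \sum_j `|Q j i|)) + min_moment c.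

Lemma quadratic_form_le (xi : 'rV[R]_d) :
  dotp xi (xi *m Q) <= enorm xi ^+ 2 * (\sum_i \sum_j `|Q j i|).
Proof.
rewrite /dotp big_distrr /=; apply: ler_sum => i _.
rewrite mxE !big_distrr /=; apply: ler_sum => j _.
rewrite (le_trans (ler_norm _))// !normrM mulrA ler_wpM2r// expr2.
by rewrite ler_pM// coord_le_enorm.
Qed.

Lemma psi_le_bound c xi : enorm xi <= c -> psi xi <= psi_bound c.
Proof.
move=> xic; have c0 : 0 <= c by exact: le_trans (enorm_ge0 _) xic.
have xc2 : enorm xi ^+ 2 <= c ^+ 2 by rewrite ler_sqr ?nnegrE ?enorm_ge0.
rewrite /psi /lk_re /psi_bound lerD//.
  rewrite ler_wpM2l// (le_trans (quadratic_form_le _))// ler_wpM2r//.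
  by apply: sumr_ge0 => i _; exact: sumr_ge0.
rewrite /Rintegral /min_moment fine_le//.
- by apply: integrable_fin_num => //; exact: integrable_one_sub_cos.
- rewrite ge0_fin_numE; first exact: min_integrable.
  by apply: integral_ge0 => z _; rewrite lee_fin le_min ler0n mulr_ge0// sqr_ge0.
- apply: ge0_le_integral => //.
  + by case/integrableP: (integrable_one_sub_cos xi).
  + apply/measurable_EFinP; apply: measurable_minr => //.
    apply: measurable_funM => //; apply: measurable_funX; exact: measurable_enorm.
  + move=> z _; rewrite lee_fin (le_trans (one_sub_cos_le_min _ _))//.
    by rewrite le_min ge_min lexx /= ge_min ler_wpM2r ?orbT// sqr_ge0.
Qed.

Lemma psi_bound_ge0 c : 0 <= psi_bound c.
Proof.
rewrite /psi_bound addr_ge0//.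
  rewrite mulr_ge0// mulr_ge0 ?sqr_ge0//.
  by apply: sumr_ge0 => i _; exact: sumr_ge0.
apply: fine_ge0; apply: integral_ge0 => z _.
by rewrite lee_fin le_min ler0n mulr_ge0// sqr_ge0.
Qed.

(** Dominated convergence in the Levy integral. This continuity of the exponent at 0 yields tail
    probabilities with an arbitrarily small rate, in [tail_small]. *)
Lemma psi_bound_cvg0 : psi_bound (n.+1%:R^-1) @[n --> \oo] --> 0.
Proof.
have s0 : (n.+1%:R^-1 : R) ^+ 2 @[n --> \oo] --> 0.
  rewrite (_ : 0 = 0 ^+ 2 :> R); last by rewrite expr0n.
  apply: (@cvg_comp _ _ _ (fun n : nat => n.+1%:R^-1 : R) (fun x => x ^+ 2) _ (nbhs 0)).
    exact: cvg_harmonic.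
  exact: exprn_continuous.
rewrite -[X in _ --> X](addr0 0); apply: cvgD.
  rewrite -[X in _ --> X](mulr0 2^-1); apply: cvgMr.
  by rewrite -[X in _ --> X](mul0r (\sum_i \sum_j `|Q j i|)); apply: cvgMl.
pose f (n : nat) (z : 'rV[R]_d) : \bar R := (Num.min 2 (n.+1%:R^-1 ^+ 2 * enorm z ^+ 2) : R)%:E.
pose g (z : 'rV[R]_d) : \bar R := (Num.min 2 (1 ^+ 2 * enorm z ^+ 2) : R)%:E.
have mmin c : measurable_fun setT
    (fun z : 'rV[R]_d => (Num.min 2 (c ^+ 2 * enorm z ^+ 2))%:E).
  apply/measurable_EFinP; apply: measurable_minr => //.
  apply: measurable_funM => //; apply: measurable_funX; exact: measurable_enorm.
have min0 c (z : 'rV[R]_d) : 0 <= Num.min 2 (c ^+ 2 * enorm z ^+ 2).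
  by rewrite le_min ler0n mulr_ge0// sqr_ge0.
have H : (\int[N]_z f n z)%E @[n --> \oo] --> (\int[N]_z (cst 0%E z))%E.
  apply: (@dominated_cvg_integral _ _ _ N f _ g) => [n| |z| |z n].
  - exact: mmin.
  - exact: measurable_cst.
  - apply: cvg_EFin; first by near=> n.
    have h1 : n.+1%:R^-1 ^+ 2 * enorm z ^+ 2 @[n --> \oo] --> 0.
      by rewrite -[X in _ --> X](mul0r (enorm z ^+ 2)); apply: cvgMl.
    have h0 : (fun=> 0 : R) n @[n --> \oo] --> (0 : R) by exact: cvg_cst.
    apply: (squeeze_cvgr _ h0 h1); near=> n.
    by rewrite min0 /= ge_min lexx orbT.
  - apply/integrableP; split; first exact: mmin.
    under eq_integral do rewrite gee0_abs ?lee_fin ?min0//.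
    exact: min_integrable.
  - rewrite gee0_abs ?lee_fin ?min0// le_min ge_min lexx /= ge_min.
    rewrite ler_wpM2r ?orbT ?sqr_ge0// expr1n exprn_ile1// invf_le1//.
    by rewrite ler1n.
rewrite integral0 in H.
exact: (fine_cvg H).
Unshelve. all: by end_near. Qed.

(** The factor 2 normalizes it: one coordinate with [|a * z_i| >= 2] already contributes at least
    1. *)
Definition barrier (a : R) (z : 'rV[R]_d) : R := 2 * \sum_i mean_cos (a * z 0 i).

Lemma barrier0 a : barrier a 0 = 0.
Proof.
rewrite /barrier big1 ?mulr0// => i _.
by rewrite mxE mulr0 mean_cos0.
Qed.

Lemma barrier_ge0 a z : 0 <= barrier a z.
Proof. by rewrite mulr_ge0//; apply: sumr_ge0 => i _; exact: mean_cos_ge0. Qed.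

Lemma continuous_barrier a : continuous (barrier a).
Proof.
move=> z; rewrite /continuous_at /barrier.
apply: (@cvgM _ _ (nbhs z)); first exact: cvg_cst.
apply: (@cvg_sumr R _ (nbhs z) _ _ _ (fun (i : 'I_d) (v : 'rV[R]_d) => mean_cos (a * v 0 i))
  (fun i => mean_cos (a * z 0 i))) => i.
apply: (@continuous_comp _ _ _ (fun z : 'rV[R]_d => a * z 0 i) mean_cos).
  apply: (@cvgM _ _ (nbhs z)); first exact: cvg_cst.
  exact: coord_continuous.
exact: continuous_mean_cos.
Qed.

Lemma barrier_ge1 a (r : R) z : (0 < d)%N -> 0 < a -> 2 * d%:R <= a * r ->
  r <= enorm z -> 1 <= barrier a z.
Proof.
move=> d0 a0 ar /(exists_coord_ge d0)[i zi].
rewrite /barrier (bigD1 i)//= -ler_pdivrMl// mulr1.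
rewrite (le_trans (@mean_cos_ge _ (a * z 0 i) _))//.
  rewrite normrM (gtr0_norm a0) (le_trans _ (ler_wpM2l (ltW a0) zi))//.
  by rewrite mulrA ler_pdivlMr ?ltr0n.
by rewrite lerDl; apply: sumr_ge0 => j _; exact: mean_cos_ge0.
Qed.

Lemma dotp_scale_delta (c : R) (i : 'I_d) (z : 'rV[R]_d) :
  dotp (c *: delta_mx 0 i) z = c * z 0 i.
Proof.
rewrite dotpZl; congr (_ * _); rewrite /dotp (bigD1 i)//= mxE !eqxx mul1r.
by rewrite big1 ?addr0// => j /negbTE ji; rewrite mxE eqxx ji mul0r.
Qed.

Lemma enorm_scale_delta (c : R) (i : 'I_d) :
  enorm (c *: delta_mx 0 i : 'rV[R]_d) = `|c|.
Proof.
by rewrite /enorm dotp_scale_delta !mxE !eqxx mulr1 -expr2 sqrtr_sqr.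
Qed.

(** For each [s] in [0, 1] the cosine of frequency [s * a] is damped exactly by [exp (- h psi)],
    where [psi] is at most [psi_bound a]; since [|c| <= 1] and [1 - u <= exp (- u)], one has
    [1 - c exp (- u) <= 1 - c + u]. Tonelli then restores the average over [s]. *)
Lemma expectation_mean_cos_le a y (i : 'I_d) h : 0 <= a -> 0 <= h ->
  (\int[P]_w (mean_cos (a * (y + X h w) 0 i))%:E <=
   (mean_cos (a * y 0 i) + h * psi_bound a)%:E)%E.
Proof.
move=> a0 h0; under eq_integral do rewrite -integral_mean_cos.
have mXi : measurable_fun setT (fun w => (y + X h w) 0 i).
  by apply: measurable_coord_comp; apply: measurable_rVD => //; exact: mX.
rewrite (@tonelli_in _ _ _ _ _ P (@lebesgue_measure R) `[0, 1]
  (fun w s => (1 - cos (s * (a * (y + X h w) 0 i)))%:E))//; last first.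
  apply/measurable_EFinP; apply: measurable_funB => //.
  apply: measurableT_comp; first exact: measurable_cos.
  apply: measurable_funM; first exact: measurable_snd.
  by apply: measurable_funM => //; apply: (measurableT_comp mXi); exact: measurable_fst.
have E s : (\int[P]_w (1 - cos (s * (a * (y + X h w) 0 i)))%:E)%E =
   (1 - cos (s * (a * y 0 i)) * expR (- h * psi ((s * a) *: delta_mx 0 i)))%:E.
  rewrite -expectation_cos_shift//.
  transitivity ((\int[P]_w (1 - cos (s * (a * y 0 i) + dotp ((s * a) *: delta_mx 0 i) (X h w))))%:E).
    rewrite /Rintegral fineK.
      by apply: eq_integral => w _; rewrite dotp_scale_delta mxE; congr (1 - cos _)%:E; ring.
    apply: integrable_fin_num => //.
    apply: (@bounded_integrable _ _ _ _ _ 2) => [|w].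
      apply: measurable_funB => //; apply: (measurable_trig_dotp (F := cos)) => //.
      exact: continuous_cos.
    by rewrite ger0_norm ?subr_ge0 ?cos_le1//; have := cos_geN1 (s * (a * y 0 i) +
       dotp ((s * a) *: delta_mx 0 i) (X h w)); lra.
  congr EFin; rewrite RintegralB//; first by rewrite Rintegral_prob_cst.
    by apply: (@bounded_integrable _ _ _ _ _ 1) => // w; rewrite normr1.
  apply: (@bounded_integrable _ _ _ _ _ 1) => [|w]; last exact: cos_max.
  by apply: (measurable_trig_dotp (F := cos)) => //; exact: continuous_cos.
under eq_integral do rewrite E.
apply: (@le_trans _ _ (\int[lebesgue_measure]_(s in `[0%R, 1%R])
  ((1 - cos (s * (a * y 0 i)))%:E + (h * psi_bound a)%:E))%E).
  have mc : measurable_fun (`[0, 1] : set R) (fun s : R => cos (s * (a * y 0 i))).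
    apply: measurable_funTS; apply: measurableT_comp; first exact: measurable_cos.
    exact: measurable_funM.
  have e0 s : 0 <= expR (- h * psi ((s * a) *: delta_mx 0 i)) <= 1.
    by rewrite expR_ge0 -expR0 ler_expR mulNr oppr_le0 mulr_ge0// psi_ge0.
  have c1 s : 0 <= 1 - cos (s * (a * y 0 i)) * expR (- h * psi ((s * a) *: delta_mx 0 i)).
    have /andP[h1 h2] := e0 s; rewrite subr_ge0 (le_trans (ler_norm _))// normrM.
    by rewrite mulr_ile1// ?cos_max// ger0_norm.
  have bd s : 0 <= s <= 1 ->
      1 - cos (s * (a * y 0 i)) * expR (- h * psi ((s * a) *: delta_mx 0 i)) <=
      (1 - cos (s * (a * y 0 i))) + h * psi_bound a.
    move=> /andP[s0 s1].
    have := psi_le_bound (c := a) (xi := (s * a) *: delta_mx 0 i).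
    rewrite enorm_scale_delta ger0_norm ?mulr_ge0// ler_piMl// => /(_ isT).
    set p := psi _; set B := psi_bound _ => pB.
    have p0 : 0 <= p by exact: psi_ge0.
    have /andP[h1 h2] := e0 s; rewrite -/p in h1 h2.
    have h3 : 1 - h * p <= expR (- h * p) by rewrite -mulNr expR_ge1Dx.
    have h4 : h * p <= h * B by rewrite ler_wpM2l.
    have h5 := cos_le1 (s * (a * y 0 i)); have h6 := cos_geN1 (s * (a * y 0 i)).
    move: h1 h2 h3 h4 h5 h6; set e := expR _; set c := cos _; set u := h * p; set v := h * B.
    by move=> *; nra.
  apply: ge0_le_integral_any => s; rewrite /= in_itv /= => s01.
    by rewrite lee_fin c1.
  by rewrite -EFinD lee_fin bd.
rewrite ge0_integralD//; last 2 first.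
- apply/measurable_EFinP; apply: measurable_funB => //; apply: measurable_funTS.
  apply: measurableT_comp; first exact: measurable_cos.
  exact: measurable_funM.
- by move=> s _; rewrite lee_fin mulr_ge0// psi_bound_ge0.
rewrite integral_mean_cos integral_cst//= lebesgue_measure_itv /= lte_fin ltr01.
by rewrite oppr0 adde0 mule1.
Qed.

Lemma expectation_barrier_le a y h : 0 <= a -> 0 <= h ->
  (\int[P]_w (barrier a (y + X h w))%:E <=
   (barrier a y + h * (2 * d%:R * psi_bound a))%:E)%E.
Proof.
move=> a0 h0; rewrite /barrier.
under eq_integral do rewrite EFinM.
rewrite ge0_integralZl//; last 2 first.
- apply/measurable_EFinP; apply: measurable_sum => i.
  apply: (measurableT_comp (continuous_measurable_fun continuous_mean_cos)).
  apply: measurable_funM => //.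
  by apply: measurable_coord_comp; apply: measurable_rVD => //; exact: mX.
- by move=> w _; rewrite lee_fin; apply: sumr_ge0 => i _; exact: mean_cos_ge0.
under eq_integral do rewrite -sumEFin.
rewrite ge0_integral_sum//; last 2 first.
- move=> i; apply/measurable_EFinP.
  apply: (measurableT_comp (continuous_measurable_fun continuous_mean_cos)).
  apply: measurable_funM => //.
  by apply: measurable_coord_comp; apply: measurable_rVD => //; exact: mX.
- by move=> i w _; rewrite lee_fin mean_cos_ge0.
rewrite (_ : _ + _ = 2 * (\sum_(i < d) (mean_cos (a * y 0 i) + h * psi_bound a))).
  rewrite EFinM lee_wpmul2l// -sumEFin; apply: lee_sum => i _.
  exact: expectation_mean_cos_le.
rewrite big_split /= big_const_ord iter_addr_0 -(mulr_natl (h * _)).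
by set S := \sum_i _; ring.
Qed.

End levy_exponent.

(** * Maximal inequalities *)

Lemma measurable_rV_neq0 (R : realType) (d : nat) : measurable [set v : 'rV[R]_d | v != 0].
Proof.
rewrite (_ : [set v | _] = enorm @^-1` [set r | 0 < r]).
  apply: open_measurable_rV; apply: open_comp; last exact: open_gt.
  by move=> v _; exact: continuous_enorm.
apply/seteqP; split => v /=; last by apply: contraTneq => ->; rewrite enorm0 ltxx.
by rewrite -normr_gt0 => v0; exact: lt_le_trans v0 (norm_le_enorm v).
Qed.

Lemma measurable_enorm_comp (R : realType) (d : nat) d0 (T : measurableType d0)
    (f : T -> 'rV[R]_d) :
  measurable_fun setT f -> measurable_fun setT (fun w => enorm (f w)).
Proof. by move=> mf; apply: (measurableT_comp (@measurable_enorm R d setT) mf). Qed.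

Lemma measurable_ge_set (R : realType) d0 (T : measurableType d0) (f : T -> R) (r : R) :
  measurable_fun setT f -> measurable [set w | r <= f w].
Proof.
move=> mf; rewrite (_ : [set w | _] = f @^-1` [set` `[r, +oo[%R]).
  by apply: measurable_preimage => //; exact: measurable_itv.
by apply/seteqP; split => w; rewrite /preimage /= in_itv /= andbT.
Qed.

Section maximal_inequality.
Context {R : realType} {d : nat} {dO : measure_display}.
Context {Omega : measurableType dO}.
Variables (P : probability Omega R) (X : R -> Omega -> 'rV[R]_d).
Hypothesis LX : levy_process P X.

Let mX t : 0 <= t -> measurable_fun setT (X t).
Proof. exact: (levy_measurable LX). Qed.

Lemma measurable_past_X s t : 0 <= s -> s <= t ->
  measurable_fun setT (X s : g_sigma_algebraType (past_sets X t) -> 'rV[R]_d).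
Proof.
move=> s0 st _ A mA; rewrite setTI; apply: sub_sigma_algebra.
by exists s, A; split.
Qed.

Lemma measurable_past_dist (s u t r : R) : 0 <= s -> s <= t -> 0 <= u -> u <= t ->
  measurable ([set w | r <= enorm (X s w - X u w)] :
    set (g_sigma_algebraType (past_sets X t))).
Proof.
move=> s0 st u0 ut.
apply: (@measurable_ge_set R _ (g_sigma_algebraType (past_sets X t))
  (fun w => enorm (X s w - X u w))).
apply: measurable_enorm_comp.
apply: measurable_rVB; exact: measurable_past_X.
Qed.

Lemma measurable_past_norm (s t r : R) : 0 <= s -> s <= t ->
  measurable ([set w | r <= enorm (X s w)] :
    set (g_sigma_algebraType (past_sets X t))).
Proof.
move=> s0 st.
apply: (@measurable_ge_set R _ (g_sigma_algebraType (past_sets X t))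
  (fun w => enorm (X s w))).
apply: measurable_enorm_comp.
exact: measurable_past_X.
Qed.

Lemma past_measurable_le s t (E : set Omega) : s <= t ->
  measurable (E : set (g_sigma_algebraType (past_sets X s))) ->
  measurable (E : set (g_sigma_algebraType (past_sets X t))).
Proof. by move=> st; exact: past_sets_le. Qed.

Lemma past_measurable t (E : set Omega) :
  measurable (E : set (g_sigma_algebraType (past_sets X t))) -> measurable E.
Proof. exact: (past_sets_measurable LX). Qed.

Variables (delta : R).
Hypothesis delta0 : 0 <= delta.

Let tau (k : nat) : R := k%:R * delta.

Let tau0 k : 0 <= tau k. Proof. by rewrite mulr_ge0. Qed.

Let tau_le j k : (j <= k)%N -> tau j <= tau k.
Proof. by move=> jk; rewrite ler_wpM2r// ler_nat. Qed.

Let tauB j k : (j <= k)%N -> tau k - tau j = tau (k - j).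
Proof. by move=> jk; rewrite /tau -mulrBl natrB. Qed.

(* Ottaviani's inequality, conditionally on the past of [tau j]. *)
Lemma ottaviani (n j : nat) (E : set Omega) (r : R) :
  measurable (E : set (g_sigma_algebraType (past_sets X (tau j)))) ->
  (forall k, (k <= n)%N -> (P [set w | (r / 2 <= enorm (X (tau k) w))%R] <= (2^-1)%:E)%E) ->
  (P (E `&` [set w | exists k, (j < k)%N /\ (k <= n)%N /\
      (r <= enorm (X (tau k) w - X (tau j) w))%R]) <=
   2%:E * P (E `&` [set w | (r / 2 <= enorm (X (tau n) w - X (tau j) w))%R]))%E.
Proof.
move=> mE small.
have [nj|jn] := leqP n j.
  rewrite (_ : _ `&` _ = set0) ?measure0 ?mule_ge0//.
  apply/seteqP; split => // w [_ [k [jk [kn _]]]].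
  by have := leq_ltn_trans nj (leq_trans jk kn); rewrite ltnn.
pose B i : set Omega := [set w | r <= enorm (X (tau (j + i.+1)) w - X (tau j) w)].
pose F i := E `&` seqDU B i.
have mB i l : (i <= l)%N ->
    measurable (B i : set (g_sigma_algebraType (past_sets X (tau (j + l.+1))))).
  move=> il; apply: measurable_past_dist => //; apply: tau_le.
    by rewrite leq_add2l ltnS.
  exact: leq_addr.
have mF i : measurable (F i : set (g_sigma_algebraType (past_sets X (tau (j + i.+1))))).
  apply: measurableI.
    by apply: past_measurable_le mE; apply: tau_le; exact: leq_addr.
  rewrite /seqDU; apply: measurableD; first exact: mB.
  by apply: bigsetU_measurable => l _; apply: mB; exact: ltnW.
have mF' i : measurable (F i) by exact: past_measurable (mF i).
have tF : trivIset setT F.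
  apply: trivIset_setIl; exact: trivIset_seqDU.
(* [F i] is the event of a first passage at index [j + i + 1]. [G i] adds that the path moves by
   less than [r / 2] from there to time [n], which has conditional probability at least 1/2; on
   [G i] the end point is still farther than [r / 2] from [X (tau j)]. *)
pose m := (n - j)%N.
have jm i : (i < m)%N -> (j + i.+1 <= n)%N by rewrite /m; lia.
pose G i := F i `&` [set w | ~ (r / 2 <= enorm (X (tau n) w - X (tau (j + i.+1)) w))].
have mfar k l : measurable [set w | r / 2 <= enorm (X (tau k) w - X (tau l) w)].
  apply: (@past_measurable (Num.max (tau k) (tau l))).
  by apply: measurable_past_dist => //; rewrite le_max lexx ?orbT.
have mG i : measurable (G i) by apply: measurableI => //; exact: measurableC (mfar _ _).
have PFG i : (i < m)%N -> (P (F i) <= 2%:E * P (G i))%E.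
  move=> im; have nji := jm i im.
  have mset : measurable [set v : 'rV[R]_d | ~ (r / 2 <= enorm v)].
    by apply: measurableC; apply: measurable_ge_set; exact: measurable_enorm.
  have := past_independent LX (tau0 _) (tau_le nji) (mF i) mset.
  rewrite -/(G i) => ->; rewrite tauB//.
  set p := P [set w | ~ _]; have p2 : ((2^-1)%:E <= p)%E.
    have ms : measurable [set w | r / 2 <= enorm (X (tau (n - (j + i.+1))) w)].
      apply: (@past_measurable (tau (n - (j + i.+1)))).
      exact: measurable_past_norm.
    have -> : p = (1 - P [set w | (r / 2 <= enorm (X (tau (n - (j + i.+1))) w))%R])%E.
      by rewrite -probability_setC.
    rewrite leeBrDr ?fin_num_measure// -leeBrDl//.
    by rewrite (le_trans (small _ (leq_subr _ _)))// -EFinB lee_fin; lra.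
  apply: (@le_trans _ _ (2%:E * (P (F i) * (2^-1)%:E))%E); last first.
    by rewrite lee_wpmul2l// lee_wpmul2l.
  rewrite muleCA -EFinM mulfV// mule1//.
apply: (@le_trans _ _ (P (\big[setU/set0]_(i < m) F i))).
  apply: le_measure; rewrite ?inE.
  - apply: measurableI; first exact: past_measurable mE.
    rewrite (_ : [set w | _] = \bigcup_(k in [set k | (j < k)%N /\ (k <= n)%N])
        [set w | r <= enorm (X (tau k) w - X (tau j) w)]).
      apply: bigcup_measurable => k _.
      apply: (@past_measurable (Num.max (tau k) (tau j))).
      by apply: measurable_past_dist => //; rewrite le_max lexx ?orbT.
    apply/seteqP; split => w /=; first by move=> [k [? [? ?]]]; exists k.
    by move=> [k [? ?] ?]; exists k.
  - exact: bigsetU_measurable.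
  move=> w [Ew [k [jk [kn rk]]]].
  rewrite -bigcup_mkord -setI_bigcupr; split => //.
  have : (\big[setU/set0]_(i < m) B i) w.
    rewrite -bigcup_mkord; exists (k - j).-1; first by rewrite /= /m; lia.
    by rewrite /B (_ : (j + (k - j).-1.+1)%N = k)//; lia.
  by rewrite bigsetU_seqDU bigcup_mkord.
rewrite measure_bigsetU//.
apply: (@le_trans _ _ (\sum_(i < m) (2%:E * P (G i)))%E).
  by apply: lee_sum => i _; exact: PFG.
rewrite -ge0_sume_distrr// lee_wpmul2l//.
rewrite -measure_bigsetU//; last first.
  move/trivIsetP : tF => tF; apply/trivIsetP => a c _ _ ac.
  apply/seteqP; split => // w [[Fa _] [Fc _]].
  by rewrite -(tF a c I I ac); split.
apply: le_measure; rewrite ?inE.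
- exact: bigsetU_measurable.
- by apply: measurableI => //; exact: past_measurable mE.
rewrite -bigcup_mkord => w [i im [[Ew Bw] far]]; split => //=.
have {}Bw : B i w by exact: subset_seqDU Bw.
have := enormD (X (tau (j + i.+1)) w - X (tau n) w) (X (tau n) w - X (tau j) w).
rewrite addrA subrK enorm_distC => H.
move: far => /= /negP; rewrite -ltNge => far.
rewrite /B /= in Bw; lra.
Qed.

Let X0 : P [set w | X 0 w != 0] = 0%E.
Proof.
rewrite (_ : [set w | _] = ~` [set w | X 0 w = 0]); last first.
  by apply/seteqP; split => w /= /eqP.
rewrite probability_setC ?levy_start// ?subee//.
rewrite (_ : [set w | _] = X 0 @^-1` (~` [set v | v != 0])); last first.
  by apply/seteqP; split => w /=; [move=> ->; rewrite eqxx|move/negP/negPn/eqP].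
by apply: measurable_preimage; [exact: mX|apply: measurableC; exact: measurable_rV_neq0].
Qed.

Variables (r C : R) (n : nat).
Hypothesis C0 : 0 <= C.
Hypothesis r0 : 0 < r.
Hypothesis small : forall s, 0 <= s ->
  (P [set w | (r / 2 <= enorm (X s w))%R] <= (C * s)%:E)%E.
Hypothesis Ch : C * tau n <= 2^-1.

Let small_half k : (k <= n)%N ->
  (P [set w | (r / 2 <= enorm (X (tau k) w))%R] <= (2^-1)%:E)%E.
Proof.
move=> kn; rewrite (le_trans (small (tau0 k)))// lee_fin (le_trans _ Ch)//.
by rewrite ler_wpM2l// tau_le.
Qed.

Let mfar s u c : 0 <= s -> 0 <= u ->
  measurable [set w | c <= enorm (X s w - X u w)].
Proof.
move=> s0 u0; apply: (@past_measurable (Num.max s u)).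
by apply: measurable_past_dist => //; rewrite le_max lexx ?orbT.
Qed.

Let mfar0 s c : 0 <= s -> measurable [set w | c <= enorm (X s w)].
Proof.
by move=> s0; apply: (@past_measurable s); exact: measurable_past_norm.
Qed.

Definition grid_exit (k : nat) : set Omega := [set w | r <= enorm (X (tau k) w)].

Lemma measurable_past_grid_exit k :
  measurable (seqDU grid_exit k : set (g_sigma_algebraType (past_sets X (tau k)))).
Proof.
rewrite /seqDU; apply: measurableD; first exact: measurable_past_norm.
apply: bigsetU_measurable => l _; apply: measurable_past_norm => //.
by apply: tau_le; exact: ltnW.
Qed.

Lemma measurable_grid_exit k : measurable (seqDU grid_exit k).
Proof. apply: (@past_sets_measurable _ _ _ _ P X LX (tau k)).
exact: measurable_past_grid_exit. Qed.

Let far_increment (E : set Omega) (j : nat) : (j <= n)%N ->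
  measurable (E : set (g_sigma_algebraType (past_sets X (tau j)))) ->
  (P (E `&` [set w | exists k, (j < k)%N /\ (k <= n)%N /\
      (r <= enorm (X (tau k) w - X (tau j) w))%R]) <=
   (2 * C * tau n)%:E * P E)%E.
Proof.
move=> jn mE; rewrite (le_trans (ottaviani mE small_half))//.
have mset : measurable [set v : 'rV[R]_d | r / 2 <= enorm v].
  by apply: measurable_ge_set; exact: measurable_enorm.
have -> := past_independent LX (tau0 _) (tau_le jn) mE mset.
rewrite tauB// muleCA muleC lee_wpmul2r//.
apply: (@le_trans _ _ (2%:E * (C * tau n)%:E)%E); last by rewrite -EFinM mulrA.
rewrite lee_wpmul2l// (le_trans (small (tau0 _)))// lee_fin ler_wpM2l// tau_le//.
exact: leq_subr.
Qed.

Lemma grid_exit_le :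
  (P (\big[setU/set0]_(k < n.+1) seqDU grid_exit k) <= (2 * C * tau n)%:E)%E.
Proof.
rewrite -bigsetU_seqDU.
have mU : measurable (\big[setU/set0]_(k < n.+1) grid_exit k).
  by apply: bigsetU_measurable => k _; exact: mfar0.
pose A : set Omega := [set w | exists k, (0 < k)%N /\ (k <= n)%N /\
      (r <= enorm (X (tau k) w - X (tau 0) w))%R].
have mA : measurable A.
  rewrite (_ : A = \bigcup_(k in [set k | (0 < k)%N /\ (k <= n)%N])
      [set w | r <= enorm (X (tau k) w - X (tau 0) w)]).
    by apply: bigcup_measurable => k _; exact: mfar.
  apply/seteqP; split => w /=; first by move=> [k [? [? ?]]]; exists k.
  by move=> [k [? ?] ?]; exists k.
have mN : measurable [set w | X 0 w != 0].
  exact: (measurable_preimage (mX (lexx 0)) (@measurable_rV_neq0 R d)).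
apply: (@le_trans _ _ (P (A `|` [set w | X 0 w != 0%R]))).
  apply: le_measure; rewrite ?inE//; first exact: measurableU.
  rewrite -bigcup_mkord => w [k kn rk].
  have [X00|X00] := eqVneq (X 0 w) 0; [left|by right].
  have t0 : tau 0 = 0 by rewrite /tau mul0r.
  exists k; rewrite t0 X00 subr0; split=> //; rewrite lt0n; apply/negP => /eqP k0.
  by move: rk; rewrite /grid_exit /= k0 t0 X00 enorm0 leNgt r0.
apply: (@le_trans _ _ (P A + P [set w | X 0 w != 0%R])%E); first exact: measureU2.
rewrite X0 adde0 -(setTI A) (le_trans (far_increment _ _))//.
by rewrite probability_setT mule1.
Qed.

(** Take the first index [j] with [|X (tau j)| >= r]. Either the path is [r] away from that position
    at time [k], or the displacement [2 r] from [k] to [n] leaves it [r] away at time [n]. So a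
    second move of size [r] follows the first, and independence multiplies the two probabilities. *)
Lemma two_moves_le :
  (P [set w | exists k, (k <= n)%N /\ (r <= enorm (X (tau k) w))%R /\
      (2 * r <= enorm (X (tau n) w - X (tau k) w))%R] <=
   ((2 * C * tau n) ^+ 2)%:E)%E.
Proof.
set A := [set w | _].
pose B j : set Omega := [set w | exists k, (j < k)%N /\ (k <= n)%N /\
      (r <= enorm (X (tau k) w - X (tau j) w))%R].
have mB j : measurable (B j).
  rewrite (_ : B j = \bigcup_(k in [set k | (j < k)%N /\ (k <= n)%N])
      [set w | r <= enorm (X (tau k) w - X (tau j) w)]).
    by apply: bigcup_measurable => k _; exact: mfar.
  apply/seteqP; split => w /=; first by move=> [k [? [? ?]]]; exists k.
  by move=> [k [? ?] ?]; exists k.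
have mA : measurable A.
  rewrite (_ : A = \bigcup_(k in [set k | (k <= n)%N])
      (grid_exit k `&` [set w | 2 * r <= enorm (X (tau n) w - X (tau k) w)])).
    by apply: bigcup_measurable => k _; apply: measurableI; [exact: mfar0|exact: mfar].
  apply/seteqP; split => w /=; first by move=> [k [? [? ?]]]; exists k.
  by move=> [k ? [? ?]]; exists k.
have mDB j : measurable (seqDU grid_exit j `&` B j).
  by apply: measurableI => //; exact: measurable_grid_exit.
have tDB : trivIset setT (fun j => seqDU grid_exit j `&` B j).
  by apply: trivIset_setIr; exact: trivIset_seqDU.
apply: (@le_trans _ _ (P (\big[setU/set0]_(j < n.+1) (seqDU grid_exit j `&` B j)))).
  apply: le_measure; rewrite ?inE//; first exact: bigsetU_measurable.
  move=> w [k [kn [rk rkn]]].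
  have : (\big[setU/set0]_(j < k.+1) grid_exit j) w.
    by rewrite -bigcup_mkord; exists k => //=.
  rewrite bigsetU_seqDU -bigcup_mkord => -[j /= jk Dj].
  rewrite -(bigcup_mkord n.+1 (fun j => seqDU grid_exit j `&` B j)).
  have jn : (j <= n)%N by rewrite (leq_trans _ kn).
  exists j => //; split => //.
  have [h|h] := leP r (enorm (X (tau k) w - X (tau j) w)).
    exists k; split=> //; rewrite ltn_neqAle -ltnS jk andbT; apply/eqP => jk'.
    by move: h; rewrite jk' subrr enorm0 leNgt r0.
  exists n; split=> [|]; last split => //.
    rewrite ltn_neqAle jn andbT; apply/eqP => jn'; rewrite jn' in h.
    move: rkn; rewrite enorm_distC leNgt => /negP; apply.
    by rewrite (lt_trans h)// ltr_pMl// ltr1n.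
  (* This triangle inequality is why the second displacement is required to be [2 * r]. *)
  have := enormD (X (tau n) w - X (tau j) w) (X (tau j) w - X (tau k) w).
  rewrite addrA subrK (enorm_distC (X (tau j) w)); lra.
rewrite (@measure_bigsetU _ _ _ P (fun j => seqDU grid_exit j `&` B j))//.
apply: (@le_trans _ _ (\sum_(j < n.+1) ((2 * C * tau n)%:E * P (seqDU grid_exit j)))%E).
  apply: lee_sum => j _; apply: far_increment; first by rewrite -ltnS.
  exact: measurable_past_grid_exit.
rewrite -ge0_sume_distrr// -measure_bigsetU//; last first.
  exact: measurable_grid_exit.
by rewrite expr2 [leRHS]EFinM lee_wpmul2l ?grid_exit_le// lee_fin !mulr_ge0.
Qed.

End maximal_inequality.

(** * Occupation functionals and Khasminskii's lemma *)

Lemma lebesgue_measure_shift (R : realType) (t : R) (A : set (measurableTypeR R)) :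
  measurable A ->
  lebesgue_measure ((fun s : measurableTypeR R => s + t) @^-1` A) = lebesgue_measure A.
Proof.
have mshift : measurable_fun setT (fun s : measurableTypeR R => (s + t : measurableTypeR R)).
  exact: measurable_funD.
move=> mA; have := @lebesgue_measure_unique R (push_measure lebesgue_measure mshift) _ A mA.
move=> -> // _ [[u v] /= _ <-].
change (@lebesgue_measure R `]u, v] =
  @lebesgue_measure R ((fun s : R => (s + t)%R) @^-1` `]u, v]%classic)).
rewrite (_ : _ @^-1` _ = `](u - t), (v - t)]%classic).
  by rewrite !lebesgue_measure_itv /= !lte_fin ltrD2r; case: ifP => // _; rewrite -!EFinB; congr EFin; ring.
by apply/seteqP; split => s /=; rewrite !in_itv /= ltrBlDr lerBrDr.
Qed.

Section occupation.
Context {R : realType} {d : nat} {dO : measure_display}.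
Context {Omega : measurableType dO}.
Variables (P : probability Omega R) (X : R -> Omega -> 'rV[R]_d).
Hypothesis LX : levy_process P X.
Local Notation leb := (@lebesgue_measure R).

Let mX t : 0 <= t -> measurable_fun setT (X t).
Proof. exact: (levy_measurable LX). Qed.

Definition clamp (t s : R) : R := Num.min t (Num.max 0 s).

Let clamp_ge0 t s : 0 <= t -> 0 <= clamp t s.
Proof. by move=> t0; rewrite /clamp le_min t0 le_max lexx. Qed.

Let clamp_le t s : clamp t s <= t.
Proof. by rewrite /clamp ge_min lexx. Qed.

Let clampE t s : 0 <= s -> s <= t -> clamp t s = s.
Proof. by move=> s0 st; rewrite /clamp max_r// min_r. Qed.

Let right_continuous_clamp t w s : 0 <= t ->
  X (clamp t u) w @[u --> s^'+] --> X (clamp t s) w.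
Proof.
move=> t0; have [s0|s0] := ltP s 0.
  apply: cvg_near_cst; near=> u.
  rewrite /clamp (max_l (ltW s0)) max_l//.
  by apply: ltW; near: u; exact: nbhs_right_lt.
have [ts|st] := leP t s.
  apply: cvg_near_cst; near=> u.
  have su : s <= u by near: u; exact: nbhs_right_ge.
  by rewrite /clamp !max_r ?(le_trans s0)// !min_l// (le_trans ts).
rewrite (clampE s0 (ltW st)); have := @levy_right_continuous _ _ _ _ _ _ LX w s s0.
apply: cvg_trans; apply: near_eq_cvg; near=> u; rewrite clampE//.
- by apply: (le_trans s0); near: u; exact: nbhs_right_ge.
- by apply: ltW; near: u; exact: nbhs_right_lt.
Unshelve. all: by end_near. Qed.

Lemma measurable_past_path t : 0 <= t ->
  measurable_fun setT (fun z : measurableTypeR R * g_sigma_algebraType (past_sets X t) =>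
    X (clamp t z.1) z.2).
Proof.
move=> t0; apply: (@measurable_right_continuous R d _
  (g_sigma_algebraType (past_sets X t)) (fun s w => X (clamp t s) w)) => [s|w s].
  by apply: measurable_past_X; [exact: clamp_ge0|exact: clamp_le].
exact: right_continuous_clamp.
Qed.

Let measurable_past_path_comp t d' (T : measurableType d') (f : T -> R)
    (g : T -> g_sigma_algebraType (past_sets X t)) : 0 <= t ->
  measurable_fun setT (f : T -> measurableTypeR R) -> measurable_fun setT g ->
  measurable_fun setT (fun z => X (clamp t (f z)) (g z)).
Proof.
move=> t0 mf mg.
exact: (measurableT_comp (measurable_past_path t0) (measurable_fun_pair mf mg)).
Qed.

Lemma measurable_path_comp t d' (T : measurableType d') (f : T -> R)
    (g : T -> Omega) : 0 <= t ->
  measurable_fun setT (f : T -> measurableTypeR R) -> measurable_fun setT g ->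
  measurable_fun setT (fun z => X (clamp t (f z)) (g z)).
Proof.
move=> t0 mf mg.
have m1 : measurable_fun setT (fun z : measurableTypeR R * Omega => X (clamp t z.1) z.2).
  apply: (@measurable_right_continuous R d _ Omega (fun s w => X (clamp t s) w)) => [s|w s].
    by apply: mX; exact: clamp_ge0.
  exact: right_continuous_clamp.
exact: (measurableT_comp m1 (measurable_fun_pair mf mg)).
Qed.

(** Half-open intervals make the decomposition along a grid disjoint; the value may be [+oo]. *)
Definition occupation (W : 'rV[R]_d -> R) (a b : R) (y : 'rV[R]_d) (w : Omega) :
  \bar R := (\int[leb]_(s in `[a, b[) (W (y + X s w)%R)%:E)%E.

Lemma measurable_path (W : 'rV[R]_d -> R) y w t : 0 <= t -> measurable_fun setT W ->
  measurable_fun setT (fun s : R => W (y + X (clamp t s) w)).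
Proof.
move=> t0 mW; apply: (measurableT_comp mW); apply: measurable_rVD => //.
by apply: measurable_path_comp => //; exact: measurable_cst.
Qed.

Section nonnegative_potential.
Variable W : 'rV[R]_d -> R.
Hypothesis mW : measurable_fun setT W.
Hypothesis W0 : forall z, 0 <= W z.

Lemma occupation_ge0 a b y w : (0 <= occupation W a b y w)%E.
Proof. by apply: integral_ge0 => s _; rewrite lee_fin. Qed.

Lemma measurable_in_path (D : set R) y w t : 0 <= t ->
  (forall s, D s -> 0 <= s <= t) -> measurable D ->
  measurable_fun D (fun s : R => (W (y + X s w))%:E).
Proof.
move=> t0 Dt mD; apply: (@eq_measurable_fun _ _ _ _ D (fun s => (W (y + X (clamp t s) w))%:E)).
  by move=> s /set_mem/Dt/andP[s0 st]; rewrite clampE.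
by apply/measurable_EFinP; apply: measurable_funTS; exact: measurable_path.
Qed.

Let itv_clamp a b t s : 0 <= a -> b <= t -> s \in `[a, b[%R -> clamp t s = s.
Proof.
move=> a0 bt; rewrite in_itv /= => /andP[ls sb].
by rewrite clampE// ?(le_trans a0)// (le_trans (ltW sb)).
Qed.

Lemma measurable_past_occupation a b t y : 0 <= a -> b <= t -> 0 <= t ->
  measurable_fun setT
    (occupation W a b y : g_sigma_algebraType (past_sets X t) -> \bar R).
Proof.
move=> a0 bt t0.
pose g (z : g_sigma_algebraType (past_sets X t) * measurableTypeR R) : \bar R :=
  ((W (y + X (clamp t z.2) z.1)) * \1_(`[a, b[%classic) z.2)%:E.
have mg : measurable_fun setT g.
  apply/measurable_EFinP; apply: measurable_funM.
    apply: (measurableT_comp mW); apply: measurable_rVD => //.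
    by apply: measurable_past_path_comp; [|exact: measurable_snd|exact: measurable_fst].
  by apply: measurableT_comp => //; exact: measurable_indic.
have g0 z : (0 <= g z)%E by rewrite lee_fin mulr_ge0.
have := @measurable_fun_fubini_tonelli_F _ _ _ _ _ leb g mg g0.
congr (measurable_fun _ _); apply/funext => w.
rewrite /occupation integral_mkcond; apply: eq_integral => s _.
rewrite patchE /g /= indicE; case: ifPn => [|_]; last by rewrite mulr0.
by rewrite mulr1 => /set_mem/(itv_clamp a0 bt) ->.
Qed.

Lemma measurable_occupation a b y : 0 <= a -> 0 <= b ->
  measurable_fun setT (occupation W a b y).
Proof.
move=> a0 b0; apply: (measurable_past LX (t := b)).
exact: measurable_past_occupation.
Qed.

Lemma occupation_split a b c y w : 0 <= a -> a <= b -> b <= c ->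
  occupation W a c y w = (occupation W a b y w + occupation W b c y w)%E.
Proof.
move=> a0 ab bc; rewrite /occupation.
have E : `[a, c[%classic = `[a, b[%classic `|` `[b, c[%classic :> set R.
  apply/seteqP; split => s /=; rewrite !in_itv /=.
    move=> /andP[h1 h2]; have [h|h] := ltP s b; [left|right].
      by rewrite h1.
    by rewrite h2.
  by move=> [/andP[-> h]|/andP[h ->]]; rewrite ?(lt_le_trans h)// (le_trans ab).
rewrite E ge0_integral_setU//.
- rewrite -E; apply: (@measurable_in_path _ y w c) => //.
    by rewrite (le_trans a0)// (le_trans ab).
  move=> s /=; rewrite in_itv /= => /andP[h1 /ltW ->].
  by rewrite (le_trans a0).
- by move=> s _; rewrite lee_fin.
- apply/disj_setPS => s /= []; rewrite !in_itv /= => /andP[_ h1] /andP[h2 _].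
  by have := lt_le_trans h1 h2; rewrite ltxx.
Qed.

Lemma occupation_bound (K a b : R) y w : (forall z, W z <= K) -> a <= b ->
  (occupation W a b y w <= (K * (b - a))%:E)%E.
Proof.
move=> WK ab.
apply: (@le_trans _ _ (\int[leb]_(s in `[a, b[) (cst K%:E s))%E).
  by apply: ge0_le_integral_any => s _; rewrite lee_fin.
rewrite integral_cst//= lebesgue_measure_itv /=; case: ifPn => _; first by rewrite -EFinB EFinM.
by rewrite mule0 lee_fin mulr_ge0 ?subr_ge0// (le_trans (W0 0)).
Qed.

Lemma integral_shift (a b t : R) (g : R -> \bar R) :
  measurable_fun setT g -> (forall s, (0 <= g s)%E) ->
  (\int[leb]_(s in `[(a + t)%R, (b + t)%R[) g (s - t)%R = \int[leb]_(s in `[a, b[) g s)%E.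
Proof.
move=> mg g0; rewrite integral_mkcond [RHS]integral_mkcond.
have mshift : measurable_fun setT (fun s : measurableTypeR R => (s - t : measurableTypeR R)).
  exact: measurable_funB.
have law A : measurable A -> leb ((fun s : measurableTypeR R => s - t) @^-1` A) = leb A.
  exact: lebesgue_measure_shift.
have mg' : measurable_fun setT (g \_ `[a, b[%classic).
  by apply/(measurable_restrictT _ _).1 => //; exact: measurable_funTS.
have g'0 s : (0 <= (g \_ `[a, b[%classic) s)%E by exact: erestrict_ge0.
rewrite -(ge0_integral_law mshift (@measurable_id _ _ setT) law mg' g'0).
apply: eq_integral => s _; rewrite !patchE.
rewrite (_ : (s \in `[a + t, b + t[%classic) = (s - t \in `[a, b[%classic))//.
by apply/idP/idP; rewrite !inE /= !in_itv /= lerBrDr ltrBlDr.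
Qed.

(** Tonelli takes the time integral outside, the Markov property at [t] is applied for each fixed
    [s], and Tonelli brings it back inside. What appears is the occupation of a fresh path started
    at [y + X t], bounded by [e] whatever that point is. *)
Lemma occupation_markov (t h : R) (e : \bar R) y
    (F : g_sigma_algebraType (past_sets X t) -> R) :
  0 <= t -> t <= h -> measurable_fun setT F -> (forall w, 0 <= F w) ->
  (forall z, (\int[P]_w occupation W 0 h z w <= e)%E) ->
  (\int[P]_w ((F w)%:E * occupation W t h y w) <= e * \int[P]_w (F w)%:E)%E.
Proof.
move=> t0 th mF F0 We.
have h0 : 0 <= h by exact: le_trans th.
have mFO : measurable_fun setT (F : Omega -> R) by exact: (measurable_past LX).
have mclamp : measurable_fun setT (fun z : Omega * measurableTypeR R => X (clamp h z.2) z.1).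
  exact: measurable_path_comp.
have Wclamp a z w : 0 <= a -> occupation W a h z w =
    (\int[leb]_(s in `[a, h[) (W (z + X (clamp h s) w)%R)%:E)%E.
  by move=> a0; apply: eq_integral => s /set_mem /= hs; rewrite (itv_clamp a0 (lexx h)).
have me (s : R) : measurable_fun setT (fun w => (W (y + X (clamp h s) w))%:E).
  apply/measurable_EFinP; apply: (measurableT_comp mW); apply: measurable_rVD => //.
  by apply: mX; exact: clamp_ge0.
under eq_integral => w _.
  rewrite Wclamp// -ge0_integralZl//; last 3 first.
  - by apply/measurable_EFinP; apply: measurable_funTS; exact: measurable_path.
  - by move=> s _; rewrite lee_fin.
  - by rewrite lee_fin.
  over.
rewrite (@tonelli_in _ _ _ _ _ P leb `[t, h[%classic
   (fun w s => (F w)%:E * (W (y + X (clamp h s) w)%R)%:E)%E)//; last 2 first.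
- apply: emeasurable_funM; apply/measurable_EFinP.
    by apply: (measurableT_comp mFO); exact: measurable_fst.
  by apply: (measurableT_comp mW); apply: measurable_rVD.
- by move=> w s; rewrite mule_ge0// lee_fin.
pose Y (w' : Omega) (s : R) := X (clamp h s) w'.
have step s : `[t, h[%classic s ->
    (\int[P]_w ((F w)%:E * (W (y + X (clamp h s) w)%R)%:E) =
     \int[P]_w \int[P]_w' ((F w)%:E * (W (y + X t w + Y w' (s - t))%R)%:E))%E.
  rewrite /= in_itv /= => /andP[ts sh].
  pose g (z : g_sigma_algebraType (past_sets X t) * 'rV[R]_d) : \bar R :=
    ((F z.1)%:E * (W (y + X t z.1 + z.2)%R)%:E)%E.
  have mg : measurable_fun setT g.
    apply: emeasurable_funM; apply/measurable_EFinP.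
      by apply: (measurableT_comp mF); exact: measurable_fst.
    apply: (measurableT_comp mW); apply: measurable_rVD; last exact: measurable_snd.
    apply: measurable_rVD => //.
    apply: (measurableT_comp (measurable_past_X t0 (lexx t))); exact: measurable_fst.
  have g0 z : (0 <= g z)%E by rewrite mule_ge0// lee_fin.
  have := markov_property LX t0 ts mg g0; rewrite /g /= => H.
  have cs : clamp h s = s by rewrite clampE ?(le_trans t0)// ltW.
  rewrite cs.
  transitivity (\int[P]_w ((F w)%:E * (W (y + X t w + (X s w - X t w))%R)%:E))%E.
    by apply: eq_integral => w _; rewrite -addrA (addrC (X t w)) subrK.
  rewrite H; apply: eq_integral => w _; apply: eq_integral => w' _.
  rewrite /Y (@clampE h (s - t))// ?subr_ge0// lerBlDr (le_trans (ltW sh))// lerDl//.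
under eq_integral => s /set_mem hs do rewrite step//.
have m3 : measurable_fun setT (fun z : Omega * (Omega * measurableTypeR R) =>
   ((F z.1)%:E * (W (y + X t z.1 + Y z.2.1 (z.2.2 - t))%R)%:E)%E).
  apply: emeasurable_funM; apply/measurable_EFinP.
    by apply: (measurableT_comp mFO); exact: measurable_fst.
  apply: (measurableT_comp mW); apply: measurable_rVD.
    apply: measurable_rVD => //; apply: (measurableT_comp (mX t0)); exact: measurable_fst.
  apply: (@measurable_path_comp h _ _ (fun z : Omega * (Omega * measurableTypeR R) => z.2.2 - t)
    (fun z => z.2.1)) => //; last exact: (measurableT_comp measurable_fst measurable_snd).
  apply: measurable_funB => //; exact: (measurableT_comp measurable_snd measurable_snd).
rewrite -(@tonelli_in _ _ _ _ _ P leb `[t, h[%classic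
   (fun w s => \int[P]_w' ((F w)%:E * (W (y + X t w + Y w' (s - t))%R)%:E))%E)//; last 2 first.
- have := @measurable_fun_fubini_tonelli_F _ _ (Omega * measurableTypeR R)%type Omega R P
    (fun z => ((F z.1.1)%:E * (W (y + X t z.1.1 + Y z.2 (z.1.2 - t))%R)%:E)%E).
  apply.
    have mm : measurable_fun setT
        (fun z : Omega * measurableTypeR R * Omega => (z.1.1, (z.2, z.1.2))).
      apply: measurable_fun_pair.
        exact: (measurableT_comp measurable_fst measurable_fst).
      apply: measurable_fun_pair; first exact: measurable_snd.
      exact: (measurableT_comp measurable_snd measurable_fst).
    exact: (measurableT_comp m3 mm).
  by move=> z; rewrite mule_ge0// lee_fin.
- by move=> w s; apply: integral_ge0 => w' _; rewrite mule_ge0// lee_fin.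
apply: (@le_trans _ _ (\int[P]_w (e * (F w)%:E))%E); last first.
  rewrite ge0_integralZl//.
  - exact/measurable_EFinP.
  - by move=> w _; rewrite lee_fin.
  - by apply: le_trans (We 0); apply: integral_ge0 => w _; exact: occupation_ge0.
apply: ge0_le_integral_any => w _.
  by apply: integral_ge0 => s _; apply: integral_ge0 => w' _; rewrite mule_ge0// lee_fin.
rewrite -(@tonelli_in _ _ _ _ _ P leb `[t, h[%classic
   (fun w' s => ((F w)%:E * (W (y + X t w + Y w' (s - t))%R)%:E))%E)//; last 2 first.
- have mm : measurable_fun setT (fun z : Omega * measurableTypeR R => (w, z)).
    exact: measurable_fun_pair.
  exact: (measurableT_comp m3 mm).
- by move=> w' s; rewrite mule_ge0// lee_fin.
apply: (@le_trans _ _ (\int[P]_w' ((F w)%:E * occupation W 0 h (y + X t w)%R w'))%E).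
  apply: ge0_le_integral_any => w' _.
    by apply: integral_ge0 => s _; rewrite mule_ge0// lee_fin.
  rewrite ge0_integralZl//; last 3 first.
  - apply/measurable_EFinP; apply: measurable_funTS.
    apply: (measurableT_comp (measurable_path (y + X t w) w' h0 mW)).
    exact: measurable_funB.
  - by move=> s _; rewrite lee_fin.
  - by rewrite lee_fin.
  rewrite lee_wpmul2l ?lee_fin//.
  (* The fresh path lives on [0, h - t]; by nonnegativity this is enlarged to [0, h], where the
     assumption is stated. *)
  have := @integral_shift 0 (h - t) t (fun s => (W (y + X t w + Y w' s))%:E).
  rewrite add0r subrK => ->; last 2 first.
  - by apply/measurable_EFinP; exact: measurable_path.
  - by move=> s; rewrite lee_fin.
  rewrite Wclamp//; apply: ge0_subset_integral => //.
  - by apply/measurable_EFinP; apply: measurable_funTS; exact: measurable_path.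
  - by move=> s _; rewrite lee_fin.
  - move=> s /=; rewrite !in_itv /= => /andP[-> hs] /=.
    by rewrite (lt_le_trans hs)// gerBl.
rewrite ge0_integralZl//; last 3 first.
- exact: measurable_occupation.
- by move=> w' _; exact: occupation_ge0.
- by rewrite lee_fin.
by rewrite muleC lee_wpmul2r// lee_fin.
Qed.

End nonnegative_potential.
End occupation.

Lemma indic_in (R : realType) (T : Type) (A : set T) w : A w -> \1_A w = 1 :> R.
Proof. by move=> Aw; rewrite indicE mem_set. Qed.

Lemma indic_out (R : realType) (T : Type) (A : set T) w : ~ A w -> \1_A w = 0 :> R.
Proof. by move=> Aw; rewrite indicE memNset. Qed.

Lemma measurable_integral_in (R : realType) d1 d2 (T1 : measurableType d1)
    (T2 : measurableType d2) (m2 : {sigma_finite_measure set T2 -> \bar R})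
    (D : set T2) (f : T1 -> T2 -> \bar R) :
  measurable D -> measurable_fun setT (fun z : T1 * T2 => f z.1 z.2) ->
  (forall x y, (0 <= f x y)%E) ->
  measurable_fun setT (fun x => \int[m2]_(y in D) f x y)%E.
Proof.
move=> mD mf f0.
pose g (z : T1 * T2) := (f z.1 z.2 * (\1_D z.2)%:E)%E.
have mg : measurable_fun setT g.
  apply: emeasurable_funM => //; apply/measurable_EFinP.
  by apply: measurableT_comp => //; exact: measurable_indic.
have g0 z : (0 <= g z)%E by rewrite mule_ge0// lee_fin.
have := @measurable_fun_fubini_tonelli_F _ _ _ _ _ m2 g mg g0.
congr (measurable_fun _ _); apply/funext => x.
rewrite integral_mkcond; apply: eq_integral => y _.
by rewrite patchE /g /= indicE; case: ifPn => _; rewrite ?mule1 ?mule0.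
Qed.

Lemma measurable_expeR (R : realType) (D : set (\bar R)) : measurable_fun D (@expeR R).
Proof.
apply: measurable_funTS.
apply: (measurability (@ErealGenCInfty.G R)); first exact: ErealGenCInfty.measurableE.
move=> _ [_ [r ->] <-]; rewrite setTI.
have [r0|r0] := leP r 0.
  rewrite (_ : _ @^-1` _ = setT)//; apply/seteqP; split => // x _ /=.
  rewrite in_itv /= andbT (le_trans _ (expeR_ge0 x))//.
rewrite (_ : _ @^-1` _ = [set` `[(ln r)%:E, +oo[%O])//; first exact: emeasurable_itv.
apply/seteqP; split => x /=; rewrite !in_itv /= !andbT;
  by have := lee_expeR (ln r)%:E x; rewrite /= lnK ?posrE// => ->.
Qed.

Lemma expR_le1D2x (R : realType) (a : R) : 0 <= a -> a <= 2^-1 -> expR a <= 1 + 2 * a.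
Proof.
move=> a0 a1; have h := expR_ge1Dx (- a); rewrite expRN in h.
have e0 := expR_gt0 a.
have : (1 - a) * expR a <= 1 by rewrite -ler_pdivlMr// mul1r.
move: (expR a) e0 => e e0 h2; nra.
Qed.

Lemma ge0_integral_addR (R : realType) d0 (T : measurableType d0)
    (mu : {measure set T -> \bar R}) (f g : T -> R) :
  measurable_fun setT f -> measurable_fun setT g ->
  (forall w, 0 <= f w) -> (forall w, 0 <= g w) ->
  (\int[mu]_w (f w + g w)%:E = \int[mu]_w (f w)%:E + \int[mu]_w (g w)%:E)%E.
Proof.
move=> mf mg f0 g0; under eq_integral do rewrite EFinD.
apply: ge0_integralD => //.
- by move=> w _; rewrite lee_fin.
- exact/measurable_EFinP.
- by move=> w _; rewrite lee_fin.
- exact/measurable_EFinP.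
Qed.

(** * Khasminskii's lemma, global and local *)

Section khasminskii.
Context {R : realType} {d : nat} {dO : measure_display}.
Context {Omega : measurableType dO}.
Variables (P : probability Omega R) (X : R -> Omega -> 'rV[R]_d).
Hypothesis LX : levy_process P X.
Local Notation leb := (@lebesgue_measure R).

Section bounded_potential.
Variables (W : 'rV[R]_d -> R) (K e delta : R) (n : nat) (y : 'rV[R]_d).
Hypothesis mW : measurable_fun setT W.
Hypothesis W0 : forall z, 0 <= W z.
Hypothesis WK : forall z, W z <= K.
Hypothesis delta0 : 0 <= delta.
Hypothesis Kdelta : K * delta <= 2^-1.
Let tau (k : nat) : R := k%:R * delta.
Hypothesis We : forall z, (\int[P]_w occupation X W 0 (tau n) z w <= e%:E)%E.
Hypothesis e4 : e <= 4^-1.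

Let tau0 k : 0 <= tau k. Proof. by rewrite mulr_ge0. Qed.

Let tau_le j k : (j <= k)%N -> tau j <= tau k.
Proof. by move=> jk; rewrite ler_wpM2r// ler_nat. Qed.

Definition future_occupation (k : nat) (w : Omega) : R :=
  fine (occupation X W (tau k) (tau n) y w).
Local Notation A := future_occupation.

Let occ_fin a b w : a <= b -> occupation X W a b y w \is a fin_num.
Proof.
move=> ab; rewrite ge0_fin_numE ?occupation_ge0//.
by rewrite (le_lt_trans (occupation_bound _ W0 _ _ WK ab))// ltry.
Qed.

Lemma future_occupationE k w : (k <= n)%N ->
  (A k w)%:E = occupation X W (tau k) (tau n) y w.
Proof. by move=> kn; rewrite fineK// occ_fin// tau_le. Qed.

Lemma future_occupation_ge0 k w : 0 <= A k w.
Proof. by rewrite fine_ge0// occupation_ge0. Qed.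

Lemma measurable_future_occupation k : measurable_fun setT (A k).
Proof.
apply: measurableT_comp => //.
exact: (measurable_occupation LX mW W0).
Qed.

Lemma future_occupation_step k : (k < n)%N -> exists a : Omega -> R,
  [/\ measurable_fun setT (a : g_sigma_algebraType (past_sets X (tau k.+1)) -> R),
      forall w, 0 <= a w <= 2^-1 & forall w, A k w = a w + A k.+1 w].
Proof.
move=> kn; have kk : tau k <= tau k.+1 by exact: tau_le.
exists (fun w => fine (occupation X W (tau k) (tau k.+1) y w)); split.
- apply: measurableT_comp => //.
  exact: (measurable_past_occupation LX mW W0).
- move=> w; rewrite fine_ge0 ?occupation_ge0//= -lee_fin fineK ?occ_fin//.
  rewrite (le_trans (occupation_bound _ W0 _ _ WK kk))// lee_fin.
  by rewrite /tau -mulrBl -natrB// subSnn mul1r.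
- move=> w; rewrite /A (occupation_split LX mW W0 _ _ (tau0 k) kk (tau_le kn)).
  by rewrite fineD// occ_fin// tau_le.
Qed.

Lemma expectation_future_occupation k (F : g_sigma_algebraType (past_sets X (tau k)) -> R) :
  (k <= n)%N -> measurable_fun setT F -> (forall w, 0 <= F w) ->
  (\int[P]_w (F w * A k w)%:E <= e%:E * \int[P]_w (F w)%:E)%E.
Proof.
move=> kn mF F0; under eq_integral do rewrite EFinM future_occupationE//.
exact: (occupation_markov LX mW W0 y (tau0 k) (tau_le kn) mF F0 We).
Qed.

(** Backward induction along the grid, for all weights [F] known at the current time at once. The
    bound is linear in the expected occupation, instead of the usual constant depending on [e] only;
    the local version relies on this, since there the expected occupation is far smaller than
    [e]. *)
Theorem khasminskii_bounded m k (F : g_sigma_algebraType (past_sets X (tau k)) -> R) :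
  (k + m = n)%N -> measurable_fun setT F -> (forall w, 0 <= F w) ->
  (\int[P]_w (F w * (expR (A k w) - 1))%:E <= 4%:E * \int[P]_w (F w * A k w)%:E)%E.
Proof.
elim: m k F => [|m IH] k F kmn mF F0.
  have kn : k = n by rewrite -kmn addn0.
  have A0 w : A k w = 0.
    by rewrite /A kn /occupation set_itvco0 integral_set0.
  under eq_integral do rewrite A0 expR0 subrr mulr0.
  rewrite integral0 mule_ge0//; apply: integral_ge0 => w _.
  by rewrite lee_fin mulr_ge0// future_occupation_ge0.
have kn : (k < n)%N by rewrite -kmn; lia.
have [a [ma a01 Aa]] := future_occupation_step kn.
have kmn' : (k.+1 + m = n)%N by rewrite -kmn; lia.
have mFO : measurable_fun setT (F : Omega -> R) by exact: (measurable_past LX).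
have maO : measurable_fun setT (a : Omega -> R) by exact: (measurable_past LX ma).
have mAk := measurable_future_occupation k.+1.
have mF' : measurable_fun setT (F : g_sigma_algebraType (past_sets X (tau k.+1)) -> R).
  move=> _ B mB; rewrite setTI; apply: (past_measurable_le (tau_le (leqnSn k))).
  exact: (measurable_preimage mF mB).
(* One grid step adds [a <= 1/2], and [exp a <= 1 + 2 a] splits off the term [F * 2 a * exp A]. It
   is handled by the induction hypothesis with the new weight [F * 2 a], which is known one step
   later. *)
pose F2 w := F w * (2 * a w).
have mF2 : measurable_fun setT (F2 : g_sigma_algebraType (past_sets X (tau k.+1)) -> R).
  by apply: measurable_funM => //; exact: measurable_funM.
have a0 w : 0 <= a w by have /andP[] := a01 w.
have F20 w : 0 <= F2 w by rewrite mulr_ge0// mulr_ge0.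
have mF2O : measurable_fun setT (F2 : Omega -> R) by exact: (measurable_past LX mF2).
have A0 := future_occupation_ge0.
have mexp : measurable_fun setT (fun w => expR (A k.+1 w) - 1).
  by apply: measurable_funB => //; apply: measurableT_comp.
have e0 w : 0 <= expR (A k.+1 w) - 1.
  by rewrite subr_ge0 -expR0 ler_expR A0.
have IH1 := IH k.+1 F2 kmn' mF2 F20.
have IH2 := IH k.+1 F kmn' mF' F0.
have E2 := expectation_future_occupation kn mF2 F20.
(* The induction hypothesis costs a factor 4 and the Markov bound a factor [e]; the assumption
   [e <= 1/4] is made so that they cancel. *)
have IF2 : (\int[P]_w (F2 w * (expR (A k.+1 w) - 1))%:E <= \int[P]_w (F2 w)%:E)%E.
  apply: (le_trans IH1); apply: (le_trans (lee_wpmul2l _ E2)) => //.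
  rewrite muleA -EFinM -[leRHS]mul1e lee_wpmul2r//.
    by apply: integral_ge0 => w _; rewrite lee_fin.
  by rewrite lee_fin; move: e4; lra.
pose g1 (w : Omega) : R := F2 w * (expR (A k.+1 w) - 1).
pose g3 (w : Omega) : R := F w * (expR (A k.+1 w) - 1).
have mg1 : measurable_fun setT g1 by exact: measurable_funM.
have mg3 : measurable_fun setT g3 by exact: measurable_funM.
have g10 w : 0 <= g1 w by rewrite mulr_ge0.
have g30 w : 0 <= g3 w by rewrite mulr_ge0.
apply: (@le_trans _ _ (\int[P]_w (g1 w + (F2 w + g3 w))%:E)%E).
  apply: ge0_le_integral_any => w _.
    rewrite lee_fin mulr_ge0// subr_ge0 -expR0 ler_expR; exact: A0.
  rewrite lee_fin /g1 /g3 /F2 Aa expRD.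
  have /andP[h1 h2] := a01 w; have h3 := expR_le1D2x h1 h2.
  have h4 := e0 w; have h5 := F0 w.
  move: h3 h4; move: (expR (a w)) (expR (A k.+1 w)) => ea eA h3 h4.
  rewrite -subr_ge0 (_ : _ - _ = F w * ((1 + 2 * a w - ea) * eA)); last by ring.
  by rewrite !mulr_ge0//; lra.
have mF2g : measurable_fun setT (fun w : Omega => F2 w + g3 w) by exact: measurable_funD.
have F2g0 w : 0 <= F2 w + g3 w by rewrite addr_ge0.
rewrite (ge0_integral_addR P mg1 mF2g g10 F2g0) (ge0_integral_addR P mF2O mg3 F20 g30).
apply: (@le_trans _ _ (\int[P]_w (F2 w)%:E + (\int[P]_w (F2 w)%:E +
   4%:E * \int[P]_w (F w * A k.+1 w)%:E))%E).
  by apply: leeD; [exact: IF2|apply: leeD; [exact: lexx|exact: IH2]].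
have F2E : (\int[P]_w (F2 w)%:E = 2%:E * \int[P]_w (F w * a w)%:E)%E.
  rewrite -ge0_integralZl//; last 2 first.
  - by apply/measurable_EFinP; exact: measurable_funM.
  - by move=> w _; rewrite lee_fin mulr_ge0.
  by apply: eq_integral => w _; rewrite -EFinM /F2 mulrCA.
have -> : (\int[P]_w (F w * A k w)%:E =
    \int[P]_w (F w * a w)%:E + \int[P]_w (F w * A k.+1 w)%:E)%E.
  rewrite -(@ge0_integral_addR _ _ _ P (fun w => F w * a w) (fun w => F w * A k.+1 w)).
  - by apply: eq_integral => w _; rewrite -mulrDr Aa.
  - exact: measurable_funM.
  - exact: measurable_funM.
  - by move=> w; rewrite mulr_ge0.
  - by move=> w; rewrite mulr_ge0.
have i10 : (0 <= \int[P]_w (F w * a w)%:E)%E.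
  by apply: integral_ge0 => w _; rewrite lee_fin mulr_ge0.
have i20 : (0 <= \int[P]_w (F w * A k.+1 w)%:E)%E.
  by apply: integral_ge0 => w _; rewrite lee_fin mulr_ge0.
rewrite F2E; move: i10 i20; move: (integral P _ _) (integral P _ _) => i1 i2 i10 i20.
rewrite ge0_muleDr// addeA -ge0_muleDl ?lee_fin// -EFinD leeD2r//.
by rewrite (_ : 2 + 2 = 4 :> R)//; ring.
Qed.

Section locality.
Variables (r C : R).
Hypothesis r0 : 0 < r.
Hypothesis C0 : 0 <= C.
Hypothesis Wr : forall z, enorm (z - y) < r -> W z = 0.
Hypothesis small : forall s, 0 <= s ->
  (P [set w | (r / 4 <= enorm (X s w))%R] <= (C * s)%:E)%E.
Hypothesis Ch : C * tau n <= 2^-1.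

Let far : set 'rV[R]_d := [set v | r / 2 <= enorm v].

Let mfar : measurable far.
Proof. by apply: measurable_ge_set; exact: measurable_enorm. Qed.

Let B j : set R := `[tau j, tau j.+1[%classic.

(** Bounds the occupation during cell [j] for a path within [r / 2] of the origin at its start: to
    reach the support of [W], at distance [r], it must move by [r / 2] within that cell. *)
Let late j w : \bar R :=
  (\int[leb]_(s in B j) (K%:E * (\1_far (X (clamp (tau n) s) w - X (tau j) w)%R)%:E))%E.

Let K0 : 0 <= K. Proof. exact: le_trans (W0 0) (WK 0). Qed.

Let late_ge0 j w : (0 <= late j w)%E.
Proof. by apply: integral_ge0 => s _; rewrite mule_ge0// lee_fin. Qed.

Let mlate j : measurable_fun setT (fun z : Omega * measurableTypeR R =>
  (K%:E * (\1_far (X (clamp (tau n) z.2) z.1 - X (tau j) z.1)%R)%:E)%E).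
Proof.
apply: emeasurable_funM => //; apply/measurable_EFinP.
have m1 : measurable_fun setT (fun v : 'rV[R]_d => \1_far v : R) by exact: measurable_indic.
have m2 : measurable_fun setT (fun z : Omega * measurableTypeR R =>
    X (clamp (tau n) z.2) z.1 - X (tau j) z.1).
  apply: measurable_rVB; first exact: (measurable_path_comp LX).
  by apply: (measurableT_comp (levy_measurable LX (tau0 j))); exact: measurable_fst.
exact: (measurableT_comp m1 m2).
Qed.

Let measurable_late j : measurable_fun setT (late j).
Proof.
apply: (@measurable_integral_in R _ _ Omega (measurableTypeR R) leb (B j)
  (fun w s => (K%:E * (\1_far (X (clamp (tau n) s) w - X (tau j) w)%R)%:E)%E)).
- exact: measurable_itv.
- exact: mlate.
- by move=> w s; rewrite mule_ge0// lee_fin.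
Qed.

Let expectation_late j : (j < n)%N -> (\int[P]_w late j w <= (K * C * delta * delta)%:E)%E.
Proof.
move=> jn.
have jj : tau j <= tau j.+1 by exact: tau_le.
have dj : tau j.+1 - tau j = delta by rewrite /tau -mulrBl -natrB// subSnn mul1r.
rewrite /late (@tonelli_in _ _ _ _ _ P leb (B j)
  (fun w s => (K%:E * (\1_far (X (clamp (tau n) s) w - X (tau j) w)%R)%:E)%E)); last 3 first.
- exact: measurable_itv.
- exact: mlate.
- by move=> w s; rewrite mule_ge0// lee_fin.
apply: (@le_trans _ _ (\int[leb]_(s in `[tau j, tau j.+1[) (cst (K * C * delta)%:E s))%E); last first.
  rewrite integral_cst//= lebesgue_measure_itv /= lte_fin; case: ifPn => _.
    by rewrite -EFinB dj -EFinM.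
  by rewrite mule0 lee_fin !mulr_ge0.
apply: ge0_le_integral_any => s; rewrite /B /= in_itv /= => /andP[js sj].
  by apply: integral_ge0 => w _; rewrite mule_ge0// lee_fin.
have s0 : 0 <= s by exact: le_trans js.
have sn : s <= tau n by rewrite (le_trans (ltW sj))// tau_le.
have mE : measurable [set w | far (X s w - X (tau j) w)].
  apply: (past_measurable LX (t := s)).
  by apply: measurable_past_dist => //.
rewrite (_ : clamp (tau n) s = s); last by rewrite /clamp max_r// min_r.
rewrite ge0_integralZl; [|exact: measurableT| | |by rewrite lee_fin]; last 2 first.
- apply/measurable_EFinP.
  have m1 : measurable_fun setT (fun v : 'rV[R]_d => \1_far v : R) by exact: measurable_indic.
  have m2 : measurable_fun setT (fun w => X s w - X (tau j) w).
    by apply: measurable_rVB; apply: (levy_measurable LX).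
  exact: (measurableT_comp m1 m2).
- by move=> w _; rewrite lee_fin.
rewrite (_ : (fun w => _) = (fun w => (\1_[set w | far (X s w - X (tau j) w)] w)%:E)); last first.
  by apply/funext => w; rewrite !indicE; congr (_%:R%:E); apply/idP/idP; rewrite !inE.
rewrite integral_indic// setIT.
have sj0 : 0 <= s - tau j by rewrite subr_ge0.
have st : tau j + (s - tau j) = s by rewrite addrC subrK.
have H := levy_stationary LX (tau0 j) sj0 mfar; rewrite st in H.
rewrite [X in (_ * X)%E](_ : _ = P [set w | far (X (s - tau j) w)]); last exact: H.
rewrite -mulrA EFinM lee_wpmul2l// ?lee_fin//.
apply: (@le_trans _ _ (C * (s - tau j))%:E).
  apply: le_trans (small sj0); apply: le_measure; rewrite ?inE//.
  - exact: (measurable_preimage (levy_measurable LX sj0) mfar).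
  - apply: (past_measurable LX (t := s - tau j)); exact: measurable_past_norm.
  - by move=> w /=; rewrite /far /=; move: r0; lra.
by rewrite lee_fin ler_wpM2l// -dj lerD2r ltW.
Qed.

Let U (m : nat) : set Omega := \big[setU/set0]_(k < m) grid_exit X delta (r / 2) k.
Let G := seqDU (grid_exit X delta (r / 2)).

(** Before the first grid exit only [late] contributes; at the first exit, with index [k], the whole
    remaining occupation [A k] is charged. The last term carries the paths that have not yet
    exited. *)
Let occupation_le_exit m w : (m <= n)%N ->
  ((A 0 w)%:E <= \sum_(k < m) (\1_(G k) w * A k w)%:E + \sum_(k < m) late k w +
     (\1_(~` U m) w * A m w)%:E)%E.
Proof.
elim: m => [_|m IH mn].
  rewrite !big_ord0 !add0e /U big_ord0 setC0 indicE in_setT mul1r.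
  exact: lexx.
apply: le_trans (IH (ltnW mn)) _; rewrite !big_ord_recr /=.
set S1 := (\sum_(k < m) _)%E; set S2 := (\sum_(k < m) _)%E.
have S10 : (0 <= S1)%E.
  by apply: sume_ge0 => k _; rewrite lee_fin mulr_ge0// future_occupation_ge0.
have S20 : (0 <= S2)%E by apply: sume_ge0.
suff H : ((\1_(~` U m) w * A m w)%:E <= (\1_(G m) w * A m w)%:E + late m w +
    (\1_(~` U m.+1) w * A m.+1 w)%:E)%E.
  apply: (le_trans (leeD2l _ H)).
  by rewrite le_eqVlt; apply/orP; left; apply/eqP; rewrite !addeA; congr (_ + _)%E;
    rewrite -!addeA; congr (_ + _)%E; rewrite addeCA.
have A0 := future_occupation_ge0.
have [Um|Um] := pselect (U m w).
  rewrite [in leLHS]indic_out ?mul0r; last by move=> /(_ Um).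
  by apply: adde_ge0; [apply: adde_ge0|]; rewrite // lee_fin mulr_ge0.
have [Em|Em] := pselect (grid_exit X delta (r / 2) m w).
  have Gm : G m w by [].
  rewrite [in leLHS]indic_in// (indic_in R Gm) -addeA leeDl//.
  have E0 : (0 <= (\1_(~` U m.+1) w * A m.+1 w)%:E)%E by rewrite lee_fin mulr_ge0.
  exact: adde_ge0.
have Um1 : (~` U m.+1) w by rewrite /U big_ord_recr /= => -[].
have nG : ~ G m w by case.
have nU : (~` U m) w by [].
rewrite (indic_in R nU) (indic_in R Um1) (indic_out R nG) mul0r add0e !mul1r.
rewrite !future_occupationE//; last exact: ltnW.
rewrite (occupation_split LX mW W0 _ _ (tau0 m) (tau_le (leqnSn m)) (tau_le mn)).
rewrite leeD2r//; apply: ge0_le_integral_any => s; rewrite /= in_itv /= => /andP[ms sm].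
  by rewrite lee_fin.
have s0 : 0 <= s by exact: le_trans ms.
rewrite (_ : clamp (tau n) s = s); last first.
  by rewrite /clamp max_r// min_r// (le_trans (ltW sm))// tau_le.
have [Wz|Wz] := eqVneq (W (y + X s w)) 0.
  by rewrite Wz mule_ge0// lee_fin.
rewrite indic_in ?mule1 ?lee_fin//.
rewrite /far /=; move: Em; rewrite /grid_exit /= => /negP; rewrite -ltNge => Em.
have rs : r <= enorm (X s w).
  by rewrite leNgt; apply/negP => h; move/eqP: Wz; apply; apply: Wr; rewrite addrC addKr.
have := enormD (X s w - X (tau m) w) (X (tau m) w); rewrite subrK.
rewrite -/(tau m) in Em; lra.
Qed.

(** After a first grid exit the Markov property bounds the remaining occupation by [e], and the
    maximal inequality bounds the exit probability: this is the term with [e]. The other term sums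
    the [late] parts, each of order [delta ^ 2], and vanishes as the grid is refined. *)
Lemma local_occupation_bounded :
  (\int[P]_w occupation X W 0 (tau n) y w <=
   (2 * C * tau n * e + K * C * delta * tau n)%:E)%E.
Proof.
have A0 := future_occupation_ge0.
have mA := measurable_future_occupation.
have mG k : measurable (G k) by exact: (measurable_grid_exit LX).
have e0 : 0 <= e.
  by rewrite -lee_fin; apply: le_trans (We 0); apply: integral_ge0 => w _; exact: occupation_ge0.
apply: (@le_trans _ _ (\int[P]_w (\sum_(k < n) (\1_(G k) w * A k w)%:E +
    \sum_(k < n) late k w))%E).
  apply: ge0_le_integral_any => w _; first exact: occupation_ge0.
  have t00 : tau 0 = 0 by rewrite /tau mul0r.
  have := occupation_le_exit w (leqnn n).
  rewrite {1}future_occupationE// t00 => /le_trans; apply.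
  rewrite (_ : A n w = 0) ?mulr0 ?adde0//.
  by rewrite /A /occupation set_itvco0 integral_set0.
have m1 k : measurable_fun setT (fun w => (\1_(G k) w * A k w)%:E).
  apply/measurable_EFinP; apply: measurable_funM => //; exact: measurable_indic.
rewrite ge0_integralD//; last 4 first.
- by move=> w _; apply: sume_ge0 => k _; rewrite lee_fin mulr_ge0.
- exact: emeasurable_sum.
- by move=> w _; apply: sume_ge0.
- exact: emeasurable_sum.
rewrite EFinD leeD//.
  rewrite ge0_integral_sum//; last by move=> k w _; rewrite lee_fin mulr_ge0.
  apply: (@le_trans _ _ (\sum_(k < n) (e%:E * P (G k)))%E).
    apply: lee_sum => k _.
    pose F : g_sigma_algebraType (past_sets X (tau k)) -> R := \1_(G k).
    have mF : measurable_fun setT F.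
      have mGk : measurable (G k : set (g_sigma_algebraType (past_sets X (tau k)))).
        exact: measurable_past_grid_exit.
      exact: measurable_indic.
    have := @expectation_future_occupation k F (ltnW (ltn_ord k)) mF (fun w => ler0n _ _).
    rewrite (_ : \int[P]_w (F w)%:E = P (G k))%E//.
    by rewrite integral_indic// setIT.
  rewrite -ge0_sume_distrr// [leRHS]EFinM muleC lee_wpmul2r ?lee_fin//.
  have small' s : 0 <= s -> (P [set w | (r / 2 / 2 <= enorm (X s w))%R] <= (C * s)%:E)%E.
    by move=> s0; rewrite (_ : r / 2 / 2 = r / 4) ?small//; field.
  have r20 : 0 < r / 2 by rewrite divr_gt0.
  apply: le_trans (grid_exit_le LX delta0 C0 r20 small' Ch).
  rewrite [leRHS]measure_bigsetU//.
  by rewrite [leRHS]big_ord_recr /= leeDl.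
rewrite ge0_integral_sum//.
apply: (@le_trans _ _ (\sum_(k < n) (K * C * delta * delta)%:E)%E).
  by apply: lee_sum => k _; exact: expectation_late.
rewrite sumEFin lee_fin sumr_const card_ord /tau -[leLHS]mulr_natr.
by rewrite -!mulrA (mulrC delta n%:R).
Qed.

End locality.

End bounded_potential.

Section small_time.
Variables (W : 'rV[R]_d -> R) (h e : R).
Hypothesis mW : measurable_fun setT W.
Hypothesis W0 : forall z, 0 <= W z.
Hypothesis h0 : 0 < h.
Hypothesis We : forall z, (\int[P]_w occupation X W 0 h z w <= e%:E)%E.
Hypothesis e4 : e <= 4^-1.

Let h0' : 0 <= h. Proof. exact: ltW. Qed.

Let trunc (K : nat) (z : 'rV[R]_d) : R := Num.min (W z) K%:R.

Let mtrunc K : measurable_fun setT (trunc K).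
Proof. exact: measurable_minr. Qed.

Let trunc0 K z : 0 <= trunc K z.
Proof. by rewrite le_min W0 ler0n. Qed.

Let truncK K z : trunc K z <= K%:R.
Proof. by rewrite ge_min lexx orbT. Qed.

Let trunc_occ K z w a b :
  (occupation X (trunc K) a b z w <= occupation X W a b z w)%E.
Proof.
by apply: ge0_le_integral_any => s _; rewrite lee_fin ?trunc0// ge_min lexx.
Qed.

Let truncWe K z : (\int[P]_w occupation X (trunc K) 0 h z w <= e%:E)%E.
Proof.
apply: le_trans (We z); apply: ge0_le_integral_any => w _; last exact: trunc_occ.
exact: occupation_ge0.
Qed.

(** Monotone convergence twice, for the occupation along a path and for the expectation. *)
Let exp_occ_trunc y (B : \bar R) :
  (forall K : nat, (\int[P]_w expeR (occupation X (trunc K) 0 h y w) <= B)%E) ->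
  (\int[P]_w expeR (occupation X W 0 h y w) <= B)%E.
Proof.
move=> HB.
have mocc K : measurable_fun setT (occupation X (trunc K) 0 h y).
  apply: (measurable_occupation LX (mtrunc K) (trunc0 K)); [exact: lexx|exact: h0'].
have trunc_le K L z : (K <= L)%N -> trunc K z <= trunc L z.
  move=> KL; rewrite le_min ge_min lexx /= ge_min.
  by rewrite (ler_nat R) KL orbT.
have ndocc w K L : (K <= L)%N ->
    (occupation X (trunc K) 0 h y w <= occupation X (trunc L) 0 h y w)%E.
  move=> KL; apply: ge0_le_integral_any => s _; rewrite lee_fin ?trunc0//.
  exact: trunc_le.
have cvgocc w : occupation X (trunc K) 0 h y w @[K --> \oo] --> occupation X W 0 h y w.
  have := @cvg_monotone_convergence _ _ _ leb `[0, h[%classic _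
     (fun K s => (trunc K (y + X s w))%:E).
  rewrite /occupation (_ : (fun x => _) = (fun s => (W (y + X s w))%:E)); last first.
    apply/funext => s; apply/cvg_lim => //; apply: cvg_EFin; first by near=> K.
    apply: cvg_near_cst; near=> K; rewrite /= /trunc min_l//.
    by near: K; exact: nbhs_infty_ger.
  apply=> //.
  - move=> K; apply: (measurable_in_path LX (mtrunc K) _ _ h0') => //.
    by move=> s /=; rewrite in_itv /= => /andP[-> /ltW].
  - by move=> K s _; rewrite lee_fin trunc0.
  - by move=> s _ K L KL; rewrite lee_fin trunc_le.
pose f K w := expeR (occupation X (trunc K) 0 h y w).
have ndf w : {homo f^~ w : K L / (K <= L)%N >-> (K <= L)%E}.
  by move=> K L KL; rewrite lee_expeR ndocc.
apply: (@le_trans _ _ (\int[P]_w limn (f^~ w))%E).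
  apply: ge0_le_integral_any => w _; first exact: expeR_ge0.
  have cf : cvgn (f^~ w) by exact: ereal_nondecreasing_is_cvgn.
  have fL K : (f K w <= limn (f^~ w))%E.
    rewrite (cvg_lim _ (ereal_nondecreasing_cvgn (ndf w)))//.
    by apply: ereal_sup_ubound; exists K.
  (* In place of continuity of [expeR] at infinite values: the limit is nonnegative, hence of the
     form [expeR u], and the inequality is proved between exponents. *)
  have [[u uL]|] : (exists u, expeR u = limn (f^~ w)) \/ False.
  - left; apply: expeR_total; apply: le_trans (fL 0%N); exact: expeR_ge0.
  - rewrite -uL lee_expeR -(cvg_lim _ (cvgocc w))//.
    apply: lime_le; first by apply/cvg_ex; eexists; exact: cvgocc.
    by near=> K; rewrite -lee_expeR uL; exact: fL.
  - by [].
have mf K : measurable_fun setT (f K).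
  by apply: measurableT_comp; [exact: measurable_expeR|exact: mocc].
rewrite (@monotone_convergence _ _ _ P setT measurableT f mf
  (fun K w _ => expeR_ge0 _) (fun w _ => ndf w)).
apply: lime_le; last by near=> K; exact: HB.
apply: ereal_nondecreasing_is_cvgn => K L KL; apply: ge0_le_integral_any => w _.
  exact: expeR_ge0.
exact: ndf.
Unshelve. all: by end_near. Qed.

(** The number of grid cells. It is large enough for [K * delta <= 1/2], and [m] remains free for
    further refinement. *)
Let n_ K m : nat := (2 * (Num.trunc (K%:R * h)).+1 + m).+1.

Let delta_ K m : R := h / (n_ K m)%:R.

Let delta_ge0 K m : 0 <= delta_ K m. Proof. by rewrite divr_ge0// ltW. Qed.

Let delta_n K m : (n_ K m)%:R * delta_ K m = h.
Proof. by rewrite /delta_ mulrC divfK// pnatr_eq0. Qed.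

Let K_delta K m : K%:R * delta_ K m <= 2^-1.
Proof.
have := truncnS_gt (K%:R * h); rewrite /delta_ mulrA ler_pdivrMr ?ltr0n// /n_.
move: (K%:R * h) => u; move: (Num.Def.trunc u).+1 => t ut.
have : (2 * t)%:R <= (2 * t + m).+1%:R :> R by rewrite ler_nat; lia.
rewrite natrM; move: ((2 * t + m).+1%:R) => v; lra.
Qed.

Let exp_le_occupation K y (B : R) : 0 <= B ->
  (\int[P]_w occupation X (trunc K) 0 h y w <= B%:E)%E ->
  (\int[P]_w expeR (occupation X (trunc K) 0 h y w) <= (1 + 4 * B)%:E)%E.
Proof.
move=> B0 HB.
have We' z : (\int[P]_w occupation X (trunc K) 0 ((n_ K 0)%:R * delta_ K 0) z w <= e%:E)%E.
  by rewrite delta_n.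
have := @khasminskii_bounded (trunc K) K%:R e (delta_ K 0) (n_ K 0) y (mtrunc K)
  (trunc0 K) (truncK K) (delta_ge0 K 0) (K_delta K 0) We' e4 (n_ K 0) 0 (cst 1)
  (add0n _) (measurable_cst _) (fun=> ler01).
pose A := future_occupation (trunc K) (delta_ K 0) (n_ K 0) y 0.
have AE w : (A w)%:E = occupation X (trunc K) 0 h y w.
  by rewrite /A (future_occupationE (K := K%:R))// ?mul0r ?delta_n//; exact: trunc0.
have mA : measurable_fun setT A.
  by apply: measurable_future_occupation => //; exact: K_delta.
have A0 w : 0 <= A w by rewrite -lee_fin AE occupation_ge0.
under eq_integral do rewrite mul1r -/A.
under [X in (_ <= _ * X)%E]eq_integral do rewrite mul1r -/A AE.
move=> H.
under eq_integral do rewrite -AE /=.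
have m1 : measurable_fun setT (fun w => expR (A w) - 1).
  by apply: measurable_funB => //; exact: measurableT_comp.
have h1 w : 0 <= expR (A w) - 1 by rewrite subr_ge0 -expR0 ler_expR.
apply: (@le_trans _ _ (\int[P]_w (1 + (expR (A w) - 1))%:E)%E).
  by apply: ge0_le_integral_any => w _; rewrite lee_fin ?expR_ge0// addrC subrK.
rewrite (ge0_integral_addR P (measurable_cst _) m1 (fun=> ler01) h1).
rewrite EFinD leeD//.
  rewrite (_ : (\int[P]_w (cst 1 w)%:E) = \int[P]_w (cst 1%:E w))%E//.
  by rewrite integral_cst//= probability_setT mul1e.
by apply: (le_trans H); rewrite EFinM lee_wpmul2l.
Qed.

Theorem khasminskii y :
  (\int[P]_w expeR (occupation X W 0 h y w) <= 2%:E)%E.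
Proof.
apply: exp_occ_trunc => K.
have e0 : 0 <= e.
  by rewrite -lee_fin; apply: le_trans (We 0); apply: integral_ge0 => w _; exact: occupation_ge0.
apply: (le_trans (exp_le_occupation e0 (truncWe K y))).
by rewrite lee_fin; move: e4; lra.
Qed.

(* [e] is small with [h], so this is [1 + o(h)]. *)
Theorem khasminskii_local y (r C : R) : 0 < r -> 0 <= C -> C * h <= 2^-1 ->
  (forall z, enorm (z - y) < r -> W z = 0) ->
  (forall s, 0 <= s -> (P [set w | (r / 4 <= enorm (X s w))%R] <= (C * s)%:E)%E) ->
  (\int[P]_w expeR (occupation X W 0 h y w) <= (1 + 8 * C * h * e)%:E)%E.
Proof.
move=> r0 C0 Ch Wr small.
have e0 : 0 <= e.
  by rewrite -lee_fin; apply: le_trans (We 0); apply: integral_ge0 => w _; exact: occupation_ge0.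
apply: exp_occ_trunc => K.
rewrite (_ : 1 + _ = 1 + 4 * (2 * C * h * e)); last by ring.
apply: exp_le_occupation; first by rewrite !mulr_ge0.
apply/lee_addgt0Pr => eta eta0.
(* With the truncation level [K] fixed, the late term is [K C h^2] divided by the number of cells;
   [m] is chosen to make it at most [eta]. *)
pose c := K%:R * C * h * h / eta.
pose m := (Num.trunc c).+1.
have mc : c <= m%:R by apply: ltW; exact: truncnS_gt.
have We' z : (\int[P]_w occupation X (trunc K) 0 ((n_ K m)%:R * delta_ K m) z w <= e%:E)%E.
  by rewrite delta_n.
have tWr z : enorm (z - y) < r -> trunc K z = 0.
  by move=> /Wr Wz; rewrite /trunc Wz min_l.
have Ch' : C * ((n_ K m)%:R * delta_ K m) <= 2^-1 by rewrite delta_n.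
have := @local_occupation_bounded (trunc K) K%:R e (delta_ K m) (n_ K m) y (mtrunc K)
  (trunc0 K) (truncK K) (delta_ge0 K m) We' r C r0 C0 tWr small Ch'.
rewrite delta_n => /le_trans; apply.
rewrite -EFinD lee_fin lerD2l /delta_.
rewrite (_ : _ * h = (K%:R * C * h * h) / (n_ K m)%:R); last by ring.
rewrite ler_pdivrMr// -ler_pdivrMl// mulrC.
by rewrite (le_trans mc)// ler_nat (leq_trans _ (leqnSn _))// leq_addl.
Qed.

(** Read off [khasminskii_local] through [1 + x <= exp x]. *)
Lemma local_occupation y (r C : R) : 0 < r -> 0 <= C -> C * h <= 2^-1 ->
  (forall z, enorm (z - y) < r -> W z = 0) ->
  (forall s, 0 <= s -> (P [set w | (r / 4 <= enorm (X s w))%R] <= (C * s)%:E)%E) ->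
  (\int[P]_w occupation X W 0 h y w <= (8 * C * h * e)%:E)%E.
Proof.
move=> r0 C0 Ch Wr small; have := khasminskii_local r0 C0 Ch Wr small.
have mJ : measurable_fun setT (occupation X W 0 h y).
  by apply: (measurable_occupation LX mW W0); [exact: lexx|exact: h0'].
have J0 w : (0 <= occupation X W 0 h y w)%E by exact: occupation_ge0.
rewrite EFinD => H; rewrite -(leeD2lE (x := 1%E))//; apply: le_trans H.
rewrite (_ : 1%E = \int[P]_w (cst 1%E w))%E; last first.
  by rewrite integral_cst//= probability_setT mul1e.
rewrite -ge0_integralD//.
apply: ge0_le_integral_any => w _ /=; first by rewrite adde_ge0.
exact: expeR_ge1Dx.
Qed.

End small_time.
End khasminskii.

(** * Small-time bounds for the Feynman-Kac weight *)

Lemma continuous_enormB (R : realType) (d : nat) (u : 'rV[R]_d) :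
  continuous (fun v : 'rV[R]_d => enorm (u - v)).
Proof.
move=> v; apply: (@continuous_comp _ _ _ (fun v : 'rV[R]_d => u - v) enorm).
  by apply: (@cvgB _ _ _ (nbhs v) _ (cst u) id); [exact: cvg_cst|exact: cvg_id].
exact: continuous_enorm.
Qed.

Lemma ge0_integral_scale (R : realType) d0 (T : measurableType d0)
    (mu : {measure set T -> \bar R}) (k : R) (f : T -> \bar R) :
  0 <= k -> measurable_fun setT f -> (forall x, (0 <= f x)%E) ->
  (\int[mu]_x (k%:E * f x) = k%:E * \int[mu]_x f x)%E.
Proof.
by move=> k0 mf f0; apply: ge0_integralZl.
Qed.

Lemma abse_integral_le_any (R : realType) d0 (T : measurableType d0)
    (mu : {measure set T -> \bar R}) (f : T -> \bar R) (D : set T) :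
  (`|\int[mu]_(x in D) f x| <= \int[mu]_(x in D) `|f x|)%E.
Proof.
rewrite integralE.
have h1 : (\int[mu]_(x in D) f^\+ x <= \int[mu]_(x in D) `|f x|)%E.
  by apply: ge0_le_integral_any => x _; [exact: funepos_ge0|rewrite funeposE ge_max abse_ge0 andbT; exact: lee_abs].
have h2 : (\int[mu]_(x in D) f^\- x <= \int[mu]_(x in D) `|f x|)%E.
  apply: ge0_le_integral_any => x _; first exact: funeneg_ge0.
  by rewrite funenegE ge_max abse_ge0 andbT -abseN; exact: lee_abs.
have p1 : (0 <= \int[mu]_(x in D) f^\+ x)%E by apply: integral_ge0 => x _; exact: funepos_ge0.
have p2 : (0 <= \int[mu]_(x in D) f^\- x)%E by apply: integral_ge0 => x _; exact: funeneg_ge0.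
move: (integral mu D (f^\+)%E) (integral mu D (f^\-)%E) (integral mu D (fun x => `|f x|)%E) h1 h2 p1 p2.
move=> [a| |] [b| |] [c| |] //; rewrite ?lee_fin /= ?leey// => ? ? ? ?.
by rewrite ler_norml; lra.
Qed.

(** * Exit probabilities and paths with two moves *)

Section exit.
Context {R : realType} {d : nat} {dO : measure_display}.
Context {Omega : measurableType dO}.
Variables (P : probability Omega R) (X : R -> Omega -> 'rV[R]_d).
Hypothesis d0 : (0 < d)%N.
Hypothesis LX : levy_process P X.
Hypothesis SX : symmetric_process P X.
Variables (b : 'rV[R]_d) (Q : 'M[R]_d) (N : {measure set 'rV[R]_d -> \bar R}).
Hypothesis TX : levy_triplet P X b Q N.

Let mX t : 0 <= t -> measurable_fun setT (X t).
Proof. exact: (levy_measurable LX). Qed.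

Let mfar t r : 0 <= t -> measurable [set w | r <= enorm (X t w)].
Proof.
by move=> t0; apply: (past_measurable LX (t := t)); exact: measurable_past_norm.
Qed.

(** Markov's inequality for the barrier started at its zero: it is at least 1 at distance [r], and
    its mean grows at a rate proportional to [psi_bound]. *)
Lemma far_probability_le (a r s : R) : 0 < a -> 2 * d%:R <= a * r -> 0 <= s ->
  (P [set w | (r <= enorm (X s w))%R] <= (2 * d%:R * psi_bound Q N a * s)%:E)%E.
Proof.
move=> a0 ar s0.
have := expectation_barrier_le LX SX TX 0 (ltW a0) s0.
rewrite barrier0 add0r mulrC => /(le_trans _); apply.
rewrite -(setIT [set w | _]) -integral_indic//; last exact: mfar.
apply: ge0_le_integral_any => w _; rewrite lee_fin//.
rewrite add0r; have [h|h] := leP r (enorm (X s w)).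
  by rewrite indic_in//; apply: barrier_ge1 h.
rewrite indic_out ?barrier_ge0//= => /le_lt_trans/(_ h); by rewrite ltxx.
Qed.

Lemma exit_small (r : R) : 0 < r -> exists2 C, 0 <= C & forall s, 0 <= s ->
  (P [set w | (r <= enorm (X s w))%R] <= (C * s)%:E)%E.
Proof.
move=> r0; have D0 : 0 < d%:R :> R by rewrite ltr0n.
exists (2 * d%:R * psi_bound Q N (2 * d%:R / r)).
  by rewrite !mulr_ge0// psi_bound_ge0.
by move=> s s0; apply: far_probability_le => //; rewrite ?divr_gt0 ?mulr_gt0// divfK ?gt_eqF.
Qed.

(** A barrier of low frequency [1 / (n + 1)] has a rate tending to 0 with [1 / n], while the radius
    where it reaches 1 grows only to [2 d (n + 1)]. *)
Lemma tail_small (eta : R) : 0 < eta -> exists2 r, 0 < r & forall s, 0 <= s ->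
  (P [set w | (r <= enorm (X s w))%R] <= (eta * s)%:E)%E.
Proof.
move=> eta0; have D0 : 0 < d%:R :> R by rewrite ltr0n.
have e0 : 0 < eta / (2 * d%:R) by rewrite divr_gt0// mulr_gt0.
have /cvgrPdist_lt/(_ _ e0)[n _ /(_ n (leqnn n))] := psi_bound_cvg0 TX.
rewrite /= sub0r normrN ger0_norm ?psi_bound_ge0// => Hn.
exists (2 * d%:R * n.+1%:R); first by rewrite !mulr_gt0.
move=> s s0; have := @far_probability_le n.+1%:R^-1 (2 * d%:R * n.+1%:R) s.
rewrite invr_gt0 ltr0n [_^-1 * _]mulrC mulfK ?pnatr_eq0// => /(_ isT (lexx _) s0)/le_trans; apply.
rewrite lee_fin ler_wpM2r// mulrC ltW// -ltr_pdivlMr ?mulr_gt0//.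
Qed.

Section dyadic.
Variable h : R.
Hypothesis h0 : 0 < h.

Let step (n : nat) : R := h / (2 ^ n)%:R.

Let stepE n : (2 ^ n)%:R * step n = h.
Proof. by rewrite mulrC divfK// pnatr_eq0 expn_eq0. Qed.

Let step_gt0 n : 0 < step n. Proof. by rewrite divr_gt0// ltr0n expn_gt0. Qed.

(** By right-continuity the path stays in the open set for a while after [s], and [s < h] leaves
    room for a dyadic time there, strictly after [s] and at most [h]. *)
Lemma dyadic_hit w s (O : set 'rV[R]_d) : open O -> 0 <= s -> s < h -> O (X s w) ->
  exists n k, (k <= 2 ^ n)%N /\ O (X (k%:R * step n) w).
Proof.
move=> oO s0 sh Os.
have : \forall u \near s^'+, O (X u w).
  have Hc := @levy_right_continuous _ _ _ _ _ _ LX w s s0.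
  by apply: (Hc O); exact: open_nbhs_nbhs.
case=> e /= e0 He.
pose c := Num.min e (h - s); have c0 : 0 < c by rewrite lt_min e0 subr_gt0.
pose n := (Num.trunc (h / c)).+1.
have nc : step n < c.
  rewrite /step ltr_pdivrMr ?ltr0n ?expn_gt0// -ltr_pdivrMl// mulrC.
  apply: (lt_le_trans (truncnS_gt _)); rewrite ler_nat ltnW//; exact: ltn_expl.
pose k := (Num.trunc (s / step n)).+1.
have k1 : s < k%:R * step n by rewrite -ltr_pdivrMr//; exact: truncnS_gt.
have k2 : k%:R * step n <= s + step n.
  rewrite -[k]addn1 natrD mulrDl mul1r lerD2r -ler_pdivlMr//.
  by rewrite truncn_le divr_ge0// ltW.
exists n, k; split.
  have : k%:R * step n <= h.
    by apply: (le_trans k2); move: nc; rewrite /c lt_min => /andP[_]; lra.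
  by rewrite -(stepE n) ler_pM2r// ler_nat.
apply: He => //=; rewrite distrC ger0_norm ?subr_ge0 1?ltW//.
by move: nc; rewrite /c lt_min => /andP[+ _]; move: k2; lra.
Qed.

Let dyadic_le n m k : (n <= m)%N -> (k <= 2 ^ n)%N ->
  exists2 l, (l <= 2 ^ m)%N & k%:R * step n = l%:R * step m.
Proof.
move=> nm k2; exists (k * 2 ^ (m - n))%N.
  by rewrite -{2}(subnKC nm) expnD leq_mul2r k2 orbT.
rewrite natrM /step -{2}(subnKC nm) expnD natrM.
have p1 i : (2 ^ i)%:R != 0 :> R by rewrite pnatr_eq0 expn_eq0.
by have := p1 n; have := p1 (m - n)%N; move=> q1 q2; field; rewrite q1.
Qed.

(** The dyadic grids are nested, so the events increase with [n] and a uniform bound passes to their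
    union. The condition may involve the end point [X h], as required for two moves. *)
Let union_dyadic (O : 'rV[R]_d -> 'rV[R]_d -> Prop) (c : \bar R) :
  (forall n, measurable [set w | exists k, (k <= 2 ^ n)%N /\
      O (X h w) (X (k%:R * step n) w)]) ->
  (forall n, (P [set w | exists k, (k <= 2 ^ n)%N /\
      O (X h w) (X (k%:R * step n) w)] <= c)%E) ->
  measurable [set w | exists n k, (k <= 2 ^ n)%N /\ O (X h w) (X (k%:R * step n) w)] /\
  (P [set w | exists n k, (k <= 2 ^ n)%N /\ O (X h w) (X (k%:R * step n) w)] <= c)%E.
Proof.
move=> mF Pc; pose F n := [set w | exists k, (k <= 2 ^ n)%N /\ O (X h w) (X (k%:R * step n) w)].
have -> : [set w | exists n k, (k <= 2 ^ n)%N /\ O (X h w) (X (k%:R * step n) w)] = \bigcup_n F n.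
  by apply/seteqP; split => w /=; [move=> [n H]; exists n|move=> [n _ H]; exists n].
have mU : measurable (\bigcup_n F n) by exact: bigcupT_measurable.
split => //.
have ndF : {homo F : n m / (n <= m)%N >-> (n <= m)%O}.
  move=> n m nm; apply/subsetPset => w [k [k2 Ok]].
  by have [l l2 kl] := dyadic_le nm k2; exists l; rewrite -kl.
have cF := nondecreasing_cvg_mu (mu := P) mF mU ndF.
rewrite -(cvg_lim _ cF)//; apply: lime_le; first by apply/cvg_ex; eexists; exact: cF.
by near=> n; exact: Pc.
Unshelve. all: by end_near. Qed.

Variables (r C : R).
Hypothesis r0 : 0 < r.
Hypothesis C0 : 0 <= C.
Hypothesis small : forall s, 0 <= s ->
  (P [set w | (r / 2 <= enorm (X s w))%R] <= (C * s)%:E)%E.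
Hypothesis Ch : C * h <= 2^-1.

Let open_above (f : 'rV[R]_d -> R) c : continuous f -> open [set v | c < f v].
Proof.
by move=> cf; apply: (open_comp _ (@open_gt R c)) => v _; exact: cf.
Qed.

(** The property over all real times is asserted off a measurable set [G], the union of the grid
    events; the uncountable event itself never has to be measured. *)
Lemma path_exit : exists G, [/\ measurable G, (P G <= (2 * C * h)%:E)%E &
  forall w, ~ G w -> forall s, 0 <= s -> s < h -> enorm (X s w) <= r].
Proof.
have [||mG PG] := @union_dyadic (fun _ v => r <= enorm v) (2 * C * h)%:E.
- move=> n; rewrite (_ : [set w | _] = \bigcup_(k in [set k | (k <= 2 ^ n)%N])
      [set w | r <= enorm (X (k%:R * step n) w)]).
    by apply: bigcup_measurable => k _; apply: mfar; rewrite mulr_ge0// ltW.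
  apply/seteqP; split => w /=; first by move=> [k [? ?]]; exists k.
  by move=> [k ? ?]; exists k.
- move=> n; have Ch' : C * ((2 ^ n)%:R * step n) <= 2^-1 by rewrite stepE.
  have := grid_exit_le LX (ltW (step_gt0 n)) C0 r0 small Ch'; rewrite stepE.
  apply: le_trans; rewrite -bigsetU_seqDU -bigcup_mkord.
  by rewrite (_ : [set w | _] = \bigcup_(k in `I_(2 ^ n).+1) grid_exit X (step n) r k)//;
    apply/seteqP; split => w /=; [move=> [k [? ?]]; exists k|move=> [k ? ?]; exists k].
eexists; split; [exact: mG|exact: PG|].
move=> w nG s s0 sh; rewrite leNgt; apply/negP => rs; apply: nG.
have [n [k [k2 Ok]]] := dyadic_hit (@open_above _ r (@continuous_enorm R d)) s0 sh rs.
by exists n, k; split => //; exact: ltW.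
Qed.

(** Same passage to the limit, for the open condition of being [r] away from the start and [2 r]
    away from the end point. *)
Lemma path_two_moves : exists G, [/\ measurable G, (P G <= ((2 * C * h) ^+ 2)%:E)%E &
  forall w, ~ G w -> forall s, 0 <= s -> s < h ->
    enorm (X s w) <= r \/ enorm (X h w - X s w) <= 2 * r].
Proof.
have [||mG PG] := @union_dyadic (fun u v => r <= enorm v /\ 2 * r <= enorm (u - v))
    ((2 * C * h) ^+ 2)%:E.
- move=> n; rewrite (_ : [set w | _] = \bigcup_(k in [set k | (k <= 2 ^ n)%N])
      ([set w | r <= enorm (X (k%:R * step n) w)] `&`
       [set w | 2 * r <= enorm (X h w - X (k%:R * step n) w)])).
    apply: bigcup_measurable => k _; have k0 : 0 <= k%:R * step n by rewrite mulr_ge0// ltW.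
    apply: measurableI; first exact: mfar.
    apply: (past_measurable LX (t := Num.max h (k%:R * step n))).
    by apply: measurable_past_dist => //; rewrite ?le_max ?lexx ?orbT// ltW.
  apply/seteqP; split => w /=; first by move=> [k [? ?]]; exists k.
  by move=> [k ? ?]; exists k.
- move=> n; have Ch' : C * ((2 ^ n)%:R * step n) <= 2^-1 by rewrite stepE.
  by have := two_moves_le LX (ltW (step_gt0 n)) C0 r0 small Ch'; rewrite stepE.
eexists; split; [exact: mG|exact: PG|].
move=> w nG s s0 sh; have [|rs] := leP (enorm (X s w)) r; [by left|right].
rewrite leNgt; apply/negP => rs2; apply: nG.
pose O := [set v : 'rV[R]_d | r < enorm v] `&` [set v | 2 * r < enorm (X h w - v)].
have oO : open O.
  apply: openI; first exact: (@open_above _ r (@continuous_enorm R d)).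
  have := @open_above _ (2 * r) (@continuous_enormB R d (X h w)).
  exact.
have [n [k [k2 [/ltW O1 /ltW O2]]]] := dyadic_hit oO s0 sh (conj rs rs2).
by exists n, k.
Qed.

End dyadic.
End exit.

(** * The Feynman-Kac operator over a short time *)

Section one_step.
Context {R : realType} {d : nat} {dO : measure_display}.
Context {Omega : measurableType dO}.
Variables (P : probability Omega R) (X : R -> Omega -> 'rV[R]_d).
Hypothesis d0 : (0 < d)%N.
Hypothesis LX : levy_process P X.
Hypothesis SX : symmetric_process P X.
Variables (b : 'rV[R]_d) (Q : 'M[R]_d) (N : {measure set 'rV[R]_d -> \bar R}).
Hypothesis TX : levy_triplet P X b Q N.
Local Notation leb := (@lebesgue_measure R).

Let mX t : 0 <= t -> measurable_fun setT (X t).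
Proof. exact: (levy_measurable LX). Qed.

Lemma kato_small (W : 'rV[R]_d -> R) : kato P X W -> (forall z, 0 <= W z) ->
  forall e, 0 < e -> exists2 h0, 0 < h0 & forall h, 0 < h -> h < h0 ->
    forall z, (\int[P]_w occupation X W 0 h z w <= e%:E)%E.
Proof.
move=> [mW KW] W0 e e0.
have e0' : (0%:E < e%:E)%E by rewrite lte_fin.
have : \forall t \near (0 : R)^'+,
   (ereal_sup [set (\int[P]_w \int[leb]_(s in `[0%R, t])
                   `|W (x + X s w)%R|%:E)%E | x in setT] < e%:E)%E.
  have O := open_nbhs_nbhs (conj (@open_ereal_lt_ereal _ e%:E) e0').
  exact: (KW _ O).
case=> h0 /= h00 Hh; exists h0 => // h hp hh z.
have /Hh/(_ hp)/ltW : ball_ [eta Num.Def.normr] 0 h0 h by rewrite /= sub0r normrN gtr0_norm.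
apply: le_trans; apply: ereal_sup_ge; eexists; first by exists z.
apply: ge0_le_integral_any => w _; first exact: occupation_ge0.
rewrite /occupation integral_itv_bndo_bndc; last first.
  apply: (measurable_in_path LX mW z w (ltW hp)) => //.
  by move=> s /=; rewrite in_itv /= => /andP[-> /ltW].
by apply: ge0_le_integral_any => s _; rewrite lee_fin// ler_norm.
Qed.

Section weight.
Variable V : 'rV[R]_d -> R.
Hypothesis mV : measurable_fun setT V.

Local Notation VP := (V^\+)%R.
Local Notation VN := (V^\-)%R.

Let mVp : measurable_fun setT VP. Proof. exact: measurable_funrpos. Qed.
Let mVn : measurable_fun setT VN. Proof. exact: measurable_funrneg. Qed.
Let Vp0 z : 0 <= VP z. Proof. exact: funrpos_ge0. Qed.
Let Vn0 z : 0 <= VN z. Proof. exact: funrneg_ge0. Qed.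

Definition fk_weight h y (w : Omega) : \bar R :=
  expeR (- \int[leb]_(s in `[0%R, h]) (V (y + X s w)%R)%:E).

Lemma occupation_closed (W : 'rV[R]_d -> R) h y w : 0 <= h -> measurable_fun setT W ->
  (\int[leb]_(s in `[0%R, h]) (W (y + X s w)%R)%:E = occupation X W 0 h y w)%E.
Proof.
move=> h0 mW; rewrite /occupation integral_itv_bndo_bndc//.
apply: (measurable_in_path LX mW y w h0) => //.
by move=> s /=; rewrite in_itv /= => /andP[-> /ltW].
Qed.

Lemma fk_weightE h y w : 0 <= h ->
  fk_weight h y w = expeR (- (occupation X VP 0 h y w - occupation X VN 0 h y w)).
Proof.
move=> h0; rewrite /fk_weight integralE -!occupation_closed//; congr (expeR (- (_ - _))).
  by apply: eq_integral => s _; rewrite funeposE -EFin_max /funrpos.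
by apply: eq_integral => s _; rewrite funenegE -EFinN -EFin_max /funrneg.
Qed.

Lemma measurable_fk_weight h y : 0 <= h -> measurable_fun setT (fk_weight h y).
Proof.
move=> h0; rewrite (_ : fk_weight h y = fun w =>
  expeR (- (occupation X VP 0 h y w - occupation X VN 0 h y w))); last first.
  by apply/funext => w; rewrite fk_weightE.
have m1 := measurable_occupation LX mVp Vp0 y (lexx 0) h0.
have m2 := measurable_occupation LX mVn Vn0 y (lexx 0) h0.
apply: (measurableT_comp (@measurable_expeR R setT)).
by apply: measurableT_comp => //; exact: emeasurable_funB.
Qed.

Lemma fk_weight_ge0 h y w : (0 <= fk_weight h y w)%E.
Proof. exact: expeR_ge0. Qed.

Lemma fk_weight_le h y w : 0 <= h ->
  (fk_weight h y w <= expeR (occupation X VN 0 h y w))%E.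
Proof.
move=> h0; rewrite fk_weightE// lee_expeR.
have := occupation_ge0 X Vp0 0 h y w; have := occupation_ge0 X Vn0 0 h y w.
move: (occupation X VN _ _ _ _) (occupation X VP _ _ _ _) => [u| |] [v| |] //=; rewrite ?leey ?leNye//.
by rewrite !lee_fin; lra.
Qed.

Lemma fk_weight_ge h y w : 0 <= h ->
  (expeR (- occupation X VP 0 h y w) <= fk_weight h y w)%E.
Proof.
move=> h0; rewrite fk_weightE// lee_expeR.
have := occupation_ge0 X Vp0 0 h y w; have := occupation_ge0 X Vn0 0 h y w.
move: (occupation X VN _ _ _ _) (occupation X VP _ _ _ _) => [u| |] [v| |] //=; rewrite ?leey ?leNye//.
by rewrite !lee_fin; lra.
Qed.

Lemma fk_weight_confined h y w L : 0 <= h -> 0 <= L ->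
  (forall s, 0 <= s -> s < h -> L <= V (y + X s w)) ->
  (fk_weight h y w <= (expR (- (L * h)))%:E)%E.
Proof.
move=> h0 L0 HL; rewrite fk_weightE//.
have -> : occupation X VN 0 h y w = 0%E.
  rewrite /occupation (eq_integral (cst 0%E)) ?integral0// => s /set_mem /=.
  rewrite in_itv /= => /andP[s0 sh]; rewrite /funrneg max_r//.
  by rewrite oppr_le0 (le_trans L0)// HL.
rewrite sube0 -[leRHS]/(expeR (- (L * h))%:E) lee_expeR EFinN leeN2.
apply: (@le_trans _ _ (\int[leb]_(s in `[0%R, h[) (cst L%:E s))%E).
  rewrite integral_cst//= lebesgue_measure_itv /= lte_fin; case: ifPn => h1.
    by rewrite oppr0 adde0 -EFinM.
  by rewrite mule0 lee_fin; move: h1; rewrite -leNgt => h1; rewrite mulr_ge0_le0.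
apply: ge0_le_integral_any => s /=; rewrite in_itv /= => /andP[s0 sh].
  by rewrite lee_fin.
by rewrite lee_fin (le_trans (HL s s0 sh))// /funrpos le_max lexx.
Qed.

Lemma feynman_kac_weight h y f :
  feynman_kac P X V h f y = (\int[P]_w (fk_weight h y w * (f (y + X h w)%R)%:E))%E.
Proof. by []. Qed.

Hypothesis KV : kato P X V^\-.

(** Off the exit set [G] the path stays in the unit ball and its weight is at most [exp (- L h)]. On
    [G] the weight is at most [exp J], and replacing it by [exp (- L h)] costs
    [M (exp J - 1) + M L h]. The first cost has expectation [O(h e)] by the local Khasminskii bound,
    the second has expectation [O(h^2)] because [P G = O(h)]. *)
Lemma one_step_upper (L M eta : R) : 0 <= L -> 0 <= M -> 0 < eta ->
  exists2 h0, 0 < h0 & forall h, 0 < h -> h < h0 ->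
  forall (x y : 'rV[R]_d) (phi : 'rV[R]_d -> R), measurable_fun setT phi ->
    (forall z, `|phi z| <= M) -> (forall z, eball x 1 z -> L <= V z) ->
    eball x (1 / 2) y ->
  (`|feynman_kac P X V h phi y| <=
    (expR (- (L * h)))%:E * \int[P]_w `|phi (y + X h w)%R|%:E + (eta * h)%:E)%E.
Proof.
move=> L0 M0 eta0.
have [C C0 small] : exists2 C, 0 <= C & forall s, 0 <= s ->
    (P [set w | (4^-1 / 4 <= enorm (X s w))%R] <= (C * s)%:E)%E.
  by apply: (exit_small d0 LX SX TX); rewrite divr_gt0.
pose c := 8 * C * M + 1; have c0 : 0 < c by rewrite ltr_wpDl// !mulr_ge0.
(* The Kato smallness: 1/4 for Khasminskii's lemma, the other entry so that [8 C M e <= eta / 2].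
   The summand 1 in [c] guards against [C M = 0]. Half of [eta] pays for [J], the other half for the
   exit. *)
have e0 : 0 < Num.min 4^-1 (eta / 2 / c) by rewrite lt_min invr_gt0 ltr0n /= !divr_gt0.
have [h1 h10 Hh1] := kato_small KV Vn0 e0.
pose c2 := 2 * C * M * L + 1; have c20 : 0 < c2 by rewrite ltr_wpDl// !mulr_ge0.
exists (Num.min h1 (Num.min (2^-1 / (C + 1)) (eta / 2 / c2))).
  by rewrite !lt_min h10 !divr_gt0// ltr_wpDl.
move=> h hp; rewrite !lt_min => /andP[hh1 /andP[hh2 hh3]] x y phi mphi phiM VL xy.
have hp' := ltW hp.
have Ch : C * h <= 2^-1.
  move: hh2; rewrite ltr_pdivlMr ?ltr_wpDl// => /ltW; apply: le_trans.
  by rewrite mulrC ler_wpM2l// lerDl.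
have {Hh1}We := Hh1 h hp hh1.
set e := Num.min _ _ in We e0.
have e4 : e <= 4^-1 by rewrite ge_min lexx.
have ce : 8 * C * M * e <= eta / 2.
  have : e * c <= eta / 2 by rewrite -ler_pdivlMr// ge_min lexx orbT.
  rewrite /c; have := ltW e0; move: (e) => e'; nra.
have ch : 2 * C * M * L * h <= eta / 2.
  by move/ltW: hh3; rewrite ler_pdivlMr// /c2; move: hp'; nra.
have small' s : 0 <= s -> (P [set w | (4^-1 / 2 <= enorm (X s w))%R] <= (C * s)%:E)%E.
  move=> s0; apply: le_trans (small s s0); apply: le_measure; rewrite ?inE.
  - by apply: (past_measurable LX (t := s)); exact: measurable_past_norm.
  - by apply: (past_measurable LX (t := s)); exact: measurable_past_norm.
  - by move=> w /=; lra.
have r40 : 0 < 4^-1 :> R by rewrite invr_gt0.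
have [G [mG PG Gc]] := path_exit LX hp r40 C0 small' Ch.
have Vz z : enorm (z - y) < 4^-1 -> eball x 1 z.
  move=> zy; rewrite /eball /=; have := enormD (z - y) (y - x); rewrite addrA subrK.
  by move: xy; rewrite /eball /=; lra.
have Wr z : enorm (z - y) < 4^-1 -> VN z = 0.
  by move=> /Vz/VL Lz; rewrite /funrneg max_r// oppr_le0 (le_trans L0).
pose J := occupation X VN 0 h y.
have EJ : (\int[P]_w expeR (J w) <= (1 + 8 * C * h * e)%:E)%E.
  exact: (khasminskii_local LX mVn Vn0 hp We e4 r40 C0 Ch Wr small).
have J0 w : (0 <= J w)%E by exact: occupation_ge0.
have mJ : measurable_fun setT (fun w => expeR (J w)).
  apply: (measurableT_comp (@measurable_expeR R setT)).
  exact: (measurable_occupation LX mVn Vn0 y (lexx 0) hp').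
have mphiX : measurable_fun setT (fun w => `|phi (y + X h w)|).
  do 2 apply: measurableT_comp => //; apply: measurable_rVD => //; exact: mX.
pose Z w := (fk_weight h y w * `|phi (y + X h w)|%:E)%E.
have mZ : measurable_fun setT Z.
  by apply: emeasurable_funM; [exact: measurable_fk_weight|exact/measurable_EFinP].
have Z0 w : (0 <= Z w)%E by rewrite mule_ge0// ?fk_weight_ge0 ?lee_fin.
have FKZ : (`|feynman_kac P X V h phi y| <= \int[P]_w Z w)%E.
  rewrite feynman_kac_weight; apply: (le_trans (abse_integral_le_any _ _ _)).
  apply: ge0_le_integral_any => w _; first exact: abse_ge0.
  by rewrite abseM gee0_abs ?fk_weight_ge0.
apply: (le_trans FKZ).
set A := (\int[P]_w `|phi (y + X h w)%R|%:E)%E.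
have A0 : (0 <= A)%E by apply: integral_ge0 => w _; rewrite lee_fin.
(* [M] is added on both sides: the term [M (exp J - 1)] becomes [M exp J], with no subtraction in
   the extended reals. *)
suff H : (\int[P]_w Z w + M%:E <= (expR (- (L * h)))%:E * A +
    M%:E * (1 + 8 * C * h * e)%:E + (M * (L * h))%:E * (2 * C * h)%:E)%E.
  rewrite -(leeD2rE (x := M%:E))//; apply: (le_trans H).
  have := le_refl ((expR (- (L * h)))%:E * A)%E; rewrite -!addeA => HA.
  apply: leeD; first exact: HA.
  rewrite -!EFinM -!EFinD lee_fin.
  have k1 : 8 * C * M * e * h <= eta / 2 * h by rewrite ler_wpM2r.
  have k2 : 2 * C * M * L * h * h <= eta / 2 * h by rewrite ler_wpM2r.
  move: k1 k2; move: (e) => e'; lra.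
have -> : (\int[P]_w Z w + M%:E = \int[P]_w (Z w + cst M%:E w))%E.
  rewrite ge0_integralD//.
  by rewrite integral_cst//= probability_setT mule1.
have mI : measurable_fun setT (fun w => (M * (L * h))%:E * (\1_G w)%:E)%E.
  by apply: emeasurable_funM => //; apply/measurable_EFinP; exact: measurable_indic.
have mA' : measurable_fun setT (fun w => (expR (- (L * h)))%:E * `|phi (y + X h w)|%:E)%E.
  by apply: emeasurable_funM => //; exact/measurable_EFinP.
have mMJ : measurable_fun setT (fun w => M%:E * expeR (J w))%E.
  exact: emeasurable_funM.
have LhM : 0 <= M * (L * h) by rewrite !mulr_ge0.
apply: (@le_trans _ _ (\int[P]_w ((expR (- (L * h)))%:E * `|phi (y + X h w)|%:E +
    M%:E * expeR (J w) + (M * (L * h))%:E * (\1_G w)%:E))%E); last first.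
  rewrite ge0_integralD//; last 3 first.
  - move=> w _; apply: adde_ge0; apply: mule_ge0; rewrite ?lee_fin ?expR_ge0//.
    exact: expeR_ge0.
  - exact: emeasurable_funD.
  - by move=> w _; rewrite mule_ge0// lee_fin.
  rewrite ge0_integralD//; last first.
    by move=> w _; rewrite mule_ge0 ?expeR_ge0 ?lee_fin ?expR_ge0.
  apply: leeD; first apply: leeD.
  - rewrite ge0_integral_scale ?expR_ge0//; first exact/measurable_EFinP.
  - rewrite ge0_integral_scale//; last by move=> w; exact: expeR_ge0.
    by rewrite lee_wpmul2l// lee_fin.
  - rewrite ge0_integral_scale//; last first.
      by apply/measurable_EFinP; exact: measurable_indic.
    by rewrite integral_indic// setIT lee_wpmul2l// lee_fin.
apply: ge0_le_integral_any => w _; first by rewrite adde_ge0// lee_fin.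
rewrite /Z /=.
have pM := phiM (y + X h w); have p0 := normr_ge0 (phi (y + X h w)).
move: (`|phi (y + X h w)|) pM p0 => p pM p0.
have J1 : (1 <= expeR (J w))%E.
  by apply: le_trans (expeR_ge1Dx _); rewrite leeDl.
have [Gw|Gw] := pselect (G w); last first.
  rewrite (indic_out R Gw) mule0 adde0; apply: leeD.
    rewrite lee_wpmul2r ?lee_fin//; apply: fk_weight_confined => // s s0 sh.
    apply: VL; rewrite /eball /=.
    have E : y + X s w - x = X s w + (y - x) by rewrite addrA (addrC (X s w)).
    rewrite E; have := enormD (X s w) (y - x).
    by have := Gc w Gw s s0 sh; move: xy; rewrite /eball /=; lra.
  by rewrite -[leLHS]mule1 lee_wpmul2l// lee_fin.
rewrite (indic_in R Gw) mule1.
have [p00|p00] := eqVneq p 0.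
  rewrite p00 !mule0 !add0e; apply: (@le_trans _ _ (M%:E * expeR (J w))%E).
    by rewrite -[leLHS]mule1 lee_wpmul2l// lee_fin.
  by rewrite leeDl// lee_fin.
have M1 : 0 < M by rewrite (lt_le_trans _ pM)// lt0r p00.
have := fk_weight_le y w hp'; rewrite -/J.
move: J1 (fk_weight_ge0 h y w).
have h2 := expR_ge1Dx (- (L * h)); have h3 := expR_ge0 (- (L * h)).
move: (expR _) h2 h3 => q h2 h3.
move: (fk_weight h y w) (expeR (J w)) => [u| |] [v| |] //; rewrite ?lee_fin => v1 u0 uv.
- have k1 : 0 <= (v - u) * p by rewrite mulr_ge0// subr_ge0.
  have [k2|k2] := leP q v.
    have k3 : 0 <= (v - q) * (M - p) by rewrite mulr_ge0// subr_ge0.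
    have k4 : 0 <= M * (q - 1 + L * h) by rewrite mulr_ge0//; lra.
    lra.
  have k3 : 0 <= (q - v) * p by rewrite mulr_ge0// subr_ge0 ltW.
  have k4 : 0 <= M * (v - 1) by rewrite mulr_ge0//; lra.
  lra.
- by rewrite gt0_muley ?lte_fin// -EFinM addey// addye// leey.
- by rewrite gt0_muley ?lte_fin// -EFinM addey// addye// leey.
Qed.

(** The part of [V^+] met by a path that has jumped from near [x] towards [B(0, 1)]; inside
    [B(x, 1)] the bound [V <= S] is used instead. *)
Let W z := VP z * \1_(eball 0 2) z.
Hypothesis KW : kato P X W.

Let W0 z : 0 <= W z. Proof. by rewrite mulr_ge0// funrpos_ge0. Qed.

Let mW : measurable_fun setT W. Proof. by case: KW. Qed.

Let occupation_upto h x y w S : 0 <= h -> 0 <= S ->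
  (forall z, eball x 1 z -> V z <= S) ->
  (forall s, 0 <= s -> s < h -> eball x 1 (y + X s w) \/ eball 0 2 (y + X s w)) ->
  (occupation X VP 0 h y w <= (S * h)%:E + occupation X W 0 h y w)%E.
Proof.
move=> h0 S0 VS HS.
apply: (@le_trans _ _ (\int[leb]_(s in `[0%R, h[) (cst S%:E s + (W (y + X s w))%:E))%E).
  apply: ge0_le_integral_any => s /=; rewrite in_itv /= => /andP[s0 sh]; rewrite lee_fin//.
  rewrite /W; have [/VS H|H] := HS s s0 sh.
    by rewrite (@le_trans _ _ S)// ?lerDl ?mulr_ge0 ?funrpos_ge0// /funrpos ge_max H.
  by rewrite (indic_in R H) mulr1 lerDr.
rewrite ge0_integralD//; last 2 first.
- by move=> s _; rewrite lee_fin.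
- apply: (measurable_in_path LX mW y w h0) => //.
  by move=> s /=; rewrite in_itv /= => /andP[-> /ltW].
rewrite leeD2r// integral_cst//= lebesgue_measure_itv /= lte_fin; case: ifPn => h1.
  by rewrite oppr0 adde0 -EFinM.
by rewrite mule0 lee_fin mulr_ge0.
Qed.

(** Off the two-moves set [T], each position is within 1/4 of the start or within 1/2 of the end
    point; if the end point lies in [B(x, 1/2)] or [B(0, 1)], the path stays in [B(x, 1)] or
    [B(0, 2)]. Its weight is then at least [exp (- S h) (1 - J)], where [J] comes from [W], a
    potential that vanishes near the start. The loss is [O(h e)] from [J] and [O(h^2)] from [T]. *)
Lemma one_step_lower (M eta : R) : 0 <= M -> 0 < eta ->
  exists2 h0, 0 < h0 & forall h, 0 < h -> h < h0 ->
  forall (x y : 'rV[R]_d) (phi : 'rV[R]_d -> R) (S : R), measurable_fun setT phi ->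
    (forall z, 0 <= phi z <= M) -> 4 <= enorm x -> 0 <= S ->
    (forall z, eball x 1 z -> V z <= S) -> eball x (1 / 2) y ->
  ((expR (- (S * h)))%:E *
     \int[P]_w (phi (y + X h w) * \1_(eball x (1 / 2) `|` eball 0 1) (y + X h w)%R)%:E <=
   feynman_kac P X V h phi y + (eta * h)%:E)%E.
Proof.
move=> M0 eta0.
have [C C0 small] : exists2 C, 0 <= C & forall s, 0 <= s ->
    (P [set w | (4^-1 / 2 <= enorm (X s w))%R] <= (C * s)%:E)%E.
  by apply: (exit_small d0 LX SX TX); rewrite divr_gt0.
pose c := 8 * C * M + 1; have c0 : 0 < c by rewrite ltr_wpDl// !mulr_ge0.
have e0 : 0 < Num.min 4^-1 (eta / 2 / c) by rewrite lt_min invr_gt0 ltr0n /= !divr_gt0.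
have [h1 h10 Hh1] := kato_small KW W0 e0.
pose c2 := 4 * C * C * M + 1; have c20 : 0 < c2 by rewrite ltr_wpDl// !mulr_ge0.
exists (Num.min h1 (Num.min (2^-1 / (C + 1)) (eta / 2 / c2))).
  by rewrite !lt_min h10 !divr_gt0// ltr_wpDl.
move=> h hp; rewrite !lt_min => /andP[hh1 /andP[hh2 hh3]] x y phi S mphi phiM x4 S0 VS xy.
have hp' := ltW hp.
have Ch : C * h <= 2^-1.
  move: hh2; rewrite ltr_pdivlMr ?ltr_wpDl// => /ltW; apply: le_trans.
  by rewrite mulrC ler_wpM2l// lerDl.
have {Hh1}We := Hh1 h hp hh1.
set e := Num.min _ _ in We e0.
have e4 : e <= 4^-1 by rewrite ge_min lexx.
have ce : 8 * C * M * e <= eta / 2.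
  have : e * c <= eta / 2 by rewrite -ler_pdivlMr// ge_min lexx orbT.
  rewrite /c; have := ltW e0; move: (e) => e'; nra.
have ch : 4 * C * C * M * h <= eta / 2.
  by move/ltW: hh3; rewrite ler_pdivlMr// /c2; move: hp'; nra.
have r40 : 0 < 4^-1 :> R by rewrite invr_gt0.
have [T [mT PT Tc]] := path_two_moves LX hp r40 C0 small Ch.
have xy' : enorm (y - x) < 2^-1 by move: xy; rewrite /eball /= div1r.
have Wr z : enorm (z - y) < 1 -> W z = 0.
  move=> zy; rewrite /W indic_out ?mulr0// /eball /= subr0 => z2.
  have := enormD (x - y) y; rewrite subrK (enorm_distC x y).
  by have := enormD (y - z) z; rewrite subrK (enorm_distC y z); lra.
have small1 s : 0 <= s -> (P [set w | (1 / 4 <= enorm (X s w))%R] <= (C * s)%:E)%E.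
  move=> s0; apply: le_trans (small s s0); apply: le_measure; rewrite ?inE.
  - by apply: (past_measurable LX (t := s)); exact: measurable_past_norm.
  - by apply: (past_measurable LX (t := s)); exact: measurable_past_norm.
  - by move=> w /=; lra.
pose J := occupation X W 0 h y.
have EJ : (\int[P]_w J w <= (8 * C * h * e)%:E)%E.
  exact: (local_occupation LX mW W0 hp We e4 ltr01 C0 Ch Wr small1).
have J0 w : (0 <= J w)%E by exact: occupation_ge0.
have mJ : measurable_fun setT J.
  exact: (measurable_occupation LX mW W0 y (lexx 0) hp').
have phi0 z : 0 <= phi z by have /andP[] := phiM z.
have phiM' z : phi z <= M by have /andP[] := phiM z.
pose D := eball x (1 / 2) `|` eball (0 : 'rV[R]_d) 1.
have mD : measurable D by apply: measurableU; exact: measurable_eball.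
have myX : measurable_fun setT (fun w => y + X h w).
  by apply: measurable_rVD => //; exact: mX.
have mphiX : measurable_fun setT (fun w => phi (y + X h w)).
  exact: (measurableT_comp mphi myX).
have mphiD : measurable_fun setT (fun w => phi (y + X h w) * \1_D (y + X h w)).
  apply: measurable_funM => //.
  have m1 : measurable_fun setT (fun v : 'rV[R]_d => \1_D v : R) by exact: measurable_indic.
  exact: (measurableT_comp m1 myX).
pose Z w := (fk_weight h y w * (phi (y + X h w))%:E)%E.
have mZ : measurable_fun setT Z.
  by apply: emeasurable_funM; [exact: measurable_fk_weight|exact/measurable_EFinP].
have Z0 w : (0 <= Z w)%E by rewrite mule_ge0// ?fk_weight_ge0 ?lee_fin.
have mMJ : measurable_fun setT (fun w => M%:E * J w)%E by exact: emeasurable_funM.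
have mT' : measurable_fun setT (fun w => (\1_T w : R)%:E).
  by apply/measurable_EFinP; exact: measurable_indic.
have mMT : measurable_fun setT (fun w => M%:E * (\1_T w)%:E)%E by exact: emeasurable_funM.
rewrite -ge0_integral_scale ?expR_ge0//; last 2 first.
- exact/measurable_EFinP.
- by move=> w; rewrite lee_fin mulr_ge0.
apply: (@le_trans _ _ (\int[P]_w (Z w + M%:E * J w + M%:E * (\1_T w)%:E))%E); last first.
  rewrite ge0_integralD//; last 3 first.
  - by move=> w _; rewrite adde_ge0// mule_ge0.
  - exact: emeasurable_funD.
  - by move=> w _; rewrite mule_ge0// lee_fin.
  rewrite ge0_integralD//; last by move=> w _; rewrite mule_ge0.
  rewrite -addeA; apply: leeD; first by rewrite feynman_kac_weight.
  rewrite !ge0_integral_scale// ?integral_indic ?setIT//.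
  apply: (@le_trans _ _ (M%:E * (8 * C * h * e)%:E + M%:E * ((2 * C * h) ^+ 2)%:E)%E).
    by apply: leeD; rewrite lee_wpmul2l// lee_fin.
  rewrite -!EFinM -EFinD lee_fin.
  have k1 : 8 * C * M * e * h <= eta / 2 * h by rewrite ler_wpM2r.
  have k2 : 4 * C * C * M * h * h <= eta / 2 * h by rewrite ler_wpM2r.
  move: k1 k2; move: (e) => e'; lra.
apply: ge0_le_integral_any => w _; first by rewrite mule_ge0// lee_fin ?expR_ge0 ?mulr_ge0.
rewrite /Z /=.
have q1 : expR (- (S * h)) <= 1 by rewrite -expR0 ler_expR oppr_le0 mulr_ge0.
have q0 := expR_ge0 (- (S * h)).
have p0 := phi0 (y + X h w); have pM := phiM' (y + X h w).
have MJ0 : (0 <= M%:E * J w)%E by rewrite mule_ge0.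
have MT0 : (0 <= M%:E * (\1_T w)%:E)%E by rewrite mule_ge0// lee_fin.
have [Dy|Dy] := pselect (D (y + X h w)); last first.
  rewrite (indic_out R Dy) mulr0 mule0.
  by apply: adde_ge0 => //; apply: adde_ge0 => //; exact: Z0.
rewrite (indic_in R Dy) mulr1.
have [Tw|Tw] := pselect (T w).
  rewrite (indic_in R Tw) mule1 -[leLHS]add0e; apply: leeD.
    by apply: adde_ge0 => //; exact: Z0.
  by rewrite -EFinM lee_fin (le_trans _ pM)// ler_piMl.
rewrite (indic_out R Tw) mule0 adde0.
have occ : (occupation X VP 0 h y w <= (S * h)%:E + J w)%E.
  apply: (occupation_upto hp' S0 VS) => s s0 sh.
  have [h2|h2] := Tc w Tw s s0 sh.
    have E : y + X s w - x = X s w + (y - x) by rewrite addrA (addrC (X s w)).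
    by left; rewrite /eball /= E; have := enormD (X s w) (y - x); lra.
  rewrite enorm_distC in h2.
  case: Dy => Dy; [left|right]; move: Dy; rewrite /eball /= ?subr0 => Dy.
    have E : y + X s w - x = (X s w - X h w) + (y + X h w - x).
      by apply/rowP => i; rewrite !mxE; ring.
    by rewrite E; have := enormD (X s w - X h w) (y + X h w - x); lra.
  have E : y + X s w = (X s w - X h w) + (y + X h w).
    by apply/rowP => i; rewrite !mxE; ring.
  by rewrite E; have := enormD (X s w - X h w) (y + X h w); lra.
have := fk_weight_ge y w hp'.
have [p00|p00] := eqVneq (phi (y + X h w)) 0.
  by rewrite p00 mule0 => _; apply: adde_ge0; rewrite ?mule0.
have M1 : 0 < M by rewrite (lt_le_trans _ pM)// lt0r p00.
move: occ (J0 w) (occupation_ge0 X Vp0 0 h y w) (fk_weight_ge0 h y w).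
move: (J w) => [j| |] //; last first.
  by move=> *; rewrite gt0_muley ?lte_fin// addey ?leey// gt_eqF// (lt_le_trans (ltNyr 0))// Z0.
move: (occupation X VP 0 h y w) (fk_weight h y w) => [v| |] [u| |] //; last first.
  by move=> _ _ _ _ _; rewrite gt0_mulye ?lte_fin ?lt0r ?p00// addye// leey.
rewrite -EFinD !lee_fin => vj j0 v0 u0 vu; rewrite ?lee_fin.
have e1 : expR (- (S * h)) * (1 - j) <= u.
  apply: le_trans vu; apply: (@le_trans _ _ (expR (- (S * h)) * expR (- j))).
    by rewrite ler_wpM2l// expR_ge1Dx.
  by rewrite -expRD ler_expR; lra.
have k1 : expR (- (S * h)) * (1 - j) * phi (y + X h w) <= u * phi (y + X h w).
  by rewrite ler_wpM2r.
have k2 : 0 <= (1 - expR (- (S * h))) * (j * phi (y + X h w)).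
  by rewrite mulr_ge0 ?subr_ge0// mulr_ge0.
have k3 : 0 <= j * (M - phi (y + X h w)) by rewrite mulr_ge0// subr_ge0.
move: k1 k2 k3; move: (expR _) (phi _) => a1 a2; lra.
Qed.

End weight.
End one_step.

(** * Small-time jump probabilities *)

Lemma eq_cvg_right (R : realType) (f g : R -> R) (a b : R) :
  f h @[h --> (0 : R)^'+] --> a -> (forall h, 0 < h -> f h = g h) -> a = b ->
  g h @[h --> (0 : R)^'+] --> b.
Proof.
move=> fa fg <-; apply: cvg_trans fa; apply: near_eq_cvg; near=> h.
by apply: fg; near: h; exact: nbhs_right_gt.
Unshelve. all: by end_near. Qed.

(** * Trigonometric polynomials as test functions *)

Section trig_polynomial.
Context {R : realType} {d : nat}.
Implicit Types (f g : 'rV[R]_d -> R) (w : 'rV[R]_d).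

(** Real trigonometric polynomials; the phase [a] accounts for sines. An inductive predicate lets
    the small-time limit be proved on single cosines and extended by linearity. *)
Inductive trig : ('rV[R]_d -> R) -> Prop :=
| trig_cos a xi : trig (fun w => cos (a + dotp xi w))
| trig_add f g : trig f -> trig g -> trig (fun w => f w + g w)
| trig_scale c f : trig f -> trig (fun w => c * f w).

Lemma eq_trig f g : f =1 g -> trig f -> trig g.
Proof. by move=> /funext ->. Qed.

Lemma trig_cst c : trig (fun=> c).
Proof.
apply: (eq_trig _ (trig_scale c (trig_cos 0 0))) => w.
by rewrite dotp0l addr0 cos0 mulr1.
Qed.

Lemma trig_opp f : trig f -> trig (fun w => - f w).
Proof. by move=> tf; apply: (eq_trig _ (trig_scale (-1) tf)) => w; rewrite mulN1r. Qed.

Lemma trig_sub f g : trig f -> trig g -> trig (fun w => f w - g w).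
Proof. by move=> tf tg; exact: trig_add tf (trig_opp tg). Qed.

Lemma trig_mul f g : trig f -> trig g -> trig (fun w => f w * g w).
Proof.
move=> + tg; elim => [a xi|f1 f2 _ IH1 _ IH2|c f1 _ IH].
- elim: tg => [b zeta|g1 g2 _ IH1 _ IH2|c g1 _ IH].
  + apply: (eq_trig _ (trig_scale 2^-1 (trig_add (trig_cos (a + b) (xi + zeta))
        (trig_cos (a - b) (xi - zeta))))) => w.
    rewrite !dotpDl dotpNl.
    rewrite (_ : a + b + _ = (a + dotp xi w) + (b + dotp zeta w)); last by ring.
    rewrite (_ : a - b + _ = (a + dotp xi w) - (b + dotp zeta w)); last by ring.
    by rewrite cosD cosB; field.
  + by apply: (eq_trig _ (trig_add IH1 IH2)) => w; ring.
  + by apply: (eq_trig _ (trig_scale c IH)) => w; ring.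
- by apply: (eq_trig _ (trig_add IH1 IH2)) => w; ring.
- by apply: (eq_trig _ (trig_scale c IH)) => w; ring.
Qed.

Lemma trig_exp f n : trig f -> trig (fun w => f w ^+ n).
Proof.
move=> tf; elim: n => [|n IH]; first exact: trig_cst.
by apply: (eq_trig _ (trig_mul tf IH)) => w; rewrite exprS.
Qed.

Lemma trig_sum (I : Type) (r : seq I) (F : I -> 'rV[R]_d -> R) :
  (forall i, trig (F i)) -> trig (fun w => \sum_(i <- r) F i w).
Proof.
move=> tF; elim: r => [|i r IH].
  by apply: (eq_trig _ (trig_cst 0)) => w; rewrite big_nil.
by apply: (eq_trig _ (trig_add (tF i) IH)) => w; rewrite big_cons.
Qed.

Lemma trig_bounded f : trig f -> exists M, forall w, `|f w| <= M.
Proof.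
elim => [a xi|f1 f2 _ [M1 H1] _ [M2 H2]|c f1 _ [M H]].
- by exists 1 => w; rewrite ler_norml cos_geN1 cos_le1.
- by exists (M1 + M2) => w; rewrite (le_trans (ler_normD _ _))// lerD.
- by exists (`|c| * M) => w; rewrite normrM ler_wpM2l.
Qed.

Lemma measurable_trig f : trig f -> measurable_fun setT f.
Proof.
elim => [a xi|f1 f2 _ H1 _ H2|c f1 _ H].
- have m : measurable_fun setT (fun w : 'rV[R]_d => a + dotp xi w).
    by apply: measurable_funD => //; exact: measurable_dotp.
  by apply: measurableT_comp => //; exact: measurable_cos.
- exact: measurable_funD.
- exact: measurable_funM.
Qed.

(* A multiple of the squared distance to [c], up to periodicity. *)
Definition sine_dist (rho : R) (c w : 'rV[R]_d) : R :=
  (2 * d%:R)^-1 * \sum_i (1 - cos (- (c 0 i / rho) + dotp (rho^-1 *: delta_mx 0 i) w)).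

Lemma trig_sine_dist rho c : trig (sine_dist rho c).
Proof.
by apply: trig_scale; apply: trig_sum => i; apply: trig_sub; [exact: trig_cst|exact: trig_cos].
Qed.

Lemma sine_distE rho c w :
  sine_dist rho c w = (2 * d%:R)^-1 * \sum_i (1 - cos ((w 0 i - c 0 i) / rho)).
Proof.
congr (_ * _); apply: eq_bigr => i _; congr (1 - cos _).
by rewrite dotp_scale_delta; ring.
Qed.

Hypothesis d0 : (0 < d)%N.

Let D0 : 0 < d%:R :> R. Proof. by rewrite ltr0n. Qed.

Lemma sine_dist_ge0 rho c w : 0 <= sine_dist rho c w.
Proof.
by rewrite mulr_ge0 ?invr_ge0 ?mulr_ge0// sumr_ge0// => i _; rewrite subr_ge0 cos_le1.
Qed.

Lemma sine_dist_le1 rho c w : sine_dist rho c w <= 1.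
Proof.
rewrite /sine_dist mulrC ler_pdivrMr ?mulr_gt0// mul1r.
apply: (@le_trans _ _ (\sum_(i < d) 2)).
  by apply: ler_sum => i _; rewrite lerBlDr -lerBlDl (_ : 1 - 2 = -1) ?cos_geN1//; ring.
by rewrite sumr_const card_ord -[leLHS]mulr_natr.
Qed.

Lemma sine_dist_le rho (c w : 'rV[R]_d) delta : 0 < rho -> (forall i, `|w 0 i - c 0 i| <= delta) ->
  sine_dist rho c w <= 4^-1 * (delta / rho) ^+ 2.
Proof.
move=> rho0 H; rewrite /sine_dist -/(sine_dist rho c w) sine_distE mulrC.
rewrite ler_pdivrMr ?mulr_gt0//.
apply: (@le_trans _ _ (\sum_(i < d) (2^-1 * (delta / rho) ^+ 2))).
  apply: ler_sum => i _; apply: (le_trans (one_sub_cos_le _)).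
  rewrite mulrC ler_wpM2l ?invr_ge0// -(real_normK (num_real (_ / rho))).
  have d' : 0 <= delta by apply: le_trans (H i).
  rewrite ler_sqr ?nnegrE ?divr_ge0// ?(ltW rho0)//.
  by rewrite normrM normfV (gtr0_norm rho0) ler_wpM2r ?invr_ge0 ?(ltW rho0).
rewrite sumr_const card_ord -[leLHS]mulr_natr le_eqVlt; apply/orP; left; apply/eqP.
by move: (delta / rho) (d%:R) => x y; field.
Qed.

Lemma one_sub_cos_ge (x : R) : `|x| <= 2 -> x ^+ 2 / 8 <= 1 - cos x.
Proof.
move=> x2.
have e : 1 - cos x = sin (x / 2) ^+ 2 * 2.
  rewrite {1}(_ : x = (x / 2) *+ 2); last by rewrite -mulr_natr divfK.
  by rewrite cos_mulr2n sin2cos2; ring.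
have [->|x0] := eqVneq x 0; first by rewrite cos0 expr0n /= mul0r subrr.
have y1 : (x / 2) ^+ 2 <= 1.
  rewrite -(real_normK (num_real (x / 2))) expr_le1// normrM normfV (gtr0_norm (ltr0n _ 2)).
  by rewrite ler_pdivrMr// mul1r.
have y0 : x / 2 != 0 by rewrite mulf_neq0// invr_eq0.
have := mean_cos_le_sqr (x / 2); rewrite /mean_cos (negbTE y0) => h.
have h2 : 2^-1 <= sin (x / 2) / (x / 2) by lra.
have h3 : (2^-1) ^+ 2 <= (sin (x / 2) / (x / 2)) ^+ 2.
  by rewrite ler_sqr ?nnegrE ?invr_ge0//; apply: le_trans h2; rewrite invr_ge0.
have h4 : 0 < (x / 2) ^+ 2 by rewrite exprn_even_gt0.
rewrite expr_div_n ler_pdivlMr// in h3.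
rewrite e; move: h3; rewrite expr_div_n expr2; move: (sin _) => s; nra.
Qed.

(** The upper restriction on the coordinate keeps the cosine within its first period, where it
    controls the distance from below. *)
Lemma sine_dist_ge rho (c w : 'rV[R]_d) i delta : 0 < rho -> 0 <= delta -> delta <= `|w 0 i - c 0 i| ->
  `|w 0 i - c 0 i| <= 2 * rho ->
  (16 * d%:R)^-1 * (delta / rho) ^+ 2 <= sine_dist rho c w.
Proof.
move=> rho0 de H1 H2; rewrite sine_distE (bigD1 i)//=.
apply: (@le_trans _ _ ((2 * d%:R)^-1 * (1 - cos ((w 0 i - c 0 i) / rho)))); last first.
  by rewrite ler_wpM2l ?invr_ge0 ?mulr_ge0// lerDl sumr_ge0.
rewrite (_ : (16 * d%:R)^-1 * _ = (2 * d%:R)^-1 * ((delta / rho) ^+ 2 / 8)); last first.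
  by move: (delta / rho) => x; field; rewrite gt_eqF.
rewrite ler_wpM2l ?invr_ge0 ?mulr_ge0//.
apply: le_trans (one_sub_cos_ge _); last first.
  by rewrite normrM normfV (gtr0_norm rho0) ler_pdivrMr.
rewrite ler_wpM2r ?invr_ge0// -(real_normK (num_real ((w 0 i - c 0 i) / rho))).
rewrite ler_sqr ?nnegrE ?divr_ge0// ?(ltW rho0)//.
by rewrite normrM normfV (gtr0_norm rho0) ler_wpM2r ?invr_ge0 ?(ltW rho0).
Qed.

End trig_polynomial.

(** * Small-time limits of the transition laws *)

Section small_time_limit.
Context {R : realType} {d : nat} {dO : measure_display}.
Context {Omega : measurableType dO}.
Variables (P : probability Omega R) (X : R -> Omega -> 'rV[R]_d).
Hypothesis d0 : (0 < d)%N.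
Hypothesis LX : levy_process P X.
Hypothesis SX : symmetric_process P X.
Variables (b : 'rV[R]_d) (Q : 'M[R]_d) (N : {measure set 'rV[R]_d -> \bar R}).
Hypothesis TX : levy_triplet P X b Q N.

Local Notation psi := (lk_re Q N).

Lemma trig_integrable f t : trig f -> 0 <= t ->
  P.-integrable setT (EFin \o (fun w => f (X t w))).
Proof.
move=> tf t0; have [M HM] := trig_bounded tf.
apply: (@bounded_integrable _ _ _ _ _ M) => // w.
exact: (measurableT_comp (measurable_trig tf) (levy_measurable LX t0)).
Qed.

Lemma levy_integrable eta f : trig f ->
  N.-integrable setT (fun z => ((1 - cos (dotp eta z)) * ((f z + f (- z)) / 2))%:E).
Proof.
move=> tf; have [M HM] := trig_bounded tf.
have mf := measurable_trig tf.
have mfN : measurable_fun setT (fun z : 'rV[R]_d => f (- z)).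
  by apply: (measurableT_comp mf); exact: measurable_rVN.
have M0 : 0 <= M by exact: le_trans (normr_ge0 _) (HM 0).
have mc : measurable_fun setT (fun z : 'rV[R]_d => 1 - cos (dotp eta z)).
  apply: measurable_funB => //.
  by apply: measurableT_comp; [exact: measurable_cos|exact: measurable_dotp].
apply: (@le_integrable _ _ _ N setT measurableT _ (fun z => (M * (1 - cos (dotp eta z)))%:E)).
- apply/measurable_EFinP; apply: measurable_funM => //.
  by apply: measurable_funM => //; exact: measurable_funD.
- move=> z _; rewrite /= lee_fin normrM mulrC [leRHS]ger0_norm; last first.
    by rewrite mulr_ge0// subr_ge0 cos_le1.
  rewrite (ger0_norm (_ : 0 <= 1 - cos (dotp eta z)))// ler_wpM2r//.
  rewrite normrM (ger0_norm (_ : 0 <= 2^-1 :> R))// ler_pdivrMr//.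
  by rewrite (le_trans (ler_normD _ _))// mulr_natr mulr2n lerD.
- under eq_fun do rewrite EFinM.
  by apply: integrableZl => //; exact: (integrable_one_sub_cos TX).
Qed.

Lemma expR_rate (p : R) : 0 <= p ->
  h^-1 * (1 - expR (- h * p)) @[h --> (0 : R)^'+] --> p.
Proof.
move=> p0; apply: (@squeeze_cvgr _ _ _ _ (fun h => p - h * p ^+ 2) (cst p)).
- near=> h; have h0 : 0 < h by near: h; exact: nbhs_right_gt.
  have hp : 0 <= h * p by rewrite mulr_ge0// ltW.
  have e1 := expR_ge1Dx (- h * p); have e2 := expR_ge1Dx (h * p).
  have e3 : expR (- h * p) * expR (h * p) = 1 by rewrite -expRD mulNr addNr expR0.
  have e4 := expR_ge0 (- h * p).
  have e5 : expR (- h * p) <= 1 - h * p + (h * p) ^+ 2.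
    move: e2 e3 e4 hp; move: (h * p) (expR (- h * p)) (expR (h * p)) => x u v e2 e3 e4 x0.
    have k1 : u * (1 + x) <= u * v by rewrite ler_wpM2l.
    rewrite e3 in k1.
    have k2 : 0 <= x ^+ 3 by rewrite exprn_ge0.
    have : u * (1 + x) <= (1 - x + x ^+ 2) * (1 + x) by apply: (le_trans k1); lra.
    by rewrite ler_pM2r//; lra.
  rewrite /= ler_pdivlMl// ler_pdivrMl//; apply/andP; split; last lra.
  by move: e5; rewrite exprMn; lra.
- rewrite -[X in _ --> X]subr0; apply: cvgB; first exact: cvg_cst.
  rewrite -[X in _ --> X](mul0r (p ^+ 2)); apply: cvgM; last exact: cvg_cst.
  exact: cvg_at_right_filter.
- exact: cvg_cst.
Unshelve. all: by end_near. Qed.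

(** The second difference of the exponent in direction [eta] is where the product
    [(1 - cos (eta.z)) cos (xi.z)] comes from; it lets [trig_limit] be computed from values of [psi]
    alone. *)
Lemma psi_parallelogram xi eta :
  - psi xi + 2^-1 * psi (xi + eta) + 2^-1 * psi (xi - eta) =
  2^-1 * dotp eta (eta *m Q) + \int[N]_z ((1 - cos (dotp eta z)) * cos (dotp xi z)).
Proof.
rewrite /lk_re; have I x := integrable_one_sub_cos TX x.
pose i x := \int[N]_z (1 - cos (dotp x z)).
have -> : \int[N]_z ((1 - cos (dotp eta z)) * cos (dotp xi z)) =
    - i xi + 2^-1 * i (xi + eta) + 2^-1 * i (xi - eta).
  have J k x : N.-integrable setT (fun z => (k * (1 - cos (dotp x z)))%:E).
    have := integrableZl measurableT k (I x).
    by apply: eq_integrable => // z _; rewrite EFinM.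
  have Z k x : k * i x = \int[N]_z (k * (1 - cos (dotp x z))).
    by rewrite RintegralZl//; exact: I.
  have J2 : N.-integrable setT (fun z => (-1 * (1 - cos (dotp xi z)) +
      2^-1 * (1 - cos (dotp (xi + eta) z)))%:E).
    exact: (integrableD measurableT (J (-1) xi) (J 2^-1 (xi + eta))).
  rewrite -mulN1r !Z -RintegralD; [|exact: measurableT|exact: J|exact: J].
  rewrite -RintegralD; [|exact: measurableT|exact: J2|exact: J].
  apply: eq_Rintegral => z _; rewrite !dotpDl dotpNl cosD cosB.
  by move: (cos _) (cos _) (sin _) (sin _) => c1 c2 s1 s2; field.
rewrite -/(i xi) -/(i (xi + eta)) -/(i (xi - eta)).
rewrite !mulmxDl mulNmx !dotpDl !dotpDr !dotpNl !dotpNr.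
by move: (dotp _ _) (dotp _ _) (dotp _ _) (dotp _ _) => q1 q2 q3 q4; field.
Qed.

(** The factor [1 - cos] compensates the divergence of [P / h] at the origin. For a cosine test
    function the product formula leaves three exponentials, differentiated at [h = 0]. Only the even
    part of [S] is seen in the limit, since the cosine integrals determine [N] up to reflection. *)
Theorem trig_limit eta S : trig S ->
  h^-1 * \int[P]_w ((1 - cos (dotp eta (X h w))) * S (X h w)) @[h --> (0 : R)^'+] -->
  2^-1 * dotp eta (eta *m Q) * S 0 +
    \int[N]_z ((1 - cos (dotp eta z)) * ((S z + S (- z)) / 2)).
Proof.
have tu : trig (fun w : 'rV[R]_d => 1 - cos (dotp eta w)).
  apply: trig_sub; first exact: trig_cst.
  by apply: (eq_trig _ (trig_cos 0 eta)) => w; rewrite add0r.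
elim => [a xi|f g tf IHf tg IHg|c f tf IH].
- pose r x h := h^-1 * (1 - expR (- h * psi x)).
  have cr x : r x h @[h --> (0 : R)^'+] --> psi x by exact: expR_rate (psi_ge0 LX SX TX x).
  rewrite (_ : _ + _ = cos a * (- psi xi + 2^-1 * psi (xi + eta) + 2^-1 * psi (xi - eta))); last first.
    rewrite psi_parallelogram [dotp xi 0]dotpC dotp0l addr0 mulrDr mulrC; congr (_ + _).
    rewrite -RintegralZl//; last first.
      have := levy_integrable eta (trig_cos 0 xi); apply: eq_integrable => // z _.
      by rewrite !add0r dotpNr cosN; congr EFin; field.
    apply: eq_Rintegral => z _; rewrite dotpNr cosB cosD.
    by move: (cos _) (cos _) (sin _) (sin _) => c1 c2 s1 s2; field.
  apply: (@cvg_trans _ ((cos a * (- r xi h + 2^-1 * r (xi + eta) h + 2^-1 * r (xi - eta) h))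
      @[h --> (0 : R)^'+])).
    apply: near_eq_cvg; near=> h.
    have h0 : 0 < h by near: h; exact: nbhs_right_gt.
    have h0' := ltW h0.
    transitivity (h^-1 * (\int[P]_w cos (a + dotp xi (X h w)) +
       - 2^-1 * \int[P]_w cos (a + dotp (xi + eta) (X h w)) +
       - 2^-1 * \int[P]_w cos (a + dotp (xi - eta) (X h w)))).
      rewrite !(expectation_cos_shift LX SX TX)// /r; move: (expR _) (expR _) (expR _) => u1 u2 u3.
      by move: (h^-1) => k; field.
    congr (_ * _).
    have I x := trig_integrable (trig_cos a x) h0'.
    rewrite -RintegralZl; [|exact: measurableT|exact: I].
    rewrite -RintegralZl; [|exact: measurableT|exact: I].
    have I2 x := trig_integrable (trig_scale (- 2^-1) (trig_cos a x)) h0'.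
    rewrite -RintegralD; [|exact: measurableT|exact: I|exact: I2].
    rewrite -RintegralD; [|exact: measurableT| |exact: I2]; last first.
      exact: (trig_integrable (trig_add (trig_cos a xi) (trig_scale (- 2^-1) (trig_cos a (xi + eta)))) h0').
    apply: eq_Rintegral => w _; rewrite !dotpDl dotpNl !addrA cosD.
    rewrite (cosB (a + dotp xi (X h w))) (cosD (a + dotp xi (X h w))) (cosD a).
    by move: (cos _) (cos _) (cos _) (sin _) (sin _) (sin _) => c1 c2 c3 s1 s2 s3; field.
  apply: cvgM; first exact: cvg_cst.
  apply: cvgD; first apply: cvgD.
  + by apply: cvgN; exact: cr.
  + by apply: cvgM; [exact: cvg_cst|exact: cr].
  + by apply: cvgM; [exact: cvg_cst|exact: cr].
- have tuf := trig_mul tu tf; have tug := trig_mul tu tg.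
  rewrite (_ : _ + _ = (2^-1 * dotp eta (eta *m Q) * f 0 +
      \int[N]_z ((1 - cos (dotp eta z)) * ((f z + f (- z)) / 2))) +
    (2^-1 * dotp eta (eta *m Q) * g 0 +
      \int[N]_z ((1 - cos (dotp eta z)) * ((g z + g (- z)) / 2)))); last first.
    rewrite addrACA -mulrDr; congr (_ + _).
    rewrite -RintegralD//; last 2 first.
    - exact: levy_integrable.
    - exact: levy_integrable.
    by apply: eq_Rintegral => z _; ring.
  apply: cvg_trans (cvgD IHf IHg); apply: near_eq_cvg; near=> h.
  have h0 : 0 < h by near: h; exact: nbhs_right_gt.
  transitivity (h^-1 * (\int[P]_w ((1 - cos (dotp eta (X h w))) * f (X h w)) +
      \int[P]_w ((1 - cos (dotp eta (X h w))) * g (X h w)))); first by rewrite mulrDr.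
  rewrite -RintegralD; [|exact: measurableT|exact: (trig_integrable tuf (ltW h0))
    |exact: (trig_integrable tug (ltW h0))].
  by congr (_ * _); apply: eq_Rintegral => w _; rewrite mulrDr.
- have tuf := trig_mul tu tf.
  rewrite (_ : _ + _ = c * (2^-1 * dotp eta (eta *m Q) * f 0 +
      \int[N]_z ((1 - cos (dotp eta z)) * ((f z + f (- z)) / 2)))); last first.
    rewrite mulrDr; congr (_ + _); first by ring.
    rewrite -RintegralZl//; last exact: levy_integrable.
    by apply: eq_Rintegral => z _; ring.
  apply: cvg_trans (cvgM (cvg_cst c) IH); apply: near_eq_cvg; near=> h.
  have h0 : 0 < h by near: h; exact: nbhs_right_gt.
  rewrite /= mulrCA -RintegralZl//; last exact: (trig_integrable tuf (ltW h0)).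
  by congr (_ * _); apply: eq_Rintegral => w _; rewrite mulrCA.
Unshelve. all: by end_near. Qed.

Lemma integrable_even f (u : 'rV[R]_d -> R) : trig f ->
  (exists s : seq 'rV[R]_d, forall z, u z = \sum_(eta <- s) (1 - cos (dotp eta z))) ->
  N.-integrable setT (fun z => (u z * ((f z + f (- z)) / 2))%:E).
Proof.
move=> tf [s us]; rewrite (_ : (fun z => _) =
  fun z => (\sum_(eta <- s) ((1 - cos (dotp eta z)) * ((f z + f (- z)) / 2))%:E)%E); last first.
  by apply/funext => z; rewrite us big_distrl /= sumEFin.
apply: integrable_sum => // eta _; exact: levy_integrable.
Qed.

Lemma trig_limit_sum (s : seq 'rV[R]_d) S : trig S ->
  let u z := \sum_(eta <- s) (1 - cos (dotp eta z)) in
  h^-1 * \int[P]_w (u (X h w) * S (X h w)) @[h --> (0 : R)^'+] -->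
  (\sum_(eta <- s) 2^-1 * dotp eta (eta *m Q)) * S 0 +
    \int[N]_z (u z * ((S z + S (- z)) / 2)).
Proof.
move=> tS /=.
have tu eta : trig (fun w : 'rV[R]_d => 1 - cos (dotp eta w)).
  apply: trig_sub; first exact: trig_cst.
  by apply: (eq_trig _ (trig_cos 0 eta)) => w; rewrite add0r.
elim: s => [|eta s IH].
  rewrite big_nil mul0r add0r; under eq_Rintegral do rewrite big_nil mul0r.
  rewrite (_ : Rintegral N _ _ = 0); last by rewrite /Rintegral integral0.
  under eq_fun => h.
    under eq_Rintegral do rewrite big_nil mul0r.
    rewrite [Rintegral _ _ _](_ : _ = 0); last by rewrite /Rintegral integral0.
    rewrite mulr0; over.
  exact: cvg_cst.
pose u z := \sum_(eta <- s) (1 - cos (dotp eta z)).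
have tus : trig (fun w => u w * S w).
  by apply: trig_mul => //; apply: trig_sum.
apply: eq_cvg_right; first by apply: cvgD; [exact: (@trig_limit eta _ tS)|exact: IH].
  move=> h h0.
transitivity (h^-1 * (\int[P]_w ((1 - cos (dotp eta (X h w))) * S (X h w)) +
    \int[P]_w (u (X h w) * S (X h w)))); first by rewrite mulrDr.
rewrite -RintegralD; [|exact: measurableT|exact: (trig_integrable (trig_mul (tu eta) tS) (ltW h0))
  |exact: (trig_integrable tus (ltW h0))].
by congr (_ * _); apply: eq_Rintegral => w _; rewrite [in RHS]big_cons [in RHS]mulrDl.
rewrite addrACA big_cons -mulrDl; congr (_ + _).
rewrite -RintegralD; [|exact: measurableT|exact: levy_integrable|]; last first.
  by apply: integrable_even => //; exists s.
by apply: eq_Rintegral => z _; rewrite [in RHS]big_cons [in RHS]mulrDl.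
Qed.

Section cutoff.
Variables (rho : R) (n : nat).
Hypothesis rho0 : 0 < rho.
Local Notation u := (sine_dist rho 0).

(* Vanishes to second order at [0] and is close to [1] away from [0]. *)
Definition cutoff (w : 'rV[R]_d) : R := 1 - (1 - u w) ^+ n.

Let G (w : 'rV[R]_d) : R := \sum_(j < n) (1 - u w) ^+ j.

(** Geometric sum. With one factor [u] split off, a combination of terms [1 - cos], the limit
    theorem applies to the test function [G * S]. *)
Let cutoffE w : cutoff w = u w * G w.
Proof.
rewrite /cutoff /G; have := subrX1 (1 - u w) n.
by rewrite (_ : 1 - u w - 1 = - u w); [move=> h; rewrite -opprB h mulNr opprK|ring].
Qed.

Let tG : trig G.
Proof.
by apply: trig_sum => j; apply: trig_exp; apply: trig_sub;
  [exact: trig_cst|exact: trig_sine_dist].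
Qed.

Lemma trig_cutoff : trig cutoff.
Proof.
apply: trig_sub; first exact: trig_cst.
by apply: trig_exp; apply: trig_sub; [exact: trig_cst|exact: trig_sine_dist].
Qed.

Let u_even (w : 'rV[R]_d) : u (- w) = u w.
Proof.
rewrite !sine_distE; congr (_ * _); apply: eq_bigr => i _.
by rewrite !mxE !subr0 mulNr cosN.
Qed.

Lemma cutoff_ge0 w : 0 <= cutoff w.
Proof.
rewrite /cutoff subr_ge0 exprn_ile1// ?subr_ge0 ?sine_dist_le1//.
by rewrite lerBlDr lerDl sine_dist_ge0.
Qed.

Lemma cutoff_le1 w : cutoff w <= 1.
Proof. by rewrite /cutoff lerBlDr lerDl exprn_ge0// subr_ge0 sine_dist_le1. Qed.

Let etas : seq 'rV[R]_d := [seq rho^-1 *: delta_mx 0 i | i <- index_enum 'I_d].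

Let uE (w : 'rV[R]_d) : u w = (2 * d%:R)^-1 * \sum_(eta <- etas) (1 - cos (dotp eta w)).
Proof.
rewrite /sine_dist /etas big_map; congr (_ * _); apply: eq_bigr => i _.
by rewrite mxE mul0r oppr0 add0r.
Qed.

(** The weight that the Gaussian part places on the origin in the limit; it does little harm when
    the test function is small at 0. *)
Definition cutoff_rate : R :=
  (2 * d%:R)^-1 * (\sum_(eta <- etas) 2^-1 * dotp eta (eta *m Q)) * n%:R.

Lemma cutoff_rate_ge0 : 0 <= cutoff_rate.
Proof.
rewrite /cutoff_rate !mulr_ge0 ?invr_ge0 ?mulr_ge0// sumr_ge0// => eta _.
by rewrite mulr_ge0// (triplet_psd TX).
Qed.

Let even_G S z : u z * ((G z * S z + G (- z) * S (- z)) / 2) = cutoff z * ((S z + S (- z)) / 2).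
Proof.
rewrite cutoffE (_ : G (- z) = G z); first by ring.
by rewrite /G u_even.
Qed.

Let cutoff_sum S z : cutoff z * ((S z + S (- z)) / 2) =
  (2 * d%:R)^-1 * ((\sum_(eta <- etas) (1 - cos (dotp eta z))) *
    ((G z * S z + G (- z) * S (- z)) / 2)).
Proof. by rewrite -even_G uE -[LHS]mulrA. Qed.

Lemma cutoff_integrable S : trig S ->
  N.-integrable setT (fun z => (cutoff z * ((S z + S (- z)) / 2))%:E).
Proof.
move=> tS; rewrite (_ : (fun z => _) = fun z => ((2 * d%:R)^-1)%:E *
   ((\sum_(eta <- etas) (1 - cos (dotp eta z))) * ((G z * S z + G (- z) * S (- z)) / 2))%:E)%E.
  apply: integrableZl => //.
  by apply: (@integrable_even (fun z => G z * S z)); [exact: trig_mul|exists etas].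
by apply/funext => z; rewrite cutoff_sum EFinM.
Qed.

Theorem cutoff_limit S : trig S ->
  h^-1 * \int[P]_w (cutoff (X h w) * S (X h w)) @[h --> (0 : R)^'+] -->
  cutoff_rate * S 0 + \int[N]_z (cutoff z * ((S z + S (- z)) / 2)).
Proof.
move=> tS; have := @trig_limit_sum etas _ (trig_mul tG tS); rewrite /= => H.
have G0 : G 0 = n%:R.
  rewrite /G (_ : u 0 = 0); first by under eq_bigr do rewrite subr0 expr1n; rewrite sumr_const card_ord.
  by rewrite uE big1 ?mulr0// => eta _; rewrite dotpC dotp0l cos0 subrr.
have tsum : trig (fun w : 'rV[R]_d => \sum_(eta <- etas) (1 - cos (dotp eta w))).
  apply: trig_sum => eta; apply: trig_sub; first exact: trig_cst.
  by apply: (eq_trig _ (trig_cos 0 eta)) => w; rewrite add0r.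
have H2 : (2 * d%:R)^-1 * (h^-1 * \int[P]_w ((\sum_(eta <- etas) (1 - cos (dotp eta (X h w)))) *
      (G (X h w) * S (X h w)))) @[h --> (0 : R)^'+] -->
    (2 * d%:R)^-1 * ((\sum_(eta <- etas) 2^-1 * dotp eta (eta *m Q)) * (G 0 * S 0) +
      \int[N]_z ((\sum_(eta <- etas) (1 - cos (dotp eta z))) *
        ((G z * S z + G (- z) * S (- z)) / 2))).
  by apply: cvgM; [exact: cvg_cst|exact: H].
apply: (eq_cvg_right H2).
  move=> h h0.
rewrite /= mulrCA; congr (_ * _).
rewrite -RintegralZl; [|exact: measurableT|]; last first.
  exact: (trig_integrable (trig_mul tsum (trig_mul tG tS)) (ltW h0)).
by apply: eq_Rintegral => w _; rewrite cutoffE uE; ring.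
rewrite mulrDr G0 /cutoff_rate; congr (_ + _); first by ring.
rewrite -RintegralZl; [|exact: measurableT|]; last first.
  by apply: (@integrable_even (fun z => G z * S z)); [exact: trig_mul|exists etas].
by apply: eq_Rintegral => z _; rewrite cutoff_sum.
Qed.

End cutoff.

End small_time_limit.

Lemma EFin_Rintegral (R : realType) d0 (T : measurableType d0)
    (mu : {measure set T -> \bar R}) (f : T -> R) :
  mu.-integrable setT (EFin \o f) ->
  (\int[mu]_x (f x)%:E = (\int[mu]_x f x)%:E)%E.
Proof. by move=> fi; rewrite /Rintegral fineK//; exact: integrable_fin_num fi. Qed.

Lemma bernoulli_ge (R : realType) (y : R) m : 0 <= y -> y <= 1 -> 1 - m%:R * y <= (1 - y) ^+ m.
Proof.
move=> y0 y1; elim: m => [|m IH]; first by rewrite mul0r subr0 expr0.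
rewrite exprS -addn1 natrD; apply: (@le_trans _ _ ((1 - y) * (1 - m%:R * y))).
  by have : 0 <= m%:R * y ^+ 2 by [rewrite mulr_ge0// sqr_ge0]; lra.
by rewrite ler_wpM2l// subr_ge0.
Qed.

Lemma bernoulli_le (R : realType) (y : R) m : 0 <= y -> y <= 1 -> (1 - y) ^+ m * (1 + m%:R * y) <= 1.
Proof.
move=> y0 y1; elim: m => [|m IH]; first by rewrite mul0r addr0 expr0 mul1r.
apply: le_trans IH; rewrite exprSr -mulrA ler_wpM2l ?exprn_ge0 ?subr_ge0//.
rewrite -addn1 natrD; have : 0 <= m%:R * y ^+ 2 by rewrite mulr_ge0// sqr_ge0.
by have : 0 <= y ^+ 2 by [exact: sqr_ge0]; lra.
Qed.

(* The Brosowski-Deutsch power [(1 - x^n)^m]: it switches from [1] to [0]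
   between [s] and [t]. *)
Lemma power_switch (R : realType) (s t e : R) : 0 < s -> s <= 4^-1 -> 4 * s <= t -> 0 < e ->
  exists n m, forall x : R, 0 <= x -> x <= 1 ->
    (x <= s -> 2^-1 <= (1 - x ^+ n) ^+ m) /\ (t <= x -> (1 - x ^+ n) ^+ m <= e).
Proof.
move=> s0 s4 st e0; have t0 : 0 < t by lra.
(* The ratio [(t / s) ^ n] is at least [4 / e], which leaves room for an [m] of size [1 / (e t ^ n)]
   with both [m s ^ n <= 1/2] and [m e t ^ n >= 1], as the two Bernoulli inequalities demand. *)
pose n := (Num.trunc (4 / e)).+1; exists n.
have n4 : 4 / e <= 4 ^+ n.
  apply: (le_trans (ltW (truncnS_gt _))); rewrite -/n -natrX ler_nat ltnW//.
  exact: ltn_expl.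
have sn : s ^+ n <= 4^-1.
  rewrite /n exprS; apply: (@le_trans _ _ (s * 1)); last by rewrite mulr1.
  by rewrite ler_wpM2l ?(ltW s0)// exprn_ile1 ?(ltW s0)//; lra.
have tn0 : 0 < t ^+ n by rewrite exprn_gt0.
have sn0 : 0 < s ^+ n by rewrite exprn_gt0.
have stn : 4 ^+ n * s ^+ n <= t ^+ n.
  by rewrite -exprMn lerXn2r ?nnegrE// ?mulr_ge0// ltW.
pose m := (Num.trunc (1 / (e * t ^+ n))).+1; exists m.
have m1 : 1 <= m%:R * (e * t ^+ n).
  by rewrite -ler_pdivrMr ?mulr_gt0//; exact: ltW (truncnS_gt _).
have m2 : m%:R <= 1 / (e * t ^+ n) + 1.
  by rewrite /m -addn1 natrD lerD2r truncn_le divr_ge0// mulr_ge0// ltW.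
have m3 : m%:R * s ^+ n <= 2^-1.
  apply: (@le_trans _ _ ((1 / (e * t ^+ n) + 1) * s ^+ n)).
    by rewrite ler_wpM2r// ltW.
  rewrite mulrDl mul1r; have : 1 / (e * t ^+ n) * s ^+ n <= 4^-1; last lra.
  rewrite mulrAC mul1r ler_pdivrMr ?mulr_gt0//.
  have k1 : e * (4 / e * s ^+ n) <= e * t ^+ n.
    rewrite ler_wpM2l ?(ltW e0)//; apply: le_trans stn.
    by rewrite ler_wpM2r// ltW.
  have k2 : e * (4 / e * s ^+ n) = 4 * s ^+ n by field; rewrite gt_eqF.
  by rewrite k2 in k1; lra.
move=> x x0 x1; have xn0 : 0 <= x ^+ n by rewrite exprn_ge0.
have xn1 : x ^+ n <= 1 by rewrite exprn_ile1.
split=> xs.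
  apply: le_trans (bernoulli_ge m xn0 xn1).
  have : m%:R * x ^+ n <= m%:R * s ^+ n; last lra.
  by rewrite ler_wpM2l// lerXn2r ?nnegrE// ltW.
have := bernoulli_le m xn0 xn1.
have k : t ^+ n <= x ^+ n by rewrite lerXn2r ?nnegrE// ltW.
have k1 : m%:R * (e * t ^+ n) <= m%:R * (e * x ^+ n).
  by rewrite ler_wpM2l// ler_wpM2l// ltW.
have z0 : 0 <= (1 - x ^+ n) ^+ m by rewrite exprn_ge0// subr_ge0.
move: z0; move: ((1 - x ^+ n) ^+ m) => z z0 h.
have k2 : z * 1 <= z * (m%:R * (e * x ^+ n)) by rewrite ler_wpM2l// (le_trans m1).
have k3 : e * (z * (1 + m%:R * x ^+ n)) <= e * 1 by rewrite ler_wpM2l// ltW.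
have k4 : 0 <= e * z by rewrite mulr_ge0// ltW.
lra.
Qed.

Lemma integral_indicT (R : realType) d0 (T : measurableType d0)
    (mu : {measure set T -> \bar R}) (A : set T) : measurable A ->
  (\int[mu]_z (\1_A z : R)%:E = mu A)%E.
Proof. by move=> mA; rewrite integral_indic// setIT. Qed.

Section cube.
Context {R : realType} {d : nat}.

Definition cube (c : 'rV[R]_d) (r : R) : set 'rV[R]_d :=
  [set w | forall i, `|w 0 i - c 0 i| <= r].

Lemma cube_itv c r : cube c r =
  [set w : 'rV[R]_d | forall i, `[c 0 i - r, c 0 i + r]%classic (w 0 i)].
Proof.
by apply/seteqP; split => w H i; have := H i; rewrite /= in_itv /= ler_distl.
Qed.

Lemma measurable_cube c r : measurable (cube c r).
Proof.
rewrite cube_itv (_ : [set w | _] =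
    \bigcap_i [set w : 'rV[R]_d | `[c 0 i - r, c 0 i + r]%classic (w 0 i)]).
  apply: fin_bigcap_measurable => // i _.
  rewrite -[X in measurable X]setTI.
  by apply: (measurable_rV_coord i) => //; exact: measurable_itv.
by apply/seteqP; split => [v H i _|v H i]; [exact: H|exact: (H i I)].
Qed.

Hypothesis d0 : (0 < d)%N.

(** The values of [sine_dist] are at most [s] on the small cube and at least [t] outside the large
    one, with [t = 4 d s]: the factor [4 d] between the cubes makes up for averaging over [d]
    coordinates. Smallness holds only within [2 rho], because the function is periodic. *)
Lemma bump_exists (rho e delta : R) (c : 'rV[R]_d) : 0 < delta -> delta <= rho -> 0 < e ->
  exists S, [/\ trig S, forall w, 0 <= S w <= 1, forall w, cube c delta w -> 2^-1 <= S w &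
    forall w, ~ cube c (4 * d%:R * delta) w -> (forall i, `|w 0 i - c 0 i| <= 2 * rho) -> S w <= e].
Proof.
move=> delta0 dr e0; have D0 : 0 < d%:R :> R by rewrite ltr0n.
have D1 : 1 <= d%:R :> R by rewrite ler1n.
have rho0 : 0 < rho by exact: lt_le_trans dr.
pose s := 4^-1 * (delta / rho) ^+ 2.
pose t := (16 * d%:R)^-1 * ((4 * d%:R * delta) / rho) ^+ 2.
have q0 : 0 < (delta / rho) ^+ 2 by rewrite exprn_gt0// divr_gt0.
have q1 : (delta / rho) ^+ 2 <= 1.
  by rewrite exprn_ile1// ?divr_ge0 ?(ltW delta0) ?(ltW rho0)// ler_pdivrMr// mul1r.
have [|||n [m H]] := @power_switch R s t e _ _ _ e0.
- by rewrite mulr_gt0.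
- by rewrite /s; lra.
- rewrite /s /t (_ : (16 * d%:R)^-1 * _ = d%:R * (delta / rho) ^+ 2); last first.
    by field; rewrite !gt_eqF.
  by move: q0; move: ((delta / rho) ^+ 2) => q; nra.
exists (fun w => (1 - sine_dist rho c w ^+ n) ^+ m).
have u0 w := @sine_dist_ge0 R d rho c w; have u1 w := @sine_dist_le1 R d d0 rho c w.
split.
- by apply: trig_exp; apply: trig_sub; [exact: trig_cst|apply: trig_exp; exact: trig_sine_dist].
- move=> w; have k1 : 0 <= sine_dist rho c w ^+ n by rewrite exprn_ge0.
  have k2 : sine_dist rho c w ^+ n <= 1 by rewrite exprn_ile1.
  by rewrite exprn_ge0 ?subr_ge0//= exprn_ile1 ?subr_ge0// lerBlDr lerDl.
- by move=> w cw; apply: (H _ (u0 w) (u1 w)).1; exact: sine_dist_le.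
- move=> w /existsNP[i /negP]; rewrite -ltNge => /ltW iw cw.
  apply: (H _ (u0 w) (u1 w)).2; apply: (sine_dist_ge d0 rho0 _ iw (cw i)).
  by rewrite !mulr_ge0// ltW.
Qed.

End cube.

(** * Comparison of transition laws and Levy measure on cubes *)

Section cube_estimates.
Context {R : realType} {d : nat} {dO : measure_display}.
Context {Omega : measurableType dO}.
Variables (P : probability Omega R) (X : R -> Omega -> 'rV[R]_d).
Hypothesis d0 : (0 < d)%N.
Hypothesis LX : levy_process P X.
Hypothesis SX : symmetric_process P X.
Variables (b : 'rV[R]_d) (Q : 'M[R]_d) (N : {measure set 'rV[R]_d -> \bar R}).
Hypothesis TX : levy_triplet P X b Q N.

Let D0 : 0 < d%:R :> R. Proof. by rewrite ltr0n. Qed.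

Let far (r : R) : set 'rV[R]_d := [set z | r <= enorm z].

Let mfar r : measurable (far r).
Proof. by apply: measurable_ge_set; exact: measurable_enorm. Qed.

Lemma levy_far_finite (r : R) : 0 < r -> (N [set z | (r <= enorm z)%R] < +oo)%E.
Proof.
move=> r0; pose m := Num.min 1 (r ^+ 2).
have m0 : 0 < m by rewrite lt_min ltr01 exprn_gt0.
have H : (m%:E * N (far r) < +oo)%E.
  apply: le_lt_trans (triplet_finite TX).
  rewrite -(setIT (far r)) -integral_indic// -ge0_integral_scale ?(ltW m0)//; last first.
    by apply/measurable_EFinP; exact: measurable_indic.
  apply: ge0_le_integral_any => z _; first by rewrite mule_ge0 ?lee_fin// ltW.
  rewrite -EFinM lee_fin; have [rz|rz] := leP r (enorm z).
    rewrite indic_in// mulr1 /m le_min ge_min lexx /= ge_min.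
    by rewrite lerXn2r ?orbT// ?nnegrE ?enorm_ge0// ltW.
  rewrite indic_out ?mulr0 ?le_min ?ler01 ?sqr_ge0//= => /le_lt_trans/(_ rz).
  by rewrite ltxx.
move: H (measure_ge0 N (far r)); rewrite -/(far r); case: (N (far r)) => [x| |] //.
  by move=> *; exact: ltry.
by rewrite gt0_muley ?lte_fin// ltxx.
Qed.

Lemma levy_tail (eta : R) : 0 < eta ->
  exists r0, forall r, r0 <= r -> (N [set z | (r <= enorm z)%R] <= eta%:E)%E.
Proof.
move=> eta0; pose F (n : nat) := far n.+1%:R.
have F0 : \bigcap_n F n = set0.
  apply/seteqP; split => // z /(_ (Num.trunc (enorm z)) I); rewrite /F /far /= leNgt.
  by rewrite truncnS_gt.
have cF : (N \o F) n @[n --> \oo] --> N (\bigcap_n F n).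
  apply: nonincreasing_cvg_mu.
  - exact: levy_far_finite.
  - by move=> n; exact: mfar.
  - by rewrite F0.
  - move=> n m nm; apply/subsetPset => z; rewrite /F /far /=; apply: le_trans.
    by rewrite ler_nat.
have e0' : (N (\bigcap_n F n) < eta%:E)%E by rewrite F0 measure0 lte_fin.
have O := open_nbhs_nbhs (conj (@open_ereal_lt_ereal _ eta%:E) e0').
have [n _ Hn] := cF _ O; exists n.+1%:R => r nr.
apply: (@le_trans _ _ (N (F n))); last by apply: ltW; exact: Hn (leqnn n).
by apply: le_measure; rewrite ?inE//; [exact: mfar|exact: mfar|move=> z /=; exact: le_trans].
Qed.

Let measurable_preX (A : set 'rV[R]_d) h : 0 <= h -> measurable A -> measurable [set w | A (X h w)].
Proof. by move=> h0 mA; exact: (measurable_preimage (levy_measurable LX h0) mA). Qed.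

(** The product of cutoff and bump is a trigonometric polynomial, so its mean over [h] converges. On
    the small cube, between radius 1/8 and [rho], both factors are at least 1/2. Off the large cube
    the bump is small up to [rho], and beyond [rho], where periodicity spoils it, the tails of both
    measures are small. *)
Lemma cube_estimates (c : 'rV[R]_d) (delta eta : R) : 0 < delta -> 0 < eta ->
  ~ cube c (4 * d%:R * delta) 0 ->
  let O := cube c (4 * d%:R * delta) in
  exists2 h0, 0 < h0 & forall h, 0 < h -> h < h0 ->
  (P [set w | cube c delta (X h w) /\ (8^-1 <= enorm (X h w))%R] <=
     h%:E * (2%:E * (N O + N [set z | O (- z)%R]) + eta%:E))%E /\
  ((forall z, cube c delta z -> 8^-1 <= enorm z) ->
   (h%:E * N (cube c delta) <= 8%:E * (P [set w | O (X h w)] + (eta * h)%:E))%E).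
Proof.
move=> delta0 eta0 nO0 O.
(* All errors are counted in units of [e1]; the upper estimate uses thirteen of them. *)
pose e1 := eta / 16; have e10 : 0 < e1 by rewrite divr_gt0.
have [r1 r10 tailP] := tail_small d0 LX SX TX e10.
have [r2 tailN] := levy_tail e10.
(* Beyond [rho] both tails are below the error. Including [|c|] guarantees that every point of norm
   at most [rho] is within [2 rho] of [c] in each coordinate. *)
pose rho := Num.max (Num.max r1 r2) (Num.max (enorm c) delta).
have rr1 : r1 <= rho by rewrite !le_max lexx.
have rr2 : r2 <= rho by rewrite !le_max lexx !orbT.
have rc : enorm c <= rho by rewrite !le_max lexx !orbT.
have rd : delta <= rho by rewrite !le_max lexx !orbT.
have rho0 : 0 < rho by exact: lt_le_trans rd.
have mO : measurable O by exact: measurable_cube.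
have mON : measurable [set z | O (- z)].
  by apply: (measurable_preimage _ mO); exact: measurable_rVN.
have tP s : 0 <= s -> (P [set w | far rho (X s w)] <= (e1 * s)%:E)%E.
  move=> s0; apply: le_trans (tailP s s0); apply: le_measure; rewrite ?inE.
  - exact: measurable_preX.
  - by apply: (measurable_preX s0 (mfar r1)).
  - by move=> w /=; exact: le_trans.
have tN : (N (far rho) <= e1%:E)%E by exact: tailN.
(* A lower bound of [sine_dist] between the radii 1/8 and [rho]; then [n >= 1 / tau] brings the
   cutoff above 1/2 there. *)
pose tau := (16 * d%:R)^-1 * ((8^-1 / d%:R) / rho) ^+ 2.
have tau0 : 0 < tau by rewrite mulr_gt0// ?exprn_gt0 ?divr_gt0// ?invr_gt0 ?mulr_gt0.
have uge (w : 'rV[R]_d) : 8^-1 <= enorm w -> enorm w <= rho -> tau <= sine_dist rho 0 w.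
  move=> w8 wr; have [i wi] := exists_coord_ge d0 w8.
  apply: (@sine_dist_ge R d d0 rho 0 w i); rewrite ?mxE ?subr0//.
  by rewrite (le_trans (coord_le_enorm _ _))// (le_trans wr)// ler_peMl ?ler1n// ltW.
pose n := (Num.trunc (1 / tau)).+1.
have ntau : 1 <= n%:R * tau by rewrite -ler_pdivrMr//; exact: ltW (truncnS_gt _).
pose v := @cutoff R d rho n.
have v0 w : 0 <= v w by exact: cutoff_ge0.
have v1 w : v w <= 1 by exact: cutoff_le1.
have vge (w : 'rV[R]_d) : 8^-1 <= enorm w -> enorm w <= rho -> 2^-1 <= v w.
  move=> w8 wr; have t1 := uge w w8 wr.
  have u0 := @sine_dist_ge0 R d rho 0 w; have u1 := sine_dist_le1 d0 rho 0 w.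
  have := bernoulli_le n u0 u1; rewrite /v /cutoff.
  have k1 : n%:R * tau <= n%:R * sine_dist rho 0 w by rewrite ler_wpM2l.
  have k0 : 0 <= (1 - sine_dist rho 0 w) ^+ n by rewrite exprn_ge0// subr_ge0.
  move: k0 k1; move: ((1 - _) ^+ n) (n%:R * sine_dist _ _ _) => y z k0 k1 k2.
  have : y * 1 <= y * z by rewrite ler_wpM2l// (le_trans ntau).
  lra.
have tv : trig v by exact: trig_cutoff.
have mv := measurable_trig tv.
have q0 := cutoff_rate_ge0 TX rho n.
set q := cutoff_rate _ _ _ in q0.
have vI : N.-integrable setT (EFin \o v).
  have := cutoff_integrable TX rho n (trig_cst 1); apply: eq_integrable => // z _.
  by rewrite /= (_ : (1 + 1) / 2 = 1 :> R) ?mulr1//; field.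
pose Iv := \int[N]_z v z.
have Iv0 : 0 <= Iv by apply: Rintegral_ge0.
pose K := q + Iv; have K0 : 0 <= K by exact: addr_ge0.
(* [K] is the limiting total mass of the cutoff, Gaussian part included, so a bump of size [e] on
   this mass contributes at most [e1]. *)
pose e := e1 / (K + 1).
have e0 : 0 < e by rewrite divr_gt0// ltr_wpDl.
have eK : e * (K + 1) = e1 by rewrite divfK// gt_eqF// ltr_wpDl.
have [S [tS S01 Snear Sfar]] := @bump_exists R d d0 rho e delta c delta0 rd e0.
have S0 w : 0 <= S w by have /andP[] := S01 w.
have S1 w : S w <= 1 by have /andP[] := S01 w.
have mS := measurable_trig tS.
have Sle z : enorm z <= rho -> S z <= \1_O z + e.
  move=> zr; have [Oz|Oz] := pselect (O z).
    by rewrite indic_in// (le_trans (S1 z))// lerDl ltW.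
  rewrite indic_out// add0r; apply: Sfar => // i.
  rewrite (le_trans (ler_normB _ _))// mulr_natl mulr2n lerD//.
    by rewrite (le_trans (coord_le_enorm _ _)).
  by rewrite (le_trans (coord_le_enorm _ _)).
have S00 : S 0 <= e.
  by have := Sle 0; rewrite enorm0 (ltW rho0) (indic_out R nO0) add0r; apply.
pose W z := v z * ((S z + S (- z)) / 2).
have W0 z : 0 <= W z by rewrite mulr_ge0// divr_ge0// addr_ge0.
have WI : N.-integrable setT (EFin \o W) by exact: (cutoff_integrable TX rho n tS).
have mW : measurable_fun setT W by have /measurable_int/measurable_EFinP := WI.
pose J := \int[N]_z W z.
have J0 : 0 <= J by apply: Rintegral_ge0.
pose L := q * S 0 + J.
have JL : J <= L by rewrite lerDr mulr_ge0.
have limL : h^-1 * \int[P]_w (v (X h w) * S (X h w)) @[h --> (0 : R)^'+] --> L.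
  exact: (cutoff_limit LX SX TX tS).
have lim1 : h^-1 * \int[P]_w (v (X h w) * 1) @[h --> (0 : R)^'+] -->
    q * 1 + \int[N]_z (v z * ((1 + 1) / 2)).
  exact: (cutoff_limit LX SX TX (trig_cst 1)).
have near1 : \forall h \near (0 : R)^'+,
    `|L - h^-1 * \int[P]_w (v (X h w) * S (X h w))| < e1.
  by move/cvgrPdist_lt : limL => /(_ _ e10).
have near2 : \forall h \near (0 : R)^'+, `|K - h^-1 * \int[P]_w (v (X h w) * 1)| < 1.
  move/cvgrPdist_lt : lim1 => /(_ _ ltr01); rewrite mulr1.
  rewrite (_ : Rintegral N _ _ = Iv)//; apply: eq_Rintegral => z _.
  by rewrite (_ : (1 + 1) / 2 = 1 :> R) ?mulr1//; field.
have [h0 /= h00 Hh] : exists2 h0 : R, 0 < h0 & forall h, 0 < h -> h < h0 ->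
    `|L - h^-1 * \int[P]_w (v (X h w) * S (X h w))| < e1 /\
    `|K - h^-1 * \int[P]_w (v (X h w) * 1)| < 1.
  have [h0 /= h00 H0] : \forall h \near (0 : R)^'+,
      `|L - h^-1 * \int[P]_w (v (X h w) * S (X h w))| < e1 /\
      `|K - h^-1 * \int[P]_w (v (X h w) * 1)| < 1 by apply/near_andP; split.
  exists h0 => // h hp hh; apply: H0 => //=.
  by rewrite sub0r normrN gtr0_norm.
exists h0 => // h hp hh; have [] := Hh h hp hh.
have hp' := ltW hp.
set E1 := Rintegral P _ _; set E2 := Rintegral P _ _ => HE1 HE2.
have E1le : E1 <= h * (L + e1).
  rewrite -ler_pdivrMl//; move: HE1; rewrite ltr_norml; move: (h^-1 * E1) => x; clear; lra.
have E1ge : h * (L - e1) <= E1.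
  rewrite -ler_pdivlMl//; move: HE1; rewrite ltr_norml; move: (h^-1 * E1) => x; clear; lra.
have E2le : E2 <= h * (K + 1).
  rewrite -ler_pdivrMl//; move: HE2; rewrite ltr_norml; move: (h^-1 * E2) => x; clear; lra.
have mXh : measurable_fun setT (X h) by exact: (levy_measurable LX).
have vle1 z : `|v z| <= 1 by rewrite ger0_norm.
have fI : (\int[P]_w (v (X h w) * S (X h w))%:E = E1%:E)%E.
  exact: EFin_Rintegral (trig_integrable LX (trig_mul tv tS) hp').
have vIh : (\int[P]_w (v (X h w) * 1)%:E = E2%:E)%E.
  exact: EFin_Rintegral (trig_integrable LX (trig_mul tv (trig_cst 1)) hp').
have mf : measurable_fun setT (fun w => (v (X h w) * S (X h w))%:E).
  apply/measurable_EFinP; exact: (measurableT_comp (measurable_trig (trig_mul tv tS)) mXh).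
have mvh : measurable_fun setT (fun w => (v (X h w) * 1)%:E).
  apply/measurable_EFinP.
  exact: (measurableT_comp (measurable_trig (trig_mul tv (trig_cst 1))) mXh).
have mfarX := measurable_preX hp' (mfar rho).
have mOX := measurable_preX hp' mO.
have mI d1 (T : measurableType d1) (A : set T) : measurable A ->
    measurable_fun setT (fun z => (\1_A z : R)%:E).
  by move=> mA; apply/measurable_EFinP; exact: measurable_indic.
have farI w : \1_[set w | far rho (X h w)] w = \1_(far rho) (X h w) :> R by [].
have PT := tP h hp'.
split.
  have JN : (J%:E <= (e * Iv)%:E + ((2^-1)%:E * N O + ((2^-1)%:E * N [set z | O (- z)%R] +
      e1%:E)))%E.
    rewrite -(EFin_Rintegral WI).
    have m1 : measurable_fun setT (fun z => e%:E * (v z)%:E)%E.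
      by apply: emeasurable_funM => //; exact/measurable_EFinP.
    have m2 := emeasurable_funM (@measurable_cst _ _ _ _ setT (2^-1 : R)%:E) (mI _ _ _ mO).
    have m3 := emeasurable_funM (@measurable_cst _ _ _ _ setT (2^-1 : R)%:E) (mI _ _ _ mON).
    have m4 := mI _ _ _ (mfar rho).
    have p1 z : (0 <= e%:E * (v z)%:E)%E by rewrite mule_ge0// lee_fin// ltW.
    have p2 (A : set 'rV[R]_d) z : (0 <= (2^-1 : R)%:E * (\1_A z : R)%:E)%E.
      by rewrite mule_ge0// lee_fin ?invr_ge0.
    have p4 z : (0 <= (\1_(far rho) z : R)%:E)%E by rewrite lee_fin.
    apply: (@le_trans _ _ (\int[N]_z (e%:E * (v z)%:E + ((2^-1 : R)%:E * (\1_O z : R)%:E +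
        ((2^-1 : R)%:E * (\1_[set z | O (- z)%R] z : R)%:E + (\1_(far rho) z : R)%:E))))%E).
      apply: ge0_le_integral_any => z _; first by rewrite lee_fin.
      rewrite -!EFinM -!EFinD lee_fin /W.
      have [rz|rz] := leP rho (enorm z).
        rewrite (indic_in R (rz : far rho z)).
        apply: (@le_trans _ _ 1).
          rewrite -[leRHS](mulr1 1); apply: ler_pM => //.
            by rewrite divr_ge0// addr_ge0.
          by have := S1 z; have := S1 (- z); lra.
        have : 0 <= e * v z by rewrite mulr_ge0// ltW.
        have : 0 <= (\1_O z : R) by [].
        have : 0 <= (\1_[set z | O (- z)] z : R) by [].
        by clear; lra.
      have k1 := Sle z (ltW rz).
      have k2 : S (- z) <= \1_[set z | O (- z)] z + e.
        by apply: (Sle (- z)); rewrite enormN ltW.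
      have k3 : 0 <= (\1_(far rho) z : R) by [].
      apply: (@le_trans _ _ (v z * e + (v z) * ((\1_O z + \1_[set z | O (- z)] z) / 2))).
        by rewrite -mulrDr ler_wpM2l//; move: k1 k2; clear; lra.
      have k4 : v z * ((\1_O z + \1_[set z | O (- z)] z) / 2) <=
          1 * ((\1_O z + \1_[set z | O (- z)] z) / 2).
        by rewrite ler_wpM2r// divr_ge0// addr_ge0.
      by move: k3 k4; clear; lra.
    rewrite ge0_integralD//; last 2 first.
    - by move=> z _; rewrite !adde_ge0.
    - by apply: emeasurable_funD => //; exact: emeasurable_funD.
    rewrite ge0_integralD//; last 2 first.
    - by move=> z _; rewrite adde_ge0.
    - exact: emeasurable_funD.
    rewrite ge0_integralD// !ge0_integral_scale ?invr_ge0 ?(ltW e0)//;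
      try (by exact/measurable_EFinP); try (by exact: mI).
    rewrite !integral_indicT// (EFin_Rintegral vI) -EFinM.
    by rewrite !leeD.
  have LN : (L%:E <= (2^-1)%:E * (N O + N [set z | O (- z)%R]) + (2 * e1)%:E)%E.
    have qe : q * S 0 + e * Iv <= e1.
      rewrite -eK /K; have : q * S 0 <= q * e by rewrite ler_wpM2l.
      by have : 0 <= e by [exact: ltW]; clear; lra.
    apply: (@le_trans _ _ ((q * S 0)%:E + J%:E)%E); first by rewrite -EFinD.
    apply: (le_trans (leeD2l _ JN)).
    rewrite addeA -EFinD [in leRHS]ge0_muleDr//.
    have : ((q * S 0 + e * Iv)%:E <= e1%:E)%E by rewrite lee_fin.
    move=> /(leeD2r ((2^-1)%:E * N O + ((2^-1)%:E * N [set z | O (- z)%R] + e1%:E))%E)/le_trans; apply.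
    rewrite (_ : 2 * e1 = e1 + e1); last by rewrite mulr_natl mulr2n.
    by rewrite EFinD [leLHS]addeC -!addeA.
  have mE : measurable [set w | cube c delta (X h w) /\ 8^-1 <= enorm (X h w)].
    by apply: (measurable_preX (A := cube c delta `&` far 8^-1)) => //; apply: measurableI => //; exact: measurable_cube.
  rewrite -integral_indicT//.
  apply: (@le_trans _ _ (\int[P]_w (4%:E * (v (X h w) * S (X h w))%:E +
      (\1_[set w | far rho (X h w)] w : R)%:E))%E).
    apply: ge0_le_integral_any => w _; rewrite lee_fin//.
    have fge : 0 <= v (X h w) * S (X h w) by rewrite mulr_ge0.
    have [[cw w8]|Ew] := pselect (cube c delta (X h w) /\ 8^-1 <= enorm (X h w)); last first.
      by rewrite indic_out// addr_ge0// mulr_ge0.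
    rewrite indic_in//; have [rz|rz] := leP rho (enorm (X h w)).
      by rewrite farI indic_in// lerDr mulr_ge0.
    have k1 := vge _ w8 (ltW rz); have k2 := Snear _ cw.
    have : 2^-1 * 2^-1 <= v (X h w) * S (X h w) by rewrite ler_pM// invr_ge0.
    have : 0 <= (\1_[set w | far rho (X h w)] w : R) by [].
    clear; lra.
  have p4 w : (0 <= 4%:E * (v (X h w) * S (X h w))%:E)%E.
    by rewrite mule_ge0// lee_fin mulr_ge0.
  have m4 : measurable_fun setT (fun w => 4%:E * (v (X h w) * S (X h w))%:E)%E.
    exact: emeasurable_funM.
  rewrite ge0_integralD//; try (by exact: mI).
  rewrite ge0_integral_scale//; last by move=> w; rewrite lee_fin mulr_ge0.
  rewrite fI integral_indicT// -EFinM.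
  apply: (@le_trans _ _ ((4 * E1)%:E + (e1 * h)%:E)%E); first by apply: leeD.
  apply: (@le_trans _ _ (h%:E * (4%:E * L%:E + (5 * e1)%:E))%E).
    rewrite [leRHS](_ : _ = (h * (4 * L + 5 * e1))%:E)// -EFinD lee_fin.
    by move: E1le; clear; lra.
  rewrite lee_wpmul2l ?lee_fin//.
  apply: (@le_trans _ _ (4%:E * ((2^-1)%:E * (N O + N [set z | O (- z)%R]) + (2 * e1)%:E) + (5 * e1)%:E)%E).
    by rewrite leeD2r// lee_wpmul2l.
  have : (0 <= N O + N [set z | O (- z)%R])%E by rewrite adde_ge0.
  case: (N O + N [set z | O (- z)%R])%E => [x| |] // x0; last first.
    by rewrite [in leRHS]gt0_muley ?lte_fin// addye// leey.
  rewrite lee_fin in x0.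
  rewrite [leLHS](_ : _ = (4 * (2^-1 * x + 2 * e1) + 5 * e1)%:E)//.
  rewrite [leRHS](_ : _ = (2 * x + eta)%:E)// lee_fin.
  rewrite (_ : eta = 16 * e1); last by rewrite /e1; field.
  by have := ltW e10; lra.
move=> I8.
have NI : (N (cube c delta) <= (8 * J + e1)%:E)%E.
  rewrite -integral_indicT; last exact: measurable_cube.
  apply: (@le_trans _ _ (\int[N]_z (8%:E * (W z)%:E + (\1_(far rho) z : R)%:E))%E).
    apply: ge0_le_integral_any => z _; rewrite lee_fin//.
    have [cz|cz] := pselect (cube c delta z); last first.
      by rewrite indic_out// addr_ge0// mulr_ge0.
    rewrite indic_in//; have [rz|rz] := leP rho (enorm z).
      by rewrite indic_in// lerDr mulr_ge0.
    have k1 := vge _ (I8 z cz) (ltW rz); have k2 := Snear _ cz.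
    (* Symmetrizing the bump may halve it once more; hence 8 in this estimate against 4 in the
       other. *)
    have : 2^-1 * 4^-1 <= W z.
      by rewrite /W ler_pM ?invr_ge0//; have := S0 (- z); lra.
    have : 0 <= (\1_(far rho) z : R) by [].
    clear -X W far; lra.
  have p8 z : (0 <= 8%:E * (W z)%:E)%E by rewrite mule_ge0// lee_fin.
  have m8 : measurable_fun setT (fun z => 8%:E * (W z)%:E)%E.
    by apply: emeasurable_funM => //; exact/measurable_EFinP.
  rewrite ge0_integralD//; try (by apply: mI; exact: mfar).
  rewrite ge0_integral_scale//; last by exact/measurable_EFinP.
  rewrite (EFin_Rintegral WI) integral_indicT//.
  by rewrite [leRHS](_ : _ = 8%:E * J%:E + e1%:E)%E// leeD2l.
have HO : (E1%:E <= P [set w | O (X h w)] + (2 * e1 * h)%:E)%E.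
  rewrite -fI.
  apply: (@le_trans _ _ (\int[P]_w ((\1_[set w | O (X h w)] w : R)%:E + (e%:E * (v (X h w) * 1)%:E +
      (\1_[set w | far rho (X h w)] w : R)%:E)))%E).
    apply: ge0_le_integral_any => w _; first by rewrite lee_fin mulr_ge0.
    rewrite -EFinM -!EFinD lee_fin mulr1.
    have k0 : 0 <= e * v (X h w) by rewrite mulr_ge0// ltW.
    have k3 : 0 <= (\1_[set w | O (X h w)] w : R) by [].
    have [rz|rz] := leP rho (enorm (X h w)).
      rewrite farI (indic_in R (rz : far rho (X h w))).
      have : v (X h w) * S (X h w) <= 1 * 1 by rewrite ler_pM.
      move: k0 k3; clear; lra.
    have k1 := Sle _ (ltW rz).
    have k4 : 0 <= (\1_[set w | far rho (X h w)] w : R) by [].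
    have k5 : v (X h w) * S (X h w) <= v (X h w) * (\1_O (X h w) + e) by rewrite ler_wpM2l.
    have k6 : v (X h w) * \1_O (X h w) <= 1 * \1_O (X h w) by rewrite ler_wpM2r.
    have k7 : \1_O (X h w) = \1_[set w | O (X h w)] w :> R by [].
    rewrite k7 in k5 k6; move: k4 k5 k6; clear; lra.
  have mev : measurable_fun setT (fun w => e%:E * (v (X h w) * 1)%:E)%E by exact: emeasurable_funM.
  have p1 w : (0 <= e%:E * (v (X h w) * 1)%:E)%E by rewrite mulr1 mule_ge0 ?lee_fin ?(ltW e0).
  have pf w : (0 <= (\1_[set w | far rho (X h w)] w : R)%:E)%E by rewrite lee_fin.
  have mF := mI _ _ _ mfarX.
  have mOI := mI _ _ _ mOX.
  have p2 w : (0 <= e%:E * (v (X h w) * 1)%:E + (\1_[set w | far rho (X h w)] w : R)%:E)%E.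
    exact: adde_ge0.
  have m2 : measurable_fun setT (fun w => e%:E * (v (X h w) * 1)%:E +
      (\1_[set w | far rho (X h w)] w : R)%:E)%E by exact: emeasurable_funD.
  rewrite ge0_integralD// ge0_integralD//.
  rewrite ge0_integral_scale ?(ltW e0)//; last by move=> w; rewrite lee_fin mulr_ge0.
  rewrite !integral_indicT// vIh leeD2l// -EFinM.
  apply: (@le_trans _ _ ((e * E2)%:E + (e1 * h)%:E)%E); first by rewrite leeD2l.
  rewrite -EFinD lee_fin.
  have : e * E2 <= e * (h * (K + 1)) by rewrite ler_wpM2l// ltW.
  rewrite mulrCA eK; clear; lra.
apply: (le_trans (lee_wpmul2l _ NI)); first by rewrite lee_fin.
move: HO; have := measure_ge0 P [set w | O (X h w)].
case: (P [set w | O (X h w)]) => [p| |] //; last by move=> *; rewrite addye// gt0_muley ?lte_fin// leey.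
rewrite -!EFinD -!EFinM !lee_fin => p0 HO.
have k1 : h * J <= h * L by rewrite ler_wpM2l.
have k2 : 0 <= e1 * h by rewrite mulr_ge0// ltW.
rewrite (_ : eta = 16 * e1); last by rewrite /e1; field.
move: k1 k2 p0 HO E1ge; clear; lra.
Qed.

End cube_estimates.

(** Two such indices differ by at most [L], so all of them lie within [L] of the smallest one. *)
Lemma grid_overlap (R : realType) (m L : nat) (y : R) :
  (#|[pred j : 'I_m | (`|y - 2 * (j : nat)%:R| <= L%:R)%R]| <= L.+1)%N.
Proof.
set A := [pred _ | _].
have [j0 j0A|A0] := pickP A; last by rewrite eq_card0.
case: (@arg_minnP _ j0 (fun j => j \in A) (fun j => nat_of_ord j) j0A) => j1 j1A min1.
pose f (j : 'I_m) : 'I_L.+1 := inord (j - j1).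
have close j : j \in A -> (j1 <= j)%N /\ (j - j1 <= L)%N.
  move=> jA; have j1j := min1 j jA; split => //.
  move: jA j1A; rewrite !inE !ler_norml => /andP[h1 h2] /andP[h3 h4].
  have : (2 * (j : nat)%:R - 2 * (j1 : nat)%:R : R) <= L%:R + L%:R by lra.
  by rewrite -mulrBr -natrB// -(ler_nat R) => h5; lra.
have finj : {in A &, injective f}.
  move=> j j' jA j'A; have [a1 a2] := close j jA; have [b1 b2] := close j' j'A.
  move/(congr1 val); rewrite /= !inordK ?ltnS// => h.
  by apply: val_inj => /=; rewrite -(subnK a1) -(subnK b1) h.
by rewrite -(card_in_imset finj) (leq_trans (max_card _))// card_ord.
Qed.

(** * Jump rates in terms of the Levy density *)

Section jump_estimates.
Context {R : realType} {d : nat} {dO : measure_display}.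
Context {Omega : measurableType dO}.
Variables (P : probability Omega R) (X : R -> Omega -> 'rV[R]_d).
Hypothesis d0 : (0 < d)%N.
Hypothesis LX : levy_process P X.
Hypothesis SX : symmetric_process P X.
Variables (b : 'rV[R]_d) (Q : 'M[R]_d) (N : {measure set 'rV[R]_d -> \bar R}).
Hypothesis TX : levy_triplet P X b Q N.
Variable nu : 'rV[R]_d -> R.
Local Notation mu := (lebesgue_rV R d).
Hypothesis mnu : measurable_fun setT nu.
Hypothesis Nnu : forall A, measurable A -> N A = (\int[mu]_(z in A) (nu z)%:E)%E.
Hypothesis nu0 : forall x, x != 0 -> 0 < nu x.
Variables C1 C2 C3 : R.
Hypothesis C11 : 1 <= C1.
Hypothesis nuC1 : forall x y, 2^-1 <= enorm y -> enorm y <= enorm x -> enorm x <= enorm y + 1 ->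
  C1^-1 * nu y <= nu x /\ nu x <= C1 * nu y.
Hypothesis C21 : 1 <= C2.
Hypothesis nuC2 : forall x y, 2^-1 <= enorm y -> enorm y <= enorm x -> nu x <= C2 * nu y.
Hypothesis C31 : 1 <= C3.
Hypothesis nuC3 : forall x y, 1 <= enorm (y - x) ->
  (\int[mu]_(z in [set z | 2^-1 < enorm (z - x) /\ 2^-1 < enorm (z - y)]%R)
     (nu (x - z) * nu (z - y))%R%:E <= (C3 * nu (x - y))%R%:E)%E.

Let D0 : 0 < d%:R :> R. Proof. by rewrite ltr0n. Qed.
Let D1 : 1 <= d%:R :> R. Proof. by rewrite ler1n. Qed.
Let C10 : 0 < C1. Proof. exact: lt_le_trans C11. Qed.

Let half : 'rV[R]_d := 2^-1 *: delta_mx 0 (Ordinal d0).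

Let enorm_half : enorm half = 2^-1.
Proof. by rewrite enorm_scale_delta ger0_norm// invr_ge0. Qed.

Lemma enorm_gt0_neq0 (x : 'rV[R]_d) : 0 < enorm x -> x != 0.
Proof. by move=> x0; apply/eqP => x00; move: x0; rewrite x00 enorm0 ltxx. Qed.

(** The density with its singularity removed, by a constant value inside the ball of radius 1/2. It
    is bounded and comparable at any two points whose norms differ by at most 1. *)
Definition nub (z : 'rV[R]_d) : R := if 2^-1 <= enorm z then nu z else nu half.

Let nu_half : 0 < nu half.
Proof. by apply: nu0; apply: enorm_gt0_neq0; rewrite enorm_half invr_gt0. Qed.

Lemma nubE z : 2^-1 <= enorm z -> nub z = nu z. Proof. by rewrite /nub => ->. Qed.

Lemma nub_gt0 z : 0 < nub z.
Proof.
rewrite /nub; case: ifPn => // z2; apply: nu0; apply: enorm_gt0_neq0.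
by apply: lt_le_trans z2; rewrite invr_gt0.
Qed.

Lemma nub_le z : nub z <= C2 * nu half.
Proof.
rewrite /nub; case: ifPn => z2.
  by apply: nuC2; rewrite enorm_half.
by rewrite ler_peMl// ltW.
Qed.

Let nu_le x y : 2^-1 <= enorm y -> 2^-1 <= enorm x -> enorm x <= enorm y + 1 ->
  enorm y <= enorm x + 1 -> nu x <= C1 * nu y.
Proof.
move=> y2 x2 xy yx; have [h|h] := leP (enorm y) (enorm x).
  by have [] := nuC1 y2 h xy.
have [+ _] := nuC1 x2 (ltW h) yx.
by rewrite ler_pdivrMl.
Qed.

Lemma nub_doubling z z' : enorm z <= enorm z' + 1 -> enorm z' <= enorm z + 1 ->
  nub z <= C1 * nub z'.
Proof.
rewrite /nub => h1 h2; case: ifPn => z2; case: ifPn => z'2.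
- exact: nu_le.
- by apply: nu_le; rewrite ?enorm_half//; move: z'2; rewrite -ltNge; lra.
- by apply: nu_le; rewrite ?enorm_half//; move: z2; rewrite -ltNge; lra.
- by rewrite ler_peMl// ltW.
Qed.

Lemma measurable_nub : measurable_fun setT nub.
Proof.
apply: measurable_fun_if => //.
- apply: (measurable_fun_bool true); rewrite setTI.
  rewrite (_ : _ @^-1` _ = [set z | 2^-1 <= enorm z])//.
  by apply: measurable_ge_set; exact: measurable_enorm.
- exact: measurable_funTS.
Qed.

(** Chosen so that [d (4 d + 1) delta = 1/16]: if a small cube meets [|w| >= 1/8], its enlargement
    stays at distance at least [a0 = 1 / (16 d)] from the origin, where [N] is finite. *)
Let delta : R := (16 * d%:R * (4 * d%:R + 1))^-1.

Let delta0 : 0 < delta.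
Proof. by rewrite invr_gt0 !mulr_gt0// ltr_wpDl// mulr_ge0. Qed.

Let deltaE : d%:R * (4 * d%:R + 1) * delta = 16^-1.
Proof.
rewrite /delta; have := gt_eqF D0; have : 4 * d%:R + 1 != 0 :> R by rewrite gt_eqF// ltr_wpDl// mulr_ge0.
by move: (d%:R : R) => x h1 h2; field; rewrite h1 h2.
Qed.

Lemma enorm_sub_cube (c : 'rV[R]_d) r (w : 'rV[R]_d) : cube c r w -> enorm (w - c) <= d%:R * r.
Proof.
move=> cw; apply: (le_trans (enorm_le_sum _)).
apply: (@le_trans _ _ (\sum_(i < d) r)); last by rewrite sumr_const card_ord mulr_natl.
by apply: ler_sum => i _; rewrite !mxE; exact: cw.
Qed.

Lemma cube_volume c (r : R) : 0 < r -> mu (cube c r) = ((2 * r) ^+ d)%:E.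
Proof.
move=> r0; rewrite cube_itv (lebesgue_rV_box (A := fun i => `[c 0 i - r, c 0 i + r]%classic))//.
rewrite (eq_bigr (fun=> (2 * r)%:E)); last first.
  move=> i _; rewrite lebesgue_measure_itv /= lte_fin ifT; last by lra.
  by rewrite -EFinB; congr EFin; ring.
by rewrite prodEFin prodr_const card_ord.
Qed.

Let dd : d%:R * (4 * d%:R * delta) <= 16^-1.
Proof. by rewrite -deltaE; have := delta0; have := D0; nra. Qed.

Let dd1 : d%:R * delta <= 16^-1.
Proof. by rewrite -deltaE; have := delta0; have := D0; nra. Qed.

(** The lower cube estimate at the centre [-x]. Norms on this cube differ from that of [x] by at
    most 1/16, so (A1)(1) compares [nu] there with [nu x], and [N] of the cube is at least a
    multiple of its volume times [nu x]. *)
Theorem jump_lower : exists2 c, 0 < c & forall x eta, 4 <= enorm x -> 0 < eta ->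
  exists2 h0, 0 < h0 & forall h, 0 < h -> h < h0 ->
  ((h * (c * nu x - eta))%:E <= P [set w | eball (- x) (1 / 2) (X h w)])%E.
Proof.
exists (8^-1 * (C1^-1 * (2 * delta) ^+ d)).
  by rewrite !mulr_gt0 ?invr_gt0// exprn_gt0// mulr_gt0.
move=> x eta x4 eta0.
have far z r : d%:R * r <= 16^-1 -> cube (- x) r z -> enorm (z - (- x)) <= 16^-1.
  by move=> dr /enorm_sub_cube/le_trans; apply.
have big z r : d%:R * r <= 16^-1 -> cube (- x) r z -> enorm x <= enorm z + 16^-1 /\ enorm z <= enorm x + 16^-1.
  move=> dr /(far _ _ dr); rewrite opprK => h1.
  have := enormD (z + x) (- z); have := enormD (z + x) (- x); rewrite !enormN.
  by rewrite addrK (addrC z) addrK (addrC x); lra.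
have n0 : ~ cube (- x) (4 * d%:R * delta) 0 by move=> /(big _ _ dd)[]; rewrite enorm0; lra.
have [h0 h00 H] := cube_estimates d0 LX SX TX delta0 eta0 n0.
exists h0 => // h hp hh; have [_] := H h hp hh.
have near8 z : cube (- x) delta z -> 8^-1 <= enorm z by move=> /(big _ _ dd1)[]; lra.
move=> /(_ near8) H1.
have mc : measurable (cube (- x) delta) by exact: measurable_cube.
have Nge : ((C1^-1 * nu x * (2 * delta) ^+ d)%:E <= N (cube (- x) delta))%E.
  rewrite Nnu// EFinM -(cube_volume (- x) delta0).
  rewrite -integral_cst//; apply: ge0_le_integral_any => z cz /=.
    by rewrite lee_fin mulr_ge0 ?invr_ge0 ?(ltW C10)// ltW// nu0// enorm_gt0_neq0//; lra.
  have [b1 b2] := big _ _ dd1 cz.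
  by rewrite lee_fin ler_pdivrMl//; apply: nu_le; lra.
have PO : (P [set w | cube (- x) (4 * d%:R * delta) (X h w)] <= P [set w | eball (- x) (1 / 2) (X h w)])%E.
  apply: le_measure; rewrite ?inE.
  - exact: (measurable_preimage (levy_measurable LX (ltW hp)) (@measurable_cube _ _ _ _)).
  - exact: (measurable_preimage (levy_measurable LX (ltW hp)) (@measurable_eball _ _ _ _)).
  - by move=> w /= /(far _ _ dd); rewrite /eball /=; lra.
have Nfin : (N (cube (- x) delta) < +oo)%E.
  apply: le_lt_trans (levy_far_finite TX (_ : 0 < 8^-1)); last by rewrite invr_gt0.
  apply: le_measure; rewrite ?inE; last exact: near8.
    exact: mc.
  by apply: measurable_ge_set; exact: measurable_enorm.
have [n NE] : exists n, N (cube (- x) delta) = n%:E.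
  by exists (fine (N (cube (- x) delta))); rewrite fineK// ge0_fin_numE.
rewrite NE in H1 Nge.
have : (h%:E * n%:E <= 8%:E * (P [set w | eball (- x) (1 / 2) (X h w)] + (eta * h)%:E))%E.
  by apply: (le_trans H1); rewrite lee_wpmul2l// leeD2r.
have mE : measurable [set w | eball (- x) (1 / 2) (X h w)].
  exact: (measurable_preimage (levy_measurable LX (ltW hp)) (@measurable_eball _ _ _ _)).
have [p PE] : exists p, P [set w | eball (- x) (1 / 2) (X h w)] = p%:E.
  by exists (fine (P [set w | eball (- x) (1 / 2) (X h w)])); rewrite fineK// fin_num_measure.
rewrite PE; move: Nge => nx.
rewrite [X in (X <= _)%E](_ : _ = (h * n)%:E)// [X in (_ <= X)%E](_ : _ = (8 * (p + eta * h))%:E)//.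
rewrite lee_fin => k1; rewrite !lee_fin in nx *.
have k2 : h * (C1^-1 * nu x * (2 * delta) ^+ d) <= h * n by rewrite ler_wpM2l// ltW.
move: k1 k2; move: (C1^-1) ((2 * delta) ^+ d) (nu x) => c1 c2 c3 k1 k2; lra.
Qed.

Let a0 : R := (16 * d%:R)^-1.

Let far0 : set 'rV[R]_d := [set z | a0 <= enorm z].

Let mfar0 : measurable far0.
Proof. by apply: measurable_ge_set; exact: measurable_enorm. Qed.

Let a00 : 0 < a0. Proof. by rewrite invr_gt0 mulr_gt0. Qed.

Let nuN0 z : far0 z -> 0 <= nu z.
Proof. by move=> z0; rewrite ltW// nu0// enorm_gt0_neq0// (lt_le_trans a00). Qed.

(* The convolution bound [A1_3], with the singularity of [nu] removed. *)
Lemma nub_convolution : exists2 C, 0 <= C & forall x, 4 <= enorm x ->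
  (\int[mu]_(z in far0) (nub (x - z) * nu z)%:E <= (C * nu x)%:E)%E.
Proof.
pose Nf := fine (N far0).
have NfE : N far0 = Nf%:E.
  by rewrite fineK// ge0_fin_numE// (levy_far_finite TX a00).
have Nf0 : 0 <= Nf by rewrite fine_ge0.
pose Vc := (2 * 2^-1 : R) ^+ d.
exists (C1 * Nf + C3 + C2 * nu half * C1 * Vc).
  rewrite !addr_ge0 ?mulr_ge0 ?exprn_ge0 ?mulr_ge0 ?invr_ge0 ?(ltW C10) ?(ltW nu_half)//;
    by [exact: le_trans C31|exact: le_trans C21].
move=> x x4; have nx0 : 0 < nu x by rewrite nu0// enorm_gt0_neq0//; lra.
(* [f2] covers the region of (A1)(3). [f1] covers [|z| <= 1/2], where [nub (x - z)] is comparable to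
   [nu x] and [N far0] is finite; [f3] covers [|z - x| <= 1/2], where the roles are exchanged and
   [nub] is bounded. *)
pose B : set 'rV[R]_d := [set z | 2^-1 < enorm (z - x) /\ 2^-1 < enorm (z - 0)].
pose f1 z := ((C1 * nu x)%:E * (nu z * \1_far0 z)%:E)%E.
pose f2 z := ((nu (x - z) * nu (z - 0)) * \1_B z)%:E.
pose K := C2 * nu half * (C1 * nu x).
pose f3 z := (K%:E * (\1_(cube x 2^-1) z : R)%:E)%E.
have mB : measurable B.
  have m1 y : measurable [set z : 'rV[R]_d | 2^-1 < enorm (z - y)].
    rewrite (_ : [set z | _] = ~` [set z | - 2^-1 <= - enorm (z - y)]); last first.
      by apply/seteqP; split => z /=; rewrite lerN2 ltNge => /negP.
    apply: measurableC; apply: measurable_ge_set; apply: measurableT_comp => //.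
    by apply: measurable_enorm_comp; apply: measurable_rVB => //; exact: measurable_cst.
  by apply: measurableI; exact: m1.
have K0 : 0 <= K.
  by rewrite !mulr_ge0 ?(ltW nx0) ?(ltW C10) ?(ltW nu_half)//; exact: le_trans C21.
have f10 z : (0 <= f1 z)%E.
  apply: mule_ge0; first by rewrite lee_fin mulr_ge0 ?(ltW nx0) ?(ltW C10).
  rewrite lee_fin; have [h|h] := pselect (far0 z); last by rewrite indic_out// mulr0.
  by rewrite indic_in// mulr1 nuN0.
have f20 z : (0 <= f2 z)%E.
  rewrite lee_fin; have [[h1 h2]|h] := pselect (B z); last by rewrite indic_out// mulr0.
  have n1 : 0 < nu (x - z).
    by apply: nu0; apply: enorm_gt0_neq0; rewrite enorm_distC; lra.
  have n2 : 0 < nu (z - 0) by apply: nu0; apply: enorm_gt0_neq0; lra.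
  by rewrite indic_in// mulr1 mulr_ge0// ltW.
have f30 z : (0 <= f3 z)%E by rewrite mule_ge0// lee_fin.
have mf1 : measurable_fun setT f1.
  by apply: emeasurable_funM => //; apply/measurable_EFinP; apply: measurable_funM.
have mf2 : measurable_fun setT f2.
  apply/measurable_EFinP; apply: measurable_funM; last exact: measurable_indic.
  apply: measurable_funM; apply: (measurableT_comp mnu).
    by apply: measurable_rVB => //; exact: measurable_cst.
  by apply: measurable_rVB => //; exact: measurable_cst.
have mf3 : measurable_fun setT f3.
  apply: emeasurable_funM => //; apply/measurable_EFinP.
  by apply: measurable_indic; exact: measurable_cube.
apply: (@le_trans _ _ (\int[mu]_z (f1 z + (f2 z + f3 z)))%E).
  rewrite integral_mkcond; apply: ge0_le_integral_any => z _.
    by rewrite erestrict_ge0// => z' z'0; rewrite lee_fin mulr_ge0 ?nuN0// ltW// nub_gt0.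
  rewrite patchE; case: ifPn => [/set_mem zf|_]; last by rewrite !adde_ge0.
  have nz0 := nuN0 zf.
  have [h1|h1] := leP (enorm (z - x)) 2^-1.
    apply: (@le_trans _ _ (f3 z)); last by rewrite addeA leeDr// adde_ge0.
    rewrite /f3 indic_in; last by move=> i; have := coord_le_enorm (z - x) i; rewrite !mxE; lra.
    rewrite mule1 lee_fin ler_pM ?(ltW (nub_gt0 _))// ?nub_le//.
    have := enorm_sub_ge z x; have := enorm_sub_ge x z; rewrite (enorm_distC x) => h3 h4.
    by apply: nu_le; lra.
  have [h2|h2] := leP (enorm z) 2^-1.
    apply: (@le_trans _ _ (f1 z)); last by rewrite leeDl// adde_ge0.
    rewrite /f1 indic_in// mulr1 -EFinM lee_fin ler_wpM2r//.
    rewrite -(nubE (_ : 2^-1 <= enorm x)); last lra.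
    have := enorm_sub_ge x z; have := enormB x z => h3 h4.
    by apply: nub_doubling; lra.
  apply: (@le_trans _ _ (f2 z)); last by rewrite addeCA leeDl// adde_ge0.
  rewrite /f2 indic_in; last by split; rewrite ?subr0.
  by rewrite mulr1 subr0 nubE// enorm_distC ltW.
rewrite ge0_integralD//; last 2 first.
- by move=> z _; rewrite adde_ge0.
- exact: emeasurable_funD.
rewrite ge0_integralD//.
have -> : (\int[mu]_z f1 z = (C1 * nu x)%:E * N far0)%E.
  rewrite ge0_integral_scale ?mulr_ge0 ?(ltW nx0) ?(ltW C10)//; last 2 first.
  - apply/measurable_EFinP; apply: measurable_funM => //; exact: measurable_indic.
  - move=> z; rewrite lee_fin; have [h|h] := pselect (far0 z); last by rewrite indic_out// mulr0.
    by rewrite indic_in// mulr1 nuN0.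
  rewrite Nnu// [in RHS]integral_mkcond; congr (_ * _)%E; apply: eq_integral => z _.
  by rewrite patchE indicE; case: ifPn; rewrite ?mulr1 ?mulr0.
have -> : (\int[mu]_z f3 z = K%:E * (Vc)%:E)%E.
  rewrite ge0_integral_scale//; last by apply/measurable_EFinP; apply: measurable_indic; exact: measurable_cube.
  rewrite integral_indicT; last exact: measurable_cube.
  by congr (_ * _)%E; apply: cube_volume; rewrite invr_gt0.
have f2le : (\int[mu]_z f2 z <= (C3 * nu x)%:E)%E.
  have x1 : 1 <= enorm (0 - x) by rewrite sub0r enormN; lra.
  have := nuC3 x1; rewrite subr0; apply: le_trans.
  rewrite -/B [in leRHS]integral_mkcond le_eqVlt; apply/orP; left; apply/eqP.
  apply: eq_integral => z _.
  by rewrite patchE /f2 indicE; case: ifPn; rewrite ?mulr1 ?mulr0.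
rewrite NfE -!EFinM.
apply: (le_trans (leeD2l _ (leeD2r _ f2le))).
by rewrite -!EFinD lee_fin /K; move: (nu half) (nu x) (Vc) => y1 y2 y3; lra.
Qed.

Section grid.
Variable m : nat.

Let ctr (k : {ffun 'I_d -> 'I_m}) : 'rV[R]_d :=
  \row_i ((2 * (k i : nat)%:R + 1 - m%:R) * delta).

Lemma grid_cover (w : 'rV[R]_d) : enorm w < m%:R * delta -> exists k, cube (ctr k) delta w.
Proof.
move=> wm; pose y i := (w 0 i / delta + m%:R) / 2.
have wi i : `|w 0 i / delta| < m%:R.
  rewrite normrM normfV (gtr0_norm delta0) ltr_pdivrMr//.
  by apply: le_lt_trans wm; exact: coord_le_enorm.
have y0 i : 0 <= y i by have := wi i; rewrite ltr_norml /y => /andP[]; lra.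
have ym i : (Num.trunc (y i) < m)%N.
  by rewrite truncn_lt_nat//; have := wi i; rewrite ltr_norml /y => /andP[]; lra.
exists [ffun i => Ordinal (ym i)] => i; rewrite mxE ffunE /=.
have /andP[t1 t2] := truncn_itv (y0 i).
move: t1 t2; rewrite -addn1 natrD; move: ((Num.trunc (y i))%:R) => t t1 t2.
have -> : w 0 i = (2 * y i - m%:R) * delta.
  by rewrite /y; have := gt_eqF delta0; move: (delta) => e e0; field; rewrite e0.
rewrite -mulrBl normrM (gtr0_norm delta0) ler_piMl ?(ltW delta0)// ler_norml.
by apply/andP; split; lra.
Qed.

(** The indicator of a cube factors over coordinates, so the sum over all centres is a product of
    one-dimensional counts, each at most [4 d + 1]. *)
Lemma grid_multiplicity (z : 'rV[R]_d) :
  \sum_k \1_(cube (ctr k) (4 * d%:R * delta)) z <= ((4 * d).+1 ^ d)%:R :> R.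
Proof.
pose y i := z 0 i / delta + m%:R - 1.
pose Pr i (j : 'I_m) : bool := `|y i - 2 * (j : nat)%:R| <= (4 * d)%:R.
have E k : \1_(cube (ctr k) (4 * d%:R * delta)) z = \prod_i ((Pr i (k i))%:R : R).
  have [H|H] := pselect (cube (ctr k) (4 * d%:R * delta) z).
    rewrite indic_in// big1// => i _; have := H i; rewrite mxE /Pr /y.
    rewrite (_ : z 0 i - _ = (z 0 i / delta + m%:R - 1 - 2 * (k i : nat)%:R) * delta); last first.
      by have := gt_eqF delta0; move: (delta) => e e0; field; rewrite e0.
    by rewrite normrM (gtr0_norm delta0) ler_pM2r// natrM => ->.
  rewrite indic_out//; have /existsNP[i Hi] := H; rewrite (bigD1 i)//=.
  have -> : Pr i (k i) = false; last by rewrite mul0r.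
  apply/negP => h; apply: Hi.
  rewrite mxE (_ : z 0 i - _ = (z 0 i / delta + m%:R - 1 - 2 * (k i : nat)%:R) * delta); last first.
    by have := gt_eqF delta0; move: (delta) => e e0; field; rewrite e0.
  by rewrite normrM (gtr0_norm delta0) ler_pM2r//; move: h; rewrite /Pr /y natrM.
rewrite (eq_bigr _ (fun k _ => E k)) -(bigA_distr_bigA (fun i j => (Pr i j)%:R)) natrX.
rewrite (_ : _ ^+ d = \prod_(i < d) ((4 * d).+1)%:R); last by rewrite prodr_const card_ord.
apply: ler_prod => i _.
rewrite sumr_ge0//= -natr_sum ler_nat.
apply: leq_trans (@grid_overlap R m (4 * d) (y i)).
by rewrite -sum1_card [leqRHS]big_mkcond /=; apply: leq_sum => j _; rewrite inE /Pr; case: ifP.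
Qed.

End grid.

Lemma finite_threshold (I : finType) (Pr : I -> R -> Prop) :
  (forall i, exists2 h0, 0 < h0 & forall h, 0 < h -> h < h0 -> Pr i h) ->
  exists2 h0, 0 < h0 & forall h, 0 < h -> h < h0 -> forall i, Pr i h.
Proof.
move=> H; have [h0 /= h00 Hh] : \forall h \near (0 : R)^'+, forall i, Pr i h.
  apply: filter_forall => i; have [h0 h00 Hi] := H i.
  near=> h; apply: Hi; first by near: h; exact: nbhs_right_gt.
  by near: h; exact: nbhs_right_lt.
exists h0 => // h hp hh; apply: Hh => //=.
by rewrite sub0r normrN gtr0_norm.
Unshelve. all: by end_near. Qed.

(** On a small cube [nub (x + .)] is constant up to a factor, and the upper cube estimate replaces
    probabilities by [N] of the enlarged cubes and of their reflections. These overlap boundedly, so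
    the sum over cells is a multiple of a convolution integral. The finitely many thresholds in [h]
    have a common one. *)
Theorem jump_upper : exists2 C, 0 <= C & forall x eta, 4 <= enorm x -> 0 < eta ->
  exists2 h0, 0 < h0 & forall h, 0 < h -> h < h0 ->
  (\int[P]_w (nub (x + X h w) * \1_[set v | 8^-1 <= enorm v] (X h w))%:E <=
   (h * (C * nu x + eta))%:E)%E.
Proof.
have [C C0 conv] := nub_convolution.
pose Kov : R := ((4 * d).+1 ^ d)%:R.
(* [Kov] counts overlaps and [C1 * C1] compares [g k] with [nub] on the enlarged cube. The two
   convolutions, at [-x] and [x], bring [C1 * C1 * C] and [C]. *)
pose CC := Kov * (C1 * C1) * (C1 * C1 * C + C).
exists (2 * CC).
  by rewrite !mulr_ge0 ?addr_ge0 ?mulr_ge0// ltW.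
move=> x eta x4 eta0.
have nx0 : 0 < nu x by apply: nu0; apply: enorm_gt0_neq0; lra.
pose Mb := C2 * nu half; have Mb0 : 0 <= Mb.
  by rewrite mulr_ge0 ?(ltW nu_half)//; exact: le_trans C21.
have e10 : 0 < eta / (2 * (Mb + 1)) by rewrite divr_gt0// mulr_gt0// ltr_wpDl.
have [r1 r10 tailP] := tail_small d0 LX SX TX e10.
pose m := (Num.trunc (r1 / delta)).+1.
have mr : r1 <= m%:R * delta by rewrite -ler_pdivrMr//; exact: ltW (truncnS_gt _).
pose ctr (k : {ffun 'I_d -> 'I_m}) : 'rV[R]_d :=
  \row_i ((2 * (k i : nat)%:R + 1 - m%:R) * delta).
pose E k : set 'rV[R]_d := cube (ctr k) delta `&` [set v | 8^-1 <= enorm v].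
pose O k : set 'rV[R]_d := cube (ctr k) (4 * d%:R * delta).
pose act (k : {ffun 'I_d -> 'I_m}) := `[< exists w, E k w >].
pose g k := C1 * nub (x + ctr k).
have g0 k : 0 <= g k by rewrite mulr_ge0 ?(ltW C10)// ltW// nub_gt0.
have O0 k z : act k -> O k z -> a0 <= enorm z.
  move=> /asboolP[w [cw w8]] Oz; have [i wi] := exists_coord_ge d0 w8.
  apply: le_trans (coord_le_enorm z i); have := Oz i; have := cw i.
  have -> : a0 = 8^-1 / d%:R - (4 * d%:R + 1) * delta.
    rewrite (_ : (4 * d%:R + 1) * delta = 16^-1 / d%:R); last first.
      by rewrite -deltaE; field; rewrite gt_eqF.
    by rewrite /a0; field; rewrite gt_eqF.
  move: wi; move: (w 0 i) (z 0 i) (ctr k 0 i) => p q r h1 h2 h3.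
  have h4 := ler_normB (p - r) (q - r); have h5 := ler_normD (p - r - (q - r)) q.
  rewrite (_ : p - r - (q - r) + q = p) in h5; last by ring.
  lra.
have Oc k z : O k z -> enorm (z - ctr k) <= 1.
  by move=> /enorm_sub_cube/le_trans; apply; apply: (le_trans dd); rewrite invf_le1 ?ler1n.
have nO0 k : act k -> ~ O k 0.
  by move=> ak /(O0 k _ ak); rewrite enorm0 leNgt a00.
pose G := \sum_k g k; have G0 : 0 <= G by apply: sumr_ge0.
have e20 : 0 < eta / (2 * (G + 1)) by rewrite divr_gt0// mulr_gt0// ltr_wpDl.
set e1 := eta / (2 * (Mb + 1)) in e10 tailP.
set e2 := eta / (2 * (G + 1)) in e20.
pose A k : \bar R := if act k then (N (O k) + N [set z | O k (- z)%R])%E else 0%E.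
have A0 k : (0 <= A k)%E by rewrite /A; case: ifP => // _; rewrite adde_ge0.
have [h0 h00 Hh] : exists2 h0, 0 < h0 & forall h, 0 < h -> h < h0 -> forall k,
    (P [set w | E k (X h w)] <= h%:E * (2%:E * A k + e2%:E))%E.
  apply: finite_threshold => k; rewrite /A; have [ak|nak] := boolP (act k); last first.
    exists 1 => // h hp _; rewrite (_ : [set w | _] = set0); last first.
      by apply/seteqP; split => // w Ew; move/negP: nak; apply; apply/asboolP; exists (X h w).
    by rewrite measure0 mule0 add0e mule_ge0// lee_fin ltW.
  have [h0 h00 H] := cube_estimates d0 LX SX TX delta0 e20 (nO0 k ak).
  by exists h0 => // h hp hh; have [H1 _] := H h hp hh; exact: H1.
exists h0 => // h hp hh; have PE := Hh h hp hh.
have hp' := ltW hp.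
have mXh := levy_measurable LX hp'.
have mcube c r : measurable (cube c r : set 'rV[R]_d) by exact: measurable_cube.
have mfarr r : measurable [set v : 'rV[R]_d | r <= enorm v].
  by apply: measurable_ge_set; exact: measurable_enorm.
have mE k : measurable (E k) by apply: measurableI.
have mEX k : measurable [set w | E k (X h w)] by exact: (measurable_preimage mXh (mE k)).
have mTX : measurable [set w | r1 <= enorm (X h w)] by exact: (measurable_preimage mXh (mfarr r1)).
have mI d1 (T : measurableType d1) (B : set T) (c : R) : measurable B ->
    measurable_fun setT (fun z => c%:E * (\1_B z : R)%:E)%E.
  by move=> mB; apply: emeasurable_funM => //; apply/measurable_EFinP; exact: measurable_indic.
have step1 : (\int[P]_w (nub (x + X h w) * \1_[set v | (8^-1 <= enorm v)%R] (X h w))%:E <=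
    \sum_k (g k)%:E * P [set w | E k (X h w)] + Mb%:E * P [set w | (r1 <= enorm (X h w))%R])%E.
  apply: (@le_trans _ _ (\int[P]_w (\sum_k ((g k)%:E * (\1_[set w | E k (X h w)] w : R)%:E) +
      Mb%:E * (\1_[set w | r1 <= enorm (X h w)] w : R)%:E))%E).
    apply: ge0_le_integral_any => w _.
      by rewrite lee_fin mulr_ge0// ltW// nub_gt0.
    under eq_bigr do rewrite -EFinM.
    rewrite sumEFin -EFinM -EFinD lee_fin.
    have S0 : 0 <= \sum_k g k * \1_[set w | E k (X h w)] w by apply: sumr_ge0 => k _; rewrite mulr_ge0.
    have [w8|w8] := leP 8^-1 (enorm (X h w)); last first.
      rewrite (_ : \1_[set v | 8^-1 <= enorm v] (X h w) = 0); last first.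
        by rewrite indic_out//=; apply/negP; rewrite -ltNge.
      by rewrite mulr0 addr_ge0// mulr_ge0.
    rewrite (_ : \1_[set v | 8^-1 <= enorm v] (X h w) = 1) ?mulr1; last by rewrite indic_in.
    have [wr|wr] := leP r1 (enorm (X h w)).
      rewrite (_ : \1_[set w | r1 <= enorm (X h w)] w = 1); last by rewrite indic_in.
      by rewrite mulr1 (le_trans (nub_le _))// lerDr.
    have [k ck] := grid_cover (lt_le_trans wr mr).
    apply: (@le_trans _ _ (g k)); last first.
      rewrite (bigD1 k)//= indic_in ?mulr1 -?addrA ?lerDl//.
      by apply: addr_ge0; [apply: sumr_ge0 => j _|]; rewrite mulr_ge0.
    have d1 : enorm (X h w - ctr k) <= 1.
      by apply: (le_trans (enorm_sub_cube ck)); apply: (le_trans dd1); rewrite invf_le1 ?ler1n.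
    have e3 : x + X h w - (x + ctr k) = X h w - ctr k by rewrite opprD addrACA subrr add0r.
    have := enorm_sub_ge (x + X h w) (x + ctr k); have := enorm_sub_ge (x + ctr k) (x + X h w).
    rewrite (enorm_distC (x + ctr k)) e3 => h1 h2.
    by apply: nub_doubling; lra.
  have mS : measurable_fun setT (fun w => \sum_k ((g k)%:E * (\1_[set w | E k (X h w)] w : R)%:E))%E.
    by apply: emeasurable_sum => k; exact: mI.
  have p0 k w : (0 <= (g k)%:E * (\1_[set w | E k (X h w)] w : R)%:E)%E by rewrite mule_ge0// lee_fin.
  rewrite ge0_integralD//; last 3 first.
  - by move=> w _; apply: sume_ge0.
  - by move=> w _; rewrite mule_ge0// lee_fin.
  - exact: mI.
  rewrite ge0_integral_sum//; last by move=> k; exact: mI.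
  rewrite ge0_integral_scale//; last by apply/measurable_EFinP; exact: measurable_indic.
  rewrite integral_indicT// leeD2r//; apply: lee_sum => k _.
  rewrite ge0_integral_scale ?integral_indicT//.
  by apply/measurable_EFinP; exact: measurable_indic.
apply: (le_trans step1).
have step2 : (\sum_k (g k)%:E * A k <= (CC * nu x)%:E)%E.
  pose F k z : R := if act k then g k * ((\1_(O k) z + \1_(O k) (- z)) * nu z) else 0.
  pose Bd z : R := C1 * C1 * ((nub (x + z) + nub (x - z)) * nu z).
  have F0 k z : 0 <= F k z.
    rewrite /F; case: ifP => // ak.
    have [Oz|Oz] := pselect (O k z).
      have nz : 0 <= nu z by apply: nuN0; exact: (O0 k).
      by rewrite mulr_ge0// mulr_ge0// addr_ge0.
    have [ONz|ONz] := pselect (O k (- z)).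
      have nz : 0 <= nu z.
        by apply: nuN0; rewrite /far0 /= -(enormN z); exact: (O0 k _ ak ONz).
      by rewrite mulr_ge0// mulr_ge0// addr_ge0.
    by rewrite !indic_out// addr0 mul0r mulr0.
  have mON k : measurable [set z | O k (- z)].
    by apply: (measurable_preimage _ (mcube _ _)); exact: measurable_rVN.
  have mF k : measurable_fun setT (fun z => (F k z)%:E).
    apply/measurable_EFinP; rewrite /F; case: (act k) => //.
    apply: measurable_funM => //; apply: measurable_funM => //; apply: measurable_funD.
      by apply: measurable_indic; exact: mcube.
    have m1 : measurable_fun setT (\1_[set z | O k (- z)] : 'rV[R]_d -> R).
      by apply: measurable_indic; exact: mON.
    exact: m1.
  have NI (B : set 'rV[R]_d) : measurable B -> (forall z, B z -> 0 <= nu z) ->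
      measurable_fun setT (fun z => (\1_B z * nu z)%:E) /\ (forall z, (0 <= (\1_B z * nu z)%:E)%E) /\
      (\int[mu]_z (\1_B z * nu z)%:E = N B)%E.
    move=> mB B0; split; last split.
    - by apply/measurable_EFinP; apply: measurable_funM => //; exact: measurable_indic.
    - move=> z; rewrite lee_fin; have [h1|h1] := pselect (B z); last by rewrite indic_out// mul0r.
      by rewrite indic_in// mul1r B0.
    - rewrite Nnu// [in RHS]integral_mkcond; apply: eq_integral => z _.
      by rewrite patchE indicE; case: ifPn; rewrite ?mul1r ?mul0r.
  have gA k : ((g k)%:E * A k = \int[mu]_z (F k z)%:E)%E.
    rewrite /A /F; have [ak|nak] := boolP (act k); last by rewrite mule0 integral0.
    have [||m1 [p1 i1]] := NI (O k); [exact: mcube|by move=> z /(O0 k _ ak) /nuN0|].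
    have [||m2 [p2 i2]] := NI [set z | O k (- z)]; [exact: mON| |].
      by move=> z /(O0 k _ ak); rewrite enormN => /nuN0.
    rewrite -i1 -i2 -ge0_integralD// -ge0_integral_scale//; last 2 first.
    - exact: emeasurable_funD.
    - by move=> z; rewrite adde_ge0.
    apply: eq_integral => z _; rewrite -EFinD -EFinM; congr EFin.
    by rewrite -mulrDl.
  under eq_bigr do rewrite gA.
  rewrite -ge0_integral_sum//; last by move=> k z _; rewrite lee_fin.
  have Bd0 z : far0 z -> 0 <= Bd z.
    move=> z0; rewrite /Bd !mulr_ge0 ?(ltW C10)// ?nuN0//.
    by rewrite addr_ge0// ltW// nub_gt0.
  apply: (@le_trans _ _ (\int[mu]_(z in far0) (Kov%:E * (Bd z)%:E))%E).
    rewrite [in leRHS]integral_mkcond; apply: ge0_le_integral_any => z _.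
      by apply: sume_ge0 => k _; rewrite lee_fin.
    rewrite sumEFin patchE; case: ifPn => [/set_mem zf|]; last first.
      move=> /negP nz; rewrite big1// => k _; rewrite /F; case: ifP => // ak.
      have nOz : ~ O k z by move=> /(O0 k _ ak) h1; apply: nz; rewrite inE.
      have nONz : ~ O k (- z).
        by move=> /(O0 k _ ak); rewrite enormN => h1; apply: nz; rewrite inE.
      by rewrite !indic_out// addr0 mul0r mulr0.
    have nz := nuN0 zf; rewrite -EFinM lee_fin.
    pose bp := C1 * C1 * (nub (x + z) * nu z); pose bm := C1 * C1 * (nub (x - z) * nu z).
    have bp0 : 0 <= bp by rewrite /bp !mulr_ge0 ?(ltW C10)// ltW// nub_gt0.
    have bm0 : 0 <= bm by rewrite /bm !mulr_ge0 ?(ltW C10)// ltW// nub_gt0.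
    have gle k v : O k v -> g k <= C1 * C1 * nub (x + v).
      move=> /Oc d1; rewrite /g -mulrA ler_wpM2l ?(ltW C10)//.
      have e3 : x + v - (x + ctr k) = v - ctr k by rewrite opprD addrACA subrr add0r.
      have := enorm_sub_ge (x + v) (x + ctr k); have := enorm_sub_ge (x + ctr k) (x + v).
      rewrite (enorm_distC (x + ctr k)) e3 => h1 h2.
      by apply: nub_doubling; lra.
    apply: (@le_trans _ _ (\sum_k (\1_(O k) z * bp + \1_(O k) (- z) * bm))).
      apply: ler_sum => k _; rewrite /F; case: ifP => ak; last by rewrite addr_ge0// mulr_ge0.
      rewrite (_ : g k * _ = \1_(O k) z * (g k * nu z) + \1_(O k) (- z) * (g k * nu z)); last by ring.
      rewrite lerD//.
        have [Oz|Oz] := pselect (O k z); last by rewrite indic_out// !mul0r.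
        by rewrite indic_in// !mul1r /bp mulrA ler_wpM2r// gle.
      have [Oz|Oz] := pselect (O k (- z)); last by rewrite indic_out// !mul0r.
      by rewrite indic_in// !mul1r /bm mulrA ler_wpM2r// gle.
    rewrite big_split /= -!mulr_suml.
    rewrite (_ : Bd z = bp + bm); last by rewrite /Bd /bp /bm; ring.
    by rewrite mulrDr lerD// ler_wpM2r//; exact: grid_multiplicity.
  have Kov0 : 0 <= Kov by [].
  apply: (@le_trans _ _ (\int[mu]_(z in far0) ((Kov * (C1 * C1) * C1)%:E * (nub (- x - z) * nu z)%:E +
      (Kov * (C1 * C1))%:E * (nub (x - z) * nu z)%:E))%E).
    apply: ge0_le_integral_any => z zf; first by rewrite mule_ge0// lee_fin// Bd0.
    have nz := nuN0 zf.
    rewrite -!EFinM -EFinD lee_fin /Bd.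
    have e3 : enorm (- x - z) = enorm (x + z) by rewrite -opprD enormN.
    (* Reflected to the form required by [nub_convolution], which is then applied at [-x]. *)
    have k1 : nub (x + z) <= C1 * nub (- x - z) by apply: nub_doubling; rewrite e3; lra.
    have k2 : Kov * (C1 * C1) * (nub (x + z) * nu z) <= Kov * (C1 * C1) * (C1 * nub (- x - z) * nu z).
      by rewrite ler_wpM2l ?mulr_ge0 ?(ltW C10)// ler_wpM2r.
    move: k2; move: (nub _) (nub _) (nub _) => y1 y2 y3; lra.
  have mnubz (y : 'rV[R]_d) : measurable_fun setT (fun z : 'rV[R]_d => (nub (y - z) * nu z)%:E).
    apply/measurable_EFinP; apply: measurable_funM => //.
    by apply: (measurableT_comp measurable_nub); apply: measurable_rVB => //; exact: measurable_cst.
  have nn (y z : 'rV[R]_d) : far0 z -> (0 <= (nub (y - z) * nu z)%:E)%E.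
    by move=> zf; rewrite lee_fin mulr_ge0 ?nuN0// ltW// nub_gt0.
  have c0 : (0 <= (Kov * (C1 * C1) * C1)%:E)%E by rewrite lee_fin !mulr_ge0 ?(ltW C10).
  have c0' : (0 <= (Kov * (C1 * C1))%:E)%E by rewrite lee_fin !mulr_ge0 ?(ltW C10).
  rewrite ge0_integralD//; last 4 first.
  - by move=> z zf; rewrite mule_ge0 ?nn.
  - by apply: measurable_funTS; apply: emeasurable_funM.
  - by move=> z zf; rewrite mule_ge0 ?nn.
  - by apply: measurable_funTS; apply: emeasurable_funM.
  rewrite !ge0_integralZl//; [|exact: measurable_funTS|exact: nn|exact: measurable_funTS|exact: nn].
  have x4' : 4 <= enorm (- x) by rewrite enormN.
  have nx' : nu (- x) <= C1 * nu x by apply: nu_le; rewrite ?enormN; lra.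
  apply: (@le_trans _ _ ((Kov * (C1 * C1) * C1)%:E * (C * nu (- x))%:E +
      (Kov * (C1 * C1))%:E * (C * nu x)%:E)%E).
    by apply: leeD; apply: lee_wpmul2l => //; exact: conv.
  rewrite -!EFinM -EFinD lee_fin /CC.
  have : Kov * (C1 * C1) * C1 * (C * nu (- x)) <= Kov * (C1 * C1) * C1 * (C * (C1 * nu x)).
    by rewrite ler_wpM2l ?ler_wpM2l// !mulr_ge0 ?(ltW C10).
  move: (nu _) (nu _) => y1 y2; lra.
have k2 : (Mb%:E * P [set w | (r1 <= enorm (X h w))%R] <= (eta / 2 * h)%:E)%E.
  apply: (@le_trans _ _ (Mb%:E * (e1 * h)%:E)%E); first by rewrite lee_wpmul2l// tailP.
  rewrite -EFinM lee_fin mulrA ler_wpM2r// /e1.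
  rewrite mulrA ler_pdivrMr ?mulr_gt0 ?ltr_wpDl//.
  rewrite (_ : eta / 2 * (2 * (Mb + 1)) = Mb * eta + eta); last by field.
  by rewrite lerDl ltW.
apply: (@le_trans _ _ (\sum_k (g k)%:E * (h%:E * (2%:E * A k + e2%:E)) + (eta / 2 * h)%:E)%E).
  apply: leeD => //; apply: lee_sum => k _.
  by rewrite lee_wpmul2l// lee_fin.
have -> : (\sum_k (g k)%:E * (h%:E * (2%:E * A k + e2%:E)) =
    (2 * h)%:E * (\sum_k (g k)%:E * A k) + (h * e2 * G)%:E)%E.
  transitivity (\sum_k ((2 * h)%:E * ((g k)%:E * A k) + (h * e2 * g k)%:E))%E.
    apply: eq_bigr => k _; rewrite ge0_muleDr//; last 2 first.
    - by rewrite mule_ge0.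
    - by rewrite lee_fin ltW.
    rewrite ge0_muleDr; last 2 first.
    - by rewrite !mule_ge0// lee_fin.
    - by rewrite mule_ge0// lee_fin ltW.
    congr (_ + _)%E; last by rewrite -!EFinM; congr EFin; ring.
    by rewrite !muleA -!EFinM; congr (_%:E * _)%E; ring.
  rewrite big_split /= -ge0_sume_distrr; last by move=> k _; rewrite mule_ge0// lee_fin.
  by rewrite sumEFin -mulr_sumr.
have e2G : e2 * G <= eta / 2.
  rewrite /e2 mulrAC ler_pdivrMr ?mulr_gt0 ?ltr_wpDl//.
  rewrite (_ : eta / 2 * (2 * (G + 1)) = eta * G + eta); last by field.
  by rewrite lerDl ltW.
apply: (@le_trans _ _ ((2 * h)%:E * (CC * nu x)%:E + (h * e2 * G)%:E + (eta / 2 * h)%:E)%E).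
  by rewrite !leeD2r// lee_wpmul2l// lee_fin mulr_ge0.
rewrite -EFinM -!EFinD lee_fin.
have : h * (e2 * G) <= h * (eta / 2) by rewrite ler_wpM2l.
move: (nu x) (e2) (CC) => y1 y2 y3; lra.
Qed.

End jump_estimates.

(** * Decay of one eigenfunction *)

(** A strict violation would persist on a small cube, which has positive volume. The eigenvalue
    equation holds almost everywhere for each time, whereas the supremum arguments need every
    point. *)
Lemma ae_everywhere (R : realType) (d : nat) (g : 'rV[R]_d -> R) (G : R)
    (O : set 'rV[R]_d) : continuous g -> open O ->
  {ae lebesgue_rV R d, forall y, O y -> g y <= G} -> forall y, O y -> g y <= G.
Proof.
move=> cg oO H y Oy; rewrite leNgt; apply/negP => Gy.
have oU : open (O `&` [set z | G < g z]).
  by apply: openI => //; apply: (open_comp _ (@open_gt R G)) => v _; exact: cg.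
have /nbhs_ballP[e /= e0 eU] := open_nbhs_nbhs (conj oU (conj Oy Gy)).
have e20 : 0 < e / 2 by rewrite divr_gt0.
have cube_sub : cube y (e / 2) `<=` [set z | ~ (O z -> g z <= G)].
  move=> z cz; have [Oz Gz] : (O `&` [set z | G < g z]) z.
    apply: eU; split => // i j; rewrite ord1 /ball /= distrC.
    by apply: le_lt_trans (cz j) _; rewrite ltr_pdivrMr// mulr_natr mulr2n ltrDl.
  by move=> /(_ Oz); rewrite leNgt Gz.
have [B [mB B0 HB]] := H.
have : (lebesgue_rV R d (cube y (e / 2)) <= lebesgue_rV R d B)%E.
  apply: le_measure; rewrite ?inE//; first exact: measurable_cube.
  by move=> z /cube_sub zz; apply: HB.
rewrite B0 cube_volume// lee_fin leNgt => /negP; apply.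
by rewrite exprn_gt0// mulr_gt0.
Qed.

Lemma continuous_norm_fun (R : realType) (d : nat) (g : 'rV[R]_d -> R) :
  continuous g -> continuous (fun y => `|g y|).
Proof. by move=> cg y; apply: (@cvg_norm _ _ _ (nbhs y)); exact: cg. Qed.

Lemma continuous_sub_barrier (R : realType) (d : nat) (g : 'rV[R]_d -> R) (A a : R)
    (x : 'rV[R]_d) : continuous g -> continuous (fun y => g y - A * barrier a (y - x)).
Proof.
move=> cg y; apply: (@cvgB _ _ _ (nbhs y)); first exact: cg.
apply: (@cvgM _ _ (nbhs y)); first exact: cvg_cst.
apply: (@continuous_comp _ _ _ (fun y : 'rV[R]_d => y - x) (barrier a)).
  by apply: (@cvgB _ _ _ (nbhs y) _ id (cst x)); [exact: cvg_id|exact: cvg_cst].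
exact: continuous_barrier.
Qed.

Lemma one_sub_expR_ge (R : realType) (u : R) : 0 <= u -> u <= 1 -> u / 2 <= 1 - expR (- u).
Proof.
move=> u0 u1; have e2 := expR_ge1Dx u.
have e3 : expR (- u) * expR u = 1 by rewrite -expRD addNr expR0.
have e4 := expR_ge0 (- u).
move: (expR u) (expR (- u)) e2 e3 e4 => v w e2 e3 e4.
have k : w * (1 + u) <= w * v by rewrite ler_wpM2l.
rewrite e3 in k; nra.
Qed.

Section eigenfunction.
Context {R : realType} {d : nat} {dO : measure_display}.
Context {Omega : measurableType dO}.
Variables (P : probability Omega R) (X : R -> Omega -> 'rV[R]_d).
Hypothesis d0 : (0 < d)%N.
Hypothesis LX : levy_process P X.
Hypothesis SX : symmetric_process P X.
Variables (b : 'rV[R]_d) (Q : 'M[R]_d) (N : {measure set 'rV[R]_d -> \bar R}).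
Hypothesis TX : levy_triplet P X b Q N.
Local Notation mu := (lebesgue_rV R d).
Variables nu nb : 'rV[R]_d -> R.
Variables C1 CU cL : R.
Hypothesis C11 : 1 <= C1.
Hypothesis CU0 : 0 <= CU.
Hypothesis cL0 : 0 < cL.
Hypothesis mnb : measurable_fun setT nb.
Hypothesis nb0 : forall z, 0 < nb z.
Hypothesis nbE : forall z, 2^-1 <= enorm z -> nb z = nu z.
Hypothesis nb_doubling : forall z z', enorm z <= enorm z' + 1 -> enorm z' <= enorm z + 1 ->
  nb z <= C1 * nb z'.
Hypothesis upper : forall x eta, 4 <= enorm x -> 0 < eta ->
  exists2 h0, 0 < h0 & forall h, 0 < h -> h < h0 ->
  (\int[P]_w (nb (x + X h w) * \1_[set v | (8^-1 <= enorm v)%R] (X h w))%:E <=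
   (h * (CU * nu x + eta))%:E)%E.
Hypothesis lower : forall x eta, 4 <= enorm x -> 0 < eta ->
  exists2 h0, 0 < h0 & forall h, 0 < h -> h < h0 ->
  ((h * (cL * nu x - eta))%:E <= P [set w | eball (- x) (1 / 2) (X h w)])%E.

Let C10 : 0 < C1. Proof. exact: lt_le_trans C11. Qed.
Let D0 : 0 < d%:R :> R. Proof. by rewrite ltr0n. Qed.

(** The frequency for which the barrier reaches 1 at distance 1/2; [cf] is its growth rate. *)
Let a1 : R := 4 * d%:R.
Let a10 : 0 < a1. Proof. by rewrite mulr_gt0. Qed.
Let f := @barrier R d a1.
Let cf : R := 2 * d%:R * psi_bound Q N a1.
Let cf0 : 0 <= cf. Proof. by rewrite !mulr_ge0// psi_bound_ge0. Qed.

Let f_ge1 z : 2^-1 <= enorm z -> 1 <= f z.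
Proof.
by move=> z2; apply: (barrier_ge1 d0 a10 _ z2); rewrite /a1 mulrAC; lra.
Qed.

Let f_ge0 z : 0 <= f z. Proof. exact: barrier_ge0. Qed.

Let expectation_f y h : 0 <= h -> (\int[P]_w (f (y + X h w))%:E <= (f y + h * cf)%:E)%E.
Proof. by move=> h0; exact: (expectation_barrier_le LX SX TX y (ltW a10) h0). Qed.

Let measurable_f : measurable_fun setT f.
Proof. by apply: continuous_measurable_rV; exact: continuous_barrier. Qed.

Variable V : 'rV[R]_d -> R.
Hypothesis mV : measurable_fun setT V.
Hypothesis KV : kato P X V^\-.

Variables (phi : 'rV[R]_d -> R) (lam M : R).
Hypothesis cphi : continuous phi.
Hypothesis phiM : forall z, `|phi z| <= M.
Hypothesis eigen : forall t, 0 < t -> {ae mu, forall x,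
    feynman_kac P X V t phi x = (expR (- lam * t) * phi x)%:E}.

Let mphi : measurable_fun setT phi. Proof. exact: continuous_measurable_rV. Qed.
Let M0 : 0 <= M. Proof. exact: le_trans (normr_ge0 _) (phiM 0). Qed.

Let expR_lam_le2 h : 0 <= h -> h * (`|lam| + 1) <= 2^-1 -> expR (lam * h) <= 2.
Proof.
move=> h0 hl; have l0 := normr_ge0 lam.
have hl' : 0 <= `|lam| * h by rewrite mulr_ge0.
have h2 : `|lam| * h <= 2^-1 by lra.
have k := expR_le1D2x hl' h2.
apply: (@le_trans _ _ (expR (`|lam| * h))); last by lra.
by rewrite ler_expR ler_wpM2r// ler_norm.
Qed.

Let mXh h : 0 < h -> measurable_fun setT (X h).
Proof. by move=> hp; exact: (levy_measurable LX (ltW hp)). Qed.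

(** A maximum principle. Let [m] be the positive part of the supremum of [|phi| - A f] over
    [B(x, 1/2)]. Then [|phi| <= A f + m] on [B(x, 1)], since [f >= 1] outside the half ball; leaving
    [B(x, 1)] needs a jump, paid through [exitP] and [upper]. One step of the semigroup gives
    [m <= exp (- q h) m + 2 h (G + e)] with [q = L - lam], hence [m <= 4 (G + e) / q]. *)
Theorem eigenfunction_upper : exists2 K, 0 <= K & forall (a bq L : R) (x : 'rV[R]_d),
  0 <= a -> 0 <= bq -> 4 <= enorm x -> (forall y, `|phi y| <= a + bq * nb y) ->
  0 <= L -> lam < L -> (forall z, eball x 1 z -> L <= V z) ->
  `|phi x| <= K / (L - lam) * (a + bq * nu x).
Proof.
have [Ce Ce0 exitP] : exists2 C, 0 <= C & forall s, 0 <= s ->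
    (P [set w | (8^-1 <= enorm (X s w))%R] <= (C * s)%:E)%E.
  by apply: (exit_small d0 LX SX TX); rewrite invr_gt0.
pose K0 := C1 * cf + Ce + C1 * CU.
have C10' := ltW C10.
have K00 : 0 <= K0.
  by rewrite /K0; have h1 := mulr_ge0 C10' cf0; have h2 := mulr_ge0 C10' CU0; lra.
exists (4 * K0); first by rewrite mulr_ge0.
move=> a bq L x a0 bq0 x4 phia L0 lamL VL.
pose q := L - lam; have q0 : 0 < q by rewrite subr_gt0.
have nbx : nb x = nu x by apply: nbE; lra.
have nx0 : 0 < nu x by rewrite -nbx.
pose B := eball x (1 / 2 : R).
have Bx : B x by rewrite /B /eball /= subrr enorm0; lra.
(* By doubling, [A] dominates [|phi|] on the whole of [B(x, 1)]. *)
pose A := a + bq * (C1 * nu x).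
have A0 : 0 <= A by rewrite addr_ge0// !mulr_ge0// ltW.
pose Sm : set R := [set `|phi y| - A * f (y - x) | y in B].
have Sm0 : Sm !=set0 by exists (`|phi x| - A * f (x - x)); exists x.
have SmM : ubound Sm M.
  by move=> _ [y _ <-]; rewrite lerBlDr (le_trans (phiM y))// lerDl mulr_ge0.
pose m := Num.max 0 (sup Sm).
have m0 : 0 <= m by rewrite le_max lexx.
have mB y : B y -> `|phi y| <= A * f (y - x) + m.
  move=> By; rewrite -lerBlDl le_max; apply/orP; right.
  by apply: ub_le_sup; [exists M|exists y].
have mle c : 0 <= c -> (forall y, B y -> `|phi y| - A * f (y - x) <= c) -> m <= c.
  move=> c0 H; rewrite /m ge_max c0 /=; apply: ge_sup => // _ [y By <-]; exact: H.
suff : m <= 4 * K0 / q * (a + bq * nu x).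
  apply: le_trans; have := mB x Bx; rewrite subrr /f barrier0 mulr0 add0r; exact.
have key e : 0 < e -> m <= 4 / q * (K0 * (a + bq * nu x) + (bq * C1 + 1) * e).
  move=> e0.
  have [h1 h10 H1] := one_step_upper d0 LX SX TX mV KV L0 M0 e0.
  have [h2 h20 H2] := upper x4 e0.
  pose hm := Num.min (Num.min h1 h2) (Num.min (1 / q) (2^-1 / (`|lam| + 1))).
  have hm0 : 0 < hm by rewrite !lt_min h10 h20 !divr_gt0// ltr_wpDl.
  pose h := hm / 2; have hp : 0 < h by rewrite divr_gt0.
  have hhm : h < hm by rewrite ltr_pdivrMr// mulr_natr mulr2n ltrDl.
  move: hhm; rewrite !lt_min => /andP[/andP[hh1 hh2] /andP[hq hl]].
  have hp' := ltW hp.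
  have hq' : q * h <= 1 by move: hq; rewrite ltr_pdivlMr// mulrC => /ltW.
  have hl' : h * (`|lam| + 1) <= 2^-1 by move: hl; rewrite ltr_pdivlMr ?ltr_wpDl// => /ltW.
  have el := expR_lam_le2 hp' hl'.
  have JU := H2 h hp hh2.
  pose G := A * cf + a * Ce + bq * C1 * (CU * nu x + e).
  have G0 : 0 <= G.
    have k1 := mulr_ge0 A0 cf0; have k2 := mulr_ge0 a0 Ce0.
    have k3 := mulr_ge0 (mulr_ge0 bq0 C10') (addr_ge0 (mulr_ge0 CU0 (ltW nx0)) (ltW e0)).
    by rewrite /G; lra.
  have meanphi y : B y ->
      (\int[P]_w `|phi (y + X h w)%R|%:E <= (A * f (y - x) + m + h * G)%:E)%E.
    move=> By; have By' : enorm (y - x) < 2^-1 by move: By; rewrite /B /eball /= div1r.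
    pose i1 w := (A%:E * (f (y - x + X h w))%:E)%E.
    pose i3 w := (a%:E * (\1_[set w | 8^-1 <= enorm (X h w)] w : R)%:E)%E.
    pose i4 w := ((bq * C1)%:E * (nb (x + X h w) * \1_[set v | (8^-1 <= enorm v)%R] (X h w))%:E)%E.
    have mfX : measurable_fun setT (fun w => (f (y - x + X h w))%:E).
      apply/measurable_EFinP; apply: (measurableT_comp measurable_f).
      by apply: measurable_rVD => //; exact: mXh.
    have mfar : measurable [set w | 8^-1 <= enorm (X h w)].
      by apply: (past_measurable LX (t := h)); exact: measurable_past_norm.
    have mind : measurable_fun setT (fun w => (\1_[set w | 8^-1 <= enorm (X h w)] w : R)%:E).
      by apply/measurable_EFinP; exact: measurable_indic.
    have mnbX : measurable_fun setT (fun w => (nb (x + X h w) * \1_[set v | (8^-1 <= enorm v)%R] (X h w))%:E).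
      apply/measurable_EFinP; apply: measurable_funM.
        apply: (measurableT_comp mnb).
        by apply: measurable_rVD => //; exact: mXh.
      have m1 : measurable_fun setT (\1_[set w | 8^-1 <= enorm (X h w)] : Omega -> R) by exact: measurable_indic.
      exact: m1.
    have p1 w : (0 <= i1 w)%E by rewrite mule_ge0// lee_fin.
    have p3 w : (0 <= i3 w)%E by rewrite mule_ge0// lee_fin.
    have p4' w : (0 <= (nb (x + X h w) * \1_[set v | (8^-1 <= enorm v)%R] (X h w))%:E)%E.
      by rewrite lee_fin mulr_ge0// ltW.
    have bqC : 0 <= bq * C1 by rewrite mulr_ge0// ltW.
    have p4 w : (0 <= i4 w)%E by rewrite mule_ge0// lee_fin.
    have mi1 : measurable_fun setT i1 by exact: emeasurable_funM.
    have mi3 : measurable_fun setT i3 by exact: emeasurable_funM.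
    have mi4 : measurable_fun setT i4 by exact: emeasurable_funM.
    apply: (@le_trans _ _ (\int[P]_w (i1 w + (cst m%:E w + (i3 w + i4 w))))%E).
      apply: ge0_le_integral_any => w _; first by rewrite lee_fin.
      rewrite /i1 /i3 /i4 /= -!EFinM -!EFinD lee_fin.
      have E : y + X h w - x = y - x + X h w by rewrite addrAC.
      (* Three positions after time [h]: in the half ball the definition of [m] applies, in the rest
         of the unit ball [A f >= A], and farther out the jump exceeds 1/8. *)
      have [zx|zx] := ltP (enorm (y - x + X h w)) 2^-1.
        apply: (@le_trans _ _ (A * f (y - x + X h w) + m)).
          by rewrite -E; apply: mB; rewrite /B /eball /= E div1r.
        rewrite -addrA lerD2l lerDl addr_ge0 ?mulr_ge0// ltW//.
      have far8 : enorm (y - x + X h w) < 1 \/ 8^-1 <= enorm (X h w).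
        have [|h3] := ltP (enorm (y - x + X h w)) 1; [by left|right].
        by have := enormD (y - x) (X h w); lra.
      have rest : 0 <= A * f (y - x + X h w) + m by rewrite addr_ge0// mulr_ge0.
      have [zx1|zx1] := ltP (enorm (y - x + X h w)) 1.
        apply: (@le_trans _ _ (A * f (y - x + X h w) + m)); last first.
          by rewrite -addrA lerD2l lerDl addr_ge0 ?mulr_ge0// ltW.
        apply: (@le_trans _ _ A); last first.
          by rewrite (@le_trans _ _ (A * f (y - x + X h w)))// ?lerDl// ler_peMr// f_ge1.
        apply: (le_trans (phia _)); rewrite lerD2l ler_wpM2l// -nbx.
        have E2 : y - x + X h w = y + X h w - x by rewrite addrAC.
        have := enorm_sub_ge (y + X h w) x; have := enorm_sub_ge x (y + X h w).
        by rewrite (enorm_distC x) -E2 => h3 h4; apply: nb_doubling; lra.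
      have w8 : 8^-1 <= enorm (X h w) by case: far8 => //; move: zx1; lra.
      rewrite indic_in//= mulr1.
      rewrite (_ : \1_[set v | 8^-1 <= enorm v] (X h w) = 1) ?mulr1; last by rewrite indic_in.
      have k1 : nb (y + X h w) <= C1 * nb (x + X h w).
        have E2 : y + X h w - (x + X h w) = y - x by rewrite opprD addrACA subrr addr0.
        have := enorm_sub_ge (y + X h w) (x + X h w); have := enorm_sub_ge (x + X h w) (y + X h w).
        by rewrite (enorm_distC (x + X h w)) E2 => h3 h4; apply: nb_doubling; lra.
      have k2 : bq * nb (y + X h w) <= bq * (C1 * nb (x + X h w)) by rewrite ler_wpM2l.
      have := phia (y + X h w).
      move: (nb _) (nb _) k1 k2 rest => y1 y2 k1 k2 rest k3; lra.
    have p34 w : (0 <= i3 w + i4 w)%E by rewrite adde_ge0.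
    have m34 : measurable_fun setT (fun w => i3 w + i4 w)%E by exact: emeasurable_funD.
    have pc (w : Omega) : (0 <= cst m%:E w)%E by rewrite lee_fin.
    have p234 w : (0 <= cst m%:E w + (i3 w + i4 w))%E by rewrite adde_ge0.
    have m234 : measurable_fun setT (fun w => cst m%:E w + (i3 w + i4 w))%E by exact: emeasurable_funD.
    rewrite ge0_integralD// ge0_integralD// ge0_integralD//.
    rewrite integral_cst//= probability_setT mule1.
    have -> : (\int[P]_w i1 w = A%:E * \int[P]_w (f (y - x + X h w))%:E)%E.
      by apply: ge0_integral_scale => // w; rewrite lee_fin.
    have -> : (\int[P]_w i3 w = a%:E * P [set w | (8^-1 <= enorm (X h w))%R])%E.
      by rewrite -integral_indicT//; apply: ge0_integral_scale => // w; rewrite lee_fin.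
    have -> : (\int[P]_w i4 w = (bq * C1)%:E *
        \int[P]_w (nb (x + X h w) * \1_[set v | (8^-1 <= enorm v)%R] (X h w))%:E)%E.
      exact: ge0_integral_scale.
    have E1 : (A%:E * \int[P]_w (f (y - x + X h w))%:E <= A%:E * (f (y - x) + h * cf)%:E)%E.
      by rewrite lee_wpmul2l ?lee_fin// expectation_f.
    have E2 : (a%:E * P [set w | (8^-1 <= enorm (X h w))%R] <= a%:E * (Ce * h)%:E)%E.
      by rewrite lee_wpmul2l ?lee_fin// exitP.
    have E3 : ((bq * C1)%:E * \int[P]_w (nb (x + X h w) * \1_[set v | (8^-1 <= enorm v)%R] (X h w))%:E <=
        (bq * C1)%:E * (h * (CU * nu x + e))%:E)%E by rewrite lee_wpmul2l ?lee_fin.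
    apply: (le_trans (leeD E1 (leeD (lexx m%:E) (leeD E2 E3)))).
    rewrite -!EFinM -!EFinD lee_fin /G; move: (f _) (nu x) => y1 y2; lra.
  have phiB : forall y, B y -> `|phi y| - A * f (y - x) <= expR (- q * h) * m + 2 * h * (G + e).
    have cg := @continuous_sub_barrier _ _ (fun y => `|phi y|) A a1 x (continuous_norm_fun cphi).
    apply: (ae_everywhere cg (@open_eball R d x (1 / 2))).
    apply: filterS (eigen hp) => y Hy By.
    have := H1 h hp hh1 x y phi mphi phiM VL By; rewrite Hy abse_EFin.
    have q1 : expR (- (L * h)) <= 1 by rewrite -expR0 ler_expR oppr_le0 mulr_ge0.
    have q2 := expR_ge0 (- (L * h)).
    have := lee_wpmul2l (_ : (0 <= (expR (- (L * h)))%:E)%E) (meanphi y By).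
    rewrite lee_fin => /(_ q2) H3 H4.
    have := le_trans H4 (leeD2r _ H3).
    rewrite -EFinM -EFinD lee_fin normrM (ger0_norm (expR_ge0 _)) => H5.
    have el0 := expR_ge0 (lam * h).
    have H6 := ler_wpM2l el0 H5.
    rewrite mulrA -expRD mulNr addrN expR0 mul1r in H6.
    have e2 : expR (lam * h) * expR (- (L * h)) = expR (- q * h).
      by rewrite -expRD; congr expR; rewrite /q; ring.
    have e3 : expR (- q * h) <= 1.
      by rewrite -expR0 ler_expR mulNr oppr_le0 mulr_ge0// ltW.
    have f0 : 0 <= A * f (y - x) by rewrite mulr_ge0.
    apply: (@le_trans _ _ (expR (- q * h) * m + expR (lam * h) * (h * (G + e)))); last first.
      rewrite lerD2l -[leRHS]mulrA ler_wpM2r//; apply: mulr_ge0 => //.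
      by apply: addr_ge0 => //; exact: ltW.
    have k1 : (1 - expR (- q * h)) * (A * f (y - x)) >= 0 by rewrite mulr_ge0// subr_ge0.
    have k2 : 0 <= expR (lam * h) * ((1 - expR (- (L * h))) * (h * G)).
      by rewrite mulr_ge0// mulr_ge0 ?subr_ge0// mulr_ge0.
    rewrite -e2 in k1 *; move: H6 k1 k2.
    move: (expR (lam * h)) (expR (- (L * h))) (A * f (y - x)) (`|phi y|) => u1 u2 u3 u4; lra.
  have c0 : 0 <= expR (- q * h) * m + 2 * h * (G + e).
    apply: addr_ge0; first by rewrite mulr_ge0// expR_ge0.
    apply: mulr_ge0; first by rewrite mulr_ge0.
    by apply: addr_ge0 => //; exact: ltW.
  have := mle _ c0 phiB => H5.
  have k1 := one_sub_expR_ge (_ : 0 <= q * h) hq'; rewrite mulr_ge0 ?(ltW q0)// in k1.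
  have {}k1 := k1 isT; rewrite -mulNr in k1.
  (* With [exp (lam h) <= 2] this is the origin of the 4 in [K]: one factor 2 from that bound, one
     from [1 - exp (- u) >= u / 2]. *)
  have k2 : q * h / 2 * m <= (1 - expR (- q * h)) * m by rewrite ler_wpM2r.
  have k3 : h * (q * m) <= h * (4 * (G + e)) by move: H5 k2; move: (expR _) => u1; lra.
  rewrite ler_pM2l// in k3.
  rewrite mulrAC ler_pdivlMr// mulrC; apply: (le_trans k3); rewrite ler_wpM2l//.
  rewrite /G /K0 /A.
  have c1 : 0 <= C1 - 1 by rewrite subr_ge0.
  have k4 := mulr_ge0 c1 (mulr_ge0 a0 cf0).
  have k5 : 0 <= a * (C1 * CU) by rewrite !mulr_ge0// ltW.
  have k6 : 0 <= bq * nu x * Ce by rewrite !mulr_ge0// ltW.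
  lra.
have qq : 0 < 4 / q * (bq * C1 + 1) by rewrite mulr_gt0 ?divr_gt0// ltr_wpDl// mulr_ge0// ltW.
apply/ler_addgt0Pl => e e0.
have := key (e / (4 / q * (bq * C1 + 1))) (divr_gt0 e0 qq).
rewrite mulrDr (_ : 4 / q * ((bq * C1 + 1) * _) = e); last first.
  by rewrite mulrA mulrCA mulfV ?mulr1// gt_eqF.
by rewrite (_ : 4 / q * _ = 4 * K0 / q * (a + bq * nu x)) ?[e + _]addrC//; ring.
Qed.

Hypothesis KW : kato P X (fun z => (V^\+)%R z * \1_(eball 0 2) z).
Hypothesis phi0 : forall z, 0 <= phi z.

(** Dual maximum principle: [n] is the positive part of the supremum of [k (1 - f) - phi] over the
    half ball. Jumps into [B(0, 1)], where [phi >= p0], feed the value at rate about [Th]. As [k] is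
    small enough for this gain to exceed the loss from killing and from the barrier, one step yields
    [n <= exp (- q h) n], so [n = 0], and [k <= phi x] because [f] vanishes at the centre. *)
Theorem eigenfunction_lower (p0 : R) : 0 < p0 -> (forall z, eball 0 1 z -> p0 <= phi z) ->
  exists2 C, 0 < C & forall (x : 'rV[R]_d) (S : R), 4 <= enorm x -> 1 <= S -> lam < S ->
    (forall z, eball x 1 z -> V z <= S) -> C * nu x / S <= phi x.
Proof.
move=> p00 phip0; have l0 := normr_ge0 lam.
have c1 : 0 < 1 + `|lam| + cf by have := cf0; lra.
exists (p0 * cL / (4 * (1 + `|lam| + cf))); first by rewrite divr_gt0// mulr_gt0.
move=> x S x4 S1 lamS VS.
have nx0 : 0 < nu x by rewrite -nbE//; lra.
pose q := S - lam; have q0 : 0 < q by rewrite subr_gt0.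
have qc0 : 0 < q + cf by have := cf0; lra.
pose Th := p0 * cL * nu x; have Th0 : 0 < Th by rewrite !mulr_gt0.
pose k := Th / (4 * (q + cf)).
have k0 : 0 < k by rewrite divr_gt0// mulr_gt0.
have kE : k * (q + cf) = Th / 4 by rewrite /k; field; rewrite gt_eqF.
suff : k <= phi x.
  (* Here [S >= 1] enters: it gives [S - lam + cf <= (1 + |lam| + cf) S]. *)
  apply: le_trans; rewrite /k (_ : _ / S = Th / (4 * (1 + `|lam| + cf) * S)); last first.
    by rewrite /Th; field; rewrite !gt_eqF//; lra.
  rewrite ler_pM2l// lef_pV2 ?posrE ?mulr_gt0//; last by lra.
  rewrite -mulrA ler_pM2l//; have h1 := ler_norm (- lam); rewrite normrN in h1.
  have s1 : 0 <= S - 1 by rewrite subr_ge0.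
  have h2 := mulr_ge0 s1 (addr_ge0 l0 cf0).
  rewrite /q; lra.
have phiM' z : 0 <= phi z <= M by rewrite phi0 (le_trans (ler_norm _)).
(* With [k (q + cf) = Th / 4] and [(p0 / 2 + 2) e = Th / 4], all losses together stay below the half
   of [Th] that survives the crude bound [exp (- q h) >= 1/2]; this is [Dle]. *)
pose e := Th / (4 * (p0 / 2 + 2)).
have pp : 0 < p0 / 2 + 2 by lra.
have e0 : 0 < e by rewrite divr_gt0// mulr_gt0.
have eE : (p0 / 2 + 2) * e = Th / 4 by rewrite /e; field; rewrite gt_eqF//; lra.
pose B := eball x (1 / 2 : R).
have Bx : B x by rewrite /B /eball /= subrr enorm0; lra.
pose Sm : set R := [set k * (1 - f (y - x)) - phi y | y in B].
have SmM : ubound Sm k.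
  move=> _ [y _ <-]; have := phi0 y; have : 0 <= k * f (y - x) by rewrite mulr_ge0// ltW.
  by lra.
pose n := Num.max 0 (sup Sm).
have n0 : 0 <= n by rewrite le_max lexx.
have nB y : B y -> k * (1 - f (y - x)) - n <= phi y.
  move=> By; rewrite lerBlDl -lerBlDr le_max; apply/orP; right.
  by apply: ub_le_sup; [exists k|exists y].
have nle c : 0 <= c -> (forall y, B y -> k * (1 - f (y - x)) - phi y <= c) -> n <= c.
  move=> c0 H; rewrite /n ge_max c0 /=; apply: ge_sup => [|_ [y By <-]]; last exact: H.
  by exists (k * (1 - f (x - x)) - phi x); exists x.
suff n00 : n <= 0.
  by have := nB x Bx; rewrite subrr /f barrier0; lra.
have S0 : 0 <= S by lra.
have [h1 h10 H1] := one_step_lower d0 LX SX TX mV KW M0 e0.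
have [h2 h20 H2] := lower x4 e0.
pose hm := Num.min (Num.min h1 h2) (Num.min (2^-1 / q) (2^-1 / (`|lam| + 1))).
have hm0 : 0 < hm by rewrite !lt_min h10 h20 !divr_gt0// ltr_wpDl.
pose h := hm / 2; have hp : 0 < h by rewrite divr_gt0.
have hhm : h < hm by rewrite ltr_pdivrMr// mulr_natr mulr2n ltrDl.
move: hhm; rewrite !lt_min => /andP[/andP[hh1 hh2] /andP[hq hl]].
have hp' := ltW hp.
have hq' : q * h <= 2^-1 by move: hq; rewrite ltr_pdivlMr// mulrC => /ltW.
have hl' : h * (`|lam| + 1) <= 2^-1 by move: hl; rewrite ltr_pdivlMr ?ltr_wpDl// => /ltW.
have el := expR_lam_le2 hp' hl'.
have qh0 : 0 < q * h by rewrite mulr_gt0.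
have eq1 : 1 - q * h <= expR (- q * h) by have := expR_ge1Dx (- q * h); rewrite mulNr.
have eq2 : expR (- q * h) < 1 by rewrite -expR0 ltr_expR mulNr oppr_lt0.
pose D := Th - p0 * e - k * cf.
have kq0 : 0 <= k * q by rewrite mulr_ge0// ltW.
have kc0 : 0 <= k * cf by rewrite mulr_ge0// ltW.
have D0' : 0 <= D by rewrite /D; lra.
have Dle : k * q - D / 2 + 2 * e <= 0 by rewrite /D; lra.
have PE := H2 h hp hh2.
have meanphi y : B y -> ((k + p0 * (h * (cL * nu x - e)))%:E <=
    \int[P]_w (phi (y + X h w) * \1_(eball x (1 / 2) `|` eball 0 1) (y + X h w)%R)%:E +
    (k * (f (y - x) + h * cf) + n)%:E)%E.
  move=> By; have By' : enorm (y - x) < 2^-1 by move: By; rewrite /B /eball /= div1r.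
  pose T := eball x (1 / 2) `|` eball (0 : 'rV[R]_d) 1.
  have mT : measurable T by apply: measurableU; exact: measurable_eball.
  pose E := [set w | eball (- x) (1 / 2) (X h w)].
  have mE : measurable E by exact: (measurable_preimage (mXh hp) (@measurable_eball _ _ _ _)).
  have myX : measurable_fun setT (fun w => y + X h w) by apply: measurable_rVD => //; exact: mXh.
  have mfX : measurable_fun setT (fun w => (f (y - x + X h w))%:E).
    apply/measurable_EFinP; apply: (measurableT_comp measurable_f).
    by apply: measurable_rVD => //; exact: mXh.
  have mphiT : measurable_fun setT (fun w => (phi (y + X h w) * \1_T (y + X h w))%:E).
    apply/measurable_EFinP; apply: measurable_funM; first exact: (measurableT_comp mphi myX).
    have m1 : measurable_fun setT (fun v : 'rV[R]_d => \1_T v : R) by exact: measurable_indic.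
    exact: (measurableT_comp m1 myX).
  have mind : measurable_fun setT (fun w => (\1_E w : R)%:E).
    by apply/measurable_EFinP; exact: measurable_indic.
  have p1 w : (0 <= (phi (y + X h w) * \1_T (y + X h w))%:E)%E by rewrite lee_fin mulr_ge0.
  have k0' := ltW k0; have p00' := ltW p00.
  have p2 w : (0 <= k%:E * (f (y - x + X h w))%:E)%E by rewrite mule_ge0// lee_fin.
  have p3 w : (0 <= p0%:E * (\1_E w : R)%:E)%E by rewrite mule_ge0// lee_fin.
  have m2 : measurable_fun setT (fun w => k%:E * (f (y - x + X h w))%:E)%E by exact: emeasurable_funM.
  have m3 : measurable_fun setT (fun w => p0%:E * (\1_E w : R)%:E)%E by exact: emeasurable_funM.
  have pk (w : Omega) : (0 <= cst k%:E w)%E by rewrite lee_fin.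
  have pn (w : Omega) : (0 <= cst n%:E w)%E by rewrite lee_fin.
  have H3 : (\int[P]_w (cst k%:E w + p0%:E * (\1_E w : R)%:E) <=
     \int[P]_w ((phi (y + X h w) * \1_T (y + X h w))%:E +
       (k%:E * (f (y - x + X h w))%:E + cst n%:E w)))%E.
    apply: ge0_le_integral_any => w _ /=; first by rewrite adde_ge0.
    rewrite -!EFinM -!EFinD lee_fin.
    have Exz : y + X h w - x = y - x + X h w by rewrite addrAC.
    have [Bz|Bz] := pselect (B (y + X h w)).
      have nE : ~ E w.
        rewrite /E /eball /= opprK => Ew; move: Bz; rewrite /B /eball /= => Bz.
        have h3 := enormD (y - x) (X h w + x).
        rewrite (_ : y - x + (X h w + x) = y + X h w) in h3; last first.
          by rewrite addrACA addNr addr0.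
        have := enorm_sub_ge x (y + X h w); rewrite (enorm_distC x).
        by move: Ew; lra.
      rewrite (indic_out R nE) mulr0 addr0 indic_in; last by left.
      by have := nB _ Bz; rewrite Exz; lra.
    have f1 : 1 <= f (y - x + X h w).
      apply: f_ge1; rewrite -Exz leNgt; apply/negP => h3; apply: Bz.
      by rewrite /B /eball /= div1r.
    have kf : k * 1 <= k * f (y - x + X h w) by rewrite ler_wpM2l.
    have pT : 0 <= phi (y + X h w) * \1_T (y + X h w) by rewrite mulr_ge0.
    have [Ew|Ew] := pselect (E w); last first.
      by rewrite (indic_out R Ew) mulr0; lra.
    have z0 : eball 0 1 (y + X h w).
      rewrite /eball /= subr0 (_ : y + X h w = (y - x) + (X h w - - x)); last first.
        by rewrite opprK addrACA addNr addr0.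
      by have := enormD (y - x) (X h w - - x); move: Ew; rewrite /E /eball /=; lra.
    rewrite (indic_in R Ew) mulr1 indic_in; last by right.
    by have := phip0 _ z0; lra.
  have m23 : measurable_fun setT (fun w => k%:E * (f (y - x + X h w))%:E + cst n%:E w)%E.
    exact: emeasurable_funD.
  have p23 w : (0 <= k%:E * (f (y - x + X h w))%:E + cst n%:E w)%E by rewrite adde_ge0.
  rewrite ge0_integralD// [in leRHS]ge0_integralD// [in leRHS]ge0_integralD// in H3.
  rewrite !integral_cst//= probability_setT !mule1 in H3.
  have I1 : (\int[P]_w (p0%:E * (\1_E w : R)%:E) = p0%:E * P E)%E.
    by rewrite -(integral_indicT P mE); apply: ge0_integral_scale => // w; rewrite lee_fin.
  have I2 : (\int[P]_w (k%:E * (f (y - x + X h w))%:E) = k%:E * \int[P]_w (f (y - x + X h w))%:E)%E.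
    by apply: ge0_integral_scale => // w; rewrite lee_fin.
  rewrite I1 I2 in H3.
  apply: (@le_trans _ _ (k%:E + p0%:E * P E)%E).
    have E1 : (p0%:E * (h * (cL * nu x - e))%:E <= p0%:E * P E)%E by apply: lee_wpmul2l.
    rewrite [leLHS](_ : _ = k%:E + p0%:E * (h * (cL * nu x - e))%:E)%E//.
    exact: leeD2l.
  apply: (le_trans H3).
  have E2 : (k%:E * \int[P]_w (f (y - x + X h w))%:E <= k%:E * (f (y - x) + h * cf)%:E)%E.
    by apply: lee_wpmul2l; [rewrite lee_fin|exact: expectation_f].
  rewrite [X in (_ <= _ + X)%E](_ : _ = k%:E * (f (y - x) + h * cf)%:E + n%:E)%E//.
  by apply: leeD2l; exact: leeD2r.
have phiB : forall y, B y -> k * (1 - f (y - x)) - phi y <= expR (- q * h) * n.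
  have cg : continuous (fun y => - phi y - k * f (y - x)).
    apply: (@continuous_sub_barrier _ _ (fun y => - phi y)) => y.
    by apply: (@cvgN _ _ _ (nbhs y)); exact: cphi.
  suff H y : B y -> - phi y - k * f (y - x) <= expR (- q * h) * n - k.
    by move=> y /H; lra.
  move: y; apply: (ae_everywhere cg (@open_eball R d x (1 / 2))).
  apply: filterS (eigen hp) => y Hy By.
  have := H1 h hp hh1 x y phi S mphi phiM' x4 S0 VS By; rewrite Hy.
  move: (meanphi y By).
  have : (0 <= \int[P]_w (phi (y + X h w) * \1_(eball x (1 / 2) `|` eball 0 1) (y + X h w)%R)%:E)%E.
    by apply: integral_ge0 => w _; rewrite lee_fin mulr_ge0.
  have e1 := expR_gt0 (- (S * h)).
  case: (integral P _ _) => [r| |] // r0; last first.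
    by move=> _; rewrite gt0_muley ?lte_fin.
  rewrite -EFinD -EFinM lee_fin => K1; rewrite -EFinD lee_fin => K2.
  have el0 := expR_ge0 (lam * h).
  have H6 := ler_wpM2l el0 K2.
  have e2 : expR (lam * h) * expR (- (S * h)) = expR (- q * h).
    by rewrite -expRD; congr expR; rewrite /q; ring.
  have e3 : expR (lam * h) * expR (- lam * h) = 1 by rewrite -expRD mulNr addrN expR0.
  have e4 : expR (lam * h) * (expR (- (S * h)) * r) = expR (- q * h) * r.
    by rewrite mulrA e2.
  have e5 : expR (lam * h) * (expR (- lam * h) * phi y + e * h) =
      phi y + expR (lam * h) * (e * h) by rewrite mulrDr mulrA e3 mul1r.
  rewrite e4 e5 in H6.
  have K3 : expR (- q * h) * (k + p0 * (h * (cL * nu x - e))) <=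
      expR (- q * h) * (r + (k * (f (y - x) + h * cf) + n)).
    by rewrite ler_wpM2l// expR_ge0.
  have K4 : expR (lam * h) * (e * h) <= 2 * (e * h).
    by rewrite ler_wpM2r// mulr_ge0// ltW.
  have f0 : 0 <= k * f (y - x) by rewrite mulr_ge0// ltW.
  have K5 : (1 - expR (- q * h)) * (k * (1 - f (y - x))) <= q * h * k.
    apply: (@le_trans _ _ ((1 - expR (- q * h)) * k)).
      by rewrite ler_wpM2l ?subr_ge0 ?(ltW eq2)//; lra.
    by rewrite ler_wpM2r ?(ltW k0)//; lra.
  have K6 : 0 <= (expR (- q * h) - 2^-1) * (h * D).
    apply: mulr_ge0; last exact: mulr_ge0 hp' D0'.
    by lra.
  have K7 : 0 <= h * (D / 2 - k * q - 2 * e).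
    by apply: (mulr_ge0 hp'); lra.
  move: H6 K3 K4 K5 K6 K7; rewrite /D /Th.
  move: (expR (- q * h)) (expR (lam * h)) (f (y - x)) (phi y) (nu x) => u1 u2 u3 u4 u5; lra.
have := nle _ _ phiB; rewrite mulr_ge0 ?expR_ge0// => /(_ isT) nn.
rewrite leNgt; apply/negP => n1; move: nn; rewrite leNgt => /negP; apply.
by rewrite gtr_pMl.
Qed.

End eigenfunction.

(** * Uniqueness of eigenbases *)

Lemma rv_consD (R : realType) (d : nat) (z : measurableTypeR R * 'rV[R]_d)
    (v : 'rV[R]_d.+1) :
  rv_cons z + v = rv_cons ((z.1 + v 0 0 : measurableTypeR R), z.2 + \row_i v 0 (lift 0 i)).
Proof.
apply/rowP => i; case: (unliftP 0 i) => [j|] ->.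
  by rewrite mxE !rv_consES !mxE.
by rewrite mxE !rv_consE0.
Qed.

(** Induction on the dimension: sections are translated in the remaining coordinates, and the first
    coordinate by invariance of Lebesgue measure on the line. *)
Lemma lebesgue_rV_shift (R : realType) (d : nat) (v : 'rV[R]_d) (A : set 'rV[R]_d) :
  measurable A -> lebesgue_rV R d ((fun x : 'rV[R]_d => x + v) @^-1` A) = lebesgue_rV R d A.
Proof.
elim: d v A => [|d IH] v A mA.
  congr (lebesgue_rV R 0 _); apply/seteqP; split => x /=;
    by rewrite (_ : x + v = x)//; apply/rowP => -[].
pose S := @rv_cons R d @^-1` A.
have mS : measurable S by exact: (measurable_preimage (@measurable_rv_cons R d)).
rewrite [LHS]/= [RHS]/= /lebesgue_rVS /pushforward /product_measure1 -/S.
pose phi (x : measurableTypeR R) := lebesgue_rV R d (xsection S x).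
have mphi : measurable_fun setT phi by exact: measurable_fun_xsection.
have mshift : measurable_fun setT (fun s : measurableTypeR R => (s + v 0 0 : measurableTypeR R)).
  exact: measurable_funD.
transitivity (\int[lebesgue_measure]_x phi (x + v 0 0 : measurableTypeR R)%R)%E.
  apply: eq_integral => x _ /=; rewrite /phi.
  rewrite -(IH (\row_i v 0 (lift 0 i))); last exact: measurable_xsection.
  congr (lebesgue_rV R d _); apply/seteqP; split => y; rewrite /xsection /= !inE /S /=.
    by rewrite rv_consD.
  by rewrite rv_consD.
apply: (ge0_integral_law (f2 := id) mshift _ _ mphi) => //.
by move=> B mB; exact: lebesgue_measure_shift.
Qed.

Lemma integral_rV_shift (R : realType) (d : nat) (v : 'rV[R]_d) (g : 'rV[R]_d -> \bar R) :
  measurable_fun setT g -> (forall x, (0 <= g x)%E) ->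
  (\int[lebesgue_rV R d]_x g (x + v)%R = \int[lebesgue_rV R d]_x g x)%E.
Proof.
move=> mg g0; apply: (ge0_integral_law (f2 := id) _ _ _ mg) => //.
  by apply: measurable_rVD => //; exact: measurable_cst.
by move=> B mB; exact: lebesgue_rV_shift.
Qed.

(** * Square-integrable functions *)

Section square_integrable.
Context {R : realType} {dT : measure_display} {T : measurableType dT}.
Variable mu : {measure set T -> \bar R}.
Implicit Types f g : T -> R.

Lemma integral_sqr_Lnorm f : finite_norm mu 2%:E f ->
  (\int[mu]_x (f x ^+ 2)%:E = (fine 'N[mu]_2%:E[EFin \o f]%E ^+ 2)%:E)%E.
Proof.
rewrite /finite_norm => Nf.
have Nfin : ('N[mu]_2%:E[EFin \o f])%E \is a fin_num by rewrite ge0_fin_numE// Lnorm_ge0.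
have N0 : 0 <= fine 'N[mu]_2%:E[EFin \o f]%E by rewrite fine_ge0// Lnorm_ge0.
rewrite -powR_mulrn// -poweR_EFin fineK//.
rewrite powR_Lnorm ?pnatr_eq0//; apply: eq_integral => x _ /=.
by rewrite powR_mulrn// real_normK// num_real.
Qed.

Lemma integrable_sqr f : measurable_fun setT f -> finite_norm mu 2%:E f ->
  mu.-integrable setT (fun x => (f x ^+ 2)%:E).
Proof.
move=> mf Nf; apply/integrableP; split; first by apply/measurable_EFinP; exact: measurable_funX.
under eq_integral do rewrite gee0_abs ?lee_fin ?sqr_ge0//.
by rewrite (integral_sqr_Lnorm Nf) ltry.
Qed.

Lemma integrable_prod f g : measurable_fun setT f -> finite_norm mu 2%:E f ->
  measurable_fun setT g -> finite_norm mu 2%:E g ->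
  mu.-integrable setT (EFin \o (fun x => f x * g x)).
Proof.
move=> mf Nf mg Ng.
apply: (@le_integrable _ _ _ mu setT measurableT _ (fun x => (f x ^+ 2)%:E + (g x ^+ 2)%:E)%E) => //.
- by apply/measurable_EFinP; exact: measurable_funM.
- move=> x _ /=; rewrite lee_fin (ger0_norm (addr_ge0 (sqr_ge0 _) (sqr_ge0 _))).
  rewrite ler_norml; move: (f x) (g x) => u v.
  have h1 := sqr_ge0 (u + v); have h2 := sqr_ge0 (u - v).
  have h3 := sqr_ge0 u; have h4 := sqr_ge0 v.
  by rewrite sqrrD in h1; rewrite sqrrB in h2; lra.
- by apply: integrableD => //; exact: integrable_sqr.
Qed.

Lemma Lnorm_cvg0_integral_sqr (F : nat -> T -> R) :
  ('N[mu]_2%:E[EFin \o F n] @[n --> \oo] --> 0)%E ->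
  forall e, 0 < e -> exists n0, forall n, (n0 <= n)%N ->
  (\int[mu]_x (F n x ^+ 2)%:E <= e%:E)%E.
Proof.
move=> /fine_cvgP[Nfin N0] e e0.
have se0 : 0 < Num.sqrt e by rewrite sqrtr_gt0.
have [n1 _ H1] := Nfin; have /cvgrPdist_lt/(_ _ se0)[n2 _ H2] := N0.
exists (maxn n1 n2) => n; rewrite geq_max => /andP[h1 h2].
have Nn := H1 n h1; have := H2 n h2; rewrite /= sub0r normrN => le.
rewrite integral_sqr_Lnorm; last by move: Nn; rewrite /finite_norm ge0_fin_numE// Lnorm_ge0.
rewrite lee_fin -(sqr_sqrtr (ltW e0)) ler_sqr ?nnegrE ?sqrtr_ge0 ?fine_ge0 ?Lnorm_ge0//.
by apply: ltW; apply: le_lt_trans le; exact: ler_norm.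
Qed.

End square_integrable.

(** * Linearity and an L2 estimate for one Feynman-Kac operator *)

Section feynman_kac_operator.
Context {R : realType} {d : nat} {dO : measure_display}.
Context {Omega : measurableType dO}.
Variables (P : probability Omega R) (X : R -> Omega -> 'rV[R]_d).
Hypothesis LX : levy_process P X.
Local Notation mu := (lebesgue_rV R d).

Let mX t : 0 <= t -> measurable_fun setT (X t).
Proof. by move=> t0; exact: levy_measurable LX t t0. Qed.

Variable V : 'rV[R]_d -> R.
Hypothesis mV : measurable_fun setT V.
Local Notation VN := (V^\-)%R.

Variable h : R.
Hypothesis h0 : 0 < h.
Hypothesis small : forall z, (\int[P]_w occupation X VN 0 h z w <= 8^-1%:E)%E.

Let h0' : 0 <= h. Proof. exact: ltW. Qed.
Let mVN : measurable_fun setT VN. Proof. exact: measurable_funrneg. Qed.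
Let VN0 z : 0 <= VN z. Proof. exact: funrneg_ge0. Qed.

Let expectation_weight y : (\int[P]_w fk_weight X V h y w <= 2%:E)%E.
Proof.
apply: le_trans (khasminskii LX mVN VN0 h0 small _ y); last by lra.
apply: ge0_le_integral_any => w _; first exact: fk_weight_ge0.
exact: (fk_weight_le LX mV).
Qed.

Let integrable_weight y (f : 'rV[R]_d -> R) : measurable_fun setT f ->
  (exists M, forall z, `|f z| <= M) ->
  P.-integrable setT (fun w => fk_weight X V h y w * (f (y + X h w)%R)%:E)%E.
Proof.
move=> mf [M fM].
have M0 : 0 <= M by exact: le_trans (normr_ge0 _) (fM 0).
have mW : measurable_fun setT (fk_weight X V h y) by exact: (measurable_fk_weight LX mV).
have mfy : measurable_fun setT (fun w => (f (y + X h w))%:E).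
  apply/measurable_EFinP; apply: (measurableT_comp mf).
  by apply: measurable_rVD; [exact: measurable_cst|exact: mX].
apply/integrableP; split; first exact: emeasurable_funM.
apply: (@le_lt_trans _ _ (\int[P]_w (M%:E * fk_weight X V h y w))%E).
  apply: ge0_le_integral_any => w _ //=.
  rewrite abseM (gee0_abs (fk_weight_ge0 _ _ _ _ _)) muleC.
  by apply: lee_wpmul2r; [exact: fk_weight_ge0|rewrite lee_fin].
rewrite ge0_integral_scale//; last by move=> w; exact: fk_weight_ge0.
apply: (@le_lt_trans _ _ (M%:E * 2%:E)%E); last by rewrite -EFinM ltry.
by apply: lee_wpmul2l; rewrite ?lee_fin//; exact: expectation_weight.
Qed.

Lemma feynman_kac_subZ (f g : 'rV[R]_d -> R) (c : R) y :
  measurable_fun setT f -> (exists M, forall z, `|f z| <= M) ->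
  measurable_fun setT g -> (exists M, forall z, `|g z| <= M) ->
  (feynman_kac P X V h (fun z => (f z - c * g z)%R) y =
   feynman_kac P X V h f y - c%:E * feynman_kac P X V h g y)%E.
Proof.
move=> mf bf mg bg; rewrite !feynman_kac_weight.
have If := integrable_weight y mf bf; have Ig := integrable_weight y mg bg.
rewrite -(integralZl measurableT Ig).
have Icg := @integrableZl _ _ _ P setT measurableT c _ Ig.
rewrite -integralB//.
have bsub : exists M, forall z, `|f z - c * g z| <= M.
  have [M fM] := bf; have [M' gM] := bg; exists (M + `|c| * M') => z.
  by apply: (le_trans (ler_normB _ _)); rewrite normrM lerD// ler_wpM2l.
have msub : measurable_fun setT (fun z => f z - c * g z).
  by apply: measurable_funB => //; exact: measurable_funM.
have /integrableP[mfg _] := integrable_weight y msub bsub.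
have /integrableP[mfcg _] := integrableB measurableT If Icg.
apply: ae_eq_integral => //.
(* Applied to the constant 1, integrability makes the weight finite almost surely, so that it
   distributes over the difference. *)
have I1 : P.-integrable setT (fun w => fk_weight X V h y w * (cst 1 (y + X h w))%:E)%E.
  by apply: integrable_weight => //; exists 1 => z; rewrite normr1.
apply: filterS (integrable_ae measurableT I1) => w /(_ I) /=; rewrite mule1 => fin _.
by rewrite EFinB muleBr// EFinM muleCA.
Qed.

(* AM-GM under the expectation, with [weight ^ 2 <= expeR (occupation of 2 V^-)]
   controlled by Khasminskii's lemma. *)
Lemma feynman_kac_young (f : 'rV[R]_d -> R) (a theta : R) y : measurable_fun setT f ->
  0 <= a -> 0 < theta ->
  (a%:E * `|feynman_kac P X V h f y| <=
   theta^-1%:E * \int[P]_w (f (y + X h w) ^+ 2)%:E + (2 * theta * a ^+ 2)%:E)%E.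
Proof.
move=> mf a0 th0; rewrite feynman_kac_weight.
pose W2 z := 2 * VN z.
have mW2 : measurable_fun setT W2 by exact: measurable_funM.
have W20 z : 0 <= W2 z by rewrite mulr_ge0.
have occ2 z w : occupation X W2 0 h z w = (2%:E * occupation X VN 0 h z w)%E.
  rewrite /occupation /W2; under eq_integral do rewrite EFinM.
  apply: ge0_integralZl_EFin => //; first by move=> s _; rewrite lee_fin.
  apply: (measurable_in_path LX mVN z w h0') => //.
  by move=> s; rewrite /= in_itv /= => /andP[-> /ltW ->].
have mo z : measurable_fun setT (occupation X VN 0 h z) by exact: (measurable_occupation LX mVN).
have small2 z : (\int[P]_w occupation X W2 0 h z w <= 4^-1%:E)%E.
  under eq_integral do rewrite occ2.
  rewrite ge0_integral_scale//; last by move=> w; exact: occupation_ge0.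
  apply: (@le_trans _ _ (2%:E * 8^-1%:E)%E); first by apply: lee_wpmul2l.
  by rewrite -EFinM lee_fin; lra.
have U2 := khasminskii LX mW2 W20 h0 small2 (lexx _) y.
pose U w := expeR (occupation X W2 0 h y w).
have U0 w : (0 <= U w)%E by exact: expeR_ge0.
have mU : measurable_fun setT U.
  apply: (measurableT_comp (@measurable_expeR R setT)).
  exact: (measurable_occupation LX mW2).
have mf2 : measurable_fun setT (fun w => (f (y + X h w) ^+ 2)%:E).
  apply/measurable_EFinP; apply: measurable_funX; apply: (measurableT_comp mf).
  by apply: measurable_rVD; [exact: measurable_cst|exact: mX].
have f20 w : (0 <= (f (y + X h w) ^+ 2)%:E)%E by rewrite lee_fin sqr_ge0.
have mfy : measurable_fun setT (fun w => (f (y + X h w))%:E).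
  apply/measurable_EFinP; apply: (measurableT_comp mf).
  by apply: measurable_rVD; [exact: measurable_cst|exact: mX].
have mW : measurable_fun setT (fk_weight X V h y) by exact: (measurable_fk_weight LX mV).
have mabs : measurable_fun setT (fun w => `|fk_weight X V h y w * (f (y + X h w)%R)%:E|)%E.
  by apply: measurableT_comp => //; exact: emeasurable_funM.
have thi : 0 <= theta^-1 by rewrite invr_ge0 ltW.
have tha : 0 <= theta * a ^+ 2 by rewrite mulr_ge0 ?sqr_ge0// ltW.
apply: (@le_trans _ _ (\int[P]_w (theta^-1%:E * (f (y + X h w) ^+ 2)%:E +
    (theta * a ^+ 2)%:E * U w))%E).
  apply: (@le_trans _ _ (a%:E * \int[P]_w `|fk_weight X V h y w * (f (y + X h w)%R)%:E|)%E).
    by apply: lee_wpmul2l; [rewrite lee_fin|exact: abse_integral_le_any].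
  rewrite -ge0_integral_scale//.
  apply: ge0_le_integral_any => w _; first by rewrite mule_ge0.
  rewrite abseM (gee0_abs (fk_weight_ge0 _ _ _ _ _)).
  have [->|ane] := eqVneq a 0.
    by rewrite mul0e adde_ge0// mule_ge0// lee_fin expr0n mulr0.
  have ap : 0 < a by rewrite lt_neqAle eq_sym ane.
  have := fk_weight_le LX mV y w h0'; have := fk_weight_ge0 X V h y w.
  rewrite /U occ2; have := occupation_ge0 X VN0 0 h y w.
  case: (occupation X VN 0 h y w) => [q| |] // q0; last first.
    move=> _ _; rewrite gt0_muley ?lte_fin//= gt0_muley ?lte_fin ?mulr_gt0 ?exprn_gt0//.
    by rewrite addey// leey.
  case: (fk_weight X V h y w) => [u| |] //=; rewrite !lee_fin => u0 uo.
  move: (f _) => v; rewrite -[in leRHS](real_normK (num_real v)); move: (normr_ge0 v).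
  move: `|v| => F F0.
  rewrite (_ : expR (2 * q) = expR q ^+ 2); last by rewrite expr2 -expRD; congr expR; ring.
  have h1 : theta * a ^+ 2 * u ^+ 2 <= theta * a ^+ 2 * expR q ^+ 2.
    by rewrite ler_wpM2l// ler_sqr ?nnegrE ?expR_ge0.
  apply: le_trans (lerD (lexx _) h1).
  have h2 : 0 <= theta^-1 * (F ^+ 2 - F * (theta * a * u) + (theta * a * u) ^+ 2).
    rewrite mulr_ge0//; move: (theta * a * u) => p.
    by have := sqr_ge0 (F - p); have := sqr_ge0 F; have := sqr_ge0 p; nra.
  rewrite -subr_ge0; move: h2; congr (_ <= _); field.
  by rewrite gt_eqF.
rewrite ge0_integralD//; last 4 first.
- by move=> w _; rewrite mule_ge0// lee_fin.
- exact: measurable_funeM.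
- by move=> w _; rewrite mule_ge0// lee_fin.
- exact: measurable_funeM.
rewrite !ge0_integral_scale// leeD2l//.
rewrite -mulrA [leRHS]EFinM muleC.
by apply: lee_wpmul2r; rewrite ?lee_fin.
Qed.

(** Stands in for the L2 boundedness of [T_h], paired with a function of norm at most 1. The
    pointwise inequality is integrated with [a = |phi|], and translation invariance of Lebesgue
    measure turns the mean of [f ^ 2] at shifted points into its integral; [theta] remains to be
    optimized. *)
Lemma integral_feynman_kac_le (f g phi : 'rV[R]_d -> R) (theta : R) :
  measurable_fun setT f -> measurable_fun setT g -> measurable_fun setT phi ->
  (\int[mu]_x (phi x ^+ 2)%:E <= 1)%E ->
  {ae mu, forall x, feynman_kac P X V h f x = (g x)%:E} -> 0 < theta ->
  (\int[mu]_x `|g x * phi x|%:E <=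
   theta^-1%:E * \int[mu]_x (f x ^+ 2)%:E + (2 * theta)%:E)%E.
Proof.
move=> mf mg mphi phi1 fg th0.
have mshift : measurable_fun setT (fun z : 'rV[R]_d * Omega => (f (z.1 + X h z.2) ^+ 2)%:E).
  apply/measurable_EFinP; apply: measurable_funX; apply: (measurableT_comp mf).
  apply: measurable_rVD; first exact: measurable_fst.
  exact: (measurableT_comp (mX h0') measurable_snd).
have f20 (y : 'rV[R]_d) (w : Omega) : (0 <= (f (y + X h w) ^+ 2)%:E)%E by rewrite lee_fin sqr_ge0.
have mA : measurable_fun setT (fun y : 'rV[R]_d => \int[P]_w (f (y + X h w) ^+ 2)%:E)%E.
  exact: measurable_integral_in.
have A0 y : (0 <= \int[P]_w (f (y + X h w) ^+ 2)%:E)%E by exact: integral_ge0.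
have mf2 : measurable_fun setT (fun x => (f x ^+ 2)%:E).
  by apply/measurable_EFinP; exact: measurable_funX.
have mphi2 : measurable_fun setT (fun x => (phi x ^+ 2)%:E).
  by apply/measurable_EFinP; exact: measurable_funX.
have thi : 0 <= theta^-1 by rewrite invr_ge0 ltW.
have th2 : 0 <= 2 * theta by rewrite mulr_ge0// ltW.
have cstP (r : \bar R) : (\int[P]_w cst r w = r)%E.
  by rewrite integral_cst//= probability_setT mule1.
have -> : (\int[mu]_x (f x ^+ 2)%:E =
    \int[mu]_y \int[P]_w (f (y + X h w) ^+ 2)%:E)%E.
  rewrite (tonelli_in mu P measurableT mshift)//.
  transitivity (\int[P]_w (cst (\int[mu]_x (f x ^+ 2)%:E) w))%E.
    by rewrite cstP.
  apply: eq_integral => w _; rewrite /cst.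
  rewrite (integral_rV_shift (X h w) (g := fun x => (f x ^+ 2)%:E))//.
  by move=> x; rewrite lee_fin sqr_ge0.
apply: (@le_trans _ _ (\int[mu]_y (theta^-1%:E * \int[P]_w (f (y + X h w) ^+ 2)%:E +
    (2 * theta)%:E * (phi y ^+ 2)%:E))%E).
  apply: ae_ge0_le_integral.
  - exact: measurableT.
  - by move=> y _; rewrite lee_fin.
  - by apply/measurable_EFinP; apply: measurableT_comp => //; exact: measurable_funM.
  - by move=> y _; rewrite adde_ge0// mule_ge0// lee_fin ?sqr_ge0.
  - by apply: emeasurable_funD; exact: measurable_funeM.
  apply: filterS fg => y Hy _.
  have := feynman_kac_young y mf (normr_ge0 (phi y)) th0.
  by rewrite Hy real_normK ?num_real// -EFinM normrM mulrC.
rewrite ge0_integralD//; last 4 first.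
- by move=> y _; rewrite mule_ge0// lee_fin.
- exact: measurable_funeM.
- by move=> y _; rewrite mule_ge0// lee_fin sqr_ge0.
- exact: measurable_funeM.
rewrite !ge0_integral_scale//; last by move=> x; rewrite lee_fin sqr_ge0.
apply: leeD2l; rewrite -[leRHS]mule1; apply: lee_wpmul2l => //.
Qed.

End feynman_kac_operator.

(** * Expansion of an eigenfunction in a given eigenbasis *)

Section eigenfunction_expansion.
Context {R : realType} {d : nat} {dO : measure_display}.
Context {Omega : measurableType dO}.
Variables (P : probability Omega R) (X : R -> Omega -> 'rV[R]_d).
Hypothesis LX : levy_process P X.
Local Notation mu := (lebesgue_rV R d).

Variable V : 'rV[R]_d -> R.
Hypothesis mV : measurable_fun setT V.
Hypothesis KV : kato P X V^\-.

Variables (lambda : nat -> R) (phi : nat -> 'rV[R]_d -> R).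
Hypothesis basis : eigenbasis P X V lambda phi.

Variables (psi : 'rV[R]_d -> R) (l0 : R).
Hypothesis cpsi : continuous psi.
Hypothesis psi_bounded : exists M, forall x, `|psi x| <= M.
Hypothesis psi_L2 : finite_norm mu 2%:E psi.
Hypothesis psi_eigen : forall t, 0 < t -> {ae mu, forall x,
  feynman_kac P X V t psi x = (expR (- l0 * t) * psi x)%:E}.

Let mpsi : measurable_fun setT psi. Proof. exact: continuous_measurable_rV. Qed.
Let phi_L2 k : finite_norm mu 2%:E (phi k).
Proof. by have [_] := basis_L2 (eigen_basis basis) k. Qed.
Let mphi k : measurable_fun setT (phi k).
Proof. by have [+ _] := basis_L2 (eigen_basis basis) k. Qed.
Let orth m n : \int[mu]_x (phi m x * phi n x) = (m == n)%:R.
Proof. exact: basis_orthonormal (eigen_basis basis) m n. Qed.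

Let c k := \int[mu]_y (psi y * phi k y).
Let f m x := psi x - \sum_(k < m) c k * phi k x.
(** The image under [T_t] of the remainder [f m] of the expansion of [psi], as [feynman_kac_partial]
    shows. *)
Let g t m x := expR (- l0 * t) * psi x - \sum_(k < m) c k * (expR (- lambda k * t) * phi k x).

Let fS m : f m.+1 = (fun x => f m x - c m * phi m x).
Proof. by apply/funext => x; rewrite /f big_ord_recr opprD addrA. Qed.
Let f0 : f 0 = psi. Proof. by apply/funext => x; rewrite /f big_ord0 subr0. Qed.
Let g0 t : g t 0 = (fun x => expR (- l0 * t) * psi x).
Proof. by apply/funext => x; rewrite /g big_ord0 subr0. Qed.
Let gS t m : g t m.+1 = (fun x => g t m x - c m * (expR (- lambda m * t) * phi m x)).
Proof. by apply/funext => x; rewrite /g big_ord_recr opprD addrA. Qed.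

Let mf m : measurable_fun setT (f m).
Proof.
elim: m => [|m IH]; first by rewrite f0.
by rewrite fS; apply: measurable_funB => //; exact: measurable_funM.
Qed.

Let mg t m : measurable_fun setT (g t m).
Proof.
elim: m => [|m IH]; first by rewrite g0; exact: measurable_funM.
by rewrite gS; apply: measurable_funB => //; apply: measurable_funM => //; exact: measurable_funM.
Qed.

Let bf m : exists M, forall x, `|f m x| <= M.
Proof.
elim: m => [|m [M IH]].
  by rewrite f0.
have [M' H] := eigen_bounded basis m; exists (M + `|c m| * M') => x.
by rewrite fS (le_trans (ler_normB _ _))// lerD// normrM ler_wpM2l.
Qed.

Let feynman_kac_partial t m : 0 < t ->
  (forall z, (\int[P]_w occupation X (V^\-)%R 0 t z w <= 8^-1%:E)%E) ->
  {ae mu, forall x, feynman_kac P X V t (f m) x = (g t m x)%:E}.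
Proof.
move=> t0 small; elim: m => [|m IH].
  by rewrite f0 g0; exact: psi_eigen.
have := eigen_eq basis m t0; apply: filterS2 IH => x IH H.
rewrite fS (feynman_kac_subZ LX mV t0 small)//.
  by rewrite IH H gS.
exact: eigen_bounded basis m.
Qed.

Let inner_g t m j : mu.-integrable setT (EFin \o (fun x => g t m x * phi j x)) /\
  \int[mu]_x (g t m x * phi j x) =
  expR (- l0 * t) * c j - \sum_(k < m) c k * expR (- lambda k * t) * (k == j :> nat)%:R.
Proof.
have scale a (F : 'rV[R]_d -> R) : mu.-integrable setT (EFin \o (fun x => F x * phi j x)) ->
    mu.-integrable setT (EFin \o (fun x => a * (F x * phi j x))).
  by move=> I; exact: (@integrableZl _ _ _ mu setT measurableT a _ I).
elim: m => [|m [I1 I2]].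
  have Ip := integrable_prod mpsi psi_L2 (mphi j) (phi_L2 j).
  rewrite g0 (_ : (fun x => _) = (fun x => expR (- l0 * t) * (psi x * phi j x))); last first.
    by apply/funext => x; rewrite mulrA.
  by rewrite RintegralZl// big_ord0 subr0; split => //; exact: scale.
have Ip := integrable_prod (mphi m) (phi_L2 m) (mphi j) (phi_L2 j).
rewrite (_ : (fun x => g t m.+1 x * phi j x) =
    (fun x => g t m x * phi j x - c m * expR (- lambda m * t) * (phi m x * phi j x))); last first.
  by apply/funext => x; rewrite gS; ring.
have Is := scale (c m * expR (- lambda m * t)) _ Ip.
split; first exact: (integrableB measurableT I1 Is).
by rewrite RintegralB// RintegralZl// I2 orth big_ord_recr opprD addrA.
Qed.

(** Pair [T_t] of the remainder with [phi j]. Once [m > j] the result is exactly [c j] times the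
    difference of the two exponentials, independently of [m]; and it is arbitrarily small, because
    the remainder tends to 0 in L2. So [c j] vanishes if the exponentials differ. *)
Theorem eigenfunctions_orthogonal j : l0 != lambda j -> \int[mu]_y (psi y * phi j y) = 0.
Proof.
move=> lj; rewrite -/(c j).
have [h0 h00 H] := kato_small LX KV (fun z => funrneg_ge0 V z) (e := 8^-1) ltac:(by []).
pose t := h0 / 2.
have t0 : 0 < t by rewrite divr_gt0.
have small := H t t0 (ltac:(by rewrite /t ltr_pdivrMr// ltr_pMr// ltr1n)).
pose D := expR (- l0 * t) - expR (- lambda j * t).
have D0 : D != 0.
  rewrite subr_eq0; apply: contra lj => /eqP/expR_inj/(mulIf (lt0r_neq0 t0))/oppr_inj ->.
  by rewrite eqxx.
suff cD : c j * D = 0.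
  by move/eqP : cD; rewrite mulf_eq0 (negbTE D0) orbF => /eqP.
apply/eqP; rewrite -normr_le0; apply/ler_addgt0Pr => e e0; rewrite add0r.
(* The two terms of the L2 estimate then become [e / 2] each, the squared norm of the remainder
   being at most [th * (e / 2)]. *)
pose th := e / 4.
have th0 : 0 < th by rewrite divr_gt0.
have [n0 Hn0] := Lnorm_cvg0_integral_sqr (basis_complete (eigen_basis basis) mpsi psi_L2)
  (mulr_gt0 th0 (divr_gt0 e0 (ltr0n R 2))).
pose m := maxn n0 j.+1.
have := Hn0 m (leq_maxl _ _); rewrite -/(f m) => fsmall.
have [Ig Eg] := inner_g t m j.
have Egj : \int[mu]_x (g t m x * phi j x) = c j * D.
  have jm : (j < m)%N by exact: leq_maxr.
  rewrite Eg (bigD1 (Ordinal jm))//= eqxx mulr1 big1 ?addr0; last first.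
    by move=> i /negbTE ij; rewrite (_ : (i == j :> nat) = false) ?mulr0// -ij.
  by rewrite /D; ring.
have phi1 : (\int[mu]_x (phi j x ^+ 2)%:E <= 1)%E.
  have Ip := integrable_prod (mphi j) (phi_L2 j) (mphi j) (phi_L2 j).
  under eq_integral do rewrite expr2.
  by rewrite (EFin_Rintegral Ip) orth eqxx.
have := integral_feynman_kac_le LX mV t0 small (mf m) (mg t m) (mphi j) phi1
  (feynman_kac_partial m t0 small) th0.
have Ia : mu.-integrable setT (EFin \o (fun x => `|g t m x * phi j x|)).
  exact: (integrable_abse Ig).
rewrite (EFin_Rintegral Ia) => le1.
rewrite -Egj; apply: (le_trans (le_normr_Rintegral measurableT Ig)).
rewrite -lee_fin; apply: (le_trans le1).
apply: (@le_trans _ _ (th^-1%:E * (th * (e / 2))%:E + (2 * th)%:E)%E).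
  by rewrite leeD2r// lee_wpmul2l// lee_fin invr_ge0 ltW.
by rewrite -EFinM -EFinD lee_fin mulKf ?gt_eqF// /th; lra.
Qed.

(** All coefficients from [m] on vanish by orthogonality, so the remainder is stationary. Its L2
    norm is therefore 0, and continuity makes it vanish everywhere. *)
Theorem eigenfunction_expansion m : (forall k, (m <= k)%N -> l0 < lambda k) ->
  forall x, psi x = \sum_(k < m) (\int[mu]_y (psi y * phi k y)) * phi k x.
Proof.
move=> lm.
have fE n : (m <= n)%N -> f n = f m.
  move=> mn; rewrite -(subnK mn); elim: (n - m)%N => [//|i IH].
  rewrite addSn fS IH; apply/funext => x.
  by rewrite /c eigenfunctions_orthogonal ?mul0r ?subr0// lt_eqF// lm// leq_addl.
have fm0 : (\int[mu]_x (f m x ^+ 2)%:E = 0)%E.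
  apply/eqP; rewrite eq_le integral_ge0 ?andbT; last by move=> x _; rewrite lee_fin sqr_ge0.
  apply/lee_addgt0Pr => e e0; rewrite add0e.
  have [n0 H] := Lnorm_cvg0_integral_sqr
    (basis_complete (eigen_basis basis) mpsi psi_L2) e0.
  by rewrite -(fE _ (leq_maxl m n0)); exact: H (leq_maxr _ _).
have cf : continuous (f m).
  have : forall n, continuous (f n); last exact.
  elim=> [|n IH]; first by rewrite f0.
  rewrite fS => x; apply: (@cvgB _ _ _ (nbhs x)); first exact: IH.
  by apply: (@cvgM _ _ (nbhs x)); [exact: cvg_cst|exact: (eigen_continuous basis)].
have ae0 : {ae mu, forall x, f m x = 0}.
  have m2 : measurable_fun setT (fun x => (f m x ^+ 2)%:E).
    by apply/measurable_EFinP; exact: measurable_funX.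
  have : (\int[mu]_x `|(f m x ^+ 2)%:E| = 0)%E.
    by rewrite -[RHS]fm0; apply: eq_integral => x _; rewrite gee0_abs ?lee_fin ?sqr_ge0.
  move/(ae_eq_integral_abs mu measurableT m2); apply: filterS => x /(_ I) /= [] /eqP.
  by rewrite sqrf_eq0 => /eqP.
move=> x; apply/eqP; rewrite -subr_eq0 -/(f m x) eq_le; apply/andP; split.
  apply: (ae_everywhere (O := setT) cf openT) => //.
  by apply: filterS ae0 => y ->.
rewrite -oppr_le0.
apply: (ae_everywhere (O := setT) (g := fun y => - f m y) _ openT) => //.
  by move=> y; apply: (@cvgN _ _ _ (nbhs y)); exact: cf.
by apply: filterS ae0 => y ->; rewrite oppr0.
Qed.

End eigenfunction_expansion.

(** * Comparison of two eigenbases *)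

Section eigenbasis_uniqueness.
Context {R : realType} {d : nat} {dO : measure_display}.
Context {Omega : measurableType dO}.
Variables (P : probability Omega R) (X : R -> Omega -> 'rV[R]_d).
Hypothesis LX : levy_process P X.
Local Notation mu := (lebesgue_rV R d).

Variable V : 'rV[R]_d -> R.
Hypothesis mV : measurable_fun setT V.
Hypothesis KV : kato P X V^\-.

Lemma eigenvalue_mono (lambda : nat -> R) (phi : nat -> 'rV[R]_d -> R) i j :
  eigenbasis P X V lambda phi -> (i <= j)%N -> lambda i <= lambda j.
Proof.
move=> B; elim: j => [|j IH]; first by rewrite leqn0 => /eqP ->.
rewrite leq_eqVlt => /predU1P[-> //|/IH ij]; apply: (le_trans ij).
case: j {IH ij} => [|j]; first exact/ltW/(eigen_gap B).
exact: (eigen_nondecreasing B).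
Qed.

Lemma eigenbasis_expansion (lambda lambda' : nat -> R) (phi phi' : nat -> 'rV[R]_d -> R) n m :
  eigenbasis P X V lambda phi -> eigenbasis P X V lambda' phi' ->
  (forall k, (m <= k)%N -> lambda' n < lambda k) ->
  forall x, phi' n x = \sum_(k < m) (\int[mu]_y (phi' n y * phi k y)) * phi k x.
Proof.
move=> B B' H; apply: (eigenfunction_expansion LX mV KV B (l0 := lambda' n)) => //.
- exact: (eigen_continuous B').
- exact: (eigen_bounded B').
- by have [_] := basis_L2 (eigen_basis B') n.
- by move=> t t0; exact: (eigen_eq B').
Qed.

Lemma expansion_inner (phi : nat -> 'rV[R]_d -> R) (chi psi : 'rV[R]_d -> R) (m : nat) (a : nat -> R) :
  orthonormal_basis phi -> measurable_fun setT psi -> finite_norm mu 2%:E psi ->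
  (forall x, chi x = \sum_(k < m) a k * phi k x) ->
  \int[mu]_x (psi x * chi x) = \sum_(k < m) a k * \int[mu]_x (psi x * phi k x).
Proof.
move=> Bphi mpsi Npsi H.
have Ip k : mu.-integrable setT (EFin \o (fun x => a k * (psi x * phi k x))).
  have [mphi Nphi] := basis_L2 Bphi k.
  exact: (@integrableZl _ _ _ mu setT measurableT (a k) _ (integrable_prod mpsi Npsi mphi Nphi)).
suff [_ <-] : mu.-integrable setT (EFin \o (fun x => \sum_(k < m) a k * (psi x * phi k x))) /\
    \int[mu]_x (\sum_(k < m) a k * (psi x * phi k x)) =
    \sum_(k < m) a k * \int[mu]_x (psi x * phi k x).
  apply: eq_Rintegral => x _; rewrite H mulr_sumr; apply: eq_bigr => k _; ring.
elim: m {H} => [|m [I1 I2]].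
  rewrite big_ord0 (_ : (fun x => _) = cst 0); last by apply/funext => x; rewrite big_ord0.
  split; first exact: integrable0.
  by rewrite Rintegral_cst// mul0r.
rewrite (_ : (fun x => \sum_(k < m.+1) _) = (fun x =>
  \sum_(k < m) a k * (psi x * phi k x) + a m * (psi x * phi m x))); last first.
  by apply/funext => x; rewrite big_ord_recr.
split; first exact: (integrableD measurableT I1 (Ip m)).
rewrite RintegralD// I2 big_ord_recr /=; congr (_ + _).
have [mphi Nphi] := basis_L2 Bphi m.
by rewrite RintegralZl//; exact: integrable_prod.
Qed.

(** Otherwise the first [n + 1] functions of one basis lie in the span of the first [n] of the
    other, and the matrix of inner products satisfies [C C^T = 1], contradicting the rank. *)
Lemma eigenvalue_le (lambda lambda' : nat -> R) (phi phi' : nat -> 'rV[R]_d -> R) n :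
  eigenbasis P X V lambda phi -> eigenbasis P X V lambda' phi' -> lambda' n <= lambda n.
Proof.
move=> B B'; rewrite leNgt; apply/negP => lt.
pose C : 'M[R]_(n.+1, n) := \matrix_(i, k) \int[mu]_y (phi i y * phi' k y).
suff /mulmx1_min : C *m C^T = 1%:M by rewrite ltnn.
apply/matrixP => i j; rewrite !mxE.
have [mphi Nphi] := basis_L2 (eigen_basis B) j.
have E := @eigenbasis_expansion _ _ _ _ i n B' B _.
have := expansion_inner (a := fun k => \int[mu]_y (phi i y * phi' k y)) (eigen_basis B') mphi Nphi (E _).
rewrite (basis_orthonormal (eigen_basis B)) eq_sym => ->; last first.
  move=> k nk; apply: le_lt_trans (eigenvalue_mono B _) (lt_le_trans lt (eigenvalue_mono B' nk)).
  by rewrite -ltnS.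
by apply: eq_bigr => k _; rewrite !mxE.
Qed.

(** The squares of the coefficients sum to the squared norm 1. The right side, including [m],
    belongs to one fixed basis, so bounds for that basis serve every other. *)
Lemma eigenfunction_dominated (lambda lambda' : nat -> R) (phi phi' : nat -> 'rV[R]_d -> R) n m :
  eigenbasis P X V lambda phi -> eigenbasis P X V lambda' phi' ->
  (forall k, (m <= k)%N -> lambda n < lambda k) ->
  forall x, `|phi' n x| <= \sum_(k < m) `|phi k x|.
Proof.
move=> B B' H x; pose c k := \int[mu]_y (phi' n y * phi k y).
have E := eigenbasis_expansion B B'
  (fun k mk => le_lt_trans (eigenvalue_le n B B') (H k mk)).
have [mphi Nphi] := basis_L2 (eigen_basis B') n.
have := expansion_inner (a := fun k => \int[mu]_y (phi' n y * phi k y)) (eigen_basis B) mphi Nphi E.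
rewrite (basis_orthonormal (eigen_basis B')) eqxx => c1.
rewrite E; apply: (le_trans (ler_norm_sum _ _ _)); apply: ler_sum => k _.
rewrite normrM ler_piMl// -/(c k) -(@ler_pXn2r _ 2)// ?nnegrE// expr1n real_normK ?num_real//.
rewrite [leRHS]c1 (bigD1 k)//= expr2 lerDl sumr_ge0// => i _.
by rewrite -expr2 sqr_ge0.
Qed.

(** The spectral gap leaves a single term in the expansion; its coefficient has square 1 and is
    positive, as both ground states are. *)
Lemma ground_state_unique (lambda lambda' : nat -> R) (phi phi' : nat -> 'rV[R]_d -> R) :
  eigenbasis P X V lambda phi -> eigenbasis P X V lambda' phi' -> phi' 0%N = phi 0%N.
Proof.
move=> B B'.
have H k : (1 <= k)%N -> lambda' 0%N < lambda k.
  move=> k1; apply: le_lt_trans (eigenvalue_le 0 B B') _.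
  exact: lt_le_trans (eigen_gap B) (eigenvalue_mono B k1).
have E := eigenbasis_expansion B B' H.
have [mphi Nphi] := basis_L2 (eigen_basis B') 0%N.
have := expansion_inner (a := fun k => \int[mu]_y (phi' 0%N y * phi k y)) (eigen_basis B) mphi Nphi E.
rewrite (basis_orthonormal (eigen_basis B')) eqxx.
rewrite big_ord1.
have E0 x : phi' 0%N x = \int[mu]_y (phi' 0%N y * phi 0%N y) * phi 0%N x.
  by rewrite {1}E big_ord1.
move: (\int[mu]_y _) E0 => c E0 c1.
have c0 : 0 < c.
  have := eigen_ground_state B' 0; rewrite E0 pmulr_lgt0//.
  exact: (eigen_ground_state B).
have c01 : c = 1.
  apply/eqP; rewrite -(@eqrXn2 _ 2)// ?ltW// expr1n expr2.
  by apply/eqP/esym; exact: c1.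
by apply/funext => x; rewrite E0 c01 mul1r.
Qed.

End eigenbasis_uniqueness.

(** * Uniform constants *)

Section unit_ball_bounds.
Context {R : realType} {d : nat}.
Implicit Types (V : 'rV[R]_d -> R) (x : 'rV[R]_d).

Lemma eball_center x (r : R) : 0 < r -> eball x r x.
Proof. by move=> r0; rewrite /eball /= subrr enorm0. Qed.

Lemma inf_ball_ge V x L : (forall z, eball x 1 z -> L <= V z) -> L <= inf_ball V x.
Proof.
move=> H; apply: lb_le_inf; last by move=> _ [z xz <-]; exact: H.
by exists (V x), x => //; exact: eball_center.
Qed.

Lemma inf_ball_le V x L : (forall z, eball x 1 z -> L <= V z) ->
  forall z, eball x 1 z -> inf_ball V x <= V z.
Proof.
move=> H z xz; apply: ge_inf; last by exists z.
by exists L => _ [y xy <-]; exact: H.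
Qed.

Lemma sup_ball_ge V x z : eball x 1 z -> ((V z)%:E <= sup_ball V x)%E.
Proof. by move=> xz; apply: ereal_sup_ubound; exists z. Qed.

Lemma confining_ball V (L : R) : confining V ->
  exists2 r, 4 <= r & forall x, r <= enorm x -> forall z, eball x 1 z -> L <= V z.
Proof.
move=> /(_ L)[r H]; exists (`|r| + 4); first by rewrite lerDr.
move=> x rx z; rewrite /eball /= => xz; apply: H.
have := enorm_sub_ge x z; rewrite enorm_distC; move: (ler_norm r); lra.
Qed.

Lemma positive_lower_bound (f : 'rV[R]_d -> R) : continuous f -> (forall z, 0 < f z) ->
  exists2 p, 0 < p & forall z, eball 0 1 z -> p <= f z.
Proof.
move=> cf f0.
have := @rV_compact R d (fun=> `[-1, 1]%classic) (fun=> @segment_compact R (-1) 1).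
set A := [set v | _] => cA.
have A0 : A !=set0 by exists 0 => i /=; rewrite mxE in_itv /= lerN10 ler01.
have [c Ac cmin] := compact_EVT_min A0 cA (continuous_subspaceT cf).
exists (f c) => // z; rewrite /eball /= subr0 => z1; apply: cmin; rewrite inE => i.
rewrite /= in_itv /= -ler_norml; apply: le_trans (ltW z1).
exact: coord_le_enorm.
Qed.

End unit_ball_bounds.

Section decay.
Context {R : realType} {d : nat}.
Variables (nu nb V phi : 'rV[R]_d -> R) (lam : R).
Hypothesis nu0 : forall x, 2^-1 <= enorm x -> 0 < nu x.
Hypothesis nbE : forall x, 2^-1 <= enorm x -> nb x = nu x.
Hypothesis nb0 : forall z, 0 < nb z.
Hypothesis Vc : confining V.

(* The factor [K / (L - lam)] of the one-step bound is at most [1 / 2] far from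
   the origin, where it is iterated starting from the boundedness of [phi]. *)
Lemma eigenfunction_decay (M K : R) :
  (forall r, exists2 e, 0 < e & forall z, enorm z <= r -> e <= nb z) ->
  (forall z, `|phi z| <= M) -> 0 <= K ->
  (forall (a bq L : R) (x : 'rV[R]_d),
    0 <= a -> 0 <= bq -> 4 <= enorm x -> (forall y, `|phi y| <= a + bq * nb y) ->
    0 <= L -> lam < L -> (forall z, eball x 1 z -> L <= V z) ->
    `|phi x| <= K / (L - lam) * (a + bq * nu x)) ->
  exists r C, [/\ 4 <= r, 0 < C & forall x, r <= enorm x ->
    1 <= inf_ball V x /\ `|phi x| <= C * (nu x / inf_ball V x)].
Proof.
move=> nb_below phiM K0 step.
have M0 : 0 <= M by exact: le_trans (normr_ge0 _) (phiM 0).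
have l0 := normr_ge0 lam; have ll := ler_norm lam.
(* Large enough for [L0 >= 1], for [K / (L0 - lam) <= 1/2], and for [K / (L - lam) <= 2 K / L]
   whenever [L >= L0]. *)
pose L0 := 2 * `|lam| + 2 * K + 2.
have [r r4 Hr] := confining_ball L0 Vc.
have [e e0 He] := nb_below r.
pose bq := M / e.
have bq0 : 0 <= bq by rewrite divr_ge0// ltW.
have iter k y : `|phi y| <= M / 2 ^+ k + bq * nb y.
  elim: k y => [|k IH] y.
    by rewrite expr0 divr1 (le_trans (phiM y))// lerDl mulr_ge0// ltW.
  have Mk0 j : 0 <= M / 2 ^+ j by rewrite divr_ge0// exprn_ge0.
  have [yr|ry] := leP (enorm y) r.
    apply: (le_trans (phiM y)); rewrite -[leLHS]add0r lerD//.
    by rewrite /bq mulrAC ler_pdivlMr// ler_wpM2l// He.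
  have y4 : 4 <= enorm y by exact: le_trans r4 (ltW ry).
  have y2 : 2^-1 <= enorm y by apply: le_trans y4; lra.
  apply: (le_trans (step _ bq L0 y (Mk0 k) bq0 y4 IH _ _ (Hr y (ltW ry)))).
  - by rewrite /L0; lra.
  - by rewrite /L0; lra.
  have K2 : K / (L0 - lam) <= 2^-1.
    by rewrite ler_pdivrMr /L0; lra.
  have nn : 0 <= bq * nu y by rewrite mulr_ge0// ltW// nu0.
  have := ler_wpM2r (addr_ge0 (Mk0 k) nn) K2.
  rewrite nbE// exprSr invfM mulrA; have := Mk0 k; move: (M / 2 ^+ k) => q q0; lra.
have bnd y : `|phi y| <= 0 + bq * nb y.
  rewrite add0r; apply/ler_addgt0Pl => q q0.
  have [k Mk] : exists k : nat, M / 2 ^+ k <= q.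
    exists (Num.trunc (M / q)).+1; rewrite ler_pdivrMr ?exprn_gt0//.
    have : M / q < (Num.trunc (M / q)).+1%:R by rewrite truncnS_gt.
    rewrite ltr_pdivrMr// => /ltW/le_trans; apply.
    rewrite mulrC ler_pM2l// -natrX ler_nat ltnW//; exact: ltn_expl.
  by apply: (le_trans (iter k y)); rewrite lerD2r.
(* The summand 1 keeps the constant positive. *)
exists r, (2 * K * bq + 1); split => //.
  exact: ltr_wpDl (mulr_ge0 (mulr_ge0 (ler0n R 2) K0) bq0) ltr01.
move=> x rx; have Lx := inf_ball_ge (Hr x rx).
have L1 : 1 <= inf_ball V x by apply: le_trans Lx; rewrite /L0; lra.
split=> //.
have x4 : 4 <= enorm x by exact: le_trans rx.
have x2 : 2^-1 <= enorm x by apply: le_trans x4; lra.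
have ip : 0 < inf_ball V x by lra.
apply: (le_trans (step 0 bq (inf_ball V x) x (lexx _) bq0 x4 bnd _ _ _)).
- exact: ltW.
- by apply: lt_le_trans Lx; rewrite /L0; lra.
- exact: (inf_ball_le (Hr x rx)).
rewrite add0r; set L := inf_ball V x in Lx L1 ip *.
have nx := nu0 x2.
have -> : (2 * K * bq + 1) * (nu x / L) = 2 * K / L * (bq * nu x) + nu x / L by ring.
have : K / (L - lam) <= 2 * K / L.
  rewrite ler_pdivrMr; last by move: Lx; rewrite /L0; lra.
  rewrite mulrAC ler_pdivlMr//.
  have : 0 <= K * (L - 2 * lam) by rewrite mulr_ge0//; move: Lx; rewrite /L0; lra.
  by lra.
move=> /(ler_wpM2r (mulr_ge0 bq0 (ltW nx))) h; apply: (le_trans h).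
by rewrite lerDl divr_ge0// ltW.
Qed.

Lemma ground_state_decay (C : R) : 0 < C -> (forall z, 0 <= phi z) ->
  (forall (x : 'rV[R]_d) (S : R), 4 <= enorm x -> 1 <= S -> lam < S ->
    (forall z, eball x 1 z -> V z <= S) -> C * nu x / S <= phi x) ->
  exists2 r, 4 <= r & forall x, r <= enorm x ->
    (C%:E * ((nu x)%:E / sup_ball V x) <= (phi x)%:E)%E.
Proof.
move=> C0 phi0 step.
have l0 := normr_ge0 lam; have ll := ler_norm lam.
have [r r4 Hr] := confining_ball (`|lam| + 1) Vc.
exists r => // x rx; have x4 : 4 <= enorm x by exact: le_trans rx.
have Vx := Hr x rx x (eball_center x ltr01).
have := @sup_ball_ge _ _ V x; move: (eball_center x (@ltr01 R)) => xx.
case: (sup_ball V x) => [S| |] H; last 2 first.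
(* An unbounded [V] on the ball: the inverse of [+oo] is 0 and the bound reduces to
   nonnegativity. *)
- by rewrite invey mule0 mule0 lee_fin.
- by have := H x xx; rewrite leeNy_eq.
have VS z : eball x 1 z -> V z <= S by move=> /H; rewrite lee_fin.
have xS := VS x xx.
rewrite inver gt_eqF ?lee_fin; last by lra.
rewrite mulrA; apply: step => //; lra.
Qed.

End decay.

Section levy_decay.
Context {R : realType} {d : nat} {dO : measure_display}.
Context {Omega : measurableType dO}.
Variables (P : probability Omega R) (X : R -> Omega -> 'rV[R]_d).
Variables nu V : 'rV[R]_d -> R.
Hypothesis d0 : (0 < d)%N.
Hypothesis hX : regular_jump_levy_process P X nu.
Hypothesis hV : kato_potential P X V.
Hypothesis Vc : confining V.

Let nu0 x : x != 0 -> 0 < nu x.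
Proof. by have [_ A1 _ _] := hX; exact: (A1_positive A1). Qed.

Lemma regular_density_gt0 (x : 'rV[R]_d) : 2^-1 <= enorm x -> 0 < nu x.
Proof. by move=> x2; apply/nu0/enorm_gt0_neq0/lt_le_trans/x2. Qed.

Lemma eigenbasis_decay (lambda : nat -> R) (phi : nat -> 'rV[R]_d -> R) n :
  eigenbasis P X V lambda phi ->
  exists r C, [/\ 4 <= r, 0 < C & forall x, r <= enorm x ->
    1 <= inf_ball V x /\ `|phi n x| <= C * (nu x / inf_ball V x)].
Proof.
move=> B; have [LX A1 _ _] := hX; have [mV KV _] := hV.
have [mnu [b [Q [N [TX Nnu]]]]] := A1_density A1.
have [C1 [C11 nuC1]] := A1_1 A1 (r := 2^-1) ltac:(by []) (lexx _).
have [C2 [C21 nuC2]] := A1_2 A1.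
have [C3 [C31 nuC3]] := A1_3 A1.
have SX := A1_symmetric A1.
have [CU CU0 HU] := jump_upper d0 LX SX TX mnu Nnu nu0 C11 nuC1 C21 nuC2 C31 nuC3.
have [M phiM] := eigen_bounded B n.
have cphi : continuous (phi n) by exact: (eigen_continuous B).
have [K K0 HK] := eigenfunction_upper d0 LX SX TX C11 CU0 (measurable_nub d0 mnu)
  (nub_gt0 d0 nu0) (nubE d0 nu) (@nub_doubling _ _ d0 _ nu0 _ C11 nuC1) HU mV KV
  cphi phiM (fun t => eigen_eq B n (t := t)).
apply: (eigenfunction_decay (nb := nub d0 nu) _ _ _ Vc _ phiM K0 HK).
- exact: regular_density_gt0.
- exact: nubE.
- exact: (nub_gt0 d0 nu0).
(* By (A1)(2) the density at a point of norm [|r| + 1] is, up to [C2], a lower bound for [nub] on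
   the ball of radius [r]. *)
move=> r; pose v : 'rV[R]_d := (`|r| + 1) *: delta_mx 0 (Ordinal d0).
have vE : enorm v = `|r| + 1 by rewrite enorm_scale_delta ger0_norm// addr_ge0.
have r0 := normr_ge0 r.
have v2 : 2^-1 <= enorm v by rewrite vE; lra.
exists (nu v / C2); first by rewrite divr_gt0 ?regular_density_gt0//; lra.
move=> z zr; rewrite ler_pdivrMr; last by lra.
rewrite mulrC /nub; case: ifPn => z2.
  by apply: nuC2; rewrite // vE; apply: (le_trans zr); move: (ler_norm r); lra.
apply: nuC2; rewrite enorm_scale_delta ger0_norm ?invr_ge0// vE; lra.
Qed.

Lemma ground_state_lower (lambda : nat -> R) (phi : nat -> 'rV[R]_d -> R) :
  eigenbasis P X V lambda phi ->
  exists r C, [/\ 4 <= r, 0 < C & forall x, r <= enorm x ->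
    (C%:E * ((nu x)%:E / sup_ball V x) <= (phi 0%N x)%:E)%E].
Proof.
move=> B; have [LX A1 _ _] := hX; have [mV _ [_ KW]] := hV.
have [mnu [b [Q [N [TX Nnu]]]]] := A1_density A1.
have [C1 [C11 nuC1]] := A1_1 A1 (r := 2^-1) ltac:(by []) (lexx _).
have SX := A1_symmetric A1.
have [cL cL0 HL] := jump_lower d0 LX SX TX Nnu nu0 C11 nuC1.
have [M phiM] := eigen_bounded B 0%N.
have cphi : continuous (phi 0%N) by exact: (eigen_continuous B).
have [p0 p00 Hp] := positive_lower_bound cphi (eigen_ground_state B).
have phi0 z : 0 <= phi 0%N z by exact/ltW/(eigen_ground_state B).
have [C C0 HC] := eigenfunction_lower d0 LX SX TX cL0 (nub_gt0 d0 nu0) (nubE d0 nu) HL mV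
  cphi phiM (fun t => eigen_eq B 0%N (t := t)) (KW 0 2) phi0 p00 Hp.
have [r r4 H] := ground_state_decay Vc C0 phi0 HC.
by exists r, C.
Qed.

End levy_decay.
Theorem corollary2p2 (R : realType) (d : nat) (hd : (0 < d)%N)
    (dO : measure_display) (Omega : measurableType dO)
    (P : probability Omega R) (X : R -> Omega -> 'rV[R]_d)
    (nu : 'rV[R]_d -> R) (hX : regular_jump_levy_process P X nu)
    (V : 'rV[R]_d -> R) (hV : kato_potential P X V) (hVc : confining V) :
  exists (Rad C7 : nat -> R) (C9 C11 : R),
    [/\ (forall n, 0 < Rad n), (forall n, 0 < C7 n), 0 < C9, 0 < C11 &
    forall (lambda : nat -> R) (phi : nat -> 'rV[R]_d -> R),
      eigenbasis P X V lambda phi ->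
    forall n : nat,
      (forall x : 'rV[R]_d, Rad n <= enorm x ->
        [/\ `|phi n x| <= C7 n * (nu x / inf_ball V x),
            (C11%:E * ((nu x)%:E / sup_ball V x) <= (phi 0%N x)%:E)%E &
            phi 0%N x <= C9 * (nu x / inf_ball V x)]) /\
      (forall C : R, 1 < C ->
        (forall z : 'rV[R]_d, eball z 1 `<=` ~` eball 0 (Rad n) ->
          (sup_ball V z <= (C * inf_ball V z)%:E)%E) ->
        forall x : 'rV[R]_d, Rad n + 1 <= enorm x ->
        [/\ `|phi n x| <= C7 n * C * (nu x / V x),
            C11 * C^-1 * (nu x / V x) <= phi 0%N x &
            phi 0%N x <= C9 * C * (nu x / V x)])].
Proof.
have [LX A1 _ _] := hX; have [mV KV _] := hV.
(* The constants precede the quantification over eigenbases, so they are read off one basis chosen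
   here; if there is none, any constants do. *)
have [[[lam phi] /= B]|noB] := pselect (exists p, eigenbasis P X V p.1 p.2); last first.
  exists (fun=> 1), (fun=> 1), 1, 1; split => // lambda phi B; exfalso; apply: noB.
  by exists (lambda, phi).
have [rC HrC] := choice (fun n => eigenbasis_decay hd hX hV hVc n B).
have mm_ex n : exists m, forall k, (m <= k)%N -> lam n < lam k.
  have /cvgryPgt/(_ (lam n))[m _ Hm] := eigen_diverge B.
  by exists m => k; exact: Hm.
have [mm Hmm] := choice mm_ex.
have [Cc HC] := choice HrC.
have [rl [Cl [rl4 Cl0 Hl]]] := ground_state_lower hd hX hV hVc B.
have rC4 k : 4 <= rC k by have [] := HC k.
have Cc0 k : 0 < Cc k by have [] := HC k.
(* Sums of nonnegative radii stand for maxima: [Rad n] exceeds the radii needed for the ground state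
   and for the first [mm n] functions, which dominate the [n]-th function of any basis. *)
pose Rad n := rl + rC 0%N + \sum_(k < mm n) rC k.
pose C7 n := 1 + \sum_(k < mm n) Cc k.
have sum_ge0 (F : nat -> R) m : (forall k, 0 <= F k) -> 0 <= \sum_(k < m) F k.
  by move=> F0; apply: sumr_ge0 => k _.
have term_le (F : nat -> R) m (k : 'I_m) : (forall k, 0 <= F k) -> F k <= \sum_(i < m) F i.
  by move=> F0; rewrite (bigD1 k)//= lerDl sumr_ge0.
have rC0 k : 0 <= rC k by exact: le_trans (rC4 k).
have Cc0' k : 0 <= Cc k by exact: ltW.
exists Rad, C7, (Cc 0%N), Cl; split => //.
- by move=> n; rewrite /Rad; have := sum_ge0 rC (mm n) rC0; have := rC4 0%N; lra.
- by move=> n; rewrite /C7; have := sum_ge0 Cc (mm n) Cc0'; lra.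
move=> lambda' phi' B' n.
have phi00 : phi' 0%N = phi 0%N := ground_state_unique LX mV KV B B'.
have inf1 x : Rad n <= enorm x -> 1 <= inf_ball V x.
  move=> rx; have [_ _ /(_ x)[]//] := HC 0%N.
  by apply: le_trans rx; rewrite /Rad; have := sum_ge0 rC (mm n) rC0; lra.
have bounds x : Rad n <= enorm x ->
  [/\ `|phi' n x| <= C7 n * (nu x / inf_ball V x),
      (Cl%:E * ((nu x)%:E / sup_ball V x) <= (phi' 0%N x)%:E)%E &
      phi' 0%N x <= Cc 0%N * (nu x / inf_ball V x)].
  move=> rx; have i1 := inf1 x rx.
  have x2 : 2^-1 <= enorm x.
    by apply: le_trans rx; rewrite /Rad; have := sum_ge0 rC (mm n) rC0; have := rC4 0%N; lra.
  have ni : 0 <= nu x / inf_ball V x.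
    by rewrite divr_ge0//; [exact/ltW/(regular_density_gt0 hX)|lra].
  split.
  - apply: (le_trans (eigenfunction_dominated LX mV KV B B' (Hmm n) x)).
    apply: (@le_trans _ _ (\sum_(k < mm n) Cc k * (nu x / inf_ball V x))).
      apply: ler_sum => k _; have [_ _ /(_ x)[]//] := HC k.
      apply: le_trans rx; have := term_le rC (mm n) k rC0.
      by rewrite /Rad; have := rC4 0%N; lra.
    by rewrite -mulr_suml ler_wpM2r// /C7 lerDr.
  - rewrite phi00; apply: Hl; apply: le_trans rx.
    by rewrite /Rad; have := sum_ge0 rC (mm n) rC0; have := rC4 0%N; lra.
  - rewrite phi00; apply: (le_trans (ler_norm _)); have [_ _ /(_ x)[]//] := HC 0%N.
    by apply: le_trans rx; rewrite /Rad; have := sum_ge0 rC (mm n) rC0; lra.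
split => // C C1 HC' x rx.
have rx' : Rad n <= enorm x by lra.
have [b1 b2 b3] := bounds x rx'; have i1 := inf1 x rx'.
have ballsub : eball x 1 `<=` ~` eball 0 (Rad n).
  move=> z; rewrite /eball /= subr0 => xz.
  by have := enorm_sub_ge x z; rewrite enorm_distC; lra.
have sup_le := HC' x ballsub.
have Vsup := sup_ball_ge V (eball_center x (@ltr01 R)).
have infV : inf_ball V x <= V x.
  have [lbd|nlb] := pselect (has_lbound [set V y | y in eball x 1]).
    by apply: (ge_inf lbd); exists x => //; exact: eball_center.
  (* The infimum of a set without lower bound is 0 by convention, which [1 <= inf_ball V x] rules
     out. *)
  by move: i1; rewrite /inf_ball inf_out ?ler10//; move=> [].
have x2 : 2^-1 <= enorm x.
  by move: rx'; rewrite /Rad; have := sum_ge0 rC (mm n) rC0; have := rC4 0%N; lra.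
have nx := regular_density_gt0 hX x2.
have V0 : 0 < V x by lra.
have VC : V x <= C * inf_ball V x by rewrite -lee_fin; exact: le_trans Vsup sup_le.
(* Since [V x] lies between the infimum and [C] times it, exchanging one for the other costs a
   factor [C]. *)
have ratio : nu x / inf_ball V x <= C * (nu x / V x).
  rewrite ler_pdivrMr; last by lra.
  rewrite mulrA mulrAC ler_pdivlMr// (mulrC C) -mulrA.
  by apply: ler_wpM2l => //; exact: ltW.
have C70 : 0 <= C7 n by rewrite /C7 addr_ge0// sum_ge0.
split.
- by apply: (le_trans b1); rewrite -mulrA ler_wpM2l.
- rewrite -lee_fin; apply: le_trans b2.
  case: (sup_ball V x) Vsup sup_le => [S| |]//; rewrite !lee_fin => VS SC.
  rewrite inver gt_eqF; last by lra.
  rewrite -!EFinM lee_fin -mulrA; apply: ler_wpM2l; first exact: ltW.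
  rewrite mulrCA; apply: ler_wpM2l; first exact: ltW.
  have C0 : 0 < C by lra.
  rewrite -invfM lef_pV2 ?posrE ?mulr_gt0//; last by lra.
  by apply: (le_trans SC); rewrite ler_wpM2l// ltW.
- by apply: (le_trans b3); rewrite -mulrA ler_wpM2l.
Qed.
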